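(* Let $\Omega\subset\mathbb{R}^2$ be a bounded domain with a straight corner. Then for every $\beta<1$ and for every $C\in\mathbb{R}$, there is a vector field $u\in H^2\cap H^1_0(\Omega,\mathbb{R}^2)$ satisfying $$\int_{\Omega} |[\Delta,P]u|^2 > \beta\int_{\Omega}|\Delta u|^2 + C\int_{\Omega}|\nabla u|^2 .$$
   Context: For $\sigma\in(0,2\pi)$ let $\mathcal{K}_\sigma=\{(x_1,x_2)\in\mathbb{R}^2: 0<r<\infty,\ 0<\theta<\sigma\}$, where $(r,\theta)$ are the polar coordinates of $(x_1,x_2)$; this is an infinite cone (sector) with vertex at the origin. A bounded domain $\Omega\subset\mathbb{R}^2$ is called a bounded domain with a straight corner if there are some $\sigma\in(0,2\pi)$ with $\sigma\neq\pi$, some rotated translate $\tilde\Omega=R(\Omega-x_0)$ of $\Omega$ ($R$ a rotation, $x_0\in\mathbb{R}^2$), and a neighborhood $U$ of $0$ such that $U\cap\tilde\Omega=U\cap\mathcal{K}_\sigma$. Leray projection on a bounded domain $\Omega\subset\mathbb{R}^N$: given $a\in L^2(\Omega,\mathbb{R}^N)$, there is a unique $q\in H^1(\Omega)$ with $\int_\Omega q=0$ such that $Pa:=a+\nabla q$ satisfies $0=\langle Pa,\nabla\phi\rangle=\langle a+\nabla q,\nabla\phi\rangle$ for all $\phi\in H^1(\Omega)$, where $\langle\cdot,\cdot\rangle$ is the $L^2(\Omega,\mathbb{R}^N)$ inner product. This defines the Leray projection operator $P$. The commutator is $[\Delta,P]u=\Delta Pu-P\Delta u$, where $\Delta$ is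 the Laplacian acting componentwise on vector fields (in the sense of distributions). *)

(* Defs.v *)
(* MathComp-Analysis development.  Points of the plane have type R * R; a scalar
   field is a function R * R -> R and a vector field is given by its two
   components, u : 'I_2 -> R * R -> R.  Classes modulo null sets are represented
   by arbitrary functions on the plane, of which only the values on Omega
   matter. *)
From HB Require Import structures.
From mathcomp Require Import all_boot all_order all_algebra.
From mathcomp Require Import all_classical all_reals all_analysis.

Set Implicit Arguments.
Unset Strict Implicit.
Unset Printing Implicit Defensive.

Import Order.TTheory GRing.Theory Num.Theory.
Import numFieldNormedType.Exports.

Local Open Scope classical_set_scope.
Local Open Scope ring_scope.

Definition leb2 {R : realType} := (@lebesgue_measure R \x @lebesgue_measure R)%E.

(* Planar geometry *)

Definition sector {R : realType} (sigma : R) : set (R * R) :=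
  [set x | exists r theta : R,
    [/\ 0 < r, 0 < theta < sigma & x = (r * cos theta, r * sin theta)]].

Definition rotation {R : realType} (alpha : R) (x : R * R) : R * R :=
  (cos alpha * x.1 - sin alpha * x.2, sin alpha * x.1 + cos alpha * x.2).

Definition bounded_domain {R : realType} (Omega : set (R * R)) : Prop :=
  [/\ open Omega, connected Omega, Omega !=set0 & bounded_set Omega].

Definition has_straight_corner {R : realType} (Omega : set (R * R)) : Prop :=
  exists (sigma alpha : R) (x0 : R * R) (U : set (R * R)),
    [/\ 0 < sigma < 2 * pi, sigma != pi, nbhs (0 : R * R) U &
        U `&` [set rotation alpha (x - x0) | x in Omega] = U `&` sector sigma].

(* Test functions *)

Definition basis2 {R : realType} (i : 'I_2) : R * R :=
  if i == ord0 then (1, 0) else (0, 1).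

(* The word s = [:: i1; ...; ik] plays the role of a multi-index of order k. *)
Definition partial {R : realType} (s : seq 'I_2) (f : R * R -> R) : R * R -> R :=
  foldr (fun i g x => 'D_(basis2 i) g x) f s.

Definition smooth {R : realType} (f : R * R -> R) : Prop :=
  forall (s : seq 'I_2) (x : R * R), differentiable (partial s f) x.

Definition test_function {R : realType} (Omega : set (R * R))
    (phi : R * R -> R) : Prop :=
  [/\ smooth phi, compact (closure [set x | phi x != 0]) &
      closure [set x | phi x != 0] `<=` Omega].

Definition laplacian {R : realType} (phi : R * R -> R) (x : R * R) : R :=
  \sum_(i < 2) partial [:: i; i] phi x.

(* Lebesgue and Sobolev spaces *)

Definition in_L2 {R : realType} (Omega : set (R * R)) (f : R * R -> R) : Prop :=
  measurable_fun (Omega : set (measurableTypeR R * measurableTypeR R)) f /\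
  leb2.-integrable Omega (fun x => (f x ^+ 2)%:E).

Definition weak_partial {R : realType} (Omega : set (R * R)) (s : seq 'I_2)
    (f g : R * R -> R) : Prop :=
  forall phi, test_function Omega phi ->
    \int[leb2]_(x in Omega) (f x * partial s phi x) =
    (-1) ^+ size s * \int[leb2]_(x in Omega) (g x * phi x).

Definition weak_gradient {R : realType} (Omega : set (R * R))
    (f : R * R -> R) (g : 'I_2 -> R * R -> R) : Prop :=
  forall i, weak_partial Omega [:: i] f (g i).

Definition weak_laplacian {R : realType} (Omega : set (R * R))
    (f g : R * R -> R) : Prop :=
  forall phi, test_function Omega phi ->
    \int[leb2]_(x in Omega) (f x * laplacian phi x) =
    \int[leb2]_(x in Omega) (g x * phi x).

Definition in_H {R : realType} (m : nat) (Omega : set (R * R))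
    (f : R * R -> R) : Prop :=
  in_L2 Omega f /\
  forall s : seq 'I_2, (size s <= m)%N ->
    exists2 g, in_L2 Omega g & weak_partial Omega s f g.

(* f is in H^1(Omega) and has gradient g *)
Definition H1_gradient {R : realType} (Omega : set (R * R))
    (f : R * R -> R) (g : 'I_2 -> R * R -> R) : Prop :=
  [/\ in_L2 Omega f, (forall i, in_L2 Omega (g i)) & weak_gradient Omega f g].

(* closure of the test functions in the H^1 norm *)
Definition in_H10 {R : realType} (Omega : set (R * R)) (f : R * R -> R) : Prop :=
  exists2 g, H1_gradient Omega f g &
    forall e : R, 0 < e -> exists2 phi, test_function Omega phi &
      \int[leb2]_(x in Omega) ((f x - phi x) ^+ 2) +
      \sum_(i < 2) \int[leb2]_(x in Omega) ((g i x - partial [:: i] phi x) ^+ 2)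
      < e.

(* Leray projection and its commutator with the Laplacian *)

Definition leray_projection {R : realType} (Omega : set (R * R))
    (a Pa : 'I_2 -> R * R -> R) : Prop :=
  (forall i, in_L2 Omega (a i)) /\
  exists q gradq,
    [/\ H1_gradient Omega q gradq,
        \int[leb2]_(x in Omega) q x = 0,
        (forall i x, Omega x -> Pa i x = a i x + gradq i x) &
        forall phi gradphi, H1_gradient Omega phi gradphi ->
          \int[leb2]_(x in Omega) (\sum_(i < 2) Pa i x * gradphi i x) = 0].

(* Delta u is an L^2 function Lu here, whereas Delta (P u) is in general only a
   distribution: the last clause says that the distribution
   Delta (P u) - P (Delta u) is the square-integrable field w. *)
Definition laplace_leray_commutator {R : realType} (Omega : set (R * R))
    (u w : 'I_2 -> R * R -> R) : Prop :=
  exists Pu Lu PLu : 'I_2 -> R * R -> R,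
    [/\ leray_projection Omega u Pu,
        (forall i, in_L2 Omega (Lu i) /\ weak_laplacian Omega (u i) (Lu i)),
        leray_projection Omega Lu PLu,
        (forall i, in_L2 Omega (w i)) &
        forall i phi, test_function Omega phi ->
          \int[leb2]_(x in Omega) (Pu i x * laplacian phi x) -
          \int[leb2]_(x in Omega) (PLu i x * phi x) =
          \int[leb2]_(x in Omega) (w i x * phi x)].

(* Main.v *)
(** Let [t] be the squared distance to the corner and [th] the angle measured from
the bisector of the sector [|th| < s].  The field [U = th (z2, - z1) / 2 + l(z)],
with [l] linear, satisfies [Delta U = z / t] and has a constant divergence, and for
[s <> pi / 2] a suitable [l] makes it vanish on both sides of the sector.  Put
[u = X U] with [X = xi (dl ln t)] for a bump function [xi] and a small [dl].  Then
[Delta u = A + O(dl / sqrt t)] where [A = X z / t] is exactly the gradient of a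
function of [t], and [grad div u = O(dl / sqrt t)].  The squared norm of [A] is of
order [1 / dl], those of the errors are of order [dl], and [grad u] is bounded.
The commutator applied to [u] is [Delta u - grad div u - P Delta u], and [P Delta u]
is orthogonal to the gradient [A]; pairing with [A] shows that the commutator has a
norm at least asymptotic to that of [A], hence to that of [Delta u].

The domain is arbitrary away from the corner, so the minimising sequence that
defines the Leray projection need not be bounded.  But the fields are supported in
an annular region around the corner, and outside of it a potential can be truncated
at an arbitrarily small cost in energy. *)
Require Import Defs.
From HB Require Import structures.
From mathcomp Require Import all_boot all_order all_algebra.
From mathcomp Require Import all_classical all_reals all_analysis.
From mathcomp Require Import measurable_realfun.
From mathcomp Require Import ring lra.

Import Order.TTheory GRing.Theory Num.Theory.
Import numFieldNormedType.Exports.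

Local Open Scope classical_set_scope.
Local Open Scope ring_scope.

Set Implicit Arguments.
Unset Strict Implicit.
Unset Printing Implicit Defensive.

(** * Smooth functions and test functions *)

(** The identity for the commutator holds in the interior: the weak equation that defines
    [P u = u + grad q] says that [Delta q = - div u], whence [Delta (P u) = Delta u - grad (div u)].
    The field [P (Delta u)] stays unknown; since it is orthogonal to all gradients, a pairing with
    the gradient [A] removes it and it never has to be estimated.

    The size 1 / |z| is the critical one in dimension 2: the squared norm of such a field is
    proportional to the length of its support in the variable ln t, here of order 1 / dl. Each
    derivative that falls on the cutoff gains a factor dl, so that an error contributes dl^2 / dl.
    Hence the ratio of the two squared norms tends to a limit of at least 1, and any beta < 1 is
    reached.

    The half-angle pi / 2 is excluded because the coefficient s tan s / 2 of [l] is infinite there.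

    The cheap truncation rests on one-dimensional absolute continuity. In the coordinates (t, th) an
    annular region is a box; almost every line in it carries an absolutely continuous representative
    of the potential, and lines with a controlled energy can be selected. The truncation is C^{1,1}
    so that its chain rule follows from Cauchy-Schwarz on short intervals. *)

Section smooth_calculus.
Context {R : realType}.

Lemma near_eq_differentiable (V : normedModType R) (f g : V -> R) (x : V) :
  {near x, f =1 g} -> differentiable f x -> differentiable g x.
Proof.
move=> fg df.
have -> : g = f + (g - f) by apply/funext => y /=; rewrite /GRing.add /= addrC subrK.
apply: differentiableD => //; apply/diff_locallyP; set k := g - f.
have k0 : \forall y \near x, k y = 0.
  by near=> y; rewrite /k /= fctE /= -(near fg y) ?subrr.
have kx0 : k x = 0 by exact: nbhs_singleton k0.
have dk : k \o shift x = cst (k x) + (0 : V -> R) +o_ (0 : V) id.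
  apply/eqaddoP => e e0; near=> h => /=.
  rewrite !fctE /= kx0 addr0 subr0.
  have -> : k (h + x) = 0.
    near: h.
    have : (fun h => h + x) @ (0 : V) --> x.
      rewrite -[X in _ --> X]add0r; apply: cvgD; [exact: cvg_id|exact: cvg_cst].
    by move=> /(_ _ k0).
  by rewrite normr0 mulr_ge0 // ltW.
have -> : 'd k x = 0 :> (V -> R).
  have c0 : continuous (\0 : {linear V -> R}) by exact: cst_continuous.
  exact: (@diff_unique _ _ _ k (\0 : {linear V -> R}) x c0 dk).
by split => //; exact: cst_continuous.
Unshelve. all: by end_near. Qed.

(** Derivatives are taken along every vector and not along a basis, so that the same inductions
    serve on the line and in the plane. The set only tells where the derivatives of [f], taken in
    the whole space, have to exist. *)
Fixpoint diffn {V : normedModType R} (n : nat) (O : set V) (f : V -> R) : Prop :=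
  if n is n'.+1 then
    (forall x, O x -> differentiable f x) /\ forall v, diffn n' O (fun x => 'D_v f x : R)
  else True.

Definition smooth_on {V : normedModType R} (O : set V) (f : V -> R) : Prop :=
  forall n, diffn n O f.

Section algebra.
Context {V : normedModType R}.
Implicit Types (O : set V) (f g : V -> R).

Lemma open_near_eq O f g : open O -> {in O, f =1 g} ->
  forall x, O x -> {near x, f =1 g}.
Proof.
move=> oO fg x Ox; near=> y.
by apply: fg; rewrite inE; near: y; exact: open_nbhs_nbhs.
Unshelve. all: by end_near. Qed.

Lemma diffn_eq n O f g : open O -> {in O, f =1 g} -> diffn n O f -> diffn n O g.
Proof.
move=> oO; elim: n f g => [//|n IH] f g fg /= [df Df]; split.
  by move=> x Ox; apply: near_eq_differentiable (df x Ox); exact: open_near_eq Ox.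
move=> v; apply: (IH _ _ _ (Df v)) => x; rewrite inE => Ox.
by apply: near_eq_derive; exact: open_near_eq Ox.
Qed.

Lemma diffnW n O f : diffn n.+1 O f -> diffn n O f.
Proof.
elim: n f => [//|n IH] f [df Df]; split => // v; exact/IH/Df.
Qed.

Lemma diffn_sub n O O' f : O' `<=` O -> diffn n O f -> diffn n O' f.
Proof.
move=> sub; elim: n f => [//|n IH] f [df Df]; split; first by move=> x /sub /df.
by move=> v; exact/IH/Df.
Qed.

(** Regularity is tested point by point, so it may be witnessed by a different set at each point;
    this is how functions glued from several formulas are treated. *)
Lemma diffn_cover n O f :
  (forall x, O x -> exists2 P, P x & diffn n P f) -> diffn n O f.
Proof.
elim: n f => [//|n IH] f H /=; split.
  by move=> x /H [P Px [df _]]; exact: df.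
by move=> v; apply: IH => x /H [P Px [_ Df]]; exists P => //; exact: Df.
Qed.

Lemma diffn_cst n O (c : R) : open O -> diffn n O (fun=> c).
Proof.
move=> oO; elim: n c => [//|n IH] c; split; first by move=> x _; exact: differentiable_cst.
move=> v; apply: (@diffn_eq _ _ (fun=> 0)) => // x _.
by rewrite derive_cst.
Qed.

Lemma diffnD n O f g : open O -> diffn n O f -> diffn n O g ->
  diffn n O (fun x => f x + g x).
Proof.
move=> oO; elim: n f g => [//|n IH] f g [df Df] [dg Dg]; split.
  by move=> x Ox; exact: (differentiableD (df x Ox) (dg x Ox)).
move=> v; apply: (diffn_eq oO _ (IH _ _ (Df v) (Dg v))) => x; rewrite inE => Ox.
have dfx : derivable f x v := diff_derivable (df x Ox).
have dgx : derivable g x v := diff_derivable (dg x Ox).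
by rewrite -(deriveD dfx dgx).
Qed.

Lemma diffnM n O f g : open O -> diffn n O f -> diffn n O g ->
  diffn n O (fun x => f x * g x).
Proof.
move=> oO; elim: n f g => [//|n IH] f g [df Df] [dg Dg]; split.
  by move=> x Ox; exact: (differentiableM (df x Ox) (dg x Ox)).
move=> v; have Wf : diffn n O f by apply: diffnW.
have Wg : diffn n O g by apply: diffnW.
apply: (diffn_eq oO _ (diffnD oO (IH _ _ Wf (Dg v)) (IH _ _ Wg (Df v)))) => x.
rewrite inE => Ox.
have dfx : derivable f x v := diff_derivable (df x Ox).
have dgx : derivable g x v := diff_derivable (dg x Ox).
by symmetry; exact: (deriveM dfx dgx).
Qed.

Lemma diffnN n O f : open O -> diffn n O f -> diffn n O (fun x => - f x).
Proof.
move=> oO df; apply: (diffn_eq oO _ (diffnM oO (diffn_cst n (-1) oO) df)) => x _.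
by rewrite mulN1r.
Qed.

Lemma diffnB n O f g : open O -> diffn n O f -> diffn n O g ->
  diffn n O (fun x => f x - g x).
Proof. by move=> oO df dg; apply: diffnD => //; exact: diffnN. Qed.

Lemma diffn_linear n O (f : {linear V -> R}) : open O -> continuous f -> diffn n O f.
Proof.
move=> oO cf; case: n => [//|n]; split; first by move=> x _; exact: linear_differentiable.
move=> v; apply: (@diffn_eq _ _ (fun=> f v)) => // [x _|]; last exact: diffn_cst.
by rewrite deriveE ?(diff_lin _ cf)//; exact: linear_differentiable.
Qed.

End algebra.

Lemma derive_comp1 (V : normedModType R) (F : R -> R) (f : V -> R) (x v : V) :
  differentiable f x -> differentiable F (f x) ->
  'D_v (F \o f) x = 'D_1 F (f x) * 'D_v f x.
Proof.
move=> df dF.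
rewrite deriveE; last exact: differentiable_comp.
rewrite diff_comp //= (deriveE v df) (deriveE (1 : R) dF).
by rewrite -[in LHS](mulr1 ('d f x v)) -/(_ *: _) linearZ /= mulrC.
Qed.

Lemma diffn_comp (V : normedModType R) n (O : set V) (J : set R) (F : R -> R) (f : V -> R) :
  open O -> diffn n J F -> diffn n O f -> (forall x, O x -> J (f x)) ->
  diffn n O (F \o f).
Proof.
move=> oO; elim: n F f => [//|n IH] F f [dF DF] [df Df] fJ; split.
  by move=> x Ox; apply: differentiable_comp; [exact: df|exact/dF/fJ].
move=> v; have Wf : diffn n O f by apply: diffnW.
apply: (diffn_eq oO _ (diffnM oO (IH _ _ (DF 1) Wf fJ) (Df v))) => x; rewrite inE => Ox.
by rewrite derive_comp1//; [exact: df|exact/dF/fJ].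
Qed.

Lemma is_derive1P (F : R -> R) (x a : R) : is_derive x 1 F a ->
  differentiable F x /\ forall v, 'D_v F x = v * a.
Proof.
move=> dF; have df : differentiable F x by apply/derivable1_diffP; exact: ex_derive.
split=> // v; rewrite deriveE // -[v in LHS]mulr1 -/(_ *: _) linearZ /= -deriveE //.
by rewrite derive_val.
Qed.

(** On the line one derivative generates all directional ones. Functions whose derivative is an
    expression in functions already treated, or in themselves, become smooth by induction on the
    order. *)
Lemma smooth_on_derive (J : set R) (F G : R -> R) : open J ->
  (forall x, J x -> is_derive x 1 F (G x)) ->
  forall n, diffn n J G -> diffn n.+1 J F.
Proof.
move=> oJ dF n DG; split; first by move=> x /dF /is_derive1P [].
move=> v; apply: (diffn_eq oJ _ (diffnM oJ (diffn_cst n v oJ) DG)) => x; rewrite inE => Jx.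
by have [_ ->] := is_derive1P (dF x Jx).
Qed.

Lemma smooth_on_id : smooth_on setT (id : R -> R).
Proof.
move=> [//|n]; apply: (@smooth_on_derive _ _ (fun=> 1)); first exact: openT.
exact/diffn_cst/openT.
Qed.

Lemma open_neq0 : open [set x : R | x != 0].
Proof.
have -> : [set x : R | x != 0] = ~` [set 0].
  by apply/seteqP; split => x /= /eqP.
by rewrite openC; apply: closed_eq.
Qed.

Lemma smooth_on_inv : smooth_on [set x : R | x != 0] (@GRing.inv R).
Proof.
elim=> [//|n IH].
apply: (@smooth_on_derive _ _ (fun x => - (x^-1 * x^-1)) open_neq0).
  move=> x /= x0; have := is_deriveV x0 (is_derive_id x 1).
  rewrite /GRing.scale /= mulr1 => d.
  by rewrite -invfM -expr2.
by apply: (diffnN open_neq0); apply: (diffnM open_neq0).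
Qed.

Lemma smooth_on_ln : smooth_on [set x : R | 0 < x] (@ln R).
Proof.
case=> [//|n]; apply: (@smooth_on_derive _ _ (@GRing.inv R)).
- exact: open_gt.
- by apply: diffn_sub (smooth_on_inv n) => x /= x0; rewrite gt_eqF.
Qed.

Lemma smooth_on_atan : smooth_on setT (@atan R).
Proof.
case=> [//|n]; apply: (@smooth_on_derive _ _ (fun x => (1 + x ^+ 2)^-1)).
- exact: openT.
apply: (@diffn_comp _ n setT [set x : R | x != 0] GRing.inv (fun x : R => 1 + x ^+ 2)).
- exact: openT.
- exact: smooth_on_inv.
- apply: (diffnD openT); first exact/diffn_cst/openT.
  apply: (diffn_eq openT _ (diffnM openT (smooth_on_id n) (smooth_on_id n))) => x _.
  by rewrite expr2.
- by move=> x _ /=; rewrite gt_eqF // ltr_wpDr // sqr_ge0.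
Qed.

End smooth_calculus.

(** * A smooth transition function *)

Section smooth_step.
Context {R : realType}.
Implicit Types (p : {poly R}) (x : R).

(** The functions p(1/x) exp(-1/x) form a family closed under differentiation: [p] is replaced by
    X^2 (p - p'). The smoothness of the classical flat function thus becomes an induction over all
    polynomials. *)
Definition flat p x : R := if 0 < x then p.[x^-1] * expR (- x^-1) else 0.

Lemma poly_bound p : exists2 C : R, 0 <= C &
  forall y : R, 1 <= y -> `|p.[y]| <= C * y ^+ size p.
Proof.
exists (\sum_(i < size p) `|p`_i|); first exact: sumr_ge0.
move=> y y1; rewrite horner_coef mulr_suml; apply: le_trans (ler_norm_sum _ _ _) _.
apply: ler_sum => i _; rewrite normrM ler_wpM2l // ger0_norm ?exprn_ge0 ?(le_trans ler01) //.
by rewrite ler_weXn2l // ltnW.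
Qed.

(** The exponential dominates every power of [x^-1]. A quadratic bound is what yields the derivative
    0 at the origin. *)
Lemma flat_bound p : exists C : R, forall x, `|x| <= 1 -> `|flat p x| <= C * `|x| ^+ 2.
Proof.
have [C C0 HC] := poly_bound p; move: (size p) HC => k HC.
pose m := k.+1; pose K : R := (m.+1)`!%:R.
have K0 : 0 < K by rewrite ltr0n fact_gt0.
exists (C * K) => x x1; rewrite /flat; case: ltP => x0; last first.
  by rewrite normr0 mulr_ge0 ?exprn_ge0 // mulr_ge0 // ltW.
move: x1; rewrite gtr0_norm // => x1.
have y1 : 1 <= x^-1 by rewrite invf_ge1.
have y0 : 0 < x^-1 by rewrite invr_gt0.
rewrite normrM (gtr0_norm (expR_gt0 _)) expRN ler_pdivrMr ?expR_gt0 //.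
apply: (le_trans (HC _ y1)).
(* The exponent [m.+1] exceeds the degree bound [k] by 2, which leaves the factor [x ^+ 2]. *)
have H : x^-1 ^+ m.+1 <= expR x^-1 * K.
  rewrite -ler_pdivrMr //; apply: le_trans (expR_ge1Dxn m (ltW y0)).
  by rewrite lerDr.
have -> : C * x^-1 ^+ k = C * (x^-1 ^+ m.+1 * x ^+ 2).
  by rewrite /m !exprS expr0; field; rewrite gt_eqF.
have -> : C * K * x ^+ 2 * expR x^-1 = C * (expR x^-1 * K * x ^+ 2) by ring.
by rewrite ler_wpM2l // ler_wpM2r // exprn_ge0 // ltW.
Qed.

Lemma is_derive_quadratic_bound (f : R -> R) (C : R) :
  (forall x, `|x| <= 1 -> `|f x| <= C * `|x| ^+ 2) -> is_derive (0 : R) (1 : R) f (0 : R).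
Proof.
move=> Hf; have f0 : f 0 = 0.
  by apply/eqP; rewrite -normr_le0 (le_trans (Hf _ _)) ?normr0 ?ler01 // expr0n mulr0.
have cv : h^-1 *: ((f \o shift 0) (h *: (1 : R)) - f 0) @[h --> 0^'] --> (0 : R).
  apply/cvgrPdist_le => e e0; near=> h.
  have h0 : h != 0 by near: h; exact: nbhs_dnbhs_neq.
  rewrite /= f0 subr0 addr0 sub0r normrN /GRing.scale /= mulr1 normrM normfV.
  rewrite ler_pdivrMl ?normr_gt0 //.
  have h1 : `|h| <= 1 by near: h; apply: dnbhs0_le.
  have hC : `|h| <= e / (`|C| + 1) by near: h; apply: dnbhs0_le; rewrite divr_gt0 // ltr_wpDl.
  apply: le_trans (Hf _ h1) _; apply: le_trans (ler_wpM2r (exprn_ge0 2 (normr_ge0 h)) (ler_norm C)) _.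
  rewrite expr2 mulrCA ler_wpM2l //.
  have C1 : 0 < `|C| + 1 by rewrite ltr_wpDl.
  move: hC; rewrite ler_pdivlMr // => hC; apply: le_trans hC.
  by rewrite mulrC ler_wpM2l // lerDl.
apply: DeriveDef; first by apply: cvgP; exact: cv.
exact: cvg_lim.
Unshelve. all: by end_near. Qed.

Lemma is_derive_flat p x : is_derive x 1 (flat p) (flat ('X^2 * (p - p^`())) x).
Proof.
have [x0|x0|->] := ltgtP x 0.
- rewrite [flat _ x]/flat ltNge (ltW x0) /=.
  apply: (@near_eq_is_derive _ _ _ (cst 0)).
  near=> y; rewrite /flat ltNge ltW //=; near: y; exact: lt_nbhsl.
- apply: (@near_eq_is_derive R R R (fun y : R => p.[y^-1] * expR (- y^-1))).
    near=> y; rewrite /flat ifT //; near: y; exact: lt_nbhsr.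
  have xn0 : x != 0 by rewrite gt_eqF.
  have dV : is_derive x 1 (@GRing.inv R) (- x ^- 2).
    by have := @is_deriveV R id x 1 1 xn0 (is_derive_id x 1); rewrite /GRing.scale /= mulr1.
  have dE : is_derive x 1 (fun y : R => expR (- y^-1)) (expR (- x^-1) * x ^- 2).
    apply: (@is_derive1_comp _ (@expR R) (fun y => - y^-1)).
    by have := is_deriveN dV; rewrite opprK.
  have dp := is_derive1_comp (is_derive_poly p x^-1) dV.
  have dM := is_deriveM dp dE; rewrite /flat x0.
  rewrite [X in is_derive _ _ _ X](_ : _ = (horner p \o GRing.inv) x *: (expR (- x^-1) / x ^+ 2) +
     expR (- x^-1) *: (p^`().[x^-1] * - x ^- 2)); first exact: dM.
  by rewrite /GRing.scale /= !hornerE /=; field.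
- rewrite [flat _ 0]/flat ltxx; have [C HC] := flat_bound p.
  exact: is_derive_quadratic_bound HC.
Unshelve. all: by end_near. Qed.

Lemma smooth_on_flat p : smooth_on setT (flat p).
Proof.
move=> n; elim: n p => [//|n IH] p; apply: smooth_on_derive (IH ('X^2 * (p - p^`()))); first exact: openT.
by move=> x _; exact: is_derive_flat.
Qed.

(** The usual quotient that passes smoothly from 0 to 1 on the unit interval. All cutoffs below are
    made of it, and its derivative is the radial profile of the vector field. *)
Definition step x : R := flat 1 x / (flat 1 x + flat 1 (1 - x)).

Lemma flat1_ge0 x : 0 <= flat 1 x.
Proof. by rewrite /flat; case: ifP => // _; rewrite hornerE mul1r expR_ge0. Qed.

Lemma flat1_gt0 x : 0 < x -> 0 < flat 1 x.
Proof. by rewrite /flat => ->; rewrite hornerE mul1r expR_gt0. Qed.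

Lemma flat_le0 p x : x <= 0 -> flat p x = 0.
Proof. by rewrite /flat ltNge => ->. Qed.

Lemma flatD_gt0 x : 0 < flat 1 x + flat 1 (1 - x).
Proof.
have [x0|x0] := ltP 0 x; first by rewrite ltr_pwDl ?flat1_gt0 ?flat1_ge0.
by rewrite ltr_wpDl ?flat1_ge0 // flat1_gt0 // subr_gt0 (le_lt_trans x0).
Qed.

Lemma step_ge0 x : 0 <= step x.
Proof. by rewrite divr_ge0 ?flat1_ge0 // ltW ?flatD_gt0. Qed.

Lemma step_le1 x : step x <= 1.
Proof. by rewrite ler_pdivrMr ?flatD_gt0 // mul1r lerDl flat1_ge0. Qed.

Lemma step0 x : x <= 0 -> step x = 0.
Proof. by move=> x0; rewrite /step flat_le0 // mul0r. Qed.

Lemma step1 x : 1 <= x -> step x = 1.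
Proof.
move=> x1; rewrite /step (@flat_le0 _ (1 - x)) ?subr_le0 // addr0 divff //.
by rewrite gt_eqF // flat1_gt0 // (lt_le_trans _ x1).
Qed.

Lemma smooth_on_step : smooth_on setT step.
Proof.
move=> n; have f1 : diffn n setT (flat 1) := smooth_on_flat 1 n.
apply: (diffnM openT f1).
apply: (@diffn_comp _ _ n setT [set x : R | x != 0] GRing.inv
  (fun x : R => flat 1 x + flat 1 (1 - x))).
- exact: openT.
- exact: smooth_on_inv.
- apply: (diffnD openT f1).
  apply: (@diffn_comp _ _ n setT setT (flat 1) (fun x : R => 1 - x)) => //.
  + exact: openT.
  + by apply: (diffnB openT); [exact/diffn_cst/openT|exact: smooth_on_id].
- by move=> x _ /=; rewrite gt_eqF // flatD_gt0.
Qed.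

End smooth_step.

(** * Test functions of the plane *)

Section test_functions.
Context {R : realType}.
Local Notation plane := (R * R)%type.
Implicit Types (O : set plane) (f g phi : plane -> R) (x v : plane).

Lemma basis2_0 : basis2 ord0 = (1, 0) :> plane. Proof. by rewrite /basis2 eqxx. Qed.

Lemma basis2_max : basis2 ord_max = (0, 1) :> plane. Proof. by []. Qed.

Lemma basis2_decomp v : v = v.1 *: basis2 ord0 + v.2 *: basis2 ord_max.
Proof.
rewrite basis2_0 basis2_max; case: v => a b /=.
by rewrite /GRing.add /= /add_pair /= /GRing.scale /= /scale_pair /= !mulr1 !mulr0 addr0 add0r.
Qed.

Lemma diffD_v f x v : differentiable f x ->
  'D_v f x = v.1 * 'D_(basis2 ord0) f x + v.2 * 'D_(basis2 ord_max) f x.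
Proof.
move=> df; rewrite (deriveE v df) {1}(basis2_decomp v) linearD !linearZ /=.
by rewrite -(deriveE (basis2 ord0) df) -(deriveE (basis2 ord_max) df).
Qed.

Lemma smooth_on_D O f v : smooth_on O f -> smooth_on O (fun x => 'D_v f x).
Proof. by move=> sf n; have [_] := sf n.+1; exact. Qed.

Lemma smooth_on_diff O f x : smooth_on O f -> O x -> differentiable f x.
Proof. by move=> sf Ox; have [+ _] := sf 1%N; exact. Qed.

Lemma smooth_on_partial O f s : smooth_on O f -> smooth_on O (partial s f).
Proof. by move=> sf; elim: s => [//|i s IH]; exact: smooth_on_D. Qed.

(** A differential is linear in the direction, so the two basis derivatives that [smooth] speaks of
    control the derivatives along all vectors. *)
Lemma smoothP f : smooth f <-> smooth_on setT f.
Proof.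
split=> [sf|sf s x]; last exact: (smooth_on_diff (smooth_on_partial s sf)).
suff H n s : diffn n setT (partial s f) by move=> n; exact: (H n [::]).
elim: n s => [//|n IH] s; split=> [x _|v]; first exact: sf.
apply: (diffn_eq openT _ (diffnD openT
  (diffnM openT (diffn_cst n v.1 openT) (IH (ord0 :: s)))
  (diffnM openT (diffn_cst n v.2 openT) (IH (ord_max :: s))))) => x _.
by rewrite (diffD_v _ (sf s x)).
Qed.

Lemma smooth_on_eq O f g : open O -> {in O, f =1 g} -> smooth_on O f -> smooth_on O g.
Proof. by move=> oO fg sf n; exact: diffn_eq fg (sf n). Qed.

Lemma smooth_on_sub O O' f : O' `<=` O -> smooth_on O f -> smooth_on O' f.
Proof. by move=> s sf n; exact: diffn_sub s (sf n). Qed.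

Lemma smooth_on_cst O (c : R) : open O -> smooth_on O (fun=> c).
Proof. by move=> oO n; exact: diffn_cst. Qed.

Lemma smooth_onD O f g : open O -> smooth_on O f -> smooth_on O g ->
  smooth_on O (fun x => f x + g x).
Proof. by move=> oO sf sg n; exact: diffnD. Qed.

Lemma smooth_onB O f g : open O -> smooth_on O f -> smooth_on O g ->
  smooth_on O (fun x => f x - g x).
Proof. by move=> oO sf sg n; exact: diffnB. Qed.

Lemma smooth_onM O f g : open O -> smooth_on O f -> smooth_on O g ->
  smooth_on O (fun x => f x * g x).
Proof. by move=> oO sf sg n; exact: diffnM. Qed.

Lemma smooth_on_comp O (J : set R) (F : R -> R) f : open O -> smooth_on J F ->
  smooth_on O f -> (forall x, O x -> J (f x)) -> smooth_on O (fun x => F (f x)).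
Proof. by move=> oO sF sf fJ n; exact: (diffn_comp oO (sF n) (sf n) fJ). Qed.

Lemma smooth_on_fst O : open O -> smooth_on O (fun x => x.1).
Proof.
move=> oO n; have c : continuous (fst : plane -> R) by move=> x; exact: cvg_fst.
exact: (@diffn_linear R plane n O (fst : {linear plane -> R}) oO c).
Qed.

Lemma smooth_on_snd O : open O -> smooth_on O (fun x => x.2).
Proof.
move=> oO n; have c : continuous (snd : plane -> R) by move=> x; exact: cvg_snd.
exact: (@diffn_linear R plane n O (snd : {linear plane -> R}) oO c).
Qed.

Lemma smooth_on_continuous O f : open O -> smooth_on O f -> forall x, O x -> {for x, continuous f}.
Proof. by move=> oO sf x Ox; exact/differentiable_continuous/(smooth_on_diff sf). Qed.

Definition support f : set plane := closure [set x | f x != 0].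

Lemma support_out f x : ~ support f x -> f x = 0.
Proof. by move=> nx; apply/eqP/negPn/negP => fx; apply: nx; exact: subset_closure. Qed.

Lemma support_sub f (C : set plane) : closed C -> (forall x, ~ C x -> f x = 0) -> support f `<=` C.
Proof.
move=> cC f0; rewrite [X in _ `<=` X](closure_id C).1 //; apply: closureS => x /= fx.
by apply: contrapT => /f0 /eqP; exact/negP.
Qed.

Lemma closed_support f : closed (support f). Proof. exact: closed_closure. Qed.

Lemma support_D f v : support (fun x => 'D_v f x) `<=` support f.
Proof.
apply: support_sub; first exact: closed_support.
move=> x nx; rewrite (@near_eq_derive _ _ _ f (cst 0) x v) ?derive_cst //.
have oC : open (~` support f) by rewrite openC; exact: closed_support.
by near=> y; apply: support_out; near: y; exact: open_nbhs_nbhs.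
Unshelve. all: by end_near. Qed.

Lemma test_functionE O phi :
  test_function O phi <-> [/\ smooth_on setT phi, compact (support phi) & support phi `<=` O].
Proof. by split=> -[/smoothP]. Qed.

Lemma test_function_D O phi v : test_function O phi -> test_function O (fun x => 'D_v phi x).
Proof.
move=> /test_functionE[sp cp pO]; apply/test_functionE; split.
- exact: smooth_on_D.
- by apply: (subclosed_compact _ cp (@support_D _ _)); exact: closed_support.
- exact: subset_trans (@support_D _ _) pO.
Qed.

Lemma test_function_partial O phi s : test_function O phi -> test_function O (partial s phi).
Proof. by move=> tp; elim: s => [//|i s IH]; exact: test_function_D. Qed.

Lemma test_function_sub O O' phi : O `<=` O' -> test_function O phi -> test_function O' phi.
Proof.
by move=> OO /test_functionE[? ? pO]; apply/test_functionE; split=> //; exact: subset_trans OO.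
Qed.

(** Nothing is known of [f] outside [O], but the product vanishes on the open complement of the
    support of [phi]; that set and [O] cover the plane. *)
Lemma test_functionM O f phi : open O -> smooth_on O f -> test_function O phi ->
  test_function O (fun x => f x * phi x).
Proof.
move=> oO sf /test_functionE[sp cp pO].
have s0 : support (fun x => f x * phi x) `<=` support phi.
  by apply: support_sub => [|x /support_out ->]; [exact: closed_support|rewrite mulr0].
have oC : open (~` support phi) by rewrite openC; exact: closed_support.
apply/test_functionE; split; last exact: subset_trans s0 pO.
  move=> n; apply: diffn_cover => x _; have [Ox|nOx] := pselect (O x).
    exists O => //; apply: (diffnM oO (sf n)).
    by apply: diffn_sub (sp n).
  exists (~` support phi); first by move=> /pO.
  apply: (@diffn_eq _ _ _ _ (fun=> 0)) => //; last exact: diffn_cst.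
  by move=> y; rewrite inE => /support_out ->; rewrite mulr0.
by apply: (subclosed_compact _ cp s0); exact: closed_support.
Qed.

Lemma test_functionD O f g : test_function O f -> test_function O g ->
  test_function O (fun x => f x + g x).
Proof.
move=> /test_functionE[sf cf fO] /test_functionE[sg cg gO].
have s0 : support (fun x => f x + g x) `<=` support f `|` support g.
  apply: support_sub => [|x /not_orP[/support_out -> /support_out ->]]; last by rewrite addr0.
  by apply: closedU; exact: closed_support.
apply/test_functionE; split; first by apply: smooth_onD => //; exact: openT.
  by apply: (subclosed_compact _ (compactU cf cg) s0); exact: closed_support.
by apply: subset_trans s0 _; rewrite subUset.
Qed.

End test_functions.

(** * Symmetry of second derivatives *)

Section mixed_partials.
Context {R : realType} {V : normedModType R}.
Implicit Types (O : set V) (f : V -> R) (x u v w : V).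

Lemma differentiable_expansion f x : differentiable f x -> forall e : R, 0 < e ->
  \forall w \near 0, `|f (x + w) - f x - 'D_w f x| <= e * `|w|.
Proof.
move=> df e e0; have /eqaddoP H := diff_locally df.
near=> w; have : `|(f \o shift x - (cst (f x) + 'd f x)) w| <= e * `|id w|.
  by near: w; exact: H.
by rewrite !fctE /= (deriveE w df) [w + x]addrC opprD addrA.
Unshelve. all: by end_near. Qed.

Lemma is_derive_line f x u (s : R) : differentiable f (x + s *: u) ->
  is_derive s (1 : R) (fun r : R => f (x + r *: u)) ('D_u f (x + s *: u)).
Proof.
move=> df; have dv : derivable f (x + s *: u) u := diff_derivable df.
have E : (fun h : R => h^-1 *: (((fun r : R => f (x + r *: u)) \o shift s) (h *: (1 : R)) - f (x + s *: u))) =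
         (fun h : R => h^-1 *: ((f \o shift (x + s *: u)) (h *: u) - f (x + s *: u))).
  apply/funext => h /=; rewrite [h *: 1]mulr1; congr (_ *: (f _ - _)).
  by rewrite scalerDl addrCA.
apply: DeriveDef; first by rewrite /derivable E.
by rewrite /derive E.
Qed.

(** The mean value theorem along [u] turns the second difference into a first difference of
    ['D_u f], evaluated at two points near [x]; the differentiability of ['D_u f] at [x] is then
    applied at both. *)
Lemma second_difference O f x u v : open O -> smooth_on O f -> O x ->
  forall e : R, 0 < e -> \forall h \near 0^'+,
    `|f (x + h *: u + h *: v) - f (x + h *: u) - f (x + h *: v) + f x
      - h ^+ 2 * 'D_v (fun y => 'D_u f y) x| <= e * h ^+ 2.
Proof.
move=> oO sf Ox e e0; pose F y := 'D_u f y : R.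
have dF : differentiable F x.
  by have [_ /(_ u) [+ _]] := sf 2%N; exact.
(* [h * C] bounds the sum of the norms of the two increments at which the expansion of [F] is used,
   and each of them separately. *)
pose C := 2 * `|u| + `|v| + 1; have C0 : 0 < C by rewrite /C; have := normr_ge0 u; have := normr_ge0 v; lra.
have eC : 0 < e / C by rewrite divr_gt0.
have /nbhs_ballP[r /= r0 Hr] := differentiable_expansion dF eC.
have /nbhs_ballP[r' /= r'0 Hr'] : nbhs x O by exact: open_nbhs_nbhs.
near=> h; have h0 : 0 < h by near: h; exact: nbhs_right_gt.
have small w : `|w| <= h * C -> ball 0 r w /\ O (x + w).
  move=> wh; have hr : h * C < Num.min r r'.
    rewrite -ltr_pdivlMr //; near: h; apply: nbhs_right_lt.
    by rewrite divr_gt0 // lt_min r0.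
  move: hr; rewrite lt_min => /andP[hr hr']; split.
    by rewrite -ball_normE /= sub0r normrN (le_lt_trans wh).
  by apply: Hr'; rewrite -ball_normE /= opprD addrA subrr sub0r normrN (le_lt_trans wh).
have nZ (c : R) w : 0 <= c <= h -> `|c *: w| <= h * `|w|.
  by move=> /andP[c0 ch]; rewrite normrZ ger0_norm // ler_wpM2r.
have uC : h * `|u| <= h * C.
  rewrite ler_wpM2l ?ltW // /C.
  have := normr_ge0 u; have := normr_ge0 v; lra.
have uvuC : h * `|u| + h * `|v| + h * `|u| <= h * C.
  rewrite -!mulrDr ler_wpM2l ?ltW // /C.
  have := normr_ge0 u; have := normr_ge0 v; lra.
have uvC : h * `|u| + h * `|v| <= h * C.
  rewrite -mulrDr ler_wpM2l ?ltW // /C.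
  have := normr_ge0 u; have := normr_ge0 v; lra.
have Oline (c : R) : 0 <= c <= h -> O (x + c *: u) /\ O (x + h *: v + c *: u).
  move=> ch; split; first by apply: (small _ _).2; exact: le_trans (nZ _ _ ch) uC.
  rewrite -addrA; apply: (small _ _).2; apply: le_trans (ler_normD _ _) _.
  rewrite addrC; apply: le_trans uvC; apply: lerD; first exact: nZ.
  by apply: nZ; rewrite lexx ltW.
pose g (s : R) := f (x + h *: v + s *: u) - f (x + s *: u).
have dg (s : R) : 0 <= s <= h -> is_derive s (1 : R) g (F (x + h *: v + s *: u) - F (x + s *: u)).
  move=> /Oline [P1 P2].
  have df1 : differentiable f (x + s *: u) by have [+ _] := sf 1%N; exact.
  have df2 : differentiable f (x + h *: v + s *: u) by have [+ _] := sf 1%N; exact.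
  exact: (is_deriveB (is_derive_line df2) (is_derive_line df1)).
have [c ch] : exists2 c, c \in `[0, h] & g h - g 0 =
    (F (x + h *: v + c *: u) - F (x + c *: u)) * (h - 0).
  apply: MVT_segment; first exact: ltW.
    by move=> s; rewrite in_itv /= => /andP[/ltW s0 /ltW sh]; apply: dg; rewrite s0.
  apply: derivable_within_continuous => s; rewrite in_itv /= => sh.
  by have [] := dg s sh.
rewrite subr0 /g !scale0r !addr0 => gE.
have -> : f (x + h *: u + h *: v) - f (x + h *: u) - f (x + h *: v) + f x =
   (F (x + h *: v + c *: u) - F (x + c *: u)) * h.
  by rewrite -gE -[x + h *: u + _]addrA [h *: u + _]addrC addrA; lra.
move: ch; rewrite in_itv /= => ch.
have n1 : `|c *: u| <= h * `|u| by exact: nZ.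
have n2 : `|h *: v + c *: u| <= h * `|u| + h * `|v|.
  by apply: le_trans (ler_normD _ _) _; rewrite addrC; apply: lerD => //; apply: nZ; rewrite lexx ltW.
have b1 := Hr _ (small _ (le_trans n1 uC)).1.
have b2 := Hr _ (small _ (le_trans n2 uvC)).1.
move: b1 b2 => /= b1 b2; rewrite addrA in b2.
have lD : 'D_(h *: v + c *: u) F x = h * 'D_v F x + 'D_(c *: u) F x.
  by rewrite !(deriveE _ dF) linearD linearZ.
rewrite lD in b2.
move: b1 b2; set A := F (x + h *: v + c *: u); set B := F (x + c *: u).
move: A B (F x) ('D_v F x) ('D_(c *: u) F x) => A B D E G b1 b2.
have -> : (A - B) * h - h ^+ 2 * E = h * ((A - D - (h * E + G)) - (B - D - G)) by ring.
rewrite normrM (gtr0_norm h0) expr2 mulrCA ler_pM2l //.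
apply: le_trans (ler_normB _ _) _; apply: le_trans (lerD b2 b1) _.
rewrite -mulrDr mulrAC ler_pdivrMr // -mulrA ler_pM2l //; apply: le_trans (lerD n2 n1) _.
exact: uvuC.
Unshelve. all: by end_near. Qed.

(** The second difference is symmetric in [u] and [v], and both mixed derivatives are its limit
    after division by [h ^+ 2]. *)
Lemma derive_commute O f x u v : open O -> smooth_on O f -> O x ->
  'D_u (fun y => 'D_v f y) x = 'D_v (fun y => 'D_u f y) x.
Proof.
move=> oO sf Ox; apply/eqP; rewrite -subr_eq0 -normr_le0.
apply/ler_addgt0Pl => e e0; rewrite addr0.
have e2 : 0 < e / 2 by rewrite divr_gt0.
have S1 := second_difference u v oO sf Ox e2.
have S2 := second_difference v u oO sf Ox e2.
have [h [[H1 H2] h0]] := filter_ex (filterI (filterI S1 S2) (nbhs_right_gt (0 : R))).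
move: H1 H2; set a := 'D_u _ x; set b := 'D_v _ x.
rewrite -[x + h *: v + h *: u]addrA [h *: v + _]addrC addrA.
move: (f _) (f _) (f _) (f _) => p q r s H1 H2.
rewrite -(ler_pM2l (exprn_gt0 2 h0)) -[X in X * `|_|](gtr0_norm (exprn_gt0 2 h0)) -normrM.
have -> : h ^+ 2 * (a - b) = (s - r - q + p - h ^+ 2 * b) - (s - q - r + p - h ^+ 2 * a) by ring.
by apply: le_trans (ler_normB _ _) _; apply: le_trans (lerD H1 H2) _; rewrite -mulrDl -splitr mulrC.
Qed.

End mixed_partials.

(** * Square-integrable functions *)

Section real_integral.
Context {d : measure_display} {T : measurableType d} {R : realType}.
Variables (mu : {measure set T -> \bar R}) (D : set T).
Hypothesis mD : measurable D.
Implicit Types f g : T -> R.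

Definition intble f := mu.-integrable D (EFin \o f).

Lemma EFin_Rintegral f : intble f ->
  ((\int[mu]_(x in D) f x)%:E = \int[mu]_(x in D) (f x)%:E)%E.
Proof. by move=> If; rewrite /Rintegral fineK // integrable_fin_num. Qed.

Lemma intble_measurable f : intble f -> measurable_fun D f.
Proof. by move=> /measurable_int /measurable_EFinP. Qed.

Lemma intble_le f g : measurable_fun D f -> (forall x, D x -> `|f x| <= g x) -> intble g -> intble f.
Proof.
move=> mf fg; apply: le_integrable => //; first exact/measurable_EFinP.
by move=> x Dx; rewrite /= lee_fin (le_trans (fg x Dx)) // ler_norm.
Qed.

Lemma intbleD f g : intble f -> intble g -> intble (fun x => f x + g x).
Proof. exact: integrableD. Qed.

Lemma intbleZ (c : R) f : intble f -> intble (fun x => c * f x).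
Proof. exact: (integrableZl mD c). Qed.

Lemma intbleN f : intble f -> intble (fun x => - f x).
Proof.
move=> /(intbleZ (-1)); congr (mu.-integrable _ _).
by apply/funext => x /=; rewrite mulN1r.
Qed.

Lemma intbleB f g : intble f -> intble g -> intble (fun x => f x - g x).
Proof. by move=> If /intbleN; exact: intbleD. Qed.

Lemma intble_eq f g : (forall x, D x -> f x = g x) -> intble f -> intble g.
Proof. by move=> fg; apply: eq_integrable => // x; rewrite inE => /fg /= ->. Qed.

Lemma Rint_eq f g : (forall x, D x -> f x = g x) ->
  \int[mu]_(x in D) f x = \int[mu]_(x in D) g x.
Proof. by move=> fg; apply: eq_Rintegral => x; rewrite inE; exact: fg. Qed.

Lemma intble0 : intble (fun=> 0).
Proof. exact: integrable0. Qed.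

Lemma Rint0 f : (forall x, D x -> f x = 0) -> \int[mu]_(x in D) f x = 0.
Proof.
move=> f0; rewrite (@Rint_eq _ (fun=> 0)) // /Rintegral (_ : (fun _ => 0%:E) = cst 0%E) //.
by rewrite integral0.
Qed.

Lemma RintN f : intble f -> \int[mu]_(x in D) (- f x) = - \int[mu]_(x in D) f x.
Proof.
move=> If; rewrite -[RHS]mulN1r -RintegralZl //; apply: Rint_eq => x _; by rewrite mulN1r.
Qed.

Lemma intble_sum (I : Type) (s : seq I) (F : I -> T -> R) :
  (forall i, intble (F i)) -> intble (fun x => \sum_(i <- s) F i x).
Proof.
move=> IF; elim: s => [|i s IH].
  by apply: intble_eq intble0 => x _; rewrite big_nil.
by apply: intble_eq (intbleD (IF i) IH) => x _; rewrite big_cons.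
Qed.

Definition sqint f := measurable_fun D f /\ mu.-integrable D (fun x => (f x ^+ 2)%:E).

Lemma sqint_mul f g : sqint f -> sqint g -> intble (fun x => f x * g x).
Proof.
move=> [mf If] [mg Ig]; apply: (@intble_le _ (fun x => f x ^+ 2 + g x ^+ 2)).
- exact: measurable_funM.
- move=> x _; rewrite normrM -(real_normK (num_real (f x))) -(real_normK (num_real (g x))).
  have := sqr_ge0 (`|f x| - `|g x|); have := sqr_ge0 (`|f x| + `|g x|).
  by rewrite sqrrB sqrrD; have := mulr_ge0 (normr_ge0 (f x)) (normr_ge0 (g x)); lra.
- exact: intbleD.
Qed.

Lemma sqint_sq f : sqint f -> intble (fun x => f x ^+ 2).
Proof. by case. Qed.

Lemma sqint_le f g : measurable_fun D f -> (forall x, D x -> `|f x| <= `|g x|) -> sqint g -> sqint f.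
Proof.
move=> mf fg [mg Ig]; split=> //.
apply: (@intble_le (fun x => f x ^+ 2) (fun x => g x ^+ 2)) => //.
  exact: measurable_funX.
move=> x Dx; rewrite normrX -[leRHS]real_normK ?num_real // lerXn2r ?nnegrE //; exact: fg.
Qed.

Lemma sqintZ (c : R) f : sqint f -> sqint (fun x => c * f x).
Proof.
move=> [mf If]; split; first exact: measurable_funM.
apply: (@intble_eq (fun x => c ^+ 2 * f x ^+ 2)); first by move=> x _; rewrite exprMn.
exact: intbleZ.
Qed.

Lemma sqintD f g : sqint f -> sqint g -> sqint (fun x => f x + g x).
Proof.
move=> sf sg; have [mf If] := sf; have [mg Ig] := sg; split; first exact: measurable_funD.
apply: (@intble_eq (fun x => f x ^+ 2 + 2 * (f x * g x) + g x ^+ 2)).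
  by move=> x _; ring.
by apply: intbleD => //; apply: intbleD => //; exact/intbleZ/sqint_mul.
Qed.

Lemma sqintN f : sqint f -> sqint (fun x => - f x).
Proof.
move=> [mf If]; split; first exact: measurableT_comp.
by apply: intble_eq If => x _; rewrite sqrrN.
Qed.

Lemma sqintB f g : sqint f -> sqint g -> sqint (fun x => f x - g x).
Proof. by move=> sf /sqintN; exact: sqintD. Qed.

Lemma sqint0 : sqint (fun=> 0).
Proof.
split; first exact: measurable_cst.
by apply: intble_eq intble0 => x _; rewrite expr0n.
Qed.

Lemma sqint_eq f g : (forall x, D x -> f x = g x) -> sqint f -> sqint g.
Proof.
move=> fg [mf If]; split.
  by apply: eq_measurable_fun mf => x; rewrite inE => /fg.
by apply: intble_eq If => x /fg ->.
Qed.

Lemma sqintM (C : R) (h f : T -> R) : measurable_fun D h -> (forall x, D x -> `|h x| <= C) -> sqint f ->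
  sqint (fun x => h x * f x).
Proof.
move=> mh hC sf; apply: (@sqint_le _ (fun x => C * f x)).
- by apply: measurable_funM => //; case: sf.
- move=> x Dx; rewrite !normrM; apply: ler_wpM2r => //; exact: le_trans (hC x Dx) (ler_norm _).
- exact: sqintZ.
Qed.

Definition ip f g : R := \int[mu]_(x in D) (f x * g x).

Lemma ipC f g : ip f g = ip g f.
Proof. by apply: Rint_eq => x _; rewrite mulrC. Qed.

Lemma ipDl f g h : sqint f -> sqint g -> sqint h -> ip (fun x => f x + g x) h = ip f h + ip g h.
Proof.
move=> sf sg sh; rewrite -RintegralD //; [|exact: sqint_mul..].
by apply: Rint_eq => x _; rewrite mulrDl.
Qed.

Lemma ipZl (c : R) f h : sqint f -> sqint h -> ip (fun x => c * f x) h = c * ip f h.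
Proof.
move=> sf sh; rewrite -RintegralZl //; last exact: sqint_mul.
by apply: Rint_eq => x _; rewrite mulrA.
Qed.

Lemma ipNl f h : sqint f -> sqint h -> ip (fun x => - f x) h = - ip f h.
Proof.
move=> sf sh; rewrite -RintN //; last exact: sqint_mul.
by apply: Rint_eq => x _; rewrite mulNr.
Qed.

Lemma ipBl f g h : sqint f -> sqint g -> sqint h -> ip (fun x => f x - g x) h = ip f h - ip g h.
Proof. by move=> sf sg sh; rewrite ipDl ?ipNl //; exact: sqintN. Qed.

Definition nrm2 f : R := \int[mu]_(x in D) (f x ^+ 2).

Lemma nrm2_ge0 f : 0 <= nrm2 f.
Proof. by apply: Rintegral_ge0 => x _; exact: sqr_ge0. Qed.

Lemma nrm2E f : nrm2 f = ip f f.
Proof. by apply: Rint_eq => x _; rewrite expr2. Qed.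

Lemma nrm2D f g : sqint f -> sqint g ->
  nrm2 (fun x => f x + g x) = nrm2 f + 2 * ip f g + nrm2 g.
Proof.
move=> sf sg; rewrite !nrm2E ipDl //; last exact: sqintD.
rewrite ![ip _ (fun x => _ + _)]ipC !ipDl // [ip g f]ipC; ring.
Qed.

Lemma nrm2Z (c : R) f : sqint f -> nrm2 (fun x => c * f x) = c ^+ 2 * nrm2 f.
Proof.
move=> sf; rewrite /nrm2 -RintegralZl //; last by case: sf.
by apply: Rint_eq => x _; rewrite exprMn.
Qed.

Lemma nrm2N f : nrm2 (fun x => - f x) = nrm2 f.
Proof. by apply: Rint_eq => x _; rewrite sqrrN. Qed.

Lemma nrm2B f g : sqint f -> sqint g ->
  nrm2 (fun x => f x - g x) = nrm2 f - 2 * ip f g + nrm2 g.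
Proof.
move=> sf sg; rewrite nrm2D ?nrm2N //; last exact: sqintN.
by rewrite [ip f _]ipC ipNl // ipC; ring.
Qed.

Lemma cauchy_schwarz f g : sqint f -> sqint g -> ip f g ^+ 2 <= nrm2 f * nrm2 g.
Proof.
move=> sf sg; set a := nrm2 f; set b := ip f g; set c := nrm2 g.
have H s : 0 <= a + 2 * s * b + s ^+ 2 * c.
  have := nrm2_ge0 (fun x => f x + s * g x).
  rewrite nrm2D ?nrm2Z //; last exact: sqintZ.
  by rewrite [ip f _]ipC ipZl // ipC -/a -/b -/c; congr (0 <= _); ring.
have [c0|c0] := eqVneq c 0.
  rewrite c0 mulr0; have [->|b0] := eqVneq b 0; first by rewrite expr0n.
  (* With [c = 0] the polynomial is affine in [s]; at this point it would take the value -1. *)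
  have := H (- (a + 1) / (2 * b)); rewrite c0 mulr0 addr0.
  have -> : a + 2 * (- (a + 1) / (2 * b)) * b = -1 by field.
  by rewrite ler0N1.
have cp : 0 < c by rewrite lt_neqAle eq_sym c0 nrm2_ge0.
have := H (- b / c).
have -> : a + 2 * (- b / c) * b + (- b / c) ^+ 2 * c = (a * c - b ^+ 2) / c by field.
by rewrite pmulr_lge0 ?invr_gt0 // subr_ge0.
Qed.

Lemma nrm2_parallelogram f g : sqint f -> sqint g ->
  nrm2 (fun x => f x - g x) = 2 * nrm2 f + 2 * nrm2 g - nrm2 (fun x => f x + g x).
Proof. by move=> sf sg; rewrite nrm2B // nrm2D //; ring. Qed.

Lemma nrm2D_le f g : sqint f -> sqint g ->
  nrm2 (fun x => f x + g x) <= 2 * nrm2 f + 2 * nrm2 g.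
Proof.
move=> sf sg; have := nrm2_parallelogram sf sg.
have := nrm2_ge0 (fun x => f x - g x); lra.
Qed.

Lemma sqint_bounded (C : R) f : (mu D < +oo)%E -> measurable_fun D f ->
  (forall x, D x -> `|f x| <= C) -> sqint f.
Proof.
move=> muD mf fC; split=> //.
have E : mu.-integrable D (EFin \o (fun x => f x ^+ 2)).
  apply: measurable_bounded_integrable => //; first exact: measurable_funX.
  exists (C ^+ 2); split; first exact: num_real.
  move=> M CM x Dx /=; rewrite normrX (le_trans _ (ltW CM)) // lerXn2r ?nnegrE //.
    exact: le_trans (fC x Dx).
  exact: fC.
exact: E.
Qed.

Lemma sqint_intble f : (mu D < +oo)%E -> sqint f -> intble f.
Proof.
move=> muD sf; apply: (intble_eq (f := fun x => f x * 1)); first by move=> x _; rewrite mulr1.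
apply: sqint_mul => //; apply: (@sqint_bounded 1) => // x _; by rewrite normr1.
Qed.

Lemma Rint_ae_eq f g : measurable_fun D f -> measurable_fun D g ->
  (\forall x \ae mu, D x -> f x = g x) -> \int[mu]_(x in D) f x = \int[mu]_(x in D) g x.
Proof.
move=> mf mg fg; rewrite /Rintegral; congr fine; apply: ae_eq_integral => //.
- exact/measurable_EFinP.
- exact/measurable_EFinP.
by apply: filterS fg => x fg /fg ->.
Qed.

Lemma intble_ae f g : measurable_fun D f -> (\forall x \ae mu, D x -> f x = g x) ->
  intble g -> intble f.
Proof.
move=> mf fg Ig; have /integrableP[mg gfin] := Ig.
apply/integrableP; split; first exact/measurable_EFinP.
rewrite (_ : (\int[mu]_(x in D) _ = \int[mu]_(x in D) `|(g x)%:E|)%E) //.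
apply: ge0_ae_eq_integral => //.
- by apply/measurable_EFinP/measurableT_comp.
- exact: measurableT_comp.
- by apply: filterS fg => x fg /fg /= ->.
Qed.

End real_integral.

Lemma cvg_realE {R : realType} (u : nat -> R) (l : R) :
  u n @[n --> \oo] --> l -> (u n)%:E @[n --> \oo] --> l%:E.
Proof. by move=> ul; apply: cvg_EFin => //; exact: nearW. Qed.

(** * Completeness of L^2 *)

Section L2_complete.
Context {d : measure_display} {T : measurableType d} {R : realType}.
Variables (mu : {measure set T -> \bar R}) (D : set T).
Hypothesis mD : measurable D.

(** The weights [4 ^+ i] force the increments below [Num.sqrt S / 2 ^+ n], so that they are
    absolutely summable. *)
Lemma cvg_weighted_squares (a : R^nat) (S : R) :
  (forall n, \sum_(i < n) 4 ^+ i * (a i.+1 - a i) ^+ 2 <= S) -> cvgn a.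
Proof.
move=> aS.
have S0 : 0 <= S by have := aS 0%N; rewrite big_ord0.
have bd n : `|a n.+1 - a n| <= Num.sqrt S / 2 ^+ n.
  have : 4 ^+ n * (a n.+1 - a n) ^+ 2 <= S.
    apply: le_trans (aS n.+1); rewrite big_ord_recr /= lerDr.
    by apply: sumr_ge0 => i _; rewrite mulr_ge0 ?sqr_ge0 ?exprn_ge0.
  rewrite ler_pdivlMr ?exprn_gt0 // => H.
  rewrite -(@ler_sqr _ (_ * _)) ?nnegrE ?mulr_ge0 ?exprn_ge0 ?sqrtr_ge0 //.
  rewrite sqr_sqrtr // exprMn real_normK ?num_real // mulrC -exprM mulnC exprM.
  by rewrite (_ : 2 ^+ 2 = 4 :> R) //; ring.
have cns : cvgn [normed series (fun n => a n.+1 - a n)].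
  apply: (@series_le_cvg _ _ (geometric (Num.sqrt S) 2^-1)) => [n|n|n|].
  - exact: normr_ge0.
  - by rewrite /= mulr_ge0 ?sqrtr_ge0 // exprn_ge0 // invr_ge0.
  - by rewrite /= exprVn; exact: bd.
  - by apply: is_cvg_geometric_series; rewrite ger0_norm ?invf_lt1 ?ltr1n // invr_ge0.
have cs := @normed_cvg R R _ cns; have -> : a = (fun n => a 0%N + series (fun n => a n.+1 - a n) n).
  apply/funext => n; rewrite /series /= telescope_sumr //; ring.
by apply: is_cvgD => //; exact: is_cvg_cst.
Qed.

(** The Riesz-Fischer argument: the squared increments weighted by [4 ^+ n] have integrals at most
    2^-n, so their sum is finite almost everywhere and the sequence converges there. Fatou's lemma
    carries the Cauchy estimate over to the limit with the same rate. *)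
Lemma sqint_rapidly_cauchy (f : nat -> T -> R) :
  (forall n, sqint mu D (f n)) ->
  (forall n m, (n <= m)%N -> nrm2 mu D (fun x => f m x - f n x) <= 8^-1 ^+ n) ->
  exists2 g, sqint mu D g & forall n, nrm2 mu D (fun x => f n x - g x) <= 8^-1 ^+ n.
Proof.
move=> sf fC.
have mf n : measurable_fun D (f n) by case: (sf n).
pose s n x : R := 4 ^+ n * (f n.+1 x - f n x) ^+ 2.
have s0 n x : 0 <= s n x by rewrite mulr_ge0 ?sqr_ge0 ?exprn_ge0.
have ms n : measurable_fun D (s n).
  by apply: measurable_funM => //; apply: measurable_funX; exact: measurable_funB.
have Is n : intble mu D (s n) by apply: intbleZ => //; exact: (sqint_sq (sqintB _ (sf _) (sf _))).
have sumfin : (\int[mu]_(x in D) \sum_(0 <= n <oo) (s n x)%:E < +oo)%E.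
  rewrite integral_nneseries //; first last.
    by move=> n x _; rewrite lee_fin.
    by move=> n; apply/measurable_EFinP.
  apply: (@le_lt_trans _ _ (\sum_(0 <= n <oo) ((2^-1 : R) ^+ n)%:E)%E).
    apply: lee_nneseries => [*|n _]; first by apply: integral_ge0 => x _; rewrite lee_fin.
    rewrite -EFin_Rintegral // lee_fin RintegralZl //; last first.
      exact: (sqint_sq (sqintB _ (sf _) (sf _))).
    apply: le_trans (ler_wpM2l _ (fC n n.+1 (leqnSn n))) _; first exact: exprn_ge0.
    by rewrite -exprMn (_ : 4 * 8^-1 = 2^-1 :> R) //; field.
  have := @cvg_geometric_series R 1 2^-1; rewrite ger0_norm ?invf_lt1 ?ltr1n ?invr_ge0 //.
  move=> /(_ isT) cg.
  rewrite (_ : (\sum_(0 <= n <oo) _)%E = (1 / (1 - 2^-1))%:E) ?ltry //.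
  apply/cvg_lim => //; rewrite (_ : (fun n => _) = EFin \o series (geometric 1 2^-1)).
    exact: cvg_realE cg.
  by apply/funext => n; rewrite /= /series /= sumEFin; congr EFin; apply: eq_bigr => i _; rewrite mul1r.
have aecv : \forall x \ae mu, D x -> cvgn (fun n => f n x).
  have mS : measurable_fun D (fun x => \sum_(0 <= n <oo) (s n x)%:E)%E.
    by apply: ge0_emeasurable_sum => [n x Dx _|n _]; [rewrite lee_fin|apply/measurable_EFinP].
  have IS : mu.-integrable D (fun x => \sum_(0 <= n <oo) (s n x)%:E)%E.
    apply/integrableP; split=> //; apply: le_lt_trans sumfin; rewrite le_eqVlt; apply/orP; left.
    apply/eqP; apply: eq_integral => x _; rewrite gee0_abs //.
    by apply: nneseries_ge0 => n _ _; rewrite lee_fin.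
  have := integrable_ae mD IS; apply: filterS => x + Dx => /(_ Dx) fx.
  apply: (@cvg_weighted_squares _ (fine (\sum_(0 <= n <oo) (s n x)%:E)%E)) => n.
  rewrite -lee_fin fineK // -(big_mkord xpredT (fun i => s i x)) -sumEFin.
  by apply: (nneseries_lim_ge (P := xpredT)) => i _ _; rewrite lee_fin.
(* The upper limit is measurable on all of [D] and agrees with the limit wherever there is one, that
   is almost everywhere. *)
pose g x := fine (limn_esup (fun n => (f n x)%:E)).
have gE x : cvgn (fun n => f n x) -> f n x @[n --> \oo] --> g x.
  move=> cf; have cE : (f n x)%:E @[n --> \oo] --> (limn (fun n => f n x))%:E.
    exact: cvg_realE cf.
  by rewrite /g (cvg_limn_einf_sup cE).2.
have mg : measurable_fun D g.
  apply: (measurableT_comp (fine_measurable measurableT)).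
  by apply: measurable_fun_limn_esup => n; apply/measurable_EFinP.
have fat n : (\int[mu]_(x in D) ((f n x - g x) ^+ 2)%:E <= (8^-1 ^+ n)%:E)%E.
  pose h m x : \bar R := ((f m x - f n x) ^+ 2)%:E.
  have mh m : measurable_fun D (h m).
    by apply/measurable_EFinP/measurable_funX; exact: measurable_funB.
  have -> : (\int[mu]_(x in D) ((f n x - g x) ^+ 2)%:E = \int[mu]_(x in D) limn_einf (h ^~ x))%E.
    apply: ae_eq_integral => //.
    - by apply/measurable_EFinP/measurable_funX; exact: measurable_funB.
    - rewrite (_ : (fun x => _) = (fun x => - limn_esup (fun m => - h m x))%E); last first.
        by apply/funext => x; rewrite -limn_einfN; congr limn_einf; apply/funext => m; exact: (esym (oppeK _)).
      apply: measurableT_comp => //; apply: measurable_fun_limn_esup => m.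
      exact: measurableT_comp.
    apply: filterS aecv => x + Dx => /(_ Dx) /gE cx; symmetry.
    have ch : h m x @[m --> \oo] --> ((g x - f n x) ^+ 2)%:E.
      apply: cvg_realE.
      have cB : f m x - f n x @[m --> \oo] --> g x - f n x by apply: cvgB => //; exact: cvg_cst.
      by rewrite expr2; apply: cvg_trans (cvgM cB cB); apply: near_eq_cvg; apply: nearW => m /=; rewrite expr2.
    by rewrite (cvg_limn_einf_sup ch).1 -sqrrN opprB.
  apply: (@le_trans _ _ (limn_einf (fun m => \int[mu]_(x in D) h m x))%E).
    by apply: fatou => // m x _; rewrite lee_fin sqr_ge0.
  rewrite limn_einf_lim; apply: lime_le; first exact: is_cvg_einfs.
  apply: nearW => k; apply: (@le_trans _ _ (\int[mu]_(x in D) h (maxn k n) x)%E).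
    by apply: ereal_inf_lbound; exists (maxn k n) => //=; exact: leq_maxl.
  rewrite -EFin_Rintegral //; last exact: (sqint_sq (sqintB _ (sf _) (sf _))).
  by rewrite lee_fin; apply: fC; exact: leq_maxr.
have dg n : sqint mu D (fun x => f n x - g x).
  split; first exact: measurable_funB.
  apply/integrableP; split.
    by apply/measurable_EFinP/measurable_funX; exact: measurable_funB.
  rewrite (_ : (\int[mu]_(x in D) _ = \int[mu]_(x in D) ((f n x - g x) ^+ 2)%:E)%E).
    exact: le_lt_trans (fat n) (ltry _).
  by apply: eq_integral => x _; rewrite gee0_abs // lee_fin sqr_ge0.
exists g.
  by apply: (@sqint_eq _ _ _ mu D mD (fun x => f 0%N x - (f 0%N x - g x))) => [x _|]; [ring|exact: sqintB].
by move=> n; rewrite -lee_fin EFin_Rintegral //; exact: (sqint_sq (dg n)).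
Qed.

End L2_complete.

(** * Measurability and area in the plane *)

Section plane_measure.
Context {R : realType}.
Local Notation plane := (R * R)%type.
Local Notation mplane := (measurableTypeR R * measurableTypeR R)%type.
Local Notation leb := (@lebesgue_measure R).

Definition box (a b c d : R) : set plane := [set x | a < x.1 < b /\ c < x.2 < d].

Lemma boxE a b c d : box a b c d = `]a, b[%classic `*` `]c, d[%classic.
Proof. by apply/seteqP; split=> x /=; rewrite !in_itv. Qed.

Lemma measurable_box a b c d : measurable (box a b c d : set mplane).
Proof. by rewrite boxE; apply: measurableX; exact: measurable_itv. Qed.

Lemma open_box a b c d : open (box a b c d).
Proof.
have -> : box a b c d = ((fst @^-1` `]a, b[%classic) `&` (snd @^-1` `]c, d[%classic) : set plane).
  by apply/seteqP; split=> x /=; rewrite !in_itv.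
by apply: openI; apply: open_comp => [x _|]; [exact: cvg_fst|exact: interval_open|exact: cvg_snd|exact: interval_open].
Qed.

Lemma ball_box (x : plane) (r : R) : 0 < r -> ball x r = box (x.1 - r) (x.1 + r) (x.2 - r) (x.2 + r).
Proof.
move=> r0; apply/seteqP; split=> y /=.
  by rewrite /ball /= /prod_ball /= /ball /= !ltr_distlC.
by move=> [h1 h2]; split; rewrite /= /ball /= ltr_distlC.
Qed.

Lemma open_boxes (O : set plane) (x : plane) : open O -> O x ->
  exists q : rat * rat * rat * rat,
    let B := box (ratr q.1.1.1) (ratr q.1.1.2) (ratr q.1.2) (ratr q.2) in B x /\ B `<=` O.
Proof.
move=> oO Ox; have /nbhs_ballP[r /= r0 rO] : nbhs x O by exact: open_nbhs_nbhs.
have H (c : R) : exists p q : rat, [/\ c - r < ratr p, ratr p < c, c < ratr q & ratr q < c + r].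
  have [p] : exists q : rat, ratr q \in `]c - r, c[ by apply: rat_in_itvoo; rewrite ltrBlDr ltrDl.
  have [q] : exists q : rat, ratr q \in `]c, c + r[ by apply: rat_in_itvoo; rewrite ltrDl.
  by rewrite !in_itv /= => /andP[? ?] /andP[? ?]; exists p, q.
have [a [b [a1 a2 b1 b2]]] := H x.1; have [c [e [c1 c2 e1 e2]]] := H x.2.
exists (a, b, c, e) => /=; split; first by split=> /=; apply/andP.
apply: subset_trans rO; rewrite ball_box // => y [/andP[y1 y2] /andP[y3 y4]].
by split; apply/andP; split; [exact: lt_trans y1|exact: lt_trans b2|exact: lt_trans y3|exact: lt_trans e2].
Qed.

(** The sigma-algebra in force is the product one, generated by rectangles; an open set belongs to
    it as a countable union of boxes with rational sides. *)
Lemma measurable_open (O : set plane) : open O -> measurable (O : set mplane).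
Proof.
move=> oO.
pose B (q : rat * rat * rat * rat) := box (ratr q.1.1.1 : R) (ratr q.1.1.2) (ratr q.1.2) (ratr q.2).
pose F q := if asbool (B q `<=` O) then B q else set0.
rewrite (_ : O = \bigcup_q F q).
  apply: countable_bigcupT_measurable => [|q]; first exact: countableP.
  by rewrite /F; case: ifP => _; [exact: measurable_box|exact: measurable0].
apply/seteqP; split=> x.
  move=> Ox; have [q [Bx BO]] := open_boxes oO Ox.
  by exists q => //; rewrite /F asboolT.
by move=> [q _]; rewrite /F; case: asboolP => [BO /BO|].
Qed.

Lemma measurable_closed (C : set plane) : closed C -> measurable (C : set mplane).
Proof.
move=> cC; rewrite -(setCK C); apply: measurableC; apply: measurable_open.
by rewrite openC.
Qed.

Lemma continuous_on_measurable (O : set plane) (f : plane -> R) : open O ->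
  (forall x, O x -> {for x, continuous f}) -> measurable_fun (O : set mplane) f.
Proof.
move=> oO cf; apply: (measurability _ (RGenOInfty.measurableE R)).
move=> _ [_ [a ->] <-]; apply: measurable_open.
rewrite openE => x [Ox fx]; rewrite /interior; near=> y; split.
  by near: y; exact: open_nbhs_nbhs.
rewrite /= in_itv /= andbT; near: y; move: fx; rewrite /= in_itv /= andbT => fx.
exact: (cf x Ox) _ (lt_nbhsr fx).
Unshelve. all: by end_near. Qed.

Lemma smooth_on_measurable (O : set plane) (f : plane -> R) : open O -> smooth_on O f ->
  measurable_fun (O : set mplane) f.
Proof. by move=> oO sf; apply: continuous_on_measurable => // x Ox; exact: smooth_on_continuous Ox. Qed.

Lemma leb2_box a b c d : a <= b -> c <= d -> leb2 (box a b c d) = ((b - a) * (d - c))%:E.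
Proof.
move=> ab cd; rewrite boxE /leb2 product_measure1E; [|exact: measurable_itv..].
have itvE (u v : R) : u <= v -> leb `]u, v[%classic = (v - u)%:E.
  by move=> uv; rewrite lebesgue_measure_itv /= lte_fin; case: ltgtP uv => // -> _; rewrite subrr.
by rewrite EFinM; congr (_ * _)%E; exact: itvE.
Qed.

End plane_measure.

Lemma derive_mul {R : realType} {V : normedModType R} (f g : V -> R) (x v : V) :
  differentiable f x -> differentiable g x ->
  'D_v (fun y => f y * g y) x = f x * 'D_v g x + g x * 'D_v f x.
Proof. by move=> df dg; exact: (deriveM (diff_derivable df) (diff_derivable dg)). Qed.

Lemma ord2_max (i : 'I_2) : i != ord0 -> i = ord_max.
Proof. by case: i => -[|[|//]] // h _; exact/val_inj. Qed.

Section support_integral.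
Context {d : measure_display} {T : measurableType d} {R : realType}.
Variables (mu : {measure set T -> \bar R}).
Implicit Types (A B : set T) (f : T -> R).

Lemma patch_support A B f : A `<=` B -> (forall x, B x -> ~ A x -> f x = 0) -> f \_ B = f \_ A.
Proof.
move=> AB f0; apply/funext => x; rewrite !patchE.
case: ifPn => [|]; rewrite ?inE ?notin_setE => Bx; case: ifPn => //; rewrite ?inE ?notin_setE => Ax.
  exact: f0.
by have := Bx (AB _ Ax).
Qed.

Lemma Rint_support A B f : A `<=` B -> (forall x, B x -> ~ A x -> f x = 0) ->
  \int[mu]_(x in B) f x = \int[mu]_(x in A) f x.
Proof. by move=> AB f0; rewrite Rintegral_mkcond (patch_support AB f0) -Rintegral_mkcond. Qed.

Lemma intble_support A B f : measurable A -> measurable B -> A `<=` B ->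
  (forall x, B x -> ~ A x -> f x = 0) -> intble mu A f <-> intble mu B f.
Proof.
move=> mA mB AB f0; rewrite /intble (integrable_mkcond _ mA) (integrable_mkcond _ mB).
by rewrite !restrict_EFin (patch_support AB f0).
Qed.

End support_integral.

(** * Integration by parts against test functions *)

Section integration_by_parts.
Context {R : realType}.
Local Notation plane := (R * R)%type.
Local Notation mplane := (measurableTypeR R * measurableTypeR R)%type.
Local Notation leb := (@lebesgue_measure R).
Implicit Types (phi psi f : plane -> R).

Lemma compact_box (K : set plane) : compact K -> exists2 M : R, 0 < M & K `<=` box (- M) M (- M) M.
Proof.
move=> /compact_bounded [M [_ HM]]; pose N := Num.max 0 M + 1.
have N0 : 0 < N by rewrite ltr_pwDr // le_max lexx.
have NM : M < N by rewrite ltr_pwDr // le_max lexx orbT.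
exists (N + 1) => [|x Kx]; first by rewrite addr_gt0.
have := HM _ NM x Kx; rewrite /= prod_normE ge_max => /andP[x1 x2].
by split; rewrite -ltr_norml (le_lt_trans x1, le_lt_trans x2) // ltrDl.
Qed.

Lemma compact_max_norm (K : set plane) f : compact K -> (forall x, K x -> {for x, continuous f}) ->
  exists2 M : R, 0 <= M & forall x, K x -> `|f x| <= M.
Proof.
move=> cK cf.
have : compact (f @` K).
  by apply: continuous_compact => //; apply: continuous_in_subspaceT => x; rewrite inE; exact: cf.
move=> /compact_bounded [M [_ HM]]; exists (Num.max 0 M + 1) => [|x Kx].
  by rewrite addr_ge0 // le_max lexx.
by apply: (HM (Num.max 0 M + 1)); [rewrite ltr_pwDr // le_max lexx orbT|exists x].
Qed.

Lemma test_bounded phi : test_function setT phi -> exists2 M : R, 0 <= M & forall x, `|phi x| <= M.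
Proof.
move=> /test_functionE[sp cp _]; have [|M M0 HM] := @compact_max_norm _ phi cp.
  by move=> x _; exact: (smooth_on_continuous openT sp).
exists M => // x; have [/HM//|/support_out ->] := pselect (support phi x).
by rewrite normr0.
Qed.

Lemma test_measurable phi : test_function setT phi -> measurable_fun (setT : set mplane) phi.
Proof. by move=> /test_functionE[sp _ _]; apply: smooth_on_measurable => //; exact: openT. Qed.

Lemma test_intble phi : test_function setT phi -> intble leb2 setT phi.
Proof.
move=> tp; have [M M0 HM] := test_bounded tp; have /test_functionE[sp cp _] := tp.
have [N N0 KN] := compact_box cp.
apply/(@intble_support _ _ _ leb2 (box (- N) N (- N) N)) => //; first exact: measurable_box.
  by move=> x _ nB; apply: support_out => /KN.
apply: measurable_bounded_integrable; first exact: measurable_box.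
- rewrite (_ : (_ < _)%E = (leb2 (box (- N) N (- N) N) < +oo)%E) //.
  by rewrite leb2_box ?ltry // ge0_cp // ltW.
- by apply: measurable_funS (test_measurable tp).
- by exists M; split; [exact: num_real|move=> e Me x _ /=; exact: le_trans (HM x) (ltW Me)].
Qed.

Lemma continuous_slice1 (f : plane -> R) (y : R) : continuous f -> continuous (fun x => f (x, y)).
Proof.
move=> cf x; apply: (cvg_comp (fun x => (x, y)) f); last exact: cf.
exact: (cvg_pair cvg_id (cvg_cst _)).
Qed.

Lemma continuous_slice2 (f : plane -> R) (x : R) : continuous f -> continuous (fun y => f (x, y)).
Proof.
move=> cf y; apply: (cvg_comp (fun y => (x, y)) f); last exact: cf.
exact: (cvg_pair (cvg_cst _) cvg_id).
Qed.

Lemma integral_derive_vanish (F f : R -> R) (N : R) : 0 < N -> continuous f -> continuous F ->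
  (forall x : R, is_derive x (1 : R) F (f x)) -> (forall x, ~ (- N < x < N) -> F x = 0) ->
  (\int[leb]_x (f x)%:E = 0)%E.
Proof.
move=> N0 cf cF dF F0.
have NN : - (N + 1) < N + 1 by move: N0; lra.
have f0 x : ~ (- (N + 1) <= x <= N + 1) -> f x = 0.
  move=> xN; rewrite -(@derive_val _ _ _ _ _ _ _ (dF x)).
  rewrite (@near_eq_derive _ _ _ F (cst 0) x 1) ?derive_cst //.
  have : x < - (N + 1) \/ N + 1 < x.
    by case: (ltP x (- (N + 1))); [left|move=> h1; right; rewrite ltNge; apply/negP => h2; apply: xN; rewrite h1].
  move=> [xl|xr]; near=> z; apply: F0 => /andP[z1 z2].
    have : z < - (N + 1) by near: z; exact: lt_nbhsl.
    by rewrite ltNge => /negP; apply; rewrite opprD ler_wnDr // ltW.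
  have : N + 1 < z by near: z; exact: lt_nbhsr.
  by rewrite ltNge => /negP; apply; rewrite ler_wpDr // ltW.
have -> : (\int[leb]_x (f x)%:E = \int[leb]_(x in `[(- (N + 1))%R, (N + 1)%R]) (f x)%:E)%E.
  rewrite [RHS]integral_mkcond; apply: eq_integral => x _; rewrite patchE.
  by case: ifPn => //; rewrite notin_setE /= in_itv /= => /f0 ->.
rewrite (@continuous_FTC2 _ f F) //.
- rewrite (@F0 (N + 1)) ?(@F0 (- (N + 1))) ?subee // => /andP[h1 h2]; move: h1 h2 N0; lra.
- exact: continuous_subspaceT.
- split; first by move=> x _; exact: ex_derive.
  + exact: (cvg_at_right_filter (cF _)).
  + exact: (cvg_at_left_filter (cF _)).
- by move=> x _; rewrite derive1E derive_val.
Unshelve. all: by end_near. Qed.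

(** Fubini allows the derivative to be integrated first along its own direction, where a compactly
    supported function contributes nothing. *)
Lemma Rint_test_D phi i : test_function setT phi ->
  \int[leb2]_x 'D_(basis2 i) phi x = 0.
Proof.
move=> tp; have [sp cp _] := (test_functionE _ _).1 tp.
have [N N0 KN] := compact_box cp.
have ID j := test_intble (test_function_D (basis2 j) tp).
have cphi : continuous phi by move=> x; exact: (smooth_on_continuous openT sp).
have cD j : continuous (fun x => 'D_(basis2 j) phi x).
  by move=> x; exact: (smooth_on_continuous openT (smooth_on_D (basis2 j) sp)).
rewrite /Rintegral; have [i0|i1] := eqVneq i ord0.
  rewrite -(@integral21_prod_meas1 _ _ _ _ _ leb leb (fun x => ('D_(basis2 i) phi x)%:E) (ID i)) //.
  rewrite integral0_eq // => y _; rewrite /fubini_G.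
  apply: (@integral_derive_vanish (fun x => phi (x, y)) _ N) => //.
  - exact: (continuous_slice1 (cD i)).
  - exact: continuous_slice1 cphi.
  - move=> x; have d1 : differentiable phi ((0, y) + x *: (basis2 i : plane)) by exact: (smooth_on_diff sp).
    have := is_derive_line d1; rewrite i0 basis2_0.
    have E r : ((0 : R), y) + r *: ((1, 0) : plane) = (r, y).
      by rewrite /GRing.add /= /add_pair /= /GRing.scale /= /scale_pair /= mulr1 mulr0 add0r addr0.
    by rewrite E (_ : (fun r => _) = (fun r => phi (r, y))) //; apply/funext => r; rewrite E.
  - by move=> x xN; apply: support_out => /KN [/= h _]; exact: xN.
rewrite (ord2_max i1).
rewrite -(@integral12_prod_meas1 _ _ _ _ _ leb leb (fun x => ('D_(basis2 ord_max) phi x)%:E) (ID ord_max)) //.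
rewrite integral0_eq // => x _; rewrite /fubini_F.
apply: (@integral_derive_vanish (fun y => phi (x, y)) _ N) => //.
- exact: (continuous_slice2 (cD ord_max)).
- exact: continuous_slice2 cphi.
- move=> y; have d1 : differentiable phi ((x, 0) + y *: (basis2 ord_max : plane)) by exact: (smooth_on_diff sp).
  have := is_derive_line d1; rewrite basis2_max.
  have E r : (x, (0 : R)) + r *: ((0, 1) : plane) = (x, r).
    by rewrite /GRing.add /= /add_pair /= /GRing.scale /= /scale_pair /= mulr1 mulr0 add0r addr0.
  by rewrite E (_ : (fun r => _) = (fun r => phi (x, r))) //; apply/funext => r; rewrite E.
- by move=> y xN; apply: support_out => /KN [_ /= h]; exact: xN.
Qed.

Lemma Rint_test_sub (Omega : set plane) phi : open Omega -> test_function Omega phi ->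
  \int[leb2]_(x in Omega) phi x = \int[leb2]_x phi x.
Proof.
move=> oO /test_functionE[_ _ pO]; symmetry; apply: Rint_support => // x _ nO.
by apply: support_out => /pO.
Qed.

Lemma test_intble_on (Omega : set plane) phi : open Omega -> test_function setT phi ->
  intble leb2 Omega phi.
Proof.
move=> oO tp; apply: (@integrableS _ _ _ leb2 setT) => //; last exact: test_intble.
exact: measurable_open.
Qed.

(** The product of [f] with a test function is a test function even when [f] is wild at the
    boundary, and its derivative has integral 0. *)
Lemma weak_partial_smooth1 (Omega : set plane) f i : open Omega -> smooth_on Omega f ->
  weak_partial Omega [:: i] f (fun x => 'D_(basis2 i) f x).
Proof.
move=> oO sf phi tp; rewrite /= expr1 mulN1r.
have sD := smooth_on_D (basis2 i) sf.
have tT g : smooth_on Omega g -> test_function setT (fun x => g x * phi x).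
  by move=> sg; apply: test_function_sub (test_functionM oO sg tp).
have tD := test_function_D (basis2 i) tp.
have I1 : intble leb2 Omega (fun x => f x * 'D_(basis2 i) phi x).
  by apply: test_intble_on => //; apply: test_function_sub (test_functionM oO sf tD).
have I2 : intble leb2 Omega (fun x => 'D_(basis2 i) f x * phi x).
  by apply: test_intble_on => //; exact: tT.
have mO := measurable_open oO.
apply/eqP; rewrite -addr_eq0 -RintegralD //; apply/eqP.
rewrite (@Rint_eq _ _ _ leb2 Omega _ (fun x => 'D_(basis2 i) (fun y => f y * phi y) x)).
  rewrite Rint_test_sub //; last exact/test_function_D/test_functionM.
  by apply: Rint_test_D; exact: tT.
move=> x Ox; have df := smooth_on_diff sf Ox.
have dp : differentiable phi x.
  by have /test_functionE[sp _ _] := tp; exact: (smooth_on_diff sp).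
rewrite (derive_mul _ df dp).
by move: ('D_(basis2 i) f x) ('D_(basis2 i) phi x) => a b; rewrite [a * _]mulrC.
Qed.

End integration_by_parts.

Lemma Rint_cvg {d : measure_display} {T : measurableType d} {R : realType}
    (mu : {measure set T -> \bar R}) (D : set T) (f_ : nat -> T -> R) (f g : T -> R) :
  measurable D -> (forall n, measurable_fun D (f_ n)) ->
  (forall x, D x -> f_ n x @[n --> \oo] --> f x) ->
  intble mu D g -> (forall n x, D x -> `|f_ n x| <= g x) ->
  intble mu D f /\ \int[mu]_(x in D) f_ n x @[n --> \oo] --> \int[mu]_(x in D) f x.
Proof.
move=> mD mf ff Ig fg.
have mfl : measurable_fun D f by exact: measurable_fun_cvg ff.
have [If _ c] := @dominated_convergence _ _ _ mu D mD (fun n => EFin \o f_ n) (EFin \o f) (EFin \o g)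
  (fun n => (measurable_EFinP _ _).2 (mf n)) ((measurable_EFinP _ _).2 mfl)
  (aeW _ (fun x Dx => cvg_realE (ff x Dx))) Ig
  (aeW _ (fun x n Dx => fg n x Dx)).
have If_ n : intble mu D (f_ n) by apply: intble_le (fg n) Ig => //.
split=> //; move: c; rewrite /= -(EFin_Rintegral _ If) // => c.
exact: (fine_cvg c).
Qed.

(** * Smooth approximation of boxes *)

Section bumps.
Context {R : realType}.
Local Notation plane := (R * R)%type.
Local Notation mplane := (measurableTypeR R * measurableTypeR R)%type.
Implicit Types (al be : R -> R) (a b c d p q r s : R).

(** Test functions of one variable. The support is recorded by a closed interval inside []a, b[],
    the form in which it passes to derivatives, primitives and products. *)
Definition test1 a b al := smooth_on setT al /\
  exists p q, [/\ a < p, q < b & forall s, ~ (p <= s <= q) -> al s = 0].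

Lemma test_function_prod a b c d al be : test1 a b al -> test1 c d be ->
  test_function (box a b c d) (fun x => al x.1 * be x.2).
Proof.
move=> [sa [p [q [ap qb al0]]]] [sb [p' [q' [cp qd be0]]]].
pose K : set plane := `[p, q]%classic `*` `[p', q']%classic.
have cK : compact K by apply: compact_setX; exact: segment_compact.
have clK : closed K by apply: compact_closed => //; exact: norm_hausdorff.
have sK : support (fun x => al x.1 * be x.2) `<=` K.
  apply: support_sub => // x; rewrite /K /= !in_itv /= => /not_andP[/al0 ->|/be0 ->].
    by rewrite mul0r.
  by rewrite mulr0.
apply/test_functionE; split.
- apply: smooth_onM; first exact: openT.
    by apply: (smooth_on_comp openT sa (smooth_on_fst openT)).
  by apply: (smooth_on_comp openT sb (smooth_on_snd openT)).
- by apply: subclosed_compact sK => //; exact: closed_support.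
- apply: subset_trans sK _ => x; rewrite /K /= !in_itv /= => -[/andP[h1 h2] /andP[h3 h4]].
  by split; apply/andP; split; [exact: lt_le_trans h1|exact: le_lt_trans qb|
     exact: lt_le_trans h3|exact: le_lt_trans qd].
Qed.

(** Smooth approximations of the indicator of []p, q[] from inside: the transitions lie between the
    distances 1/(n+1) and 2/(n+1) from the end points. *)
Definition bump p q (n : nat) s : R :=
  step (n.+1%:R * (s - p) - 1) * step (n.+1%:R * (q - s) - 1).

Lemma bump_ge0 p q n s : 0 <= bump p q n s.
Proof. by rewrite mulr_ge0 // step_ge0. Qed.

Lemma bump_le1 p q n s : bump p q n s <= 1.
Proof. by rewrite mulr_ile1 // ?step_ge0 ?step_le1. Qed.

Lemma bump_out p q n s : ~ (p + n.+1%:R^-1 <= s <= q - n.+1%:R^-1) -> bump p q n s = 0.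
Proof.
move=> /negP; rewrite negb_and -!ltNge => /orP[] h; rewrite /bump.
  rewrite (@step0 _ (_ * (s - p) - 1)) ?mul0r // subr_le0 mulrC -ler_pdivlMr ?ltr0Sn //.
  by rewrite lerBlDl div1r ltW.
rewrite (@step0 _ (_ * (q - s) - 1)) ?mulr0 // subr_le0 mulrC -ler_pdivlMr ?ltr0Sn //.
by rewrite lerBlDl div1r -lerBlDr ltW.
Qed.

Lemma bump_cvg p q s : bump p q n s @[n --> \oo] --> (if p < s < q then 1 else 0 : R).
Proof.
case: ifPn => [/andP[ps sq]|psq]; last first.
  apply: cvg_near_cst; apply: nearW => n; apply: bump_out => /andP[h1 h2].
  move/negP: psq; apply; apply/andP; split.
    by apply: lt_le_trans h1; rewrite ltrDl invr_gt0.
  by apply: le_lt_trans h2 _; rewrite ltrBlDr ltrDl invr_gt0.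
have near_ge (r : R) : \forall k \near \oo, r <= k.+1%:R.
  near=> k; apply: (@le_trans _ _ k%:R); last by rewrite ler_nat.
  by near: k; exact: nbhs_infty_ger.
apply: cvg_near_cst; near=> n.
have big (t : R) : 0 < t -> 2 / t <= n.+1%:R -> 1 <= n.+1%:R * t - 1.
  by move=> t0; rewrite ler_pdivrMr // => h; rewrite lerBrDr.
rewrite /bump !step1 ?mulr1 //; apply: big; rewrite ?subr_gt0 //.
  by near: n; exact: near_ge.
by near: n; exact: near_ge.
Unshelve. all: by end_near. Qed.

Lemma smooth_on_affine (k l : R) : smooth_on setT (fun s : R => k * s + l).
Proof.
move=> n; apply: (diffnD openT); last exact/diffn_cst/openT.
apply: (diffnM openT); [exact/diffn_cst/openT|exact: smooth_on_id].
Qed.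

Lemma smooth_on_bump p q n : smooth_on setT (bump p q n).
Proof.
move=> k; rewrite /bump; apply: (diffnM openT).
  apply: (@diffn_comp _ _ k setT setT step (fun s : R => n.+1%:R * (s - p) - 1)) => //.
  - exact: openT.
  - exact: smooth_on_step.
  - have := @smooth_on_affine n.+1%:R (- n.+1%:R * p - 1) k; congr diffn.
    by apply/funext => s; ring.
apply: (@diffn_comp _ _ k setT setT step (fun s : R => n.+1%:R * (q - s) - 1)) => //.
- exact: openT.
- exact: smooth_on_step.
- have := @smooth_on_affine (- n.+1%:R) (n.+1%:R * q - 1) k; congr diffn.
  by apply/funext => s; ring.
Qed.

Lemma test1_bump a b p q n : a <= p -> q <= b -> test1 a b (bump p q n).
Proof.
move=> ap qb; split; first exact: smooth_on_bump.
exists (p + n.+1%:R^-1), (q - n.+1%:R^-1); split; last exact: bump_out.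
- by rewrite (le_lt_trans ap) // ltrDl invr_gt0.
- by rewrite (lt_le_trans _ qb) // ltrBlDr ltrDl invr_gt0.
Qed.

Lemma smooth1_measurable al : smooth_on setT al -> measurable_fun (setT : set R) al.
Proof.
move=> sa; apply: continuous_measurable_fun => x; apply: differentiable_continuous.
by have [+ _] := sa 1%N; exact.
Qed.

Lemma measurable_prod_fun al be (D : set mplane) : smooth_on setT al -> smooth_on setT be -> measurable D ->
  measurable_fun D (fun x : mplane => al x.1 * be x.2).
Proof.
move=> sa sb mD; apply: measurable_funM.
  by apply: measurable_funTS; apply: (measurableT_comp (smooth1_measurable sa)).
by apply: measurable_funTS; apply: (measurableT_comp (smooth1_measurable sb)).
Qed.

Lemma Rint_bump_cvg (m : {measure set mplane -> \bar R}) (D : set mplane) (f : mplane -> R) p q r s :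
  measurable D -> intble m D f ->
  \int[m]_(x in D) (f x * (bump p q n x.1 * bump r s n x.2)) @[n --> \oo] -->
  \int[m]_(x in D `&` box p q r s) f x.
Proof.
move=> mD If; have mf := intble_measurable If.
rewrite Rintegral_mkcondr.
apply: (Rint_cvg (g := fun x => `|f x|) mD _ _ _ _).2.
- move=> n; apply: measurable_funM => //; apply: measurable_prod_fun => //; exact: smooth_on_bump.
- move=> x Dx; rewrite patchE.
  have -> : (if x \in box p q r s then f x else 0) = f x * ((if p < x.1 < q then 1 else 0) * (if r < x.2 < s then 1 else 0)).
    case: ifPn => [|]; rewrite ?inE ?notin_setE.
      by move=> [-> ->]; rewrite !mulr1.
    by move=> /not_andP[/negP/negbTE ->|/negP/negbTE ->]; rewrite ?mul0r ?mulr0 ?mulr0.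
  by apply: cvgM; [exact: cvg_cst|apply: cvgM; exact: bump_cvg].
- exact: integrable_norm.
- move=> n x _; rewrite normrM ler_piMr // ger0_norm; last by apply: mulr_ge0; exact: bump_ge0.
  by rewrite mulr_ile1 ?bump_ge0 ?bump_le1.
Qed.

End bumps.

(** * Boxes as a generating class, and the fundamental lemma of the calculus of variations *)

Section box_uniqueness.
Context {R : realType}.
Local Notation plane := (R * R)%type.
Local Notation mplane := (measurableTypeR R * measurableTypeR R)%type.

Definition boxes : set (set mplane) := [set B | exists a b c d : R, B = box a b c d].

Lemma boxI (a b c d a' b' c' d' : R) : box a b c d `&` box a' b' c' d' =
  box (Num.max a a') (Num.min b b') (Num.max c c') (Num.min d d').
Proof.
apply/seteqP; split=> x /=; rewrite /box /= !gt_max !lt_min.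
  by move=> [[/andP[-> ->] /andP[-> ->]] [/andP[-> ->] /andP[-> ->]]].
by move=> [/andP[/andP[-> ->] /andP[-> ->]] /andP[/andP[-> ->] /andP[-> ->]]].
Qed.

Lemma boxIr (a b c d p q r s : R) : box a b c d `&` box p q r s =
  box a b c d `&` box (Num.max a p) (Num.min b q) (Num.max c r) (Num.min d s).
Proof. by rewrite -boxI setIA setIid. Qed.

Lemma setI_closed_boxes : setI_closed boxes.
Proof.
move=> _ _ [a [b [c [d ->]]]] [a' [b' [c' [d' ->]]]]; rewrite boxI.
by do 4 eexists; reflexivity.
Qed.

Lemma nat_norm_lt (x : R) : exists n : nat, `|x| < n%:R.
Proof. by exists (Num.truncn `|x|).+1; exact: truncnS_gt. Qed.

(** Both coordinates are measurable for the sigma-algebra of the boxes, since a half-plane is a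
    countable union of bounded boxes. Bounded boxes are preferred because they have finite area, as
    the uniqueness of measures requires. *)
Lemma measurable_boxes : measurable = <<s boxes >> :> set (set mplane).
Proof.
apply/seteqP; split=> E; last first.
  apply: smallest_sub; first exact: sigma_algebra_measurable.
  by move=> _ [a [b [c [d ->]]]]; exact: measurable_box.
move=> mE; pose T' := g_sigma_algebraType boxes.
have box_nat (n : nat) (a : R) : (boxes (box a (a + n%:R) (- n%:R) n%:R)) by do 4 eexists; reflexivity.
have box_nat2 (n : nat) (a : R) : (boxes (box (- n%:R) n%:R a (a + n%:R))) by do 4 eexists; reflexivity.
have m1 : measurable_fun (setT : set T') (fst : T' -> R).
  apply: (measurability _ (RGenOInfty.measurableE R)) => _ [_ [a ->] <-]; rewrite setTI.
  rewrite (_ : _ @^-1` _ = \bigcup_n box a (a + n%:R) (- n%:R) n%:R).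
    by apply: bigcupT_measurable => n; exact: sub_sigma_algebra.
  apply/seteqP; split=> [x /=|x [n _ [/andP[ax _] _]]]; rewrite /preimage /= in_itv /= andbT //.
  move=> ax; have [n xn] := nat_norm_lt (`|x.1 - a| + `|x.2|).
  move: xn; rewrite ger0_norm ?addr_ge0 // => xn.
  exists n => //; split=> /=.
    rewrite ax /= -ltrBlDl; apply: le_lt_trans xn; apply: le_trans (ler_norm _) _.
    by rewrite lerDl.
  by rewrite -ltr_norml; apply: le_lt_trans xn; rewrite lerDr.
have m2 : measurable_fun (setT : set T') (snd : T' -> R).
  apply: (measurability _ (RGenOInfty.measurableE R)) => _ [_ [a ->] <-]; rewrite setTI.
  rewrite (_ : _ @^-1` _ = \bigcup_n box (- n%:R) n%:R a (a + n%:R)).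
    by apply: bigcupT_measurable => n; exact: sub_sigma_algebra.
  apply/seteqP; split=> [x /=|x [n _ [_ /andP[ax _]]]]; rewrite /preimage /= in_itv /= andbT //.
  move=> ax; have [n xn] := nat_norm_lt (`|x.2 - a| + `|x.1|).
  move: xn; rewrite ger0_norm ?addr_ge0 // => xn.
  exists n => //; split=> /=; last first.
    rewrite ax /= -ltrBlDl; apply: le_lt_trans xn; apply: le_trans (ler_norm _) _.
    by rewrite lerDl.
  by rewrite -ltr_norml; apply: le_lt_trans xn; rewrite lerDr.
have := measurable_fun_pair m1 m2 measurableT mE.
by rewrite setTI (_ : _ @^-1` E = E) //; apply/seteqP; split=> -[].
Qed.

Lemma box_dynkin (P : set (set mplane)) : dynkin P ->
  (forall a b c d, P (box a b c d)) -> forall E, measurable E -> P E.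
Proof.
move=> dP Pbox E; rewrite measurable_boxes -setI_closed_g_dynkin_g_sigma_algebra; last exact: setI_closed_boxes.
by apply: smallest_sub => // _ [a [b [c [d ->]]]]; exact: Pbox.
Qed.

(** Bumps transfer the hypothesis to the integrals over sub-boxes, and the sets over which [f] has
    integral 0 form a Dynkin class. Testing with products only is enough, and it is all that the
    arguments by separate variables provide. *)
Lemma Rint_test_ae0 (m : {measure set mplane -> \bar R}) (a b c d : R) (f : mplane -> R) :
  intble m (box a b c d) f ->
  (forall al be, test1 a b al -> test1 c d be ->
    \int[m]_(x in box a b c d) (f x * (al x.1 * be x.2)) = 0) ->
  \forall x \ae m, box a b c d x -> f x = 0.
Proof.
move=> If H; have mB : measurable (box a b c d : set mplane) by exact: measurable_box.
pose B : set mplane := box a b c d.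
have sub E : measurable E -> intble m (B `&` E) f.
  move=> mE; apply: (@integrableS _ _ _ m B) => //; exact: measurableI.
pose P E := measurable E /\ \int[m]_(x in B `&` E) f x = 0.
have Pbox p q r s : P (box p q r s).
  split; first exact: measurable_box.
  (* The box is first shrunk into [B], so that its bumps are admissible. *)
  rewrite (_ : B `&` _ = B `&` box (Num.max a p) (Num.min b q) (Num.max c r) (Num.min d s)); last first.
    exact: boxIr.
  have cv := @Rint_bump_cvg _ m B f (Num.max a p) (Num.min b q) (Num.max c r) (Num.min d s) mB If.
  have c0 : (fun n => \int[m]_(x in B) (f x * (bump (Num.max a p) (Num.min b q) n x.1 *
      bump (Num.max c r) (Num.min d s) n x.2))) = (fun=> 0).
    by apply/funext => n; apply: H; apply: test1_bump; rewrite ?le_max ?ge_min lexx.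
  rewrite c0 in cv; exact: (cvg_unique _ cv (cvg_cst 0)).
have PB : \int[m]_(x in B) f x = 0.
  by have [_] := Pbox a b c d; rewrite setIid.
have PE E : measurable E -> P E.
  move: E; apply: box_dynkin => //; split.
  - by split=> //; rewrite setIT.
  - move=> E [mE E0]; split; first exact: measurableC.
    have := PB; rewrite -{1}(setIT B) -(setUv E) setIUr Rintegral_setU ?E0 ?add0r //.
    + exact: measurableI.
    + by apply: measurableI => //; exact: measurableC.
    + by rewrite -setIUr setUv setIT.
    + by apply/disj_setPS => x [[_ Ex] [_ nEx]].
  - move=> F tF PF; have mF n : measurable (F n) by have [] := PF n.
    split; first exact: bigcupT_measurable.
    rewrite setI_bigcupr /Rintegral integral_bigcup.
    + rewrite eseries0 // => n _ _.
      by have [_ F0] := PF n; rewrite -EFin_Rintegral ?F0 //; [exact: measurableI|exact: sub].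
    + by apply: trivIset_setIl.
    + by move=> n; exact: measurableI.
    + rewrite -setI_bigcupr; apply: sub; exact: bigcupT_measurable.
suff : ae_eq m B (EFin \o f) (cst 0%E).
  by apply: filterS => x h Bx; have /= := h Bx; case.
apply: (integral_ae_eq mB If); first exact: measurable_cst.
move=> E EB mE; have [_] := PE E mE; rewrite (setIidr EB) => E0.
rewrite integral_cst // mul0e /comp -(@EFin_Rintegral _ _ _ m E mE f) ?E0 //.
by apply: (@integrableS _ _ _ m B).
Qed.

End box_uniqueness.

(** * Fubini for real integrals, and the exchange of the coordinates *)

Section fubini_real.
Context {R : realType}.
Local Notation plane := (R * R)%type.
Local Notation mplane := (measurableTypeR R * measurableTypeR R)%type.
Local Notation mR := (measurableTypeR R).
Local Notation leb := (@lebesgue_measure R).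

Lemma Rint_fubini (f : mplane -> R) : intble leb2 setT f ->
  intble leb setT (fun x : mR => \int[leb]_y f (x, y)) /\
  \int[leb2]_x f x = \int[leb]_x \int[leb]_y f (x, y).
Proof.
move=> If; have IF := @integrable_fubini_F _ _ mR mR R leb leb _ If.
have E : \forall x \ae leb, [set: mR] x -> fubini_F leb (EFin \o f) x = (\int[leb]_y f (x, y))%:E.
  have := integrable_ae measurableT IF; apply: filterS => x h _.
  by rewrite /Rintegral fineK // -/(fubini_F _ _ _); exact: h.
have mf : measurable_fun [set: mR] (fun x : mR => \int[leb]_y f (x, y)).
  apply: (measurableT_comp (fine_measurable measurableT)); exact: measurable_int IF.
have I1 : intble leb setT (fun x : mR => \int[leb]_y f (x, y)).
  apply/integrableP; split; first exact/measurable_EFinP.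
  have /integrableP[_] := IF; congr (_ < _)%E.
  apply: ge0_ae_eq_integral => //.
  - by apply: measurableT_comp => //; exact: measurable_int IF.
  - by apply/measurable_EFinP/measurableT_comp.
  - by apply: filterS E => x h /h /= ->.
split=> //; rewrite {1}/Rintegral -(@integral12_prod_meas1 _ _ mR mR R leb leb _ If).
rewrite [RHS]/Rintegral; congr fine; apply: ae_eq_integral => //.
- exact: measurable_int IF.
- exact/measurable_EFinP.
Qed.

Lemma measurable_Rint_param {d1 d2 : measure_display} (T1 : measurableType d1) (T2 : measurableType d2)
    (m : {sigma_finite_measure set T2 -> \bar R}) (F : T1 * T2 -> R) :
  measurable_fun setT F -> measurable_fun setT (fun x => \int[m]_y F (x, y)).
Proof.
move=> mF; apply: (measurableT_comp (fine_measurable measurableT)).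
have -> : (fun x => \int[m]_y (F (x, y))%:E)%E =
   (fun x => fubini_F m (EFin \o F)^\+ x - fubini_F m (EFin \o F)^\- x)%E.
  by apply/funext => x; rewrite integralE; congr (_ - _)%E; apply: eq_integral => y _; rewrite ?funeposE ?funenegE.
have mE : measurable_fun setT (EFin \o F) by exact/measurable_EFinP.
apply: emeasurable_funB; apply: measurable_fun_fubini_tonelli_F => //.
- exact: measurable_funepos.
- exact: measurable_funeneg.
Qed.

Definition swap (x : plane) : plane := (x.2, x.1).

Lemma measurable_swap : measurable_fun (setT : set mplane) (swap : mplane -> mplane).
Proof. exact: measurable_fun_pair. Qed.

Lemma swap_box (a b c d : R) : swap @^-1` (box a b c d) = box c d a b.
Proof. by apply/seteqP; split=> x [h1 h2]. Qed.

Lemma box_degenerate (a b c d : R) : ~ (a <= b /\ c <= d) -> box a b c d = set0.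
Proof.
move=> h; apply/seteqP; split=> // x [/andP[h1 h2] /andP[h3 h4]]; apply: h.
by split; apply: ltW; [exact: lt_trans h2|exact: lt_trans h4].
Qed.

Lemma leb2_box_sym (a b c d : R) : leb2 (box a b c d) = leb2 (box c d a b).
Proof.
have [[ab cd]|h] := pselect (a <= b /\ c <= d).
  by rewrite !leb2_box // mulrC.
rewrite !box_degenerate ?measure0 // => -[h1 h2]; exact: h.
Qed.

Lemma bigcup_box_nat : \bigcup_n box (- n%:R) n%:R (- n%:R) n%:R = [set: plane].
Proof.
apply/seteqP; split=> // x _; have [n] := nat_norm_lt (`|x.1| + `|x.2|).
rewrite ger0_norm ?addr_ge0 // => xn; exists n => //; split; rewrite /= -ltr_norml.
  by apply: le_lt_trans xn; rewrite lerDl.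
by apply: le_lt_trans xn; rewrite lerDr.
Qed.

Lemma leb2_swap (E : set mplane) : measurable E -> leb2 (swap @^-1` E) = leb2 E.
Proof.
move=> mE; have mc := measurable_swap.
have := @measure_unique _ R mplane boxes (fun n => box (- n%:R) n%:R (- n%:R) n%:R)
  measurable_boxes setI_closed_boxes _ bigcup_box_nat
  (pushforward leb2 (swap : mplane -> mplane)) leb2.
rewrite /= /pushforward => H; apply: H => //.
- by move=> n; do 4 eexists; reflexivity.
- by move=> _ [a [b [c [d ->]]]]; rewrite swap_box; exact: leb2_box_sym.
- move=> n; rewrite swap_box.
  have := @leb2_box R (- n%:R) n%:R (- n%:R) n%:R; rewrite /leb2 => ->; rewrite ?ltry ?ge0_cp //.
Qed.

Lemma Rint_swap (D : set mplane) (f : mplane -> R) : measurable D -> intble leb2 D f ->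
  intble leb2 (swap @^-1` D) (fun x => f (swap x)) /\
  \int[leb2]_(x in swap @^-1` D) f (swap x) = \int[leb2]_(x in D) f x.
Proof.
move=> mD If; have mc := measurable_swap.
have mD' : measurable (swap @^-1` D : set mplane).
  by rewrite -[X in measurable X]setTI; exact: mc.
have mf := intble_measurable If.
pose f0 := f \_ D.
have mf0 : measurable_fun (setT : set mplane) (EFin \o f0).
  by apply/measurable_EFinP; apply/(measurable_restrictT _ mD).
have eqm : forall h : mplane -> \bar R, measurable_fun setT h -> (forall x, 0 <= h x)%E ->
    (\int[leb2]_x h (swap x) = \int[leb2]_x h x)%E.
  move=> h mh h0.
  have := @ge0_integral_pushforward _ _ mplane mplane R swap mc leb2 setT h measurableT mh (fun x _ => h0 x).
  rewrite /= preimage_setT => <-.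
  by apply: eq_measure_integral => A mA _ /=; rewrite /pushforward; exact: leb2_swap.
have pf : (fun x => f (swap x)) \_ (swap @^-1` D) = f0 \o swap.
  by apply/funext => x; rewrite /= /f0 !patchE.
have If0 : intble leb2 setT f0.
  by have := If; rewrite /intble (integrable_mkcond _ mD) restrict_EFin.
split.
  rewrite /intble (integrable_mkcond _ mD') restrict_EFin pf.
  have /integrableP[_ fin] := If0; apply/integrableP; split.
    apply/measurable_EFinP; apply: (measurableT_comp _ mc); exact/measurable_EFinP.
  by rewrite (eqm (fun x => `|(f0 x)%:E|)%E) // ; exact: measurableT_comp.
rewrite Rintegral_mkcond pf [RHS]Rintegral_mkcond -/f0 /Rintegral; congr fine.
rewrite integralE [RHS]integralE; congr (_ - _)%E.
  rewrite -(eqm (EFin \o f0)^\+%E) //; last exact: measurable_funepos.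
  by apply: eq_integral => x _; rewrite !funeposE.
rewrite -(eqm (EFin \o f0)^\-%E) //; last exact: measurable_funeneg.
by apply: eq_integral => x _; rewrite !funenegE.
Qed.

End fubini_real.

(** * Weak derivatives on boxes *)

Section cumulative.
Context {R : realType}.
Local Notation plane := (R * R)%type.
Local Notation mplane := (measurableTypeR R * measurableTypeR R)%type.
Local Notation mR := (measurableTypeR R).
Local Notation leb := (@lebesgue_measure R).
Implicit Types (al f g : R -> R).

Definition cumul f (x : R) : R := \int[leb]_(t in `]-oo, x]) f t.

Lemma smooth1_continuous al : smooth_on setT al -> continuous al.
Proof.
by move=> sa x; apply: differentiable_continuous; have [+ _] := sa 1%N; exact.
Qed.

Lemma smooth1_D al : smooth_on setT al -> smooth_on setT (fun x : R => 'D_1 al x).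
Proof. by move=> sa n; have [_] := sa n.+1; exact. Qed.

Lemma smooth1_is_derive al (x : R) : smooth_on setT al -> is_derive x (1 : R) al ('D_1 al x).
Proof.
move=> sa; have [+ _] := sa 1%N; move=> /(_ x I) da.
by apply: DeriveDef => //; exact: diff_derivable.
Qed.

Lemma D1_out al (p q : R) : (forall s, ~ (p <= s <= q) -> al s = 0) ->
  forall s, ~ (p <= s <= q) -> 'D_1 al s = 0 :> R.
Proof.
move=> al0 s spq; rewrite (@near_eq_derive _ _ _ al (cst 0) s 1) ?derive_cst //.
have : s < p \/ q < s.
  by case: (ltP s p); [left|move=> h1; right; rewrite ltNge; apply/negP => h2; apply: spq; rewrite h1].
move=> [sl|sr]; near=> z; apply: al0 => /andP[z1 z2].
  have : z < p by near: z; exact: lt_nbhsl.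
  by rewrite ltNge z1.
have : q < z by near: z; exact: lt_nbhsr.
by rewrite ltNge z2.
Unshelve. all: by end_near. Qed.

Lemma test1_D (a b : R) al : test1 a b al -> test1 a b (fun x : R => 'D_1 al x).
Proof.
move=> [sa [p [q [ap qb al0]]]]; split; first exact: smooth1_D.
by exists p, q; split=> //; exact: D1_out.
Qed.

Lemma compact_support_intble al (p q : R) : continuous al -> (forall s, ~ (p <= s <= q) -> al s = 0) ->
  intble leb setT al.
Proof.
move=> ca al0; apply/(@intble_support _ _ _ leb (`[p, q]%classic : set mR)) => //.
- by move=> x _; rewrite /= in_itv /=; exact: al0.
- apply: continuous_compact_integrable; first exact: segment_compact.
  exact: continuous_subspaceT.
Qed.

Lemma test1_intble (a b : R) al : test1 a b al -> intble leb setT al.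
Proof.
move=> [sa [p [q [_ _ al0]]]]; apply: compact_support_intble al0.
exact: smooth1_continuous.
Qed.

Lemma test1_bounded (a b : R) al : test1 a b al -> exists2 M, 0 <= M & forall x, `|al x| <= M.
Proof.
move=> [sa [p [q [_ _ al0]]]].
have : compact (al @` `[p, q]%classic).
  apply: continuous_compact; last exact: segment_compact.
  by apply: continuous_subspaceT; exact: smooth1_continuous.
move=> /compact_bounded [M [_ HM]]; exists (Num.max 0 M + 1) => [|x].
  by rewrite addr_ge0 // le_max lexx.
have [xpq|/al0 ->] := pselect (p <= x <= q).
  apply: (HM (Num.max 0 M + 1)); first by rewrite ltr_pwDr // le_max lexx orbT.
  by exists x => //; rewrite /= in_itv.
by rewrite normr0 addr_ge0 // le_max lexx.
Qed.

Lemma cumul_derive f (x : R) : continuous f -> intble leb setT f ->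
  is_derive x (1 : R) (cumul f) (f x).
Proof.
move=> cf If; have x1 : x < x + 1 by rewrite ltrDl.
have If' : lebesgue_measure.-integrable `]-oo, x + 1] (EFin \o f).
  by apply: (@integrableS _ mR _ leb setT).
have [|d1 d2] := @continuous_FTC1 _ f (BInfty _ true) x (x + 1) x1 If' _ (cf x).
  by rewrite ltNyr.
by rewrite derive1E in d2; exact: (DeriveDef d1 d2).
Qed.

Lemma Rint_half_derive al (p q s : R) : smooth_on setT al -> (forall s, ~ (p <= s <= q) -> al s = 0) ->
  \int[leb]_(x in `[s, +oo[) 'D_1 al x = - al s.
Proof.
move=> sa al0; pose N := Num.max s q + 1.
have sN : s < N by rewrite ltr_pwDr // le_max lexx.
have qN : q < N by rewrite ltr_pwDr // le_max lexx orbT.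
have ca : continuous al := smooth1_continuous sa.
have cD : continuous (fun x : R => 'D_1 al x : R) by exact/smooth1_continuous/smooth1_D.
rewrite (@Rint_support _ _ _ leb (`[s, N]%classic : set mR)); first last.
- move=> x; rewrite /= !in_itv /= andbT => sx sxN; apply: (D1_out al0) => /andP[_ xq].
  by apply: sxN; rewrite sx (le_trans xq) // ltW.
- by move=> x; rewrite /= !in_itv /= andbT => /andP[].
rewrite /Rintegral (@continuous_FTC2 _ _ al s N) //.
- by rewrite -EFinD /= (@al0 N) ?sub0r // => /andP[_]; rewrite leNgt qN.
- exact: continuous_subspaceT.
- split; first by move=> x _; have [] := smooth1_is_derive x sa.
  + exact: (cvg_at_right_filter (ca s)).
  + exact: (cvg_at_left_filter (ca N)).
- by move=> x _; rewrite derive1E.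
Qed.

(** The vanishing total integral is what makes the primitive return to 0 on the right of the
    support. *)
Lemma test1_cumul (a b : R) f : test1 a b f -> \int[leb]_t f t = 0 ->
  test1 a b (cumul f) /\ forall x : R, 'D_1 (cumul f) x = f x.
Proof.
move=> tf f0; have [sf [p [q [ap qb fpq]]]] := tf.
have If := test1_intble tf.
have cf := smooth1_continuous sf.
have dc x : is_derive x (1 : R) (cumul f) (f x) by exact: cumul_derive.
split; last by move=> x; rewrite derive_val.
split.
  case=> [//|n]; apply: (smooth_on_derive openT _ (sf n)) => x _; exact: dc.
exists p, q; split=> // s spq.
have : s < p \/ q < s.
  by case: (ltP s p); [left|move=> h1; right; rewrite ltNge; apply/negP => h2; apply: spq; rewrite h1].
move=> [sp|qs].
  apply: Rint0 => x; rewrite /= in_itv /= => xs; apply: fpq => /andP[px _].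
  by have := le_lt_trans (le_trans px xs) sp; rewrite ltxx.
rewrite /cumul -(@Rint_support _ _ _ leb (`]-oo, s]%classic : set mR) setT) // => x _.
rewrite /= in_itv /= => /negP; rewrite -ltNge => sx; apply: fpq => /andP[_ xq].
by have := lt_le_trans (lt_trans qs sx) xq; rewrite ltxx.
Qed.

Lemma intble_prod f g : intble leb setT f -> intble leb setT g ->
  intble leb2 setT (fun x : mplane => f x.1 * g x.2).
Proof.
move=> If Ig; have mf := intble_measurable If; have mg := intble_measurable Ig.
have m1 : measurable_fun (setT : set mplane) (fun x : mplane => f x.1 * g x.2).
  apply: measurable_funM.
    by apply: (measurableT_comp mf).
  by apply: (measurableT_comp mg).
apply/integrableP; split; first exact/measurable_EFinP.
have mn : measurable_fun (setT : set mplane) (fun x => `|(f x.1 * g x.2)%:E|%E).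
  by apply: measurableT_comp => //; exact/measurable_EFinP.
rewrite /leb2 (@fubini_tonelli1 _ _ mR mR R leb leb) //.
have If1 := intble_eq measurableT (fun x _ => erefl) (integrable_norm If).
have Ig1 := integrable_norm Ig.
have E x : fubini_F leb (fun x : mplane => `|(f x.1 * g x.2)%:E|)%E x =
   (`|f x| * \int[leb]_y `|g y|)%:E.
  rewrite /fubini_F /= EFinM EFin_Rintegral // -ge0_integralZl_EFin //.
  - by apply: eq_integral => y _; rewrite -EFinM normrM.
  - by apply/measurable_EFinP/measurableT_comp.
have -> : (\int[leb]_x fubini_F leb (fun x : mplane => `|(f x.1 * g x.2)%:E|)%E x =
   \int[leb]_x (`|f x| * \int[leb]_y `|g y|)%:E)%E.
  by apply: eq_integral => x _; exact: E.
have I2 : intble leb setT (fun x => `|f x| * \int[leb]_y `|g y|).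
  apply: (@intble_eq _ _ _ leb setT measurableT (fun x => (\int[leb]_y `|g y|) * `|f x|)).
    by move=> x _; rewrite mulrC.
  by apply: intbleZ => //; exact: integrable_norm.
by rewrite -EFin_Rintegral // ltry.
Qed.

End cumulative.

Lemma intble_le_ae {d : measure_display} {T : measurableType d} {R : realType}
    (mu : {measure set T -> \bar R}) (D : set T) (f g : T -> R) : measurable D ->
  measurable_fun D f -> (\forall x \ae mu, D x -> `|f x| <= g x) -> intble mu D g -> intble mu D f.
Proof.
move=> mD mf fg Ig; have /integrableP[mg gfin] := Ig.
apply/integrableP; split; first exact/measurable_EFinP.
apply: le_lt_trans gfin; apply: ae_ge0_le_integral => //.
- by apply: measurableT_comp => //; exact/measurable_EFinP.
- exact: measurableT_comp.
- by apply: filterS fg => x h Dx; rewrite /= lee_fin (le_trans (h Dx)) // ler_norm.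
Qed.

Section weak_derivative_box.
Context {R : realType}.
Local Notation plane := (R * R)%type.
Local Notation mplane := (measurableTypeR R * measurableTypeR R)%type.
Local Notation mR := (measurableTypeR R).
Local Notation leb := (@lebesgue_measure R).
Implicit Types (al be f g : R -> R).

Lemma ae_fst (Q : R -> Prop) : (\forall x \ae leb, Q x) -> \forall z \ae leb2, Q z.1.
Proof.
move=> [N [mN N0 NQ]]; exists (N `*` setT); split.
- by apply: measurableX.
- by rewrite /leb2 product_measure1E //= N0 mul0e.
- by move=> z /= nQ; split=> //; exact: NQ.
Qed.

(** The kernel of [cumul]. It turns a primitive into an integral over the whole line, for which
    Fubini and measurability in parameters are available. *)
Definition half (s y : R) : R := if s <= y then 1 else 0.

Lemma half_ge0 s y : 0 <= half s y. Proof. by rewrite /half; case: ifP. Qed.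

Lemma half_le1 s y : half s y <= 1. Proof. by rewrite /half; case: ifP. Qed.

Lemma cumulE f (y : R) : cumul f y = \int[leb]_t (f t * half t y).
Proof.
rewrite /cumul Rintegral_mkcond; apply: Rint_eq => t _; rewrite patchE /half.
case: ifPn => h.
  by move: h; rewrite inE /= in_itv /= => ->; rewrite mulr1.
by move: h; rewrite notin_setE /= in_itv /= => /negP/negbTE ->; rewrite mulr0.
Qed.

Lemma measurable_half : measurable_fun (setT : set mplane) (fun z : mplane => half z.1 z.2).
Proof.
have mle : measurable ([set z : plane | z.1 <= z.2] : set mplane).
  apply: measurable_closed.
  have -> : [set z : plane | z.1 <= z.2] = (fun z : plane => z.2 - z.1) @^-1` `[0, +oo[%classic.
    by apply/seteqP; split=> z /=; rewrite in_itv /= andbT subr_ge0.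
  apply: closed_comp => [z _|]; last exact: interval_closed.
  by apply: cvgB; [exact: cvg_snd|exact: cvg_fst].
have -> : (fun z : mplane => half z.1 z.2) = \1_([set z : plane | z.1 <= z.2]).
  apply/funext => z; rewrite indicE /half; case: ifPn => h; first by rewrite mem_set.
  by rewrite memNset //; exact/negP.
exact: measurable_indic.
Qed.

Lemma half_mul_intble g (y : R) : intble leb setT g -> intble leb setT (fun t => g t * half t y).
Proof.
move=> Ig; have mg := intble_measurable Ig.
apply: (@intble_le _ _ _ leb setT measurableT _ (fun t => `|g t|)).
- apply: measurable_funM => //.
  exact: (measurableT_comp measurable_half (pair2_measurable (y : mR))).
- by move=> t _; rewrite normrM ler_piMr // ger0_norm ?half_ge0 ?half_le1.
- exact: integrable_norm Ig.
Qed.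

Lemma cumul_le f (y : R) : intble leb setT f -> `|cumul f y| <= \int[leb]_t `|f t|.
Proof.
move=> If; rewrite cumulE; have I1 := half_mul_intble y If.
apply: (le_trans (le_normr_Rintegral measurableT I1)); apply: le_Rintegral => //.
- exact: integrable_norm I1.
- exact: integrable_norm If.
by move=> t _; rewrite normrM ler_piMr // ger0_norm ?half_ge0 ?half_le1.
Qed.

Lemma cumul_transpose g h H : intble leb setT g -> intble leb setT h ->
  (forall s, \int[leb]_y (half s y * h y) = H s) ->
  \int[leb]_y (cumul g y * h y) = \int[leb]_s (g s * H s).
Proof.
move=> Ig Ih hH; have mg := intble_measurable Ig; have mh := intble_measurable Ih.
pose k (z : mplane) : R := half z.1 z.2 * (g z.1 * h z.2).
have mk : measurable_fun setT k.
  apply: measurable_funM; first exact: measurable_half.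
  exact: intble_measurable (intble_prod Ig Ih).
have Ik : intble leb2 setT k.
  have IG := integrable_norm (intble_prod Ig Ih).
  apply: (@intble_le _ _ _ leb2 setT measurableT _ _ mk _ IG) => z _.
  by rewrite /k normrM ler_piMl // ger0_norm ?half_ge0 ?half_le1.
have [_ E1] := Rint_fubini Ik.
have [Is Es] := Rint_swap measurableT Ik.
have [_ E2] := Rint_fubini Is.
have E3 : \int[leb]_x \int[leb]_y k (x, y) = \int[leb]_s (g s * H s).
  apply: Rint_eq => s _; rewrite -hH -RintegralZl //; last first.
    apply: (@intble_le _ _ _ leb setT measurableT _ (fun t => `|h t|)).
    - apply: measurable_funM => //.
      exact: (measurableT_comp measurable_half (pair1_measurable (s : mR))).
    - by move=> t _; rewrite normrM ler_piMl // ger0_norm ?half_ge0 ?half_le1.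
    - exact: integrable_norm Ih.
  by apply: Rint_eq => y _; rewrite /k /=; ring.
have -> : \int[leb]_y (cumul g y * h y) = \int[leb]_y \int[leb]_s k (s, y).
  apply: Rint_eq => y _; rewrite cumulE -RintegralZr //; last exact: half_mul_intble.
  by apply: Rint_eq => s _; rewrite /k /=; ring.
by rewrite -E3 -E1 -Es E2.
Qed.

(** Since [g] is merely integrable, Fubini stands in for the fundamental theorem of calculus: after
    the exchange, the inner integral of the derivative of [be] over [[s, +oo[] is [- be s]. *)
Lemma cumul_ibp g be (c d : R) : intble leb setT g -> test1 c d be ->
  \int[leb]_y (cumul g y * 'D_1 be y) = - \int[leb]_s (g s * be s).
Proof.
move=> Ig tb; have mg := intble_measurable Ig.
rewrite (cumul_transpose (H := fun s => - be s) Ig (test1_intble (test1_D tb))).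
  rewrite -RintN //; first by apply: Rint_eq => s _; rewrite mulrN.
  have [M M0 bM] := test1_bounded tb.
  have mb := smooth1_measurable tb.1.
  apply: (@intble_le _ _ _ leb setT measurableT _ (fun t => M * `|g t|)).
  - exact: measurable_funM.
  - by move=> t _; rewrite normrM mulrC ler_wpM2r.
  - by apply: intbleZ => //; exact: integrable_norm Ig.
move=> s; have [sb [p [q [_ _ bpq]]]] := tb.
rewrite -(Rint_half_derive s sb bpq) [RHS]Rintegral_mkcond.
apply: Rint_eq => y _; rewrite patchE /half.
case: ifPn => sy; case: ifPn => h.
- by rewrite mul1r.
- by move: h; rewrite notin_setE /= in_itv /= andbT sy.
- by move: h; rewrite inE /= in_itv /= andbT (negbTE sy).
- by rewrite mul0r.
Qed.

End weak_derivative_box.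

Lemma aeS {d : measure_display} {T : measurableType d} {R : realType} (mu : {measure set T -> \bar R})
    (P Q : T -> Prop) : (forall x, P x -> Q x) ->
  (\forall x \ae mu, P x) -> \forall x \ae mu, Q x.
Proof. by move=> PQ; apply: filterS. Qed.

Lemma aeI {d : measure_display} {T : measurableType d} {R : realType} (mu : {measure set T -> \bar R})
    (P Q : T -> Prop) : (\forall x \ae mu, P x) -> (\forall x \ae mu, Q x) ->
  \forall x \ae mu, P x /\ Q x.
Proof. by move=> aP aQ; exact: filterI. Qed.

(** * Representatives that are primitives along lines *)

Section absolute_continuity.
Context {R : realType}.
Local Notation plane := (R * R)%type.
Local Notation mplane := (measurableTypeR R * measurableTypeR R)%type.
Local Notation mR := (measurableTypeR R).
Local Notation leb := (@lebesgue_measure R).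
Implicit Types (al be ga : R -> R).

Lemma test1_lin (c d k : R) ga ga0 : test1 c d ga -> test1 c d ga0 ->
  test1 c d (fun s => ga s - k * ga0 s).
Proof.
move=> [s1 [p [q [cp qd g1]]]] [s0 [p0 [q0 [cp0 qd0 g0]]]]; split.
  move=> n; apply: (diffnB openT); first exact: s1.
  by apply: (diffnM openT); [exact/diffn_cst/openT|exact: s0].
exists (Num.min p p0), (Num.max q q0); split; rewrite ?lt_min ?gt_max ?cp ?cp0 ?qd ?qd0 //.
move=> s h; rewrite g1 ?g0 ?mulr0 ?subr0 // => /andP[h1 h2]; apply: h.
  by rewrite ge_min h1 orbT le_max h2 orbT.
by rewrite ge_min h1 le_max h2.
Qed.

Lemma leb_oo (c d : R) : c <= d -> leb `]c, d[%classic = (d - c)%:E.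
Proof.
by move=> cd; rewrite lebesgue_measure_itv /= lte_fin; case: ltgtP cd => // -> _; rewrite subrr.
Qed.

(** The integrals of the bumps tend to [d - c], so one of them is positive and can be normalised. *)
Lemma test1_unit (c d : R) : c < d -> exists2 ga, test1 c d ga & \int[leb]_s ga s = 1.
Proof.
move=> cd.
have tb n : test1 c d (bump c d n) by apply: test1_bump.
pose J : set mR := `]c, d[%classic.
have mJ : measurable J by exact: measurable_itv.
have JE : leb J = (d - c)%:E := leb_oo (ltW cd).
have Jfin : (leb J < +oo)%E by rewrite JE ltry.
have IJ : \int[leb]_(s in J) (1 : R) = d - c.
  by rewrite Rintegral_cst // mul1r; exact: (congr1 fine JE).
have bE n : \int[leb]_s bump c d n s = \int[leb]_(s in J) bump c d n s.
  apply: Rint_support => // s _; rewrite /J /= in_itv /= => h; apply: bump_out => /andP[h1 h2].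
  by apply: h; rewrite (lt_le_trans _ h1) ?(le_lt_trans h2) // ?ltrBlDr ltrDl invr_gt0.
have I1 : intble leb J (cst 1).
  apply: measurable_bounded_integrable => //.
  by exists 1; split; [exact: num_real|move=> e e1 x _ /=; rewrite normr1 ltW].
have cv := @Rint_cvg _ mR R leb J (fun n => bump c d n) (cst 1) (cst 1) mJ.
have [|||_] := cv _ _ I1 _.
- by move=> n; apply: measurable_funTS; apply: smooth1_measurable; exact: smooth_on_bump.
- by move=> s; rewrite /J /= in_itv /= => h; have := @bump_cvg R c d s; rewrite h.
- by move=> n s _; rewrite /= ger0_norm ?bump_ge0 ?bump_le1.
rewrite /cst IJ => cvJ.
have : \forall n \near \oo, 0 < \int[leb]_(s in J) bump c d n s.
  by apply: (cvgr_gt _ cvJ); rewrite subr_gt0.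
move=> [n _ /(_ n (leqnn n))]; rewrite /= -bE; set I0 := Rintegral _ _ _ => I0p.
exists (fun s => I0^-1 * bump c d n s); last first.
  rewrite RintegralZl // -/I0 ?mulVf ?gt_eqF //; exact: (test1_intble (tb n)).
have [s1 [p [q [cp qd g1]]]] := tb n; split.
  by move=> k; apply: (diffnM openT); [exact/diffn_cst/openT|exact: s1].
by exists p, q; split=> // s /g1 ->; rewrite mulr0.
Qed.

Lemma ae_slice_intble (f : mplane -> R) : intble leb2 setT f ->
  \forall x \ae leb, intble leb setT (fun y => f (x, y)).
Proof. by move=> If; have := @ae_integrable1 _ _ mR mR R leb leb _ If. Qed.

Definition vprim (G : plane -> R) (x : plane) : R := cumul (fun s => G (x.1, s)) x.2.

Lemma measurable_vprim (G : mplane -> R) : measurable_fun setT G ->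
  measurable_fun (setT : set mplane) (vprim G).
Proof.
move=> mG; pose F (z : mplane * mR) : R := G (z.1.1, z.2) * half z.2 z.1.2.
have mF : measurable_fun setT F.
  apply: measurable_funM.
    apply: (measurableT_comp mG); apply: measurable_fun_pair => //.
    exact: (measurableT_comp measurable_fst measurable_fst).
  have mp : measurable_fun setT (fun z : mplane * mR => (z.2, z.1.2)).
    apply: measurable_fun_pair => //; exact: (measurableT_comp measurable_snd measurable_fst).
  exact: (measurableT_comp (@measurable_half R) mp).
have := @measurable_Rint_param R _ _ mplane mR leb F mF.
by congr measurable_fun; apply/funext => x; rewrite /vprim cumulE.
Qed.

Lemma vprim_bound (G : mplane -> R) : intble leb2 setT G ->
  exists K : R -> R, [/\ intble leb setT K, forall x, 0 <= K x &
    \forall x \ae leb, intble leb setT (fun y => G (x, y)) /\ forall y, `|vprim G (x, y)| <= K x].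
Proof.
move=> IG; have [IK _] := Rint_fubini (integrable_norm IG : intble leb2 setT (fun z => `|G z|)).
exists (fun x => \int[leb]_y `|G (x, y)|); split=> //.
  by move=> x; apply: Rintegral_ge0 => y _; exact: normr_ge0.
have := ae_slice_intble IG; apply: filterS => x Ix; split=> // y.
exact: cumul_le.
Qed.

Lemma Rint_box (a b c d : R) (f : mplane -> R) : (forall x, ~ box a b c d x -> f x = 0) ->
  \int[leb2]_(x in box a b c d) f x = \int[leb2]_x f x.
Proof. by move=> f0; symmetry; apply: Rint_support => // x _; exact: f0. Qed.

Lemma intble_box (a b c d : R) (f : mplane -> R) : (forall x, ~ box a b c d x -> f x = 0) ->
  intble leb2 (box a b c d) f <-> intble leb2 setT f.
Proof.
move=> f0; apply: intble_support => //; first exact: measurable_box.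
by move=> x _; exact: f0.
Qed.

Lemma test1_out (a b c d : R) al be : test1 a b al -> test1 c d be ->
  forall x : plane, ~ box a b c d x -> al x.1 * be x.2 = 0.
Proof.
move=> [_ [p [q [ap qb a0]]]] [_ [p' [q' [cp qd b0]]]] x nB.
have [h1|/a0 ->] := pselect (p <= x.1 <= q); last by rewrite mul0r.
have [h2|/b0 ->] := pselect (p' <= x.2 <= q'); last by rewrite mulr0.
case: nB; split; move: h1 h2 => /andP[h1 h2] /andP[h3 h4].
  by rewrite (lt_le_trans ap h1) (le_lt_trans h2 qb).
by rewrite (lt_le_trans cp h3) (le_lt_trans h4 qd).
Qed.

Lemma vprim_ibp (a b c d : R) (G : mplane -> R) al be : intble leb2 setT G ->
  test1 a b al -> test1 c d be ->
  intble leb2 setT (fun x => vprim G x * (al x.1 * 'D_1 be x.2)) /\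
  \int[leb2]_x (vprim G x * (al x.1 * 'D_1 be x.2)) = - \int[leb2]_x (G x * (al x.1 * be x.2)).
Proof.
move=> IG ta tb; have tD := test1_D tb; have mG := intble_measurable IG.
have [K [IK K0 HK]] := vprim_bound IG.
have [Ma Ma0 bMa] := test1_bounded ta.
have [Mb Mb0 bMb] := test1_bounded tb.
have mP : measurable_fun setT (fun x : mplane => vprim G x * (al x.1 * 'D_1 be x.2)).
  apply: measurable_funM; first exact: measurable_vprim.
  exact: (measurable_prod_fun ta.1 tD.1 measurableT).
have IKa : intble leb setT (fun x => Ma * K x) by exact: intbleZ.
have ID : intble leb setT (fun y => `|'D_1 be y : R|) := integrable_norm (test1_intble tD).
have IP : intble leb2 setT (fun x => vprim G x * (al x.1 * 'D_1 be x.2)).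
  apply: (intble_le_ae measurableT mP _ (intble_prod IKa ID)).
  apply: aeS (ae_fst HK) => -[x y] /= [_ hK] _; rewrite !normrM mulrA.
  apply: ler_wpM2r => //; rewrite mulrC; apply: ler_pM => //; exact: hK.
split=> //; have [_ ->] := Rint_fubini IP.
have IGab : intble leb2 setT (fun x => G x * (al x.1 * be x.2)).
  have IGM : intble leb2 setT (fun x => Ma * Mb * `|G x|).
    by apply: intbleZ => //; exact: integrable_norm IG.
  apply: (@intble_le _ _ _ leb2 setT measurableT _ _ _ _ IGM).
    apply: measurable_funM => //.
    exact: (measurable_prod_fun ta.1 tb.1 measurableT).
  move=> x _; rewrite normrM mulrC ler_wpM2r // normrM; exact: ler_pM.
have [IF ->] := Rint_fubini IGab; rewrite -RintN //.
have [IP1 _] := Rint_fubini IP.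
apply: Rint_ae_eq => //.
- exact: intble_measurable IP1.
- exact: intble_measurable (intbleN measurableT IF).
apply: filterS HK => x [Ix _] _.
have [M M0 bM] := test1_bounded tb.
transitivity (al x * \int[leb]_y (vprim G (x, y) * 'D_1 be y)).
  rewrite -RintegralZl //.
    by apply: Rint_eq => y _; rewrite /=; move: ('D_1 be y) => t; ring.
  apply: (@intble_le _ _ _ leb setT measurableT _ (fun y => (\int[leb]_s `|G (x, s)|) * `|'D_1 be y : R|)).
  - apply: measurable_funM; last exact: intble_measurable (test1_intble tD).
    exact: (measurableT_comp (measurable_vprim mG) (pair1_measurable (x : mR))).
  - by move=> y _; rewrite normrM ler_wpM2r //; exact: cumul_le.
  - exact: intbleZ.
rewrite (cumul_ibp Ix tb) mulrN -RintegralZl //.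
  by congr (- _); apply: Rint_eq => y _; rewrite /=; ring.
apply: (@intble_le _ _ _ leb setT measurableT _ (fun y => M * `|G (x, y)|)).
- by apply: measurable_funM; [exact: intble_measurable Ix|exact: intble_measurable (test1_intble tb)].
- by move=> y _; rewrite normrM mulrC ler_wpM2r.
- by apply: intbleZ => //; exact: integrable_norm Ix.
Qed.

End absolute_continuity.

Section weak_derivative_primitive.
Context {R : realType}.
Local Notation plane := (R * R)%type.
Local Notation mplane := (measurableTypeR R * measurableTypeR R)%type.
Local Notation mR := (measurableTypeR R).
Local Notation leb := (@lebesgue_measure R).
Implicit Types (al be ga : R -> R).

Lemma patch_box (a b c d : R) (f : plane -> R) (x : plane) :
  ~ box a b c d x -> (f \_ (box a b c d)) x = 0.
Proof. by move=> nB; rewrite patchE memNset. Qed.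

Lemma patch_in (a b c d : R) (f : plane -> R) (x : plane) :
  box a b c d x -> (f \_ (box a b c d)) x = f x.
Proof. by move=> Bx; rewrite patchE mem_set. Qed.

Lemma intble_patch_box (a b c d : R) (f : mplane -> R) :
  intble leb2 (box a b c d) f -> intble leb2 setT (f \_ (box a b c d)).
Proof.
move=> If; apply/(intble_box (a := a) (b := b) (c := c) (d := d)); first exact: patch_box.
apply: (intble_eq (measurable_box a b c d) _ If) => x Bx; by rewrite patch_in.
Qed.

Lemma intble_box_fst (a b c d : R) (K : R -> R) : intble leb setT K ->
  intble leb2 (box a b c d) (fun x => K x.1).
Proof.
move=> IK.
have I1 : intble leb setT (\1_(`]c, d[%classic) : mR -> R).
  apply/(@intble_support _ _ _ leb (`]c, d[%classic : set mR)) => //.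
    by move=> x _ nx; rewrite indicE memNset.
  apply: measurable_bounded_integrable => //.
  - have [cd|dc] := leP c d; first by have := leb_oo cd => h; apply: (@le_lt_trans _ _ (d - c)%:E); rewrite ?ltry // -h.
    by rewrite set_itv_ge ?measure0 // -leNgt bnd_simp ltW.
  - by exists 1; split; [exact: num_real|move=> e e1 x _ /=; rewrite indicE ger0_norm ?ler0n // (le_trans _ (ltW e1)) // lern1; case: (_ \in _)].
have IB : intble leb2 (box a b c d) (fun x : mplane => K x.1 * \1_(`]c, d[%classic) x.2).
  by apply: (@integrableS _ _ _ leb2 setT) => //; [exact: measurable_box|exact: intble_prod].
apply: (intble_eq (measurable_box a b c d) _ IB) => x [_ x2].
by rewrite indicE mem_set ?mulr1 //= in_itv.
Qed.

(** The difference [W] of [V] and the primitive of [G] has the weak derivative 0. A test function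
    [ga] with integral [k] differs from [k * g0] by the derivative of a test function, so the
    pairing of [W] with [ga] in the second variable sees only [k]; hence [W] is a function of the
    first variable. *)
Lemma weak_dy_vprim (a b c d : R) (V G : mplane -> R) : c < d ->
  intble leb2 (box a b c d) V -> intble leb2 (box a b c d) G ->
  (forall al be, test1 a b al -> test1 c d be ->
    \int[leb2]_(x in box a b c d) (V x * (al x.1 * 'D_1 be x.2)) =
    - \int[leb2]_(x in box a b c d) (G x * (al x.1 * be x.2))) ->
  exists C : R -> R, \forall x \ae leb2, box a b c d x ->
    V x = C x.1 + vprim (G \_ (box a b c d)) x.
Proof.
move=> cd IV IG H; set B := box a b c d; set G0 := G \_ B.
have mB : measurable (B : set mplane) by exact: measurable_box.
have IG0 : intble leb2 setT G0 by exact: intble_patch_box.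
have [K [IK K0 HK]] := vprim_bound IG0.
have mP := measurable_vprim (intble_measurable IG0).
have IP : intble leb2 B (vprim G0).
  apply: (intble_le_ae mB _ _ (intble_box_fst a b c d IK)).
    exact: measurable_funTS.
  by apply: aeS (ae_fst HK) => -[x y] /= [_ hK] _; exact: hK.
pose W x := V x - vprim G0 x.
have IW : intble leb2 B W by exact: intbleB.
pose W0 := W \_ B; have IW0 : intble leb2 setT W0 by exact: intble_patch_box.
have mprod al be : smooth_on setT al -> smooth_on setT be ->
  measurable_fun (setT : set mplane) (fun x : mplane => al x.1 * be x.2).
  by move=> sa sb; exact: measurable_prod_fun.
have Itest (f : mplane -> R) al be : intble leb2 setT f -> test1 a b al -> test1 c d be ->
  intble leb2 setT (fun x => f x * (al x.1 * be x.2)).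
  move=> If ta tb; have [Ma Ma0 bMa] := test1_bounded ta; have [Mb Mb0 bMb] := test1_bounded tb.
  have IfM : intble leb2 setT (fun x => Ma * Mb * `|f x|).
    by apply: intbleZ => //; exact: integrable_norm If.
  apply: (@intble_le _ _ _ leb2 setT measurableT _ _ _ _ IfM).
    by apply: measurable_funM; [exact: intble_measurable If|apply: mprod; [exact: ta.1|exact: tb.1]].
  by move=> x _; rewrite normrM mulrC ler_wpM2r // normrM; exact: ler_pM.
have toT (f : mplane -> R) al be : test1 a b al -> test1 c d be ->
  \int[leb2]_(x in B) (f x * (al x.1 * be x.2)) = \int[leb2]_x ((f \_ B) x * (al x.1 * be x.2)).
  move=> ta tb; rewrite -(@Rint_box _ a b c d); last first.
    by move=> x nB; rewrite patch_box ?mul0r.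
  by apply: Rint_eq => x Bx; rewrite patch_in.
have tabox (f : mplane -> R) al be : test1 a b al -> test1 c d be -> intble leb2 B f ->
    intble leb2 B (fun x => f x * (al x.1 * be x.2)).
  move=> ta tb If; apply: (intble_eq mB (f := fun x => (f \_ B) x * (al x.1 * be x.2))).
    by move=> x Bx; rewrite patch_in.
  apply: (@integrableS _ _ _ leb2 setT) => //.
  exact: (Itest _ _ _ (intble_patch_box If) ta tb).
have HW al be : test1 a b al -> test1 c d be -> \int[leb2]_x (W0 x * (al x.1 * 'D_1 be x.2)) = 0.
  move=> ta tb; have tD := test1_D tb.
  rewrite -(toT W _ _ ta tD).
  have [IPt EP] := vprim_ibp IG0 ta tb.
  transitivity (\int[leb2]_(x in B) (V x * (al x.1 * 'D_1 be x.2) - vprim G0 x * (al x.1 * 'D_1 be x.2))).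
    by apply: Rint_eq => x _; rewrite /W mulrBl.
  rewrite RintegralB //; last first.
  - by apply: (@integrableS _ _ _ leb2 setT).
  - exact: (tabox V _ _ ta tD IV).
  rewrite H // [X in _ - X](@Rint_box _ a b c d) ?EP ?(toT G _ _ ta tb) ?subrr //.
  by move=> x nB; rewrite (test1_out ta tD nB) mulr0.
have [g0 tg0 g01] := test1_unit cd.
(* The candidate is the mean of [W] along the vertical line, with the weight [g0] of integral 1. *)
pose C0 x : R := \int[leb]_y (W0 (x, y) * g0 y).
have [M M0 bM] := test1_bounded tg0.
have mg0 : measurable_fun (setT : set mplane) (fun x : mplane => g0 x.2).
  by apply: (measurableT_comp (smooth1_measurable tg0.1)).
have IWg : intble leb2 setT (fun x => W0 x * g0 x.2).
  have IM : intble leb2 setT (fun x => M * `|W0 x|) by apply: intbleZ => //; exact: integrable_norm IW0.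
  apply: (@intble_le _ _ _ leb2 setT measurableT _ _ _ _ IM).
    by apply: measurable_funM => //; exact: intble_measurable IW0.
  by move=> x _; rewrite normrM mulrC ler_wpM2r.
have [IC0 _] := Rint_fubini IWg; rewrite -/C0 in IC0.
have ICB : intble leb2 B (fun x => C0 x.1) by exact: intble_box_fst.
exists C0.
suff : \forall x \ae leb2, B x -> W x - C0 x.1 = 0.
  by apply: aeS => x h Bx; have /eqP := h Bx; rewrite subr_eq0 /W subr_eq => /eqP.
apply: Rint_test_ae0; first exact: intbleB.
move=> al ga ta tg; pose k : R := \int[leb]_y ga y.
have [Ma Ma0 bMa] := test1_bounded ta.
have tf := test1_lin k tg tg0.
have If0 : \int[leb]_y (ga y - k * g0 y) = 0.
  rewrite RintegralB //; [|exact: test1_intble tg|apply: intbleZ => //; exact: test1_intble tg0].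
  by rewrite RintegralZl ?g01 ?mulr1 ?subrr //; exact: test1_intble tg0.
have [tc Dc] := test1_cumul tf If0.
have E1 := HW al _ ta tc.
have E2 : \int[leb2]_x (W0 x * (al x.1 * (ga x.2 - k * g0 x.2))) = 0.
  by rewrite -[RHS]E1; apply: Rint_eq => x _; rewrite Dc.
have E3 : \int[leb2]_x (W0 x * (al x.1 * ga x.2)) = k * \int[leb2]_x (W0 x * (al x.1 * g0 x.2)).
  rewrite -RintegralZl //; last exact: Itest.
  apply/eqP; rewrite -subr_eq0 -RintegralB //; [|exact: Itest|exact/intbleZ/Itest].
  by apply/eqP; rewrite -[RHS]E2; apply: Rint_eq => x _; ring.
have IWag := Itest _ _ _ IW0 ta tg0.
have ma := smooth1_measurable ta.1.
have E4 : \int[leb2]_x (W0 x * (al x.1 * g0 x.2)) = \int[leb]_x (C0 x * al x).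
  have [IF EF] := Rint_fubini IWag; rewrite EF.
  have IC : intble leb setT (fun x => C0 x * al x).
    have IM : intble leb setT (fun x => Ma * `|C0 x|) by apply: intbleZ => //; exact: integrable_norm IC0.
    apply: (@intble_le _ _ _ leb setT measurableT _ _ _ _ IM).
      by apply: measurable_funM => //; exact: intble_measurable IC0.
    by move=> x _; rewrite normrM mulrC ler_wpM2r.
  apply: Rint_ae_eq => //; [exact: intble_measurable IF|exact: intble_measurable IC|].
  have := ae_slice_intble IWg; apply: aeS => x Ix _.
  rewrite /C0 -RintegralZr //; by apply: Rint_eq => y _; rewrite /=; ring.
have E5 : \int[leb2]_(x in B) (C0 x.1 * (al x.1 * ga x.2)) = \int[leb]_x (C0 x * al x) * k.
  rewrite (@Rint_box _ a b c d); last by move=> x nB; rewrite (test1_out ta tg nB) mulr0.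
  have IC : intble leb setT (fun x => C0 x * al x).
    have IM : intble leb setT (fun x => Ma * `|C0 x|) by apply: intbleZ => //; exact: integrable_norm IC0.
    apply: (@intble_le _ _ _ leb setT measurableT _ _ _ _ IM).
      by apply: measurable_funM => //; exact: intble_measurable IC0.
    by move=> x _; rewrite normrM mulrC ler_wpM2r.
  have [_ EF] := Rint_fubini (intble_prod IC (test1_intble tg)).
  transitivity (\int[leb2]_x (C0 x.1 * al x.1 * ga x.2)).
    by apply: Rint_eq => x _; rewrite mulrA.
  rewrite EF -RintegralZr //; apply: Rint_eq => x _ /=.
  by rewrite RintegralZl //; exact: test1_intble tg.
transitivity (\int[leb2]_(x in B) (W x * (al x.1 * ga x.2) - C0 x.1 * (al x.1 * ga x.2))).
  by apply: Rint_eq => x _; rewrite mulrBl.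
rewrite RintegralB //; [|exact: (tabox W _ _ ta tg IW)|exact: (tabox (fun x => C0 x.1) _ _ ta tg ICB)].
by rewrite E5 (toT W _ _ ta tg) -/W0 E3 E4 mulrC subrr.
Qed.

End weak_derivative_primitive.

(** * The chain rule for primitives of square-integrable functions *)

Section chain_rule_1d.
Context {R : realType}.
Local Notation mR := (measurableTypeR R).
Local Notation leb := (@lebesgue_measure R).

(** On a subdivision into [n.+1] equal pieces the increments of [Q] telescope, while the length
    contributes the factor 1/(n+1). *)
Lemma quadratic_increment_const (H Q : R -> R) (C x y : R) : x <= y ->
  (forall s t, s <= t -> `|H t - H s| <= C * (t - s) * (Q t - Q s)) -> H y = H x.
Proof.
move=> xy HQ; apply/eqP; rewrite -subr_eq0 -normr_le0.
have bound (n : nat) : `|H y - H x| <= C * (y - x) * (Q y - Q x) / n.+1%:R.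
  pose t (i : nat) : R := x + (y - x) * i%:R / n.+1%:R.
  have tS i : t i.+1 - t i = (y - x) / n.+1%:R.
    by rewrite /t -natr1; field; rewrite addrC natr1 pnatr_eq0.
  have le_t i : t i <= t i.+1 by rewrite -subr_ge0 tS divr_ge0 // subr_ge0.
  have t0 : t 0%N = x by rewrite /t mulr0 mul0r addr0.
  have tn : t n.+1 = y by rewrite /t mulfK ?pnatr_eq0 // addrC subrK.
  have -> : H y - H x = \sum_(0 <= i < n.+1) (H (t i.+1) - H (t i)).
    by rewrite telescope_sumr // t0 tn.
  have -> : C * (y - x) * (Q y - Q x) / n.+1%:R =
      \sum_(0 <= i < n.+1) (C * ((y - x) / n.+1%:R) * (Q (t i.+1) - Q (t i))).
    by rewrite -mulr_sumr telescope_sumr // t0 tn; ring.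
  apply: (le_trans (ler_norm_sum _ _ _)); apply: ler_sum => i _.
  by rewrite -(tS i); exact: HQ.
apply/ler_addgt0Pl => e e0; rewrite addr0; set L := C * (y - x) * (Q y - Q x) in bound.
have [n Ln] := nat_norm_lt (L / e).
apply: (le_trans (bound n)); rewrite ler_pdivrMr // mulrC -ler_pdivrMr //.
apply: (le_trans (ler_norm _)); apply: (le_trans (ltW Ln)); by rewrite ler_nat.
Qed.

Lemma cumulB (g : R -> R) (x y : R) : intble leb setT g -> x <= y ->
  cumul g y - cumul g x = \int[leb]_(t in `]x, y]) g t.
Proof.
move=> Ig xy; rewrite /cumul Rintegral_itvB //.
by apply: (@integrableS _ mR _ leb setT).
Qed.

Lemma Rint_Ioc_ub (g h : R -> R) (x y M : R) : intble leb setT g -> intble leb setT h ->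
  (forall t, x < t <= y -> `|h t| <= M * `|g t|) ->
  `|\int[leb]_(t in `]x, y]) h t| <= M * \int[leb]_(t in `]x, y]) `|g t|.
Proof.
move=> Ig Ih hg; pose J : set mR := `]x, y]%classic.
have mJ : measurable J by exact: measurable_itv.
have IhJ : intble leb J h by apply: (@integrableS _ mR _ leb setT).
have IgJ : intble leb J (fun t => `|g t|).
  by apply: (@integrableS _ mR _ leb setT) => //; exact: integrable_norm Ig.
apply: (le_trans (le_normr_Rintegral mJ IhJ)); rewrite -RintegralZl //.
apply: le_Rintegral => //; first exact: integrable_norm IhJ.
exact: intbleZ.
Qed.

Lemma cauchy_schwarz_Ioc (g : R -> R) (x y : R) : x <= y -> intble leb setT g ->
  intble leb setT (fun t => g t ^+ 2) ->
  (\int[leb]_(t in `]x, y]) `|g t|) ^+ 2 <= (y - x) * (cumul (fun t => g t ^+ 2) y - cumul (fun t => g t ^+ 2) x).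
Proof.
move=> xy Ig Ig2; pose J : set mR := `]x, y]%classic.
have mJ : measurable J by exact: measurable_itv.
have JE : leb J = (y - x)%:E.
  by rewrite lebesgue_measure_itv /= lte_fin; case: ltgtP xy => // -> _; rewrite subrr.
have mg := intble_measurable Ig.
have sg : sqint leb J (fun t => `|g t|).
  split; first by apply: measurable_funTS; exact: measurableT_comp.
  have : intble leb J (fun t => g t ^+ 2) by apply: (@integrableS _ mR _ leb setT).
  by apply: intble_eq => // t _; rewrite real_normK ?num_real.
have s1 : sqint leb J (cst (1 : R)).
  apply: (sqint_bounded mJ (C := 1)) => //; first by rewrite [X in (X < _)%E]JE ltry.
  by move=> t _; rewrite normr1.
have := cauchy_schwarz mJ sg s1; rewrite /ip /nrm2 cumulB // mulrC.
have -> : \int[leb]_(t in J) (`|g t| * cst 1 t) = \int[leb]_(t in J) `|g t|.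
  by apply: Rint_eq => t _; rewrite mulr1.
have -> : \int[leb]_(t in J) (`|g t| ^+ 2) = \int[leb]_(t in J) (g t ^+ 2).
  by apply: Rint_eq => t _; rewrite real_normK ?num_real.
have -> // : \int[leb]_(t in J) (cst 1 t ^+ 2) = y - x.
transitivity (\int[leb]_(t in J) (1 : R)); first by apply: Rint_eq => t _; rewrite /cst expr1n.
by rewrite Rintegral_cst // mul1r; exact: (congr1 fine JE).
Qed.

(** Functions with a Lipschitz derivative, described by a Taylor remainder for all increments; this
    form can be checked directly for formulas given by cases. *)
Definition C11 (Z Z' : R -> R) (A : R) := [/\ 0 <= A,
  forall u v, `|Z v - Z u - Z' u * (v - u)| <= A * (v - u) ^+ 2 &
  forall u v, `|Z' v - Z' u| <= A * `|v - u|].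

Lemma C11_continuous (Z Z' : R -> R) (A : R) : C11 Z Z' A -> continuous Z /\ continuous Z'.
Proof.
move=> [A0 H1 H2].
have c' : continuous Z'.
  move=> u; apply/cvgrPdist_le => e e0; near=> v.
  rewrite distrC; apply: (le_trans (H2 u v)).
  have : `|v - u| <= e / (A + 1).
    rewrite distrC; near: v; apply: cvgr_dist_le; first exact: cvg_id.
    by rewrite divr_gt0 // ltr_wpDl.
  rewrite ler_pdivlMr ?ltr_wpDl // => h; apply: le_trans h.
  by rewrite mulrC ler_wpM2l // lerDl.
split=> // u; apply/cvgrPdist_le => e e0; near=> v.
have h1 : `|v - u| <= 1 by rewrite distrC; near: v; apply: cvgr_dist_le; [exact: cvg_id|].
have h2 : `|v - u| <= e / (A + `|Z' u| + 1).
  rewrite distrC; near: v; apply: cvgr_dist_le; first exact: cvg_id.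
  by rewrite divr_gt0 // ltr_wpDl // addr_ge0.
move: h2; rewrite ler_pdivlMr ?ltr_wpDl ?addr_ge0 // => h2; rewrite distrC; apply: le_trans h2.
have -> : Z v - Z u = (Z v - Z u - Z' u * (v - u)) + Z' u * (v - u) by ring.
apply: (le_trans (ler_normD _ _)); apply: (le_trans (lerD (H1 u v) (lexx _))).
rewrite normrM -(real_normK (num_real (v - u))).
have n0 : 0 <= `|v - u| by [].
have q : A * `|v - u| ^+ 2 <= A * `|v - u|.
  by rewrite ler_wpM2l // expr2 ler_piMr.
by rewrite !mulrDr mulr1 mulrC [X in _ + X <= _]mulrC; lra.
Unshelve. all: by end_near. Qed.

(** Over an interval []s, t]] let N be the integral of |g|. Linearising [Z] at [p s] costs A N^2,
    and so does freezing the factor [Z' (p r)]. By Cauchy-Schwarz N^2 is at most [t - s] times the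
    increment of the primitive of [g ^+ 2], so [quadratic_increment_const] applies; no
    differentiation of an integral almost everywhere takes place. *)
Lemma C11_cumul (Z Z' : R -> R) (A c M : R) (g : R -> R) : C11 Z Z' A ->
  (forall u, `|Z' u| <= M) ->
  intble leb setT g -> intble leb setT (fun t => g t ^+ 2) ->
  let p y := c + cumul g y in
  intble leb setT (fun t => Z' (p t) * g t) /\
  forall x y, x <= y -> Z (p y) = Z (p x) + (cumul (fun t => Z' (p t) * g t) y - cumul (fun t => Z' (p t) * g t) x).
Proof.
move=> ZA Z'M Ig Ig2 p; have [cZ cZ'] := C11_continuous ZA; have [A0 H1 H2] := ZA.
have mg := intble_measurable Ig.
have mp : measurable_fun (setT : set mR) p.
  apply: measurable_funD => //.
  have := @measurable_vprim R (fun z => g z.2) (measurableT_comp mg measurable_snd).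
  move=> mv; exact: (measurableT_comp mv (pair1_measurable (0 : mR))).
have mZ' : measurable_fun (setT : set mR) (fun t => Z' (p t)).
  apply: (measurableT_comp _ mp); exact: continuous_measurable_fun.
have Ih : intble leb setT (fun t => Z' (p t) * g t).
  have IM : intble leb setT (fun t => M * `|g t|) by apply: intbleZ => //; exact: integrable_norm Ig.
  apply: (@intble_le _ _ _ leb setT measurableT _ _ _ _ IM); first exact: measurable_funM.
  by move=> t _; rewrite normrM ler_wpM2r.
split=> // x y xy; pose h t := Z' (p t) * g t.
suff : Z (p y) - cumul h y = Z (p x) - cumul h x by rewrite /h; lra.
apply: (@quadratic_increment_const (fun y => Z (p y) - cumul h y) (cumul (fun t => g t ^+ 2)) (2 * A)) => // s t st.
pose N := \int[leb]_(r in `]s, t]) `|g r|.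
have N0 : 0 <= N by apply: Rintegral_ge0 => r _.
have pE r : s <= r -> p r - p s = \int[leb]_(r in `]s, r]) g r.
  by move=> sr; rewrite -cumulB // /p; ring.
have mono r : r <= t -> \int[leb]_(r in `]s, r]) `|g r| <= N.
  move=> rt; rewrite /N [leRHS]Rintegral_mkcond [leLHS]Rintegral_mkcond; apply: le_Rintegral => //.
  - rewrite -restrict_EFin; apply/(integrable_mkcond (D := `]s, r]%classic : set mR)) => //.
    apply: (@integrableS _ mR _ leb setT) => //; exact: integrable_norm Ig.
  - rewrite -restrict_EFin; apply/(integrable_mkcond (D := `]s, t]%classic : set mR)) => //.
    apply: (@integrableS _ mR _ leb setT) => //; exact: integrable_norm Ig.
  move=> w _; rewrite !patchE; case: ifPn => h1; case: ifPn => h2 //.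
    move: h1 h2; rewrite inE notin_setE /= !in_itv /= => /andP[h1 h2] []; rewrite h1 /=.
    exact: le_trans rt.
  exact: normr_ge0.
have pN r : s <= r <= t -> `|p r - p s| <= N.
  move=> /andP[sr rt]; rewrite pE //; apply: le_trans (mono r rt).
  have := @Rint_Ioc_ub g g s r 1 Ig Ig; rewrite mul1r; apply=> w _; by rewrite mul1r.
have E : Z (p t) - cumul h t - (Z (p s) - cumul h s) =
   (Z (p t) - Z (p s) - Z' (p s) * (p t - p s)) - \int[leb]_(r in `]s, t]) (h r - Z' (p s) * g r).
  have mJ : measurable (`]s, t]%classic : set mR) by exact: measurable_itv.
  have IhJ : intble leb (`]s, t]%classic : set mR) h by apply: (@integrableS _ mR _ leb setT).
  have IgJ : intble leb (`]s, t]%classic : set mR) g by apply: (@integrableS _ mR _ leb setT).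
  have E1 := RintegralB mJ IhJ (intbleZ mJ (Z' (p s)) IgJ).
  have E2 := RintegralZl (Z' (p s)) mJ IgJ.
  have E3 := cumulB Ih st; have E4 := pE t st.
  rewrite -/h in E3; move: E1 E2 E3 E4.
  set i1 := Rintegral _ _ _; set i2 := Rintegral _ _ _; set i3 := Rintegral _ _ _; set i4 := Rintegral _ _ _.
  by move=> -> -> h3 h4; rewrite h4; move: h3; clear; lra.
rewrite E; apply: (le_trans (ler_normB _ _)).
have B1 : `|Z (p t) - Z (p s) - Z' (p s) * (p t - p s)| <= A * N ^+ 2.
  apply: (le_trans (H1 _ _)); rewrite ler_wpM2l // -(real_normK (num_real (p t - p s))).
  by rewrite lerXn2r ?nnegrE // pN // st lexx.
have B2 : `|\int[leb]_(r in `]s, t]) (h r - Z' (p s) * g r)| <= A * N ^+ 2.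
  have -> : A * N ^+ 2 = A * N * N by rewrite expr2 mulrA.
  apply: (@Rint_Ioc_ub g (fun r => h r - Z' (p s) * g r) s t (A * N) Ig).
    by apply: intbleB => //; exact: intbleZ.
  move=> r /andP[sr rt]; rewrite /h -mulrBl normrM ler_wpM2r //.
  by apply: (le_trans (H2 _ _)); rewrite ler_wpM2l // pN // (ltW sr) rt.
apply: (le_trans (lerD B1 B2)); have CS := cauchy_schwarz_Ioc st Ig Ig2.
have -> : 2 * A * (t - s) * (cumul (fun r => g r ^+ 2) t - cumul (fun r => g r ^+ 2) s) =
  A * ((t - s) * (cumul (fun r => g r ^+ 2) t - cumul (fun r => g r ^+ 2) s)) +
  A * ((t - s) * (cumul (fun r => g r ^+ 2) t - cumul (fun r => g r ^+ 2) s)) by ring.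
by apply: lerD; rewrite ler_wpM2l.
Qed.

End chain_rule_1d.

(** * The chain rule on a box *)

Section chain_rule_box.
Context {R : realType}.
Local Notation plane := (R * R)%type.
Local Notation mplane := (measurableTypeR R * measurableTypeR R)%type.
Local Notation mR := (measurableTypeR R).
Local Notation leb := (@lebesgue_measure R).

Lemma is_derive_slice2 (f : plane -> R) (x y : R) : differentiable f (x, y) ->
  is_derive y (1 : R) (fun s : R => f (x, s)) ('D_(basis2 ord_max) f (x, y)).
Proof.
move=> df; have E (r : R) : (x, (0 : R)) + r *: (basis2 ord_max : plane) = (x, r).
  by rewrite basis2_max /GRing.add /= /add_pair /= /GRing.scale /= /scale_pair /= mulr1 mulr0 add0r addr0.
have d1 : differentiable f ((x, 0) + y *: (basis2 ord_max : plane)) by rewrite E.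
have := is_derive_line d1; rewrite E (_ : (fun r => _) = (fun r => f (x, r))) //.
by apply/funext => r; rewrite E.
Qed.

Lemma smooth_slice2 (f : plane -> R) (x : R) : smooth_on setT f ->
  smooth_on setT (fun y : R => f (x, y)).
Proof.
move=> sf n; elim: n f sf => [//|n IH] f sf.
apply: (smooth_on_derive openT _ (IH _ (smooth_on_D (basis2 ord_max) sf))) => y _.
by apply: is_derive_slice2; exact: (smooth_on_diff sf).
Qed.

Lemma compact_gt (K : set plane) (h : plane -> R) : compact K -> continuous h ->
  (forall x, K x -> 0 < h x) -> exists2 e : R, 0 < e & forall x, K x -> e <= h x.
Proof.
move=> cK ch h0; have [|M M0 HM] := @compact_max_norm R K (fun x => (h x)^-1) cK.
  by move=> x Kx; apply: cvgV; [rewrite gt_eqF // h0|exact: ch].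
exists (M + 1)^-1 => [|x Kx]; first by rewrite invr_gt0 ltr_wpDl.
rewrite -[leRHS]invrK lef_pV2 ?posrE ?invr_gt0 ?h0 ?ltr_wpDl //.
by apply: (le_trans (ler_norm _)); apply: (le_trans (HM x Kx)); rewrite lerDl.
Qed.

Lemma test1_slice2 (a b c d x : R) (psi : plane -> R) : test_function (box a b c d) psi ->
  test1 c d (fun y => psi (x, y)).
Proof.
move=> /test_functionE[sp cp pB]; split; first exact: smooth_slice2.
have cs : continuous (snd : plane -> R) by move=> z; exact: cvg_snd.
have [|z /pB[_ /andP[h _]]|e1 e10 H1] := @compact_gt _ (fun z => z.2 - c) cp.
- by move=> z; apply: cvgB; [exact: cs|exact: cvg_cst].
- by rewrite subr_gt0.
have [|z /pB[_ /andP[_ h]]|e2 e20 H2] := @compact_gt _ (fun z => d - z.2) cp.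
- by move=> z; apply: cvgB; [exact: cvg_cst|exact: cs].
- by rewrite subr_gt0.
exists (c + e1), (d - e2); split; rewrite ?ltrDl ?ltrBlDr ?ltrDl // => s h.
apply: support_out => /[dup] /H1 /= h1 /H2 /= h2; apply: h.
by rewrite -lerBrDl h1 /= lerBrDr addrC -lerBrDr.
Qed.

Lemma test_out (O : set plane) (psi : plane -> R) : test_function O psi ->
  forall x, ~ O x -> psi x = 0.
Proof. by move=> /test_functionE[_ _ pO] x nO; apply: support_out => /pO. Qed.

(** The area of a null set is the integral of the lengths of its sections, so almost all sections
    are null. *)
Lemma ae_slices (Q : plane -> Prop) : (\forall z \ae leb2, Q z) ->
  \forall x \ae leb, \forall y \ae leb, Q (x, y).
Proof.
move=> [N [mN N0 NQ]].
have mx : measurable_fun (setT : set mR) (fun x => leb (xsection N x)).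
  exact: measurable_fun_xsection.
have h : (\int[leb]_x `|leb (xsection N x)| = 0)%E.
  rewrite -[RHS]N0 /leb2 /product_measure1; apply: eq_integral => x _.
  by rewrite gee0_abs.
have /(ae_eq_integral_abs leb measurableT mx) h' := h.
apply: aeS h' => x /(_ I) /= hx; exists (xsection N x); split=> //.
- exact: measurable_xsection.
- by move=> y /= nQ; rewrite /xsection /= inE; exact: NQ.
Qed.

Lemma Rint_D1_test1 (c d : R) (be : R -> R) : test1 c d be -> \int[leb]_y 'D_1 be y = 0.
Proof.
move=> [sb [p [q [_ _ b0]]]].
have E : \int[leb]_y 'D_1 be y = \int[leb]_(y in `[p - 1, +oo[) 'D_1 be y.
  apply: Rint_support => // y _ h; apply: (D1_out b0) => /andP[py _]; apply: h.
  by rewrite /= in_itv /= andbT (le_trans _ py) // gerBl.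
rewrite E (Rint_half_derive _ sb b0) b0 ?oppr0 // => /andP[h _].
by move: h; rewrite leNgt ltrBlDr ltrDl ltr01.
Qed.

(** On almost every vertical line [V] is a constant plus the primitive of a square-integrable
    function, where the one-dimensional rule holds; Fubini reassembles the lines. *)
Lemma chain_rule_box (a b c d : R) (V G : mplane -> R) (Z Z' : R -> R) (A M : R) : c < d ->
  intble leb2 (box a b c d) V -> intble leb2 (box a b c d) G ->
  intble leb2 (box a b c d) (fun x => G x ^+ 2) ->
  (forall al be, test1 a b al -> test1 c d be ->
    \int[leb2]_(x in box a b c d) (V x * (al x.1 * 'D_1 be x.2)) =
    - \int[leb2]_(x in box a b c d) (G x * (al x.1 * be x.2))) ->
  C11 Z Z' A -> (forall u, `|Z' u| <= M) -> (forall u v, `|Z v - Z u| <= M * `|v - u|) ->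
  forall psi, test_function (box a b c d) psi ->
  \int[leb2]_(x in box a b c d) (Z (V x) * 'D_(basis2 ord_max) psi x) =
  - \int[leb2]_(x in box a b c d) (Z' (V x) * G x * psi x).
Proof.
move=> cd IV IG IG2 H ZA Z'M ZL psi tp; set B := box a b c d.
have mB : measurable (B : set mplane) by exact: measurable_box.
have [C HC] := weak_dy_vprim cd IV IG H; rewrite -/B in HC.
set G0 := G \_ B in HC.
have IG0 : intble leb2 setT G0 by exact: intble_patch_box.
have IG02 : intble leb2 setT (fun x => G0 x ^+ 2).
  have := intble_patch_box IG2; apply: intble_eq => // x _.
  have [Bx|nB] := pselect (B x); first by rewrite /G0 !patch_in.
  by rewrite /G0 !patch_box // expr0n.
have tD := test_function_D (basis2 ord_max) tp.
have [cZ cZ'] := C11_continuous ZA.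
have psi0 := test_out tp; have Dpsi0 := test_out tD.
have tpT := test_function_sub (@subsetT _ _) tp.
have tDT := test_function_sub (@subsetT _ _) tD.
have [N N0 bN] := test_bounded tpT.
have [ND ND0 bND] := test_bounded tDT.
have mV := intble_measurable IV; have mG := intble_measurable IG.
have mZV : measurable_fun (B : set mplane) (fun x : mplane => Z (V x)).
  by apply: (measurableT_comp _ mV); exact: continuous_measurable_fun.
have mZ'V : measurable_fun (B : set mplane) (fun x : mplane => Z' (V x)).
  by apply: (measurableT_comp _ mV); exact: continuous_measurable_fun.
have I1 : intble leb2 B (fun x => Z (V x) * 'D_(basis2 ord_max) psi x).
  have I0 : intble leb2 B (fun x => `|Z 0| * `|'D_(basis2 ord_max) psi x : R|).
    apply: intbleZ => //; apply: integrable_norm; apply: (@integrableS _ _ _ leb2 setT) => //.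
    exact: test_intble.
  have I0' : intble leb2 B (fun x => ND * (M * `|V x|)).
    by apply: intbleZ => //; apply: intbleZ => //; exact: integrable_norm IV.
  apply: (@intble_le _ _ _ leb2 B mB _ _ _ _ (intbleD mB I0 I0')).
    apply: measurable_funM => //; apply: measurable_funTS; exact: test_measurable tDT.
  move=> x _; rewrite normrM; have zv := ZL 0 (V x); rewrite subr0 in zv.
  have zv2 : `|Z (V x)| <= `|Z 0| + M * `|V x|.
    by apply: le_trans (lerD (lexx _) zv); rewrite -{1}(subrK (Z 0) (Z (V x))) addrC ler_normD.
  apply: (le_trans (ler_wpM2r (normr_ge0 _) zv2)); rewrite mulrDl lerD2l mulrC.
  by apply: ler_wpM2r; [exact: le_trans zv|exact: bND].
have I2 : intble leb2 B (fun x => Z' (V x) * G x * psi x).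
  have I0 : intble leb2 B (fun x => M * N * `|G x|).
    by apply: intbleZ => //; exact: integrable_norm IG.
  apply: (@intble_le _ _ _ leb2 B mB _ _ _ _ I0).
    apply: measurable_funM; first exact: measurable_funM.
    by apply: measurable_funTS; exact: test_measurable tpT.
  move=> x _; rewrite !normrM -mulrA mulrCA [leRHS]mulrC; apply: ler_wpM2l => //.
  by apply: ler_pM.
have F1 := intble_patch_box I1; have F2 := intble_patch_box I2.
have toT (f : mplane -> R) : \int[leb2]_(x in B) f x = \int[leb2]_x (f \_ B) x.
  by rewrite Rintegral_mkcond.
rewrite !toT; have [J1 ->] := Rint_fubini F1; have [J2 ->] := Rint_fubini F2.
rewrite -RintN //; apply: Rint_ae_eq => //.
- exact: intble_measurable J1.
- exact: intble_measurable (intbleN measurableT J2).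
have HC1 := ae_slices HC.
apply: aeS (aeI (aeI (aeI (ae_slice_intble IG0) (ae_slice_intble IG02)) HC1)
  (aeI (ae_slice_intble F1) (ae_slice_intble F2))) => x [[[Ix Ix2] HCx] [s1 s2]] _.
pose g y := G0 (x, y); pose p y := C x + cumul g y.
have [Ih Hp] := C11_cumul (C x) ZA Z'M Ix Ix2.
rewrite -/g in Ih Hp; pose h y := Z' (p y) * g y.
have tb : test1 c d (fun y => psi (x, y)) by exact: test1_slice2 tp.
set be := fun y => psi (x, y) in tb.
have Dy y : 'D_(basis2 ord_max) psi (x, y) = 'D_1 be y.
  have /test_functionE[sp _ _] := tp.
  by rewrite (@derive_val _ _ _ _ _ _ _ (@is_derive_slice2 psi x y (smooth_on_diff sp I))).
have tDb := test1_D tb; have IDb := test1_intble tDb.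
(* On this line [Z (V)] equals [k0] plus the primitive of [h]; the constant disappears against the
   derivative of the test function. *)
pose k0 := Z (p c) - cumul h c.
have [M1 M10 bM1] := test1_bounded tDb.
have mcum : measurable_fun (setT : set mR) (cumul h).
  have := @measurable_vprim R (fun z => h z.2) (measurableT_comp (intble_measurable Ih) measurable_snd).
  by move=> mv; exact: (measurableT_comp mv (pair1_measurable (0 : mR))).
have Icum : intble leb setT (fun y => cumul h y * 'D_1 be y).
  have IM : intble leb setT (fun y => (\int[leb]_t `|h t|) * `|'D_1 be y : R|).
    by apply: intbleZ => //; exact: integrable_norm IDb.
  apply: (@intble_le _ _ _ leb setT measurableT _ _ _ _ IM).
    by apply: measurable_funM => //; exact: intble_measurable IDb.
  by move=> y _; rewrite normrM; apply: ler_wpM2r => //; exact: cumul_le.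
have E1 : \int[leb]_y ((fun z => Z (V z) * 'D_(basis2 ord_max) psi z) \_ B) (x, y) =
    \int[leb]_y (k0 * 'D_1 be y + cumul h y * 'D_1 be y).
  apply: Rint_ae_eq => //.
  - exact: intble_measurable s1.
  - exact: intble_measurable (intbleD measurableT (intbleZ measurableT k0 IDb) Icum).
  apply: aeS HCx => y HVy _; have [Bxy|nB] := pselect (B (x, y)); last first.
    by rewrite patch_box // -Dy Dpsi0 // !mulr0 addr0.
  rewrite patch_in // HVy // Dy -mulrDl; congr (_ * _).
  rewrite /vprim /= -/(p y) (Hp c y); last by case: Bxy => _ /andP[/ltW].
  by rewrite /k0 /h -addrA [- _ + _]addrC addrA.
have E2 : \int[leb]_y ((fun z => Z' (V z) * G z * psi z) \_ B) (x, y) = \int[leb]_y (h y * be y).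
  apply: Rint_ae_eq => //.
  - exact: intble_measurable s2.
  - by apply: measurable_funM; [exact: intble_measurable Ih|exact: intble_measurable (test1_intble tb)].
  apply: aeS HCx => y HVy _; have [Bxy|nB] := pselect (B (x, y)); last first.
    by rewrite patch_box // /be psi0 // mulr0.
  by rewrite patch_in // HVy // /h /g /G0 patch_in.
rewrite E1 E2 RintegralD //; last exact: intbleZ.
by rewrite RintegralZl // (Rint_D1_test1 tb) mulr0 add0r (cumul_ibp Ih tb).
Qed.

End chain_rule_box.

(** * Weak derivatives on open sets *)

Section localisation.
Context {R : realType}.
Local Notation plane := (R * R)%type.

Lemma differentiable_swap (x : plane) : differentiable (swap : plane -> plane) x.
Proof.
have d1 : differentiable (fst : plane -> R) x := smooth_on_diff (smooth_on_fst openT) I.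
have d2 : differentiable (snd : plane -> R) x := smooth_on_diff (smooth_on_snd openT) I.
exact: (differentiable_pair d2 d1).
Qed.

Lemma diffn_swap n (f : plane -> R) : diffn n setT f -> diffn n setT (fun x => f (swap x)).
Proof.
have ds := differentiable_swap.
elim: n f => [//|n IH] f [df Df]; split.
  by move=> x _; apply: (@differentiable_comp _ _ _ _ swap f x (ds x) (df (swap x) I)).
by move=> v; exact: (IH _ (Df (swap v))).
Qed.

Lemma derive_swap (f : plane -> R) (v x : plane) :
  'D_v (fun x => f (swap x)) x = 'D_(swap v) f (swap x).
Proof. by []. Qed.

Lemma test_function_swap (a b c d : R) (psi : plane -> R) : test_function (box a b c d) psi ->
  test_function (box c d a b) (fun x => psi (swap x)).
Proof.
move=> /test_functionE[sp cp pB].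
have sK : support (fun x => psi (swap x)) `<=` swap @` support psi.
  apply: support_sub.
    apply: compact_closed; first exact: norm_hausdorff.
    apply: continuous_compact => //; apply: continuous_subspaceT => x.
    exact: differentiable_continuous (differentiable_swap x).
  move=> x nx; apply: support_out => sx; apply: nx; exists (swap x) => //.
  by case: (x).
have cK : compact (swap @` support psi).
  apply: continuous_compact => //; apply: continuous_subspaceT => x.
  exact: differentiable_continuous (differentiable_swap x).
apply/test_functionE; split.
- by move=> n; exact: diffn_swap.
- by apply: (subclosed_compact _ cK sK); exact: closed_support.
- by apply: subset_trans sK _ => _ [x /pB [h1 h2] <-]; split.
Qed.

Definition plateau (p r s : R) : R := step (4 / r * (s - p) + 3) * step (3 - 4 / r * (s - p)).

Lemma smooth_on_plateau p r : smooth_on setT (plateau p r).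
Proof.
move=> k; rewrite /plateau; apply: (diffnM openT).
  apply: (@diffn_comp _ _ k setT setT step (fun s : R => 4 / r * (s - p) + 3)) => //.
  - exact: openT.
  - exact: smooth_on_step.
  - have := @smooth_on_affine R (4 / r) (- (4 / r) * p + 3) k; congr diffn.
    by apply/funext => s; ring.
apply: (@diffn_comp _ _ k setT setT step (fun s : R => 3 - 4 / r * (s - p))) => //.
- exact: openT.
- exact: smooth_on_step.
- have := @smooth_on_affine R (- (4 / r)) (4 / r * p + 3) k; congr diffn.
  by apply/funext => s; ring.
Qed.

Lemma plateau1 p r s : 0 < r -> `|s - p| < r / 2 -> plateau p r s = 1.
Proof.
move=> r0; rewrite ltr_norml => /andP[h1 h2].
have k0 : 0 < 4 / r by rewrite divr_gt0.
have e1 : 4 / r * (- (r / 2)) = -2 by field; rewrite gt_eqF.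
have e2 : 4 / r * (r / 2) = 2 by field; rewrite gt_eqF.
have H1 : 4 / r * (s - p) <= 4 / r * (r / 2) by rewrite ler_pM2l // ltW.
have H2 : 4 / r * (- (r / 2)) <= 4 / r * (s - p) by rewrite ler_pM2l // ltW.
rewrite e2 in H1; rewrite e1 in H2.
by rewrite /plateau !step1 ?mulr1 //; move: H1 H2; set A := 4 / r * _; lra.
Qed.

Lemma plateau0 p r s : 0 < r -> ~ (p - 3 / 4 * r <= s <= p + 3 / 4 * r) -> plateau p r s = 0.
Proof.
move=> r0 /negP; rewrite negb_and -!ltNge => h.
have k0 : 0 < 4 / r by rewrite divr_gt0.
have e1 : 4 / r * (3 / 4 * r) = 3 by field; rewrite gt_eqF.
move: h => /orP[h|h]; rewrite /plateau.
  have H : 4 / r * (s - p) <= 4 / r * (- (3 / 4 * r)).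
    by rewrite ler_pM2l //; lra.
  rewrite mulrN e1 in H.
  by rewrite (@step0 _ (4 / r * _ + 3)) ?mul0r //; move: H; set A := 4 / r * _; lra.
have H : 4 / r * (3 / 4 * r) <= 4 / r * (s - p).
  by rewrite ler_pM2l //; lra.
rewrite e1 in H.
by rewrite (@step0 _ (3 - 4 / r * _)) ?mulr0 //; move: H; set A := 4 / r * _; lra.
Qed.

Lemma test1_plateau p r : 0 < r -> test1 (p - r) (p + r) (plateau p r).
Proof.
move=> r0; split; first exact: smooth_on_plateau.
exists (p - 3 / 4 * r), (p + 3 / 4 * r); split; [lra|lra|move=> s; exact: plateau0].
Qed.

Definition bump2 (z : plane) (r : R) (x : plane) : R := plateau z.1 r x.1 * plateau z.2 r x.2.

Lemma smooth_on_bump2 z r : smooth_on setT (bump2 z r).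
Proof.
apply: smooth_onM; first exact: openT.
  exact: (smooth_on_comp openT (smooth_on_plateau z.1 r) (smooth_on_fst openT)).
exact: (smooth_on_comp openT (smooth_on_plateau z.2 r) (smooth_on_snd openT)).
Qed.

Lemma bump2_eq1 z r x : 0 < r -> ball z (r / 2) x -> bump2 z r x = 1.
Proof.
move=> r0; rewrite /ball /= /prod_ball /= /ball /= => -[h1 h2].
by rewrite /bump2 !plateau1 ?mulr1 // distrC.
Qed.

(** A partition of unity made one step at a time: the support is covered by finitely many half-size
    balls, which are boxes for the product norm. Multiplying by a bump and by its complement to 1
    splits off a test function of one box and removes one ball from the cover. *)
Lemma test_localize (Omega : set plane) (L : (plane -> R) -> R) : open Omega ->
  (forall f g, test_function Omega f -> test_function Omega g ->
    L (fun x => f x + g x) = L f + L g) ->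
  (forall a b c d, a < b -> c < d -> box a b c d `<=` Omega ->
    forall f, test_function (box a b c d) f -> L f = 0) ->
  forall f, test_function Omega f -> L f = 0.
Proof.
move=> oO Ladd Lbox f tf.
have Hr (z : plane) : exists r, Omega z -> 0 < r /\ ball z r `<=` Omega.
  have [Oz|nO] := pselect (Omega z); last by exists 1.
  have /nbhs_ballP[r /= r0 rO] : nbhs z Omega by exact: open_nbhs_nbhs.
  by exists r.
have [rad Hrad] := choice Hr.
pose I z := ball z (rad z / 2).
have zero g : test_function Omega g -> (forall x, g x = 0) -> L g = 0.
  move=> tg g0; have E : (fun x => g x + g x) = g by apply/funext => x; rewrite g0 addr0.
  have := Ladd g g tg tg; rewrite E => h.
  by apply: (@addrI _ (L g)); rewrite addr0.
suff H (l : seq plane) : (forall z, z \in l -> Omega z) -> forall g, test_function Omega g ->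
    (forall x, support g x -> exists2 z, z \in l & I z x) -> L g = 0.
  have cf : compact (support f) by have /test_functionE[_ + _] := tf.
  have sO : support f `<=` Omega by have /test_functionE[_ _ +] := tf.
  (* Compactness is used in its filter form. A property is eventual for this filter when it holds
     for all lists that contain some fixed list of points of [Omega], so the conclusion is a finite
     subcover. *)
  pose F : set_system (seq plane) := [set P : set (seq plane) | exists2 l0 : seq plane,
    (forall z, z \in l0 -> Omega z) & forall l, {subset l0 <= l} -> P l].
  have FF : Filter F.
    split; first by exists [::].
      move=> P Q [l1 o1 h1] [l2 o2 h2]; exists (l1 ++ l2).
        by move=> z; rewrite mem_cat => /orP[/o1|/o2].
      move=> l sl; split; [apply: h1|apply: h2] => z zl; apply: sl; rewrite mem_cat zl ?orbT //.
    by move=> P Q PQ [l0 o0 h0]; exists l0 => // l /h0 /PQ.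
  have [|l0 o0 h0] := (compact_near_coveringP _).1 cf _ F
      (fun l x => exists2 z, z \in l & I z x) FF.
    move=> x /sO Ox; have [r0 _] := Hrad x Ox.
    exists (I x, [set l : seq plane | x \in l]).
      split; first by apply: nbhsx_ballx; rewrite divr_gt0.
      exists [:: x] => [z|l]; first by rewrite inE => /eqP ->.
      by move=> h; apply: h; rewrite inE eqxx.
    by move=> [y l] /= [Iy xl]; exists x.
  by apply: (H l0) => // x /(h0 l0 (fun _ => id)).
elim: l => [|z l IH] lO g tg cov.
  by apply: zero => // x; apply: support_out => /cov[].
have Oz : Omega z by apply: lO; rewrite inE eqxx.
have [r0 rO] := Hrad z Oz; set r := rad z in r0 rO.
have sb := smooth_on_bump2 z r.
pose g1 x := bump2 z r x * g x; pose g2 x := (1 - bump2 z r x) * g x.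
have tg1 : test_function Omega g1.
  by apply: test_functionM => //; exact: smooth_on_sub sb.
have tg2 : test_function Omega g2.
  apply: test_functionM => //; apply: smooth_onB => //; first exact: smooth_on_cst.
  exact: smooth_on_sub sb.
have -> : g = (fun x => g1 x + g2 x) by apply/funext => x; rewrite /g1 /g2; ring.
rewrite Ladd //.
have -> : L g1 = 0.
  apply: (Lbox (z.1 - r) (z.1 + r) (z.2 - r) (z.2 + r)).
  - lra.
  - lra.
  - by rewrite -ball_box.
  have t1 := test_function_prod (test1_plateau z.1 r0) (test1_plateau z.2 r0).
  have /test_functionE[sg _ _] := tg.
  have := test_functionM (@open_box R _ _ _ _) (smooth_on_sub (@subsetT _ _) sg) t1.
  by congr test_function; apply/funext => x; rewrite /g1 mulrC.
rewrite add0r; apply: IH => // [y yl|x sx].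
  by apply: lO; rewrite inE yl orbT.
have sg : support g x.
  have H : support g2 `<=` support g.
    apply: support_sub; first exact: closed_support.
    by move=> y ny; rewrite /g2 (support_out ny) mulr0.
  exact: H.
have nI : ~ I z x.
  have cC : closed (~` I z) by apply: open_closedC; exact: ball_open.
  have H : support g2 `<=` ~` I z.
    apply: support_sub => // y /contrapT Iy.
    by rewrite /g2 bump2_eq1 // subrr mul0r.
  exact: H.
have [y] := cov x sg; rewrite inE => /orP[/eqP -> //|yl Iy]; by exists y.
Qed.

End localisation.

Section bounded_product.
Context {d : measure_display} {T : measurableType d} {R : realType}.
Variables (mu : {measure set T -> \bar R}) (D : set T).
Hypothesis mD : measurable D.
Implicit Types f h : T -> R.

Lemma intble_norm f : intble mu D f -> intble mu D (fun x => `|f x|).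
Proof. exact: integrable_abse. Qed.

Lemma intbleM (C : R) h f : measurable_fun D h -> (forall x, D x -> `|h x| <= C) -> intble mu D f ->
  intble mu D (fun x => h x * f x).
Proof.
move=> mh hC If; apply: (@intble_le _ _ _ mu D mD _ (fun x => C * `|f x|)).
- by apply: measurable_funM => //; exact: intble_measurable If.
- by move=> x Dx; rewrite normrM ler_wpM2r // hC.
- by apply: intbleZ => //; exact: intble_norm.
Qed.

Lemma RintD f h : intble mu D f -> intble mu D h ->
  \int[mu]_(x in D) (f x + h x) = \int[mu]_(x in D) f x + \int[mu]_(x in D) h x.
Proof. exact: RintegralD. Qed.

Lemma RintD_eq f h k : intble mu D f -> intble mu D h -> (forall x, D x -> k x = f x + h x) ->
  \int[mu]_(x in D) k x = \int[mu]_(x in D) f x + \int[mu]_(x in D) h x.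
Proof. by move=> If Ih E; rewrite -RintD //; exact: Rint_eq. Qed.

Lemma RintB f h : intble mu D f -> intble mu D h ->
  \int[mu]_(x in D) (f x - h x) = \int[mu]_(x in D) f x - \int[mu]_(x in D) h x.
Proof. exact: RintegralB. Qed.

Lemma RintZ (c : R) f : intble mu D f ->
  \int[mu]_(x in D) (c * f x) = c * \int[mu]_(x in D) f x.
Proof. by move=> If; rewrite RintegralZl. Qed.

End bounded_product.

Section chain_rule.
Context {R : realType}.
Local Notation plane := (R * R)%type.
Local Notation mplane := (measurableTypeR R * measurableTypeR R)%type.
Local Notation mR := (measurableTypeR R).
Local Notation leb := (@lebesgue_measure R).

Lemma intble_test (D : set mplane) (f : mplane -> R) (phi : plane -> R) : measurable D ->
  intble leb2 D f -> test_function setT phi -> intble leb2 D (fun x => f x * phi x).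
Proof.
move=> mD If tp; have [M M0 pM] := test_bounded tp.
have mp : measurable_fun D (phi : mplane -> R).
  by apply: (measurable_funS measurableT (@subsetT _ D)); exact: test_measurable tp.
have := intbleM mD mp (fun x _ => pM x) If.
by apply: intble_eq => // x _; rewrite mulrC.
Qed.

Lemma Rint_swap_box (a b c d : R) (f : mplane -> R) : intble leb2 (box a b c d) f ->
  intble leb2 (box c d a b) (fun x => f (swap x)) /\
  \int[leb2]_(x in box c d a b) f (swap x) = \int[leb2]_(x in box a b c d) f x.
Proof.
by move=> /(Rint_swap (@measurable_box R a b c d)); rewrite (@swap_box R a b c d).
Qed.

(** The second direction only needs the hypothesis specialised to products of test functions; the
    first direction is brought back to it by exchanging the coordinates. *)
Lemma chain_rule_box_dir (i : 'I_2) (a b c d : R) (V G : mplane -> R) (Z Z' : R -> R) (A M : R) :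
  a < b -> c < d -> intble leb2 (box a b c d) V -> intble leb2 (box a b c d) G ->
  intble leb2 (box a b c d) (fun x => G x ^+ 2) ->
  (forall psi, test_function (box a b c d) psi ->
    \int[leb2]_(x in box a b c d) (V x * 'D_(basis2 i) psi x) =
    - \int[leb2]_(x in box a b c d) (G x * psi x)) ->
  C11 Z Z' A -> (forall u, `|Z' u| <= M) -> (forall u v, `|Z v - Z u| <= M * `|v - u|) ->
  forall psi, test_function (box a b c d) psi ->
  \int[leb2]_(x in box a b c d) (Z (V x) * 'D_(basis2 i) psi x) =
  - \int[leb2]_(x in box a b c d) (Z' (V x) * G x * psi x).
Proof.
have weak_max (a' b' c' d' : R) (V' G' : mplane -> R) : (forall psi, test_function (box a' b' c' d') psi ->
    \int[leb2]_(x in box a' b' c' d') (V' x * 'D_(basis2 ord_max) psi x) =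
    - \int[leb2]_(x in box a' b' c' d') (G' x * psi x)) ->
    forall al be, test1 a' b' al -> test1 c' d' be ->
    \int[leb2]_(x in box a' b' c' d') (V' x * (al x.1 * 'D_1 be x.2)) =
    - \int[leb2]_(x in box a' b' c' d') (G' x * (al x.1 * be x.2)).
  move=> H al be ta tb; have tp := test_function_prod ta tb.
  rewrite -(H _ tp); apply: Rint_eq => // -[x y] _ /=; congr (_ * _).
  have /test_functionE[sp _ _] := tp.
  have dp : differentiable (fun x : plane => al x.1 * be x.2) (x, y).
    by apply: (smooth_on_diff sp).
  have [_ <-] := is_derive_slice2 dp.
  have [db _] : is_derive y (1 : R) be ('D_1 be y) by apply: smooth1_is_derive; case: tb.
  by rewrite /= (deriveZ (al x) db).
have [->|/ord2_max ->] := eqVneq i ord0; last first.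
  move=> ab cd IV IG IG2 /weak_max H cZ bZ lZ; exact: (chain_rule_box cd IV IG IG2 H cZ bZ lZ).
move=> ab cd IV IG IG2 H cZ bZ lZ psi tpsi.
have mB := @measurable_box R a b c d.
have [IV' _] := Rint_swap_box IV; have [IG' _] := Rint_swap_box IG.
have [IG2' _] := Rint_swap_box IG2.
have Dsw (f : plane -> R) (x : plane) : 'D_(basis2 ord0) (fun x => f (swap x)) x = 'D_(basis2 ord_max) f (swap x).
  by rewrite derive_swap; congr ('D_ _ _ _); rewrite basis2_0 basis2_max.
have tT (a' b' c' d' : R) (f : plane -> R) : test_function (box a' b' c' d') f -> test_function setT f.
  by apply: test_function_sub.
have H' : forall f, test_function (box c d a b) f ->
    \int[leb2]_(x in box c d a b) (V (swap x) * 'D_(basis2 ord_max) f x) =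
    - \int[leb2]_(x in box c d a b) (G (swap x) * f x).
  move=> f tf; have tfs := test_function_swap tf.
  have := H _ tfs.
  have I1 := intble_test mB IV (tT _ _ _ _ _ (test_function_D (basis2 ord0) tfs)).
  have I2 := intble_test mB IG (tT _ _ _ _ _ tfs).
  have [_ <-] := Rint_swap_box I1; have [_ <-] := Rint_swap_box I2.
  move=> E; transitivity (\int[leb2]_(x in box c d a b)
      (V (swap x) * 'D_(basis2 ord0) (fun x0 => f (swap x0)) (swap x))).
    by apply: Rint_eq => // -[x y] _; rewrite Dsw.
  by rewrite E; congr (- _); apply: Rint_eq => // -[x y] _.
have := chain_rule_box ab IV' IG' IG2' (weak_max _ _ _ _ _ _ H') cZ bZ lZ (test_function_swap tpsi).
have [cZc cZ'c] := C11_continuous cZ.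
have mV := intble_measurable IV; have mG := intble_measurable IG.
have mZV : measurable_fun (box a b c d) (fun x => Z (V x)).
  exact: (measurableT_comp (continuous_measurable_fun cZc) mV).
have mZ'V : measurable_fun (box a b c d) (fun x => Z' (V x)).
  exact: (measurableT_comp (continuous_measurable_fun cZ'c) mV).
have fB : (leb2 (box a b c d) < +oo)%E by rewrite leb2_box ?ltry // ltW.
have IZV : intble leb2 (box a b c d) (fun x => Z (V x)).
  apply: (@intble_le _ _ _ _ _ mB _ (fun x => `|Z 0| + M * `|V x|)) => //.
    move=> x _; have := lZ 0 (V x); rewrite subr0 => h.
    by have := ler_normD (Z 0) (Z (V x) - Z 0); rewrite addrC subrK => /le_trans; apply; rewrite lerD2l.
  apply: intbleD => //.
    have : sqint leb2 (box a b c d) (fun=> `|Z 0|).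
      apply: (@sqint_bounded _ _ _ _ _ mB `|Z 0|) => //.
      by move=> x _; rewrite normr_id.
    exact: sqint_intble.
  by apply: intbleZ => //; exact: intble_norm.
have IZG : intble leb2 (box a b c d) (fun x => Z' (V x) * G x).
  exact: (intbleM mB mZ'V (fun x _ => bZ (V x)) IG).
have I1 := intble_test mB IZV (tT _ _ _ _ _ (test_function_D (basis2 ord0) tpsi)).
have I2 := intble_test mB IZG (tT _ _ _ _ _ tpsi).
have [_ <-] := Rint_swap_box I1; have [_ <-] := Rint_swap_box I2.
move=> E; transitivity (\int[leb2]_(x in box c d a b)
    (Z (V (swap x)) * 'D_(basis2 ord_max) (fun x0 => psi (swap x0)) x)).
  by apply: Rint_eq => // -[x y] _; rewrite derive_swap basis2_0.
by rewrite E.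
Qed.

End chain_rule.

Section weak_calculus.
Context {R : realType}.
Local Notation plane := (R * R)%type.
Local Notation mplane := (measurableTypeR R * measurableTypeR R)%type.
Variable Omega : set plane.
Hypotheses (oO : open Omega) (fO : (leb2 (Omega : set mplane) < +oo)%E).
Local Notation mO := (measurable_open oO).
Implicit Types (v : mplane -> R) (phi : plane -> R).

Lemma sqint_test v phi : sqint leb2 Omega v -> test_function Omega phi ->
  intble leb2 Omega (fun x => v x * phi x).
Proof.
move=> sv tp; apply: (intble_test mO); first exact: (sqint_intble mO fO sv).
exact: (test_function_sub (@subsetT _ Omega) tp).
Qed.

Lemma weak_partialP (i : 'I_2) v w : weak_partial Omega [:: i] v w <->
  forall phi, test_function Omega phi ->
    \int[leb2]_(x in Omega) (v x * 'D_(basis2 i) phi x) = - \int[leb2]_(x in Omega) (w x * phi x).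
Proof.
split=> H phi tp; first by rewrite (H phi tp) /= expr1 mulN1r.
by rewrite /= expr1 mulN1r; exact: H.
Qed.

Lemma test_measurable_fun phi : test_function Omega phi -> measurable_fun (Omega : set mplane) phi.
Proof.
move=> /test_functionE[sp _ _]; apply: (smooth_on_measurable oO).
exact: (smooth_on_sub (@subsetT _ Omega) sp).
Qed.

(** The identity is additive in the test function, so [test_localize] reduces it to boxes inside
    [Omega]; this is where an arbitrary open set is dealt with. *)
Lemma weak_chain_rule (i : 'I_2) v w (Z Z' : R -> R) (A M : R) :
  sqint leb2 Omega v -> sqint leb2 Omega w -> weak_partial Omega [:: i] v w ->
  C11 Z Z' A -> (forall u, `|Z' u| <= M) -> (forall r s, `|Z s - Z r| <= M * `|s - r|) ->
  [/\ sqint leb2 Omega (fun x => Z (v x)), sqint leb2 Omega (fun x => Z' (v x) * w x) &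
    weak_partial Omega [:: i] (fun x => Z (v x)) (fun x => Z' (v x) * w x)].
Proof.
move=> sv sw /weak_partialP H cZ bZ lZ.
have [cZc cZ'c] := C11_continuous cZ.
have [mv _] := sv; have [mw _] := sw.
have mZV : measurable_fun (Omega : set mplane) (fun x => Z (v x)).
  exact: (measurableT_comp (continuous_measurable_fun cZc) mv).
have mZ'V : measurable_fun (Omega : set mplane) (fun x => Z' (v x)).
  exact: (measurableT_comp (continuous_measurable_fun cZ'c) mv).
have sZ0 : sqint leb2 (Omega : set mplane) (fun=> Z 0).
  by apply: (@sqint_bounded _ _ _ _ _ mO `|Z 0|).
have s1 : sqint leb2 Omega (fun x => Z (v x)).
  have : sqint leb2 Omega (fun x => Z 0 + (Z (v x) - Z 0)).
    apply: (sqintD mO) => //.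
    apply: (@sqint_le _ _ _ _ _ mO _ (fun x => M * v x)).
    - by apply: measurable_funB.
    - move=> x _; have := lZ 0 (v x); rewrite subr0 => /le_trans; apply.
      by rewrite normrM ler_wpM2r // ler_norm.
    - exact: (sqintZ mO).
  by apply: (sqint_eq mO) => x _; rewrite addrC subrK.
have s2 : sqint leb2 Omega (fun x => Z' (v x) * w x).
  exact: (sqintM mO mZ'V (fun x _ => bZ (v x)) sw).
split=> //; apply/weak_partialP => psi tpsi.
pose L f := \int[leb2]_(x in Omega) (Z (v x) * 'D_(basis2 i) f x)
  + \int[leb2]_(x in Omega) (Z' (v x) * w x * f x).
suff : L psi = 0 by rewrite /L => h; apply/eqP; rewrite -addr_eq0; apply/eqP.
apply: (test_localize oO _ _ tpsi) => [f g tf tg|a b c d ab cd BO f tf].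
  have I1 := sqint_test s1 (test_function_D (basis2 i) tf).
  have I2 := sqint_test s1 (test_function_D (basis2 i) tg).
  have I3 := sqint_test s2 tf; have I4 := sqint_test s2 tg.
  have E1 : \int[leb2]_(x in Omega) (Z (v x) * 'D_(basis2 i) (fun x => f x + g x) x) =
      \int[leb2]_(x in Omega) (Z (v x) * 'D_(basis2 i) f x) +
      \int[leb2]_(x in Omega) (Z (v x) * 'D_(basis2 i) g x).
    apply: (RintD_eq mO I1 I2) => x _; rewrite -mulrDr; congr (_ * _).
    have /test_functionE[sf _ _] := tf; have /test_functionE[sg _ _] := tg.
    have df : differentiable f x := smooth_on_diff sf I.
    have dg : differentiable g x := smooth_on_diff sg I.
    by rewrite -deriveD //; exact: diff_derivable.
  have E2 : \int[leb2]_(x in Omega) (Z' (v x) * w x * (f x + g x)) =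
      \int[leb2]_(x in Omega) (Z' (v x) * w x * f x) +
      \int[leb2]_(x in Omega) (Z' (v x) * w x * g x).
    by apply: (RintD_eq mO I3 I4) => x _; rewrite mulrDr.
  by rewrite /L E1 E2; exact: addrACA.
have mB := @measurable_box R a b c d.
have out (h : plane -> R) : test_function (box a b c d) h -> forall k : plane -> R,
    \int[leb2]_(x in Omega) (k x * h x) = \int[leb2]_(x in box a b c d) (k x * h x).
  move=> th k; apply: Rint_support => // x _ nB.
  by rewrite (test_out th nB) mulr0.
have Isub (h : mplane -> R) : intble leb2 Omega h -> intble leb2 (box a b c d) h.
  move=> Ih; exact: (integrableS mO mB BO Ih).
rewrite /L (out _ (test_function_D _ tf)) (out _ tf).
rewrite (chain_rule_box_dir ab cd (Isub _ (sqint_intble mO fO sv))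
  (Isub _ (sqint_intble mO fO sw)) (Isub _ (sqint_sq sw)) _ cZ bZ lZ tf) ?addNr //.
move=> h th; rewrite -(out _ (test_function_D _ th)) -(out _ th).
exact: H (test_function_sub BO th).
Qed.

Lemma weak_partial_linear (i : 'I_2) (c : R) v1 w1 v2 w2 : sqint leb2 Omega v1 -> sqint leb2 Omega w1 ->
  sqint leb2 Omega v2 -> sqint leb2 Omega w2 ->
  weak_partial Omega [:: i] v1 w1 -> weak_partial Omega [:: i] v2 w2 ->
  weak_partial Omega [:: i] (fun x => v1 x + c * v2 x) (fun x => w1 x + c * w2 x).
Proof.
move=> s1 t1 s2 t2 /weak_partialP H1 /weak_partialP H2; apply/weak_partialP => phi tp.
have E (f1 f2 h : mplane -> R) : intble leb2 Omega (fun x => f1 x * h x) ->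
    intble leb2 Omega (fun x => f2 x * h x) ->
    \int[leb2]_(x in Omega) ((f1 x + c * f2 x) * h x) =
    \int[leb2]_(x in Omega) (f1 x * h x) + c * \int[leb2]_(x in Omega) (f2 x * h x).
  move=> I1 I2; rewrite -(RintZ mO c I2).
  by apply: (RintD_eq mO I1 (intbleZ mO c I2)) => x _; ring.
have tD := test_function_D (basis2 i) tp.
rewrite (E _ _ _ (sqint_test s1 tD) (sqint_test s2 tD)) (E _ _ _ (sqint_test t1 tp) (sqint_test t2 tp)).
by rewrite (H1 _ tp) (H2 _ tp) opprD mulrN.
Qed.

Lemma weak_partial_eq (i : 'I_2) v w v' w' : {in Omega, v =1 v'} -> {in Omega, w =1 w'} ->
  weak_partial Omega [:: i] v w -> weak_partial Omega [:: i] v' w'.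
Proof.
move=> ev ew /weak_partialP H; apply/weak_partialP => phi tp.
transitivity (\int[leb2]_(x in Omega) (v x * 'D_(basis2 i) phi x)).
  by apply: Rint_eq => // x Ox; rewrite ev // inE.
by rewrite (H _ tp); congr (- _); apply: Rint_eq => // x Ox; rewrite ew // inE.
Qed.

(** The factor [chi] is absorbed by the test function, and the Leibniz rule is applied to that
    smooth product. *)
Lemma weak_partialM (i : 'I_2) v w (chi : plane -> R) : sqint leb2 Omega v -> sqint leb2 Omega w ->
  smooth_on Omega chi ->
  weak_partial Omega [:: i] v w ->
  weak_partial Omega [:: i] (fun x => chi x * v x) (fun x => chi x * w x + 'D_(basis2 i) chi x * v x).
Proof.
move=> sv sw sc /weak_partialP H; apply/weak_partialP => phi tp.
have tcp := test_functionM oO sc tp.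
have tc'p := test_functionM oO (smooth_on_D (basis2 i) sc) tp.
have tD := test_functionM oO sc (test_function_D (basis2 i) tp).
have := H _ tcp.
have -> : \int[leb2]_(x in Omega) (v x * 'D_(basis2 i) (fun x => chi x * phi x) x) =
    \int[leb2]_(x in Omega) (v x * (chi x * 'D_(basis2 i) phi x)) +
    \int[leb2]_(x in Omega) (v x * ('D_(basis2 i) chi x * phi x)).
  apply: (RintD_eq mO (sqint_test sv tD) (sqint_test sv tc'p)) => x Ox; rewrite derive_mul; last 2 first.
  - exact: smooth_on_diff sc Ox.
  - by have /test_functionE[sp _ _] := tp; exact: smooth_on_diff sp I.
  by rewrite -mulrDr; congr (_ * (_ + _)); rewrite mulrC.
move=> E.
have -> : \int[leb2]_(x in Omega) (chi x * v x * 'D_(basis2 i) phi x) =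
    \int[leb2]_(x in Omega) (v x * (chi x * 'D_(basis2 i) phi x)).
  by apply: Rint_eq => // x _; rewrite mulrA (mulrC (v x)).
have -> : \int[leb2]_(x in Omega) ((chi x * w x + 'D_(basis2 i) chi x * v x) * phi x) =
    \int[leb2]_(x in Omega) (w x * (chi x * phi x)) +
    \int[leb2]_(x in Omega) (v x * ('D_(basis2 i) chi x * phi x)).
  apply: (RintD_eq mO (sqint_test sw tcp) (sqint_test sv tc'p)) => x _; move: ('D_ _ _ _) => D; ring.
by move: E; move: (Rintegral _ _ _) (Rintegral _ _ _) (Rintegral _ _ _) => X Y W; lra.
Qed.

End weak_calculus.

(** * A truncation with a Lipschitz derivative *)

Section truncation.
Context {R : realType}.
Implicit Types (x y u v r s M : R).

(** With [d] the positive part of [x], this is the integral of 1 - (1 + s)^-2 over [0, d]: it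
    replaces the positive part by a function whose derivative vanishes at 0, and falls short of it
    by at most 1. *)
Definition excess x : R := let d := Num.max x 0 in d - 1 + (1 + d)^-1.
Definition excess' x : R := let d := Num.max x 0 in 1 - ((1 + d)^-1) ^+ 2.

Let maxP x : exists d p, [/\ (1 + Num.max x 0)^-1 = p, Num.max x 0 = d, 0 <= d, 0 < p <= 1 & p * (1 + d) = 1].
Proof.
exists (Num.max x 0), (1 + Num.max x 0)^-1.
have d0 : 0 <= Num.max x 0 by rewrite le_max lexx orbT.
have d1 : 0 < 1 + Num.max x 0 by lra.
split=> //; last by rewrite mulVf ?gt_eqF.
by rewrite invr_gt0 d1 /= invf_le1 //; lra.
Qed.

Lemma excess_le0 x : x <= 0 -> excess x = 0 /\ excess' x = 0.
Proof. by move=> x0; rewrite /excess /excess' /= max_r // addr0 invr1 expr1n; split; ring. Qed.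

Lemma excess_bounds x : 0 <= excess x <= Num.max x 0 /\ Num.max x 0 - 1 <= excess x.
Proof.
by rewrite /excess /=; have [d [p [-> -> d0 /andP[p0 p1] pd]]] := maxP x; split; nra.
Qed.

Lemma excess'_bounds x : 0 <= excess' x <= 1.
Proof.
rewrite /excess' /=; have [d [p [-> _ d0 /andP[p0 p1] pd]]] := maxP x.
have : 0 <= p ^+ 2 <= 1 by rewrite sqr_ge0 expr_le1 // ltW.
by move: (p ^+ 2) => q; lra.
Qed.

Lemma excess_C11 : C11 excess excess' 2.
Proof.
split=> [//|u v|u v]; rewrite /excess /excess' /=.
  have [d [p [-> hd d0 /andP[p0 p1] pd]]] := maxP u.
  have [e [q [-> he e0 /andP[q0 q1] qe]]] := maxP v.
  rewrite hd he.
  (* In terms of the positive parts [d] and [e] the remainder is exactly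
     [p ^+ 2 * q * (e - d) ^+ 2]. The four sign cases below then compare [d] and [e] with [u] and
     [v]. *)
  have main : `|e - 1 + q - (d - 1 + p) - (1 - p ^+ 2) * (e - d)| <= (e - d) ^+ 2.
    have -> : e - 1 + q - (d - 1 + p) - (1 - p ^+ 2) * (e - d) = p ^+ 2 * q * (e - d) ^+ 2.
      have pq : 0 < p * q by rewrite mulr_gt0.
      have E1 : d = p^-1 - 1 by apply: (mulfI (lt0r_neq0 p0)); rewrite mulrBr divff ?lt0r_neq0 //; lra.
      have E2 : e = q^-1 - 1 by apply: (mulfI (lt0r_neq0 q0)); rewrite mulrBr divff ?lt0r_neq0 //; lra.
      by rewrite E1 E2; field; rewrite !lt0r_neq0.
    have h : 0 <= p ^+ 2 * q <= 1.
      have p2 : 0 <= p ^+ 2 <= 1 by rewrite sqr_ge0 expr_le1 // ltW.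
      by move: (p ^+ 2) p2 => k kk; apply/andP; split; nra.
    case/andP: h => h0 h1; rewrite ger0_norm; last by rewrite mulr_ge0 // sqr_ge0.
    by rewrite ler_piMl // sqr_ge0.
  have hp : 0 <= 1 - p ^+ 2 <= 2 * d by nra.
  have [u0|u0] := lerP u 0; have [v0|v0] := lerP v 0.
  - move: hd he; rewrite !max_r // => ? ?; subst d e.
    have ? : p = 1 by lra. have ? : q = 1 by lra. subst p q.
    have -> : 0 - 1 + 1 - (0 - 1 + 1) - (1 - 1 ^+ 2) * (v - u) = 0 :> R by ring.
    by rewrite normr0 mulr_ge0 // sqr_ge0.
  - move: hd he; rewrite (max_r u0) (max_l (ltW v0)) => ? ?; subst d e.
    have ? : p = 1 by lra. subst p.
    move: main; have -> : 1 - 1 ^+ 2 = 0 :> R by ring.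
    rewrite !mul0r => /le_trans; apply; nra.
  - move: hd he; rewrite (max_l (ltW u0)) (max_r v0) => ? ?; subst d e.
    have ? : q = 1 by lra. subst q.
    rewrite ler_norml; move: (1 - p ^+ 2) hp => k hp; apply/andP; split; nra.
  - move: hd he; rewrite (max_l (ltW u0)) (max_l (ltW v0)) => ? ?; subst d e.
    by apply: le_trans main _; have := sqr_ge0 (v - u); lra.
have [d [p [-> hd d0 /andP[p0 p1] pd]]] := maxP u.
have [e [q [-> he e0 /andP[q0 q1] qe]]] := maxP v.
have ed : `|e - d| <= `|v - u|.
  rewrite -hd -he.
  have [u0|u0] := lerP u 0; have [v0|v0] := lerP v 0.
  - by rewrite subrr normr0.
  - by rewrite subr0 !ger0_norm; lra.
  - by rewrite sub0r normrN ger0_norm 1?ler0_norm; lra.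
  - by [].
have -> : 1 - q ^+ 2 - (1 - p ^+ 2) = (p * q * (p + q)) * (e - d).
  have E1 : d = p^-1 - 1 by apply: (mulfI (lt0r_neq0 p0)); rewrite mulrBr divff ?lt0r_neq0 //; lra.
  have E2 : e = q^-1 - 1 by apply: (mulfI (lt0r_neq0 q0)); rewrite mulrBr divff ?lt0r_neq0 //; lra.
  by rewrite E1 E2; field; rewrite !lt0r_neq0.
rewrite normrM; apply: ler_pM => //.
have pq1 : p * q <= 1 by rewrite mulr_ile1 // ltW.
have pq : 0 < p * q by rewrite mulr_gt0.
by rewrite ger0_norm; [nra|apply: mulr_ge0; lra].
Qed.

Lemma excess_lip u v : `|excess v - excess u| <= `|v - u|.
Proof.
rewrite /excess /=.
have [d [p [-> hd d0 /andP[p0 p1] pd]]] := maxP u.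
have [e [q [-> he e0 /andP[q0 q1] qe]]] := maxP v.
have ed : `|e - d| <= `|v - u|.
  rewrite -hd -he.
  have [u0|u0] := lerP u 0; have [v0|v0] := lerP v 0.
  - by rewrite subrr normr0.
  - by rewrite subr0 !ger0_norm; lra.
  - by rewrite sub0r normrN ger0_norm 1?ler0_norm; lra.
  - by [].
apply: le_trans ed; rewrite hd he.
have -> : e - 1 + q - (d - 1 + p) = (1 - p * q) * (e - d).
  have E1 : d = p^-1 - 1 by apply: (mulfI (lt0r_neq0 p0)); rewrite mulrBr divff ?lt0r_neq0 //; lra.
  have E2 : e = q^-1 - 1 by apply: (mulfI (lt0r_neq0 q0)); rewrite mulrBr divff ?lt0r_neq0 //; lra.
  by rewrite E1 E2; field; rewrite !lt0r_neq0.
have pq1 : p * q <= 1 by rewrite mulr_ile1 // ltW.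
have pq : 0 < p * q by rewrite mulr_gt0.
by rewrite normrM ler_piMl // ler_norml; lra.
Qed.

(* A C^{1,1} version of the truncation of [r] at the levels [M] and [- M]. *)
Definition trunc M r : R := r - excess (r - M) + excess (- r - M).
Definition trunc' M r : R := 1 - excess' (r - M) - excess' (- r - M).

Lemma trunc_C11 M : C11 (trunc M) (trunc' M) 4.
Proof.
have [_ H1 H2] := excess_C11; split=> [//|u v|u v]; rewrite /trunc /trunc'.
  have := H1 (u - M) (v - M); have := H1 (- u - M) (- v - M).
  have -> : v - M - (u - M) = v - u by ring.
  have -> : - v - M - (- u - M) = - (v - u) by ring.
  rewrite sqrrN; move: (excess _) (excess _) (excess _) (excess _) (excess' _) (excess' _).
  move=> a b c d e f; move: ((v - u) ^+ 2) => w2 h1 h2.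
  set X := (X in `|X| <= _).
  have -> : X = (d - c - f * - (v - u)) - (b - a - e * (v - u)) by rewrite /X; ring.
  by apply: le_trans (ler_normB _ _) _; lra.
have := H2 (u - M) (v - M); have := H2 (- u - M) (- v - M).
have -> : v - M - (u - M) = v - u by ring.
have -> : - v - M - (- u - M) = - (v - u) by ring.
rewrite normrN; move: (excess' _) (excess' _) (excess' _) (excess' _) => a b c d.
move: `|v - u| => w h1 h2.
set X := (X in `|X| <= _).
have -> : X = (a - b) - (d - c) by rewrite /X; ring.
by apply: le_trans (ler_normB _ _) _; rewrite distrC; lra.
Qed.

Lemma trunc_lip M u v : `|trunc M v - trunc M u| <= 3 * `|v - u|.
Proof.
rewrite /trunc; have := excess_lip (u - M) (v - M); have := excess_lip (- u - M) (- v - M).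
have -> : v - M - (u - M) = v - u by ring.
have -> : - v - M - (- u - M) = - (v - u) by ring.
rewrite normrN; have := ler_norm (v - u); have := ler_norm (- (v - u)); rewrite normrN.
by move: `|v - u| => w; rewrite !ler_norml; lra.
Qed.

Lemma trunc'_bounds M u : 0 <= M -> `|trunc' M u| <= 1.
Proof.
move=> M0; rewrite /trunc'; have := excess'_bounds (u - M); have := excess'_bounds (- u - M).
have [u0|u0] := lerP u 0.
  have [_ ->] : excess (u - M) = 0 /\ excess' (u - M) = 0 by apply: excess_le0; lra.
  by rewrite ler_norml; lra.
have [_ ->] : excess (- u - M) = 0 /\ excess' (- u - M) = 0 by apply: excess_le0; lra.
by rewrite ler_norml; lra.
Qed.

Lemma trunc_bounded M u : 0 <= M -> `|trunc M u| <= M + 1.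
Proof.
move=> M0; rewrite /trunc; have := excess_bounds (u - M); have := excess_bounds (- u - M).
have [u0|u0] := lerP u 0.
  have [-> _] : excess (u - M) = 0 /\ excess' (u - M) = 0 by apply: excess_le0; lra.
  move=> [+ +] _; rewrite ler_norml; case: (lerP (- u - M) 0); lra.
have [-> _] : excess (- u - M) = 0 /\ excess' (- u - M) = 0 by apply: excess_le0; lra.
move=> _ [+ +]; rewrite ler_norml; case: (lerP (u - M) 0); lra.
Qed.

(** What is cut off from [u] is at most the distance of [u] to [-M, M], hence at most its distance
    to any [s] of that interval. In the application [s] is the value on a selected line. *)
Lemma trunc_error M u s : `|s| <= M -> `|u - trunc M u| <= `|u - s|.
Proof.
rewrite ler_norml => sM; rewrite /trunc.
have -> : u - (u - excess (u - M) + excess (- u - M)) = excess (u - M) - excess (- u - M) by ring.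
have [h1 h1'] := excess_bounds (u - M); have [h2 h2'] := excess_bounds (- u - M).
have l1 := ler_norm (u - s); have l2 := ler_norm (- (u - s)); rewrite normrN in l2.
have l3 := normr_ge0 (u - s).
move: `|u - s| l1 l2 l3 => w l1 l2 l3.
rewrite ler_norml; move: h1 h2.
by case: (lerP (u - M) 0); case: (lerP (- u - M) 0); lra.
Qed.

End truncation.

Lemma le_Rint_ae {d : measure_display} {T : measurableType d} {R : realType}
    (mu : {measure set T -> \bar R}) (D : set T) (f g : T -> R) : measurable D ->
  intble mu D f -> intble mu D g -> (\forall x \ae mu, D x -> f x <= g x) ->
  \int[mu]_(x in D) f x <= \int[mu]_(x in D) g x.
Proof.
move=> mD If Ig fg; have mf := intble_measurable If; have mg := intble_measurable Ig.
have mh : measurable_fun D (fun x => Num.max (f x) (g x)) by exact: measurable_maxr.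
have E : \forall x \ae mu, D x -> Num.max (f x) (g x) = g x.
  by apply: aeS fg => x h Dx; rewrite max_r // h.
rewrite -(Rint_ae_eq mD mh mg E); apply: le_Rintegral => //; first exact: (intble_ae mD mh E Ig).
by move=> x _; rewrite le_max lexx.
Qed.

Lemma Rint_ge0 {d : measure_display} {T : measurableType d} {R : realType}
  (mu : {measure set T -> \bar R}) (D : set T) (f : T -> R) :
  (forall x, D x -> 0 <= f x) -> 0 <= \int[mu]_(x in D) f x.
Proof. by move=> f0; apply: Rintegral_ge0. Qed.

Lemma le_Rint_sub {d : measure_display} {T : measurableType d} {R : realType}
    (mu : {measure set T -> \bar R}) (A B : set T) (f : T -> R) : measurable A -> measurable B ->
  A `<=` B -> (forall x, B x -> 0 <= f x) -> intble mu B f ->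
  \int[mu]_(x in A) f x <= \int[mu]_(x in B) f x.
Proof.
move=> mA mB AB f0 IB; have IA : intble mu A f by exact: (integrableS mB mA AB IB).
rewrite -lee_fin (EFin_Rintegral mA IA) (EFin_Rintegral mB IB).
apply: ge0_subset_integral => //.
by apply/measurable_EFinP; exact: intble_measurable IB.
Qed.

(** * Hoelder estimates and the selection of good lines *)

Section cumul_estimates.
Context {R : realType}.
Local Notation plane := (R * R)%type.
Local Notation mplane := (measurableTypeR R * measurableTypeR R)%type.
Local Notation mR := (measurableTypeR R).
Local Notation leb := (@lebesgue_measure R).
Implicit Types (f g : R -> R) (p q t x y K : R).

Lemma cumul_mono f x y : intble leb setT f -> (forall s, 0 <= f s) -> x <= y -> cumul f x <= cumul f y.
Proof. by move=> If f0 xy; rewrite -subr_ge0 cumulB //; apply: Rint_ge0. Qed.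

Lemma cumul_total f y : intble leb setT f -> (forall s, 0 <= f s) -> 0 <= cumul f y <= \int[leb]_s f s.
Proof.
move=> If f0; rewrite /cumul Rint_ge0 //=.
have := cumul_le y If; rewrite ger0_norm; last exact: Rint_ge0.
by under eq_Rintegral do rewrite ger0_norm //.
Qed.

Lemma cumul_holder g (l r x y : R) : intble leb setT g -> intble leb setT (fun s => g s ^+ 2) ->
  l <= x <= r -> l <= y <= r ->
  (cumul g y - cumul g x) ^+ 2 <=
  `|y - x| * (cumul (fun s => g s ^+ 2) r - cumul (fun s => g s ^+ 2) l).
Proof.
move=> Ig Ig2.
have main (u v : R) : l <= u -> v <= r -> u <= v -> (cumul g v - cumul g u) ^+ 2 <=
    (v - u) * (cumul (fun s => g s ^+ 2) r - cumul (fun s => g s ^+ 2) l).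
  move=> lu vr uv; have [g2 m1 m2] : [/\ forall s : R, 0 <= g s ^+ 2,
      cumul (fun s => g s ^+ 2) l <= cumul (fun s => g s ^+ 2) u &
      cumul (fun s => g s ^+ 2) v <= cumul (fun s => g s ^+ 2) r].
    by have g2 (s : R) : 0 <= g s ^+ 2; [exact: sqr_ge0|split=> //; exact: cumul_mono].
  apply: le_trans (_ : (v - u) * (cumul (fun s => g s ^+ 2) v - cumul (fun s => g s ^+ 2) u) <= _); last first.
    by rewrite ler_wpM2l ?subr_ge0 //; lra.
  apply: le_trans (cauchy_schwarz_Ioc uv Ig Ig2).
  rewrite cumulB // -(real_normK (num_real (\int[leb]_(s in `]u, v]) g s))).
  rewrite ler_sqr ?nnegrE ?normr_ge0 //; last exact: Rint_ge0.
  apply: le_normr_Rintegral; first exact: measurable_itv.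
  by apply: (integrableS measurableT _ _ Ig) => //; exact: measurable_itv.
move=> /andP[lx xr] /andP[ly yr]; have [xy|xy] := lerP x y.
  exact: main.
by rewrite -sqrrN opprB; apply: main => //; exact: ltW.
Qed.

(** If no point worked, [f] would be at least [2 * K / (q - p)] almost everywhere on the interval
    and its integral at least [2 * K]; the factor 2 makes this exceed [K]. *)
Lemma chebyshev_slice (P : R -> Prop) f p q K : p < q -> 0 < K -> intble leb setT f ->
  (forall s, 0 <= f s) -> \int[leb]_s f s <= K -> (\forall s \ae leb, P s) ->
  exists t, [/\ p < t < q, P t & f t <= 2 * K / (q - p)].
Proof.
move=> pq K0 If f0 fK aP; apply: contrapT => nex.
have qp : 0 < q - p by rewrite subr_gt0.
have h : \forall s \ae leb, `]p, q[%classic s -> 2 * K / (q - p) <= f s.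
  apply: aeS aP => s Ps /=; rewrite in_itv /= => spq; rewrite leNgt; apply/negP => hs.
  by apply: nex; exists s; split=> //; exact: ltW.
have mI : measurable (`]p, q[%classic : set mR) by exact: measurable_itv.
have lI : leb (`]p, q[%classic : set mR) = (q - p)%:E by exact: (leb_oo (ltW pq)).
have fI : (leb (`]p, q[%classic : set mR) < +oo)%E by rewrite lI ltry.
have Ic : intble leb `]p, q[%classic (fun=> 2 * K / (q - p)).
  apply: (sqint_intble mI fI).
  exact: (@sqint_bounded _ _ _ _ _ mI `|2 * K / (q - p)|).
have If' : intble leb `]p, q[%classic f by exact: (integrableS measurableT mI (@subsetT _ _) If).
have := le_Rint_ae mI Ic If' h.
have -> : \int[leb]_(s in `]p, q[) (2 * K / (q - p)) = 2 * K.
  rewrite Rintegral_cst // (_ : fine _ = q - p); last exact: (congr1 fine lI).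
  by rewrite -mulrA mulVf ?mulr1 // gt_eqF.
have := le_Rint_sub mI measurableT (@subsetT _ _) (fun s _ => f0 s) If.
move: (Rintegral _ _ _) (Rintegral _ _ _) fK => x y; lra.
Qed.

(** By dominated convergence the mass of [f] in a shrinking interval around [t] tends to 0: the
    integrands tend to 0 except at the single point [t]. *)
Lemma cumul_small f t (e h0 : R) : intble leb setT f -> (forall s, 0 <= f s) -> 0 < e -> 0 < h0 ->
  exists h, 0 < h < h0 /\ cumul f (t + h) - cumul f (t - h) <= e.
Proof.
move=> If f0 e0 h00.
pose h (n : nat) : R := n.+1%:R^-1.
have hh n : 0 < h n by rewrite invr_gt0 ltr0n.
have h_cvg : h n @[n --> \oo] --> (0 : R) by exact: cvg_harmonic.
pose F n s := f s * half s (t + h n) - f s * half s (t - h n).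
have If_half y : intble leb setT (fun s => f s * half s y) by exact: half_mul_intble.
have mF n : measurable_fun (setT : set mR) (F n).
  exact: (intble_measurable (intbleB measurableT (If_half _) (If_half _))).
have cF s : setT s -> F n s @[n --> \oo] --> (if s == t then f s else 0).
  move=> _; case: (ltgtP s t) => st.
  - apply: cvg_near_cst; have hs : 0 < t - s by rewrite subr_gt0.
    have [N _ HN] := cvgr_lt 0 h_cvg _ hs; exists N => // n /HN /= hn; rewrite /F /half !ifT ?subrr //; have := hh n; lra.
  - apply: cvg_near_cst; have hs : 0 < s - t by rewrite subr_gt0.
    have [N _ HN] := cvgr_lt 0 h_cvg _ hs; exists N => // n /HN /= hn; rewrite /F /half !ifF ?subrr //; have := hh n; lra.
  - rewrite (_ : (fun n => F n s) = (fun=> f s)); first exact: cvg_cst.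
    apply/funext => n; have := hh n; rewrite /F /half st => hn.
    by rewrite ifT ?ifF ?mulr1 ?mulr0 ?subr0 //; lra.
have bF n s : setT s -> `|F n s| <= f s.
  move=> _; rewrite /F -mulrBr normrM ger0_norm // ler_piMr //.
  have := half_ge0 s (t + h n); have := half_ge0 s (t - h n).
  by have := half_le1 s (t + h n); have := half_le1 s (t - h n); rewrite ler_norml; lra.
have [Il C] := Rint_cvg measurableT mF cF If bF.
have E0 : \int[leb]_s (if s == t then f s else 0) = 0.
  rewrite (@Rint_ae_eq _ _ _ leb setT measurableT _ (fun=> 0)); first exact: Rint0.
  - exact: intble_measurable Il.
  - exact: measurable_cst.
  - exists [set t]; split; [exact: measurable_set1|exact: lebesgue_measure_set1|].
    by move=> s /=; apply: contra_notP => st _; case: eqP.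
rewrite E0 in C.
have [N1 _ HN1] := cvgr_lt 0 h_cvg _ h00; have [N2 _ HN2] := cvgr_lt 0 C _ e0.
pose N := maxn N1 N2; have H1 : h N < h0 by apply: HN1; exact: leq_maxl.
have H2 := HN2 N (leq_maxr N1 N2).
exists (h N); rewrite hh H1; split=> //; apply: le_trans (ltW H2).
by rewrite /F !cumulE RintB.
Qed.

Lemma Rint_box_snd (k : R -> R) (p q c d : R) : p <= q -> intble leb setT k -> (forall s, 0 <= k s) ->
  intble leb2 (box p q c d) (fun x : mplane => k x.2) /\
  \int[leb2]_(x in box p q c d) (k x.2) <= (q - p) * \int[leb]_s k s.
Proof.
move=> pq Ik k0.
pose J : set mR := `]p, q[%classic; pose i : mR -> R := \1_J.
have mJ : measurable J by exact: measurable_itv.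
have lJ : leb J = (q - p)%:E by exact: (leb_oo pq).
have iJ x : J x -> i x = 1 by move=> Jx; rewrite /i indicE mem_set.
have i0 x : 0 <= i x by rewrite /i indicE.
have iN x : setT x -> ~ J x -> i x = 0 by move=> _ Jx; rewrite /i indicE memNset.
have IJ : intble leb J i.
  apply: (intble_eq mJ (f := fun=> 1)); first by move=> x /iJ ->.
  have fJ : (leb J < +oo)%E by rewrite lJ ltry.
  apply: (sqint_intble mJ fJ); apply: (@sqint_bounded _ _ _ _ _ mJ 1) => //.
  by move=> *; rewrite normr1.
have I1 : intble leb setT i by rewrite -(@intble_support _ _ _ leb J setT i mJ measurableT (@subsetT _ J) iN).
have V1 : \int[leb]_x i x = q - p.
  rewrite (@Rint_support _ _ _ leb J setT i (@subsetT _ J) iN).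
  rewrite (Rint_eq _ (f := i) (g := fun=> 1)); last by move=> x /iJ ->.
  by rewrite Rintegral_cst // mul1r; exact: (congr1 fine lJ).
have I12 := intble_prod I1 Ik.
have mB := @measurable_box R p q c d.
have f0 (x : mplane) : setT x -> 0 <= i x.1 * k x.2 by move=> _; rewrite mulr_ge0.
have E (x : mplane) : box p q c d x -> i x.1 * k x.2 = k x.2.
  by case=> x1 _; rewrite iJ ?mul1r //= /J /= in_itv.
have IB : intble leb2 (box p q c d) (fun x : mplane => k x.2).
  apply: (intble_eq mB E); exact: (integrableS measurableT mB (@subsetT _ _) I12).
split=> //; have := le_Rint_sub mB measurableT (@subsetT _ _) f0 I12.
rewrite (Rint_eq _ E); move/le_trans; apply.
have [_ ->] := Rint_fubini I12.
rewrite le_eqVlt; apply/orP; left; apply/eqP.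
transitivity (\int[leb]_x ((\int[leb]_s k s) * i x)).
  by apply: Rint_eq => x _ /=; rewrite RintZ // mulrC.
by rewrite RintZ // mulrC V1.
Qed.

End cumul_estimates.

Section slices.
Context {R : realType}.
Local Notation plane := (R * R)%type.
Local Notation mplane := (measurableTypeR R * measurableTypeR R)%type.
Local Notation mR := (measurableTypeR R).
Local Notation leb := (@lebesgue_measure R).

Lemma ae_swap (P : plane -> Prop) : (\forall z \ae leb2, P z) -> \forall z \ae leb2, P (swap z).
Proof.
move=> [N [mN N0 NP]]; exists (swap @^-1` N); split; last by move=> z; exact: NP.
  by rewrite -[X in measurable X]setTI; exact: measurable_swap.
by rewrite [LHS]leb2_swap.
Qed.

Lemma Rint_fubini_swap (F : mplane -> R) : intble leb2 setT F ->
  intble leb setT (fun y : mR => \int[leb]_x F (x, y)) /\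
  \int[leb2]_x F x = \int[leb]_y \int[leb]_x F (x, y).
Proof.
move=> IF; have [IS E] := Rint_swap measurableT IF.
have [I1 E1] := Rint_fubini IS.
by split=> //; rewrite -E1 -E.
Qed.

Lemma ae_slice_intble_swap (F : mplane -> R) : intble leb2 setT F ->
  \forall y \ae leb, intble leb setT (fun x => F (x, y)).
Proof. by move=> IF; have [IS _] := Rint_swap measurableT IF; exact: ae_slice_intble IS. Qed.

Lemma patch_swap (a b c d : R) (G : plane -> R) (x : plane) :
  ((fun x => G (swap x)) \_ (box c d a b)) x = (G \_ (box a b c d)) (swap x).
Proof.
have [bx|nx] := pselect (box c d a b x).
  by rewrite !patch_in //; case: bx.
by rewrite !patch_box // => -[h1 h2]; apply: nx.
Qed.

Lemma weak_dx_vprim (a b c d : R) (V G : mplane -> R) : a < b ->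
  intble leb2 (box a b c d) V -> intble leb2 (box a b c d) G ->
  (forall al be, test1 a b al -> test1 c d be ->
    \int[leb2]_(x in box a b c d) (V x * ('D_1 al x.1 * be x.2)) =
    - \int[leb2]_(x in box a b c d) (G x * (al x.1 * be x.2))) ->
  exists C : R -> R, \forall x \ae leb2, box a b c d x ->
    V x = C x.2 + cumul (fun s => (G \_ (box a b c d)) (s, x.2)) x.1.
Proof.
move=> ab IV IG H; have mB := @measurable_box R a b c d.
have [IV' _] := Rint_swap_box IV; have [IG' _] := Rint_swap_box IG.
have tT al be : test1 a b al -> test1 c d be -> test_function setT (fun x : plane => al x.1 * be x.2).
  by move=> ta tb; apply: test_function_sub (test_function_prod ta tb).
have [be al tb ta|C HC] := weak_dy_vprim ab IV' IG' _.
  have I1 := intble_test mB IV (tT _ _ (test1_D ta) tb).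
  have I2 := intble_test mB IG (tT _ _ ta tb).
  have [_ E1] := Rint_swap_box I1; have [_ E2] := Rint_swap_box I2.
  have := H _ _ ta tb; rewrite -E1 -E2 => E.
  transitivity (\int[leb2]_(x in box c d a b)
      (V (swap x) * ('D_1 al (swap x).1 * be (swap x).2))).
    by apply: Rint_eq => x _; rewrite (mulrC (be _)).
  by rewrite E; congr (- _); apply: Rint_eq => x _; rewrite (mulrC (be _)).
exists C; have := ae_swap HC; apply: aeS => -[s y] h bx.
have /h : box c d a b (swap (s, y)) by case: bx.
rewrite /= => ->; congr (_ + _); rewrite /vprim /=; congr cumul.
by apply/funext => r; rewrite patch_swap.
Qed.

Lemma norm_le_1sqr (x : R) : `|x| <= 1 + x ^+ 2.
Proof. by have := sqr_ge0 (`|x| - 1); rewrite -(real_normK (num_real x)); have := normr_ge0 x; nra. Qed.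

Lemma cumul_holder_total (g : R -> R) (x y l : R) : intble leb setT g ->
  intble leb setT (fun s => g s ^+ 2) -> `|y - x| <= l ->
  (cumul g y - cumul g x) ^+ 2 <= l * \int[leb]_s (g s ^+ 2).
Proof.
move=> Ig Ig2 yx; have g2 (s : R) : 0 <= g s ^+ 2 by exact: sqr_ge0.
have hx : Num.min x y <= x <= Num.max x y by rewrite ge_min le_max lexx.
have hy : Num.min x y <= y <= Num.max x y by rewrite ge_min le_max lexx !orbT.
apply: le_trans (cumul_holder Ig Ig2 hx hy) _.
have /andP[h1 _] := cumul_total (Num.min x y) Ig2 g2.
have /andP[_ h2] := cumul_total (Num.max x y) Ig2 g2.
have h3 := cumul_mono Ig2 g2 (le_trans (andP hx).1 (andP hx).2).
by apply: ler_pM => //; lra.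
Qed.

(** The Chebyshev inequality selects two vertical lines and a horizontal one that carry a controlled
    energy. On them [V] is Hoelder continuous, so it stays within a bound [M] of [m] on both
    vertical lines, with [M] determined by the box and [K]. The second conclusion is a trace
    estimate without traces: the part of [V - m] beyond the truncation is small near these lines. *)
Lemma slices (a b c d a' b' K : R) : a < a' -> a' < b' -> b' < b -> c < d -> 0 < K ->
  exists M, 0 <= M /\ forall V G H : mplane -> R,
  sqint leb2 (box a b c d) V -> sqint leb2 (box a b c d) G -> sqint leb2 (box a b c d) H ->
  (forall al be, test1 a b al -> test1 c d be ->
    \int[leb2]_(x in box a b c d) (V x * ('D_1 al x.1 * be x.2)) =
    - \int[leb2]_(x in box a b c d) (G x * (al x.1 * be x.2))) ->
  (forall al be, test1 a b al -> test1 c d be ->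
    \int[leb2]_(x in box a b c d) (V x * (al x.1 * 'D_1 be x.2)) =
    - \int[leb2]_(x in box a b c d) (H x * (al x.1 * be x.2))) ->
  nrm2 leb2 (box a b c d) G <= K -> nrm2 leb2 (box a b c d) H <= K ->
  exists m t1 t2 : R, [/\ a < t1 < a', b' < t2 < b,
    nrm2 leb2 (box a b c d) (fun x => V x - m) <= M &
    forall t, t = t1 \/ t = t2 -> forall e h0, 0 < e -> 0 < h0 -> exists h, 0 < h < h0 /\
      nrm2 leb2 (box (t - h) (t + h) c d) (fun x => V x - m - trunc M (V x - m)) <= e * h ^+ 2].
Proof.
move=> aa' ab' bb' cd K0; have ab : a < b by lra.
set Q := box a b c d; have mQ : measurable (Q : set mplane) by exact: measurable_box.
have lQ : leb2 (Q : set mplane) = ((b - a) * (d - c))%:E by apply: leb2_box; exact: ltW.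
have fQ : (leb2 (Q : set mplane) < +oo)%E by rewrite lQ ltry.
(* [A1] and [A2] bound the squared oscillations on the two vertical lines and [B] the one on the
   horizontal line; [D1 + D2] will bound the squared norm of [V - m]. *)
pose A1 := (d - c) * (2 * K / (a' - a)); pose A2 := (d - c) * (2 * K / (b - b')).
pose B := (b - a) * (2 * K / (d - c)).
have A10 : 0 <= A1 by rewrite /A1 !mulr_ge0 ?invr_ge0 //; lra.
have A20 : 0 <= A2 by rewrite /A2 !mulr_ge0 ?invr_ge0 //; lra.
have B0 : 0 <= B by rewrite /B !mulr_ge0 ?invr_ge0 //; lra.
pose D1 := 2 * ((b - a) * ((b - a) * K)); pose D2 := 2 * A1 * ((b - a) * (d - c)).
have D10 : 0 <= D1 by rewrite /D1 !mulr_ge0 //; lra.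
have D20 : 0 <= D2 by rewrite /D2; apply: mulr_ge0; [lra|apply: mulr_ge0; lra].
exists (2 + A1 + A2 + B + D1 + D2); set M := _ + D2.
have M0 : 0 <= M by rewrite /M; lra.
split=> // V G H sV sG sH W1 W2 GK HK.
have IV := sqint_intble mQ fQ sV; have IG := sqint_intble mQ fQ sG; have IH := sqint_intble mQ fQ sH.
pose Gp := G \_ Q; pose Hp := H \_ Q.
have IGp : intble leb2 setT Gp by exact: intble_patch_box.
have IHp : intble leb2 setT Hp by exact: intble_patch_box.
have sq_patch (F : mplane -> R) : sqint leb2 Q F -> intble leb2 setT (fun x => (F \_ Q) x ^+ 2) /\
    \int[leb2]_x ((F \_ Q) x ^+ 2) = nrm2 leb2 Q F.
  move=> sF; have F0 x : ~ box a b c d x -> (F \_ Q) x ^+ 2 = 0.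
    by move=> nx; rewrite patch_box // expr0n.
  have E x : Q x -> F x ^+ 2 = (F \_ Q) x ^+ 2 by move=> Qx; rewrite patch_in.
  split; first by apply/(intble_box F0); apply: (intble_eq mQ E); exact: sqint_sq.
  by rewrite -(Rint_box F0) /nrm2; apply/esym/Rint_eq.
have [IG2 EG2] := sq_patch _ sG; have [IH2 EH2] := sq_patch _ sH.
rewrite -/Gp -/Hp in IG2 EG2 IH2 EH2.
have [C rep1] := weak_dx_vprim ab IV IG W1; have [C' rep2] := weak_dy_vprim cd IV IH W2.
rewrite -/Q -/Gp -/Hp in rep1 rep2.
pose fH t := \int[leb]_y (Hp (t, y) ^+ 2).
pose fG y := \int[leb]_s (Gp (s, y) ^+ 2).
pose gG s := \int[leb]_y (Gp (s, y) ^+ 2).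
have [IfH EfH] := Rint_fubini IH2; have [IfG EfG] := Rint_fubini_swap IG2.
have [IgG EgG] := Rint_fubini IG2.
rewrite -/fH -/fG -/gG in IfH EfH IfG EfG IgG EgG.
have fH0 s : 0 <= fH s by apply: Rint_ge0 => y _; exact: sqr_ge0.
have fG0 s : 0 <= fG s by apply: Rint_ge0 => y _; exact: sqr_ge0.
have gG0 s : 0 <= gG s by apply: Rint_ge0 => y _; exact: sqr_ge0.
have fHK : \int[leb]_s fH s <= K by rewrite -EfH EH2.
have fGK : \int[leb]_s fG s <= K by rewrite -EfG EG2.
pose P1 (z : plane) := Q z -> V z = C z.2 + cumul (fun s => Gp (s, z.2)) z.1.
pose P2 (z : plane) := Q z -> V z = C' z.1 + cumul (fun s => Hp (z.1, s)) z.2.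
pose PT t := (\forall y \ae leb, P1 (t, y) /\ P2 (t, y)) /\
  (intble leb setT (fun y => Hp (t, y)) /\ intble leb setT (fun y => Hp (t, y) ^+ 2)).
have aPT : \forall t \ae leb, PT t.
  have rep12 : \forall z \ae leb2, P1 z /\ P2 z by exact: aeI rep1 rep2.
  apply: aeI (ae_slices rep12) _.
  exact: aeI (ae_slice_intble IHp) (ae_slice_intble IH2).
have [t1 [/andP[at1 ta1] [PV1 [IH1 IH12]] fHt1]] := chebyshev_slice aa' K0 IfH fH0 fHK aPT.
have [t2 [/andP[bt2 tb2] [PV2 [IHt2 IHt22]] fHt2]] := chebyshev_slice bb' K0 IfH fH0 fHK aPT.
have aPY : \forall y \ae leb, ((P1 (t1, y) /\ P2 (t1, y)) /\ (P1 (t2, y) /\ P2 (t2, y))) /\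
    (intble leb setT (fun s => Gp (s, y)) /\ intble leb setT (fun s => Gp (s, y) ^+ 2)).
  exact: aeI (aeI PV1 PV2) (aeI (ae_slice_intble_swap IGp) (ae_slice_intble_swap IG2)).
have [y0 [y0cd [[[p11 p12] [p21 p22]] [Iy0 Iy02]] fy0]] := chebyshev_slice cd K0 IfG fG0 fGK aPY.
have Qt1 y : c < y < d -> Q (t1, y).
  by move=> ?; split=> //=; move: at1 ta1 aa' ab' bb'; clear; lra.
have Qt2 y : c < y < d -> Q (t2, y).
  by move=> ?; split=> //=; move: bt2 tb2 aa' ab' bb'; clear; lra.
have [db_a db_c] : 0 <= b - a /\ 0 <= d - c by move: ab cd; clear; lra.
(* All representations are valid at the two crossings with the line [y0], which connects the values
   on [t1] with those on [t2]. *)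
pose m := V (t1, y0).
have S1 y : P2 (t1, y) -> c < y < d -> (V (t1, y) - m) ^+ 2 <= A1.
  move=> p2 ycd; pose hh s := Hp (t1, s).
  have -> : V (t1, y) - m = cumul hh y - cumul hh y0.
    by rewrite /m (p2 (Qt1 _ ycd)) (p12 (Qt1 _ y0cd)) /=; ring.
  have h : `|y - y0| <= d - c by move: ycd y0cd; clear; rewrite ler_norml; lra.
  apply: le_trans (cumul_holder_total IH1 IH12 h) _.
  by rewrite /A1 ler_wpM2l.
have S2 y : P2 (t2, y) -> c < y < d -> (V (t2, y) - V (t2, y0)) ^+ 2 <= A2.
  move=> p2 ycd; pose hh s := Hp (t2, s).
  have -> : V (t2, y) - V (t2, y0) = cumul hh y - cumul hh y0.
    by rewrite (p2 (Qt2 _ ycd)) (p22 (Qt2 _ y0cd)) /=; ring.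
  have h : `|y - y0| <= d - c by move: ycd y0cd; clear; rewrite ler_norml; lra.
  apply: le_trans (cumul_holder_total IHt2 IHt22 h) _.
  by rewrite /A2 ler_wpM2l.
have S3 : (V (t2, y0) - m) ^+ 2 <= B.
  pose hh s := Gp (s, y0).
  have -> : V (t2, y0) - m = cumul hh t2 - cumul hh t1.
    by rewrite /m (p11 (Qt1 _ y0cd)) (p21 (Qt2 _ y0cd)) /=; ring.
  have h : `|t2 - t1| <= b - a.
    by move: at1 ta1 bt2 tb2 ab'; clear; rewrite ler_norml; lra.
  apply: le_trans (cumul_holder_total Iy0 Iy02 h) _.
  by rewrite /B ler_wpM2l.
have N1 y : P2 (t1, y) -> c < y < d -> `|V (t1, y) - m| <= M.
  move=> p2 ycd; apply: le_trans (norm_le_1sqr _) _; have := S1 y p2 ycd.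
  by rewrite /M; move: ((V (t1, y) - m) ^+ 2) A20 B0 D10 D20; clear; move=> X; clearbody A1 A2 B D1 D2; lra.
have N2 y : P2 (t2, y) -> c < y < d -> `|V (t2, y) - m| <= M.
  move=> p2 ycd; rewrite -(subrK (V (t2, y0)) (V (t2, y))) -addrA.
  apply: le_trans (ler_normD _ _) _.
  have := norm_le_1sqr (V (t2, y) - V (t2, y0)); have := norm_le_1sqr (V (t2, y0) - m).
  have := S2 y p2 ycd; move: S3.
  rewrite /M; move: (_ ^+ 2) (_ ^+ 2) `|_| `|_| A10 D10 D20; clear; move=> X Y Z W.
  clearbody A1 A2 B D1 D2; lra.
have cM : continuous (trunc M) by have [] := C11_continuous (trunc_C11 M).
have sm : sqint leb2 Q (fun x => V x - m).
  by apply: (sqintB mQ) => //; apply: (@sqint_bounded _ _ _ _ _ mQ `|m|).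
have sT : sqint leb2 Q (fun x => V x - m - trunc M (V x - m)).
  have [mVm _] := sm.
  apply: (@sqint_le _ _ _ _ _ mQ _ (fun x => V x - m)) => //.
    by apply: measurable_funB => //; exact: (measurableT_comp (continuous_measurable_fun cM) mVm).
  by move=> x _; have := @trunc_error R M (V x - m) 0; rewrite normr0 subr0; apply.
exists m, t1, t2; split.
- by rewrite at1 ta1.
- by rewrite bt2 tb2.
- have ae1 : \forall x \ae leb2, Q x -> (V x - m) ^+ 2 <= 2 * (b - a) * fG x.2 + 2 * A1.
    have := aeI rep1 (ae_swap (ae_fst aPY)); apply: aeS => -[s y] [] p1 [[[q1 q2] _] [Iy Iy2]] Qx.
    rewrite /= in p1 q1 q2 Iy Iy2 *.
    have ycd : c < y < d by case: Qx.
    have sab : a < s < b by case: Qx.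
    have h1 : (V (s, y) - V (t1, y)) ^+ 2 <= (b - a) * fG y.
      rewrite (p1 Qx) (q1 (Qt1 _ ycd)) /=.
      have -> : C y + cumul (fun r => Gp (r, y)) s - (C y + cumul (fun r => Gp (r, y)) t1) =
        cumul (fun r => Gp (r, y)) s - cumul (fun r => Gp (r, y)) t1 by ring.
      apply: (cumul_holder_total Iy Iy2); move: sab at1 ta1 ab' bb'; clear; rewrite ler_norml; lra.
    have h2 := S1 y q2 ycd.
    have -> : V (s, y) - m = (V (s, y) - V (t1, y)) + (V (t1, y) - m) by ring.
    move: (V (s, y) - V (t1, y)) (V (t1, y) - m) h1 h2 => u v h1 h2.
    have := sqr_ge0 (u - v); have -> : (u - v) ^+ 2 = 2 * u ^+ 2 + 2 * v ^+ 2 - (u + v) ^+ 2 by ring.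
    by rewrite -mulrA; move: (u ^+ 2) (v ^+ 2) ((u + v) ^+ 2) ((b - a) * fG y) h1 h2; clear; move=> X Y Z W; clearbody A1; lra.
  have [IQ EQ] := Rint_box_snd c d (ltW ab) IfG fG0.
  rewrite -/Q in IQ EQ.
  have Ic : intble leb2 Q (fun=> 2 * A1).
    by apply: (sqint_intble mQ fQ); apply: (@sqint_bounded _ _ _ _ _ mQ `|2 * A1|).
  have IQ' := intbleZ mQ (2 * (b - a)) IQ.
  apply: le_trans (le_Rint_ae mQ (sqint_sq sm) (intbleD mQ IQ' Ic) ae1) _.
  rewrite (RintD mQ IQ' Ic) (RintZ mQ _ IQ) Rintegral_cst //.
  rewrite (_ : fine _ = (b - a) * (d - c)); last exact: (congr1 fine lQ).
  have h3 : 2 * (b - a) * \int[leb2]_(x in Q) fG x.2 <= D1.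
    rewrite /D1 -mulrA ler_wpM2l // ler_wpM2l //.
    by apply: le_trans EQ _; rewrite ler_wpM2l.
  rewrite -/D2 /M; move: (2 * (b - a) * Rintegral _ _ _) h3 A10 A20 B0; clear; move=> X.
  by clearbody A1 A2 B D1 D2; lra.
(* In the collar, [V] differs from its value on the line by at most the square root of [h * ga], and
   [trunc_error] bounds the cut-off part by this difference. One factor [h] comes from the Hoelder
   estimate and one from the width of the collar; the factor [e] comes from [cumul_small]. *)
have key t : a < t < b -> (\forall y \ae leb, c < y < d -> `|V (t, y) - m| <= M) ->
    (\forall y \ae leb, P1 (t, y)) -> forall e h0, 0 < e -> 0 < h0 -> exists h, 0 < h < h0 /\
      nrm2 leb2 (box (t - h) (t + h) c d) (fun x => V x - m - trunc M (V x - m)) <= e * h ^+ 2.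
  move=> /andP[a_t t_b] aN aP e h0 e0 h00.
  have e20 : 0 < e / 2 by rewrite divr_gt0.
  have h10 : 0 < Num.min h0 (Num.min (t - a) (b - t)) by rewrite !lt_min h00 !subr_gt0 a_t t_b.
  have [h [/andP[hp]]] := cumul_small t IgG gG0 e20 h10.
  rewrite !lt_min => /andP[hh0 /andP[hta hbt]] Hsm.
  exists h; rewrite hp hh0; split=> //.
  set S := box (t - h) (t + h) c d; have mS : measurable (S : set mplane) by exact: measurable_box.
  have SQ : S `<=` Q.
    by move=> x [h1 h2]; split=> //; move: h1 hta hbt; clear; lra.
  pose chi s : R := half s (t + h) - half s (t - h).
  have chi0 s : 0 <= chi s.
    rewrite /chi /half; case: (lerP s (t - h)) => hs; last by case: ifP => _; rewrite subr0.
    by rewrite ifT ?subrr //; move: hs hp; clear; lra.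
  have chi1 s : `|chi s| <= 1.
    rewrite ger0_norm // /chi; have := half_le1 s (t + h); have := half_ge0 s (t - h).
    by move: (half _ _) (half _ _); clear; move=> X Y; lra.
  have mhalf y : measurable_fun (setT : set mR) (fun s => half s y).
    exact: (measurableT_comp measurable_half (pair2_measurable (y : mR))).
  have mchi : measurable_fun (setT : set mplane) (fun x : mplane => chi x.1).
    have mc : measurable_fun (setT : set mR) chi by exact: measurable_funB.
    exact: (measurableT_comp mc measurable_fst).
  pose ga y := \int[leb]_s (chi s * Gp (s, y) ^+ 2).
  have ga0 y : 0 <= ga y by apply: Rint_ge0 => s _; rewrite mulr_ge0 // sqr_ge0.
  have IGh : intble leb2 setT (fun x => chi x.1 * Gp x ^+ 2).
    by apply: (intbleM measurableT mchi _ IG2) => x _; exact: chi1.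
  have chi_cumul (f : R -> R) : intble leb setT f ->
      \int[leb]_s (chi s * f s) = cumul f (t + h) - cumul f (t - h).
    move=> If; rewrite !cumulE -RintB //; try exact: half_mul_intble.
    by apply: Rint_eq => s _; rewrite /chi; ring.
  have [Iga Ega] := Rint_fubini_swap IGh.
  have [IGs EGs] := Rint_fubini IGh.
  rewrite -/ga in Iga Ega.
  have gae : \int[leb]_y ga y <= e / 2.
    apply: le_trans Hsm; rewrite -chi_cumul // -Ega EGs le_eqVlt; apply/orP; left; apply/eqP.
    apply: Rint_ae_eq => //.
    - exact: intble_measurable IGs.
    - apply: measurable_funM; first exact: measurable_funB.
      exact: intble_measurable IgG.
    - have := ae_slice_intble IG2; apply: aeS => s Is _.
      exact: (RintZ measurableT (chi s) Is).
  have aeS1 : \forall x \ae leb2, S x ->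
      (V x - m - trunc M (V x - m)) ^+ 2 <= h * ga x.2.
    have aY := aeI aPY (aeI aN aP).
    have := aeI rep1 (ae_swap (ae_fst aY)); apply: aeS => -[s y] [] p1 [[_ [Iy Iy2]] [n1 q1]] Sx.
    rewrite /= in p1 n1 q1 Iy Iy2 *.
    have ycd : c < y < d by case: Sx.
    have sth : t - h < s < t + h by case: Sx.
    have [b1 b2] : t - h <= t <= t + h /\ t - h <= s <= t + h by move: sth hp; clear; lra.
    have Qt : Q (t, y) by split=> //=; rewrite a_t t_b.
    apply: le_trans (_ : (V (s, y) - V (t, y)) ^+ 2 <= _).
      have := @trunc_error R M (V (s, y) - m) (V (t, y) - m) (n1 ycd).
      have -> : V (s, y) - m - (V (t, y) - m) = V (s, y) - V (t, y) by ring.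
      move: (V (s, y) - m - _) (V (s, y) - V (t, y)) => u v uv.
      by rewrite -(real_normK (num_real u)) -(real_normK (num_real v)) ler_sqr ?nnegrE ?normr_ge0.
    rewrite (p1 (SQ _ Sx)) (q1 Qt) /=.
    have -> : C y + cumul (fun r => Gp (r, y)) s - (C y + cumul (fun r => Gp (r, y)) t) =
      cumul (fun r => Gp (r, y)) s - cumul (fun r => Gp (r, y)) t by ring.
    apply: le_trans (cumul_holder Iy Iy2 b1 b2) _.
    rewrite -(chi_cumul _ Iy2) -/(ga y) ler_wpM2r //.
    by move: sth; clear; rewrite ler_norml; lra.
  have th : t - h <= t + h by move: hp; clear; lra.
  have [IS ES] := Rint_box_snd c d th Iga ga0.
  rewrite -/S in IS ES.
  have sTS : intble leb2 S (fun x => (V x - m - trunc M (V x - m)) ^+ 2).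
    exact: (integrableS mQ mS SQ (sqint_sq sT)).
  apply: le_trans (le_Rint_ae mS sTS (intbleZ mS h IS) aeS1) _.
  rewrite (RintZ mS _ IS) expr2 mulrCA; apply: ler_wpM2l; first exact: ltW.
  apply: le_trans ES _; have -> : t + h - (t - h) = 2 * h by ring.
  have -> : e * h = 2 * h * (e / 2) by move: (h) (e); clear; move=> x y; field.
  by apply: ler_wpM2l => //; rewrite mulr_ge0 // ltW.
move=> t [->|->]; apply: key.
- by move: at1 ta1 ab' bb'; clear; lra.
- by apply: aeS aPY => y [[[_ p2] _] _] ycd; exact: N1.
- by apply: aeS aPY => y [[[p1 _] _] _].
- by move: bt2 tb2 aa' ab'; clear; lra.
- by apply: aeS aPY => y [[_ [_ p2]] _] ycd; exact: N2.
- by apply: aeS aPY => y [[_ [p1 _]] _].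
Qed.

End slices.

(** * Polar coordinates at the corner *)

Section polar_coordinates.
Context {R : realType}.
Local Notation plane := (R * R)%type.

Lemma smooth_on_sqrt : smooth_on [set x : R | 0 < x] (@Num.sqrt R).
Proof.
have oP : open [set x : R | 0 < x] by exact: open_gt.
elim=> [//|n IH]; apply: (@smooth_on_derive _ _ _ (fun x => (2 * Num.sqrt x)^-1)) => //.
apply: (@diffn_comp _ _ n _ [set x : R | x != 0] GRing.inv (fun x : R => 2 * Num.sqrt x)) => //.
- exact: smooth_on_inv.
- by apply: diffnM => //; exact: diffn_cst.
- by move=> x /= x0; rewrite mulf_neq0 // gt_eqF // sqrtr_gt0.
Qed.

Lemma derive_affine (p q k : R) (x v : plane) :
  'D_v (fun x => p * x.1 + q * x.2 + k) x = p * v.1 + q * v.2.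
Proof.
apply: cvg_lim; first exact: norm_hausdorff.
apply: cvg_near_cst; near=> h.
have h0 : h != 0 by near: h; exact: nbhs_dnbhs_neq.
rewrite /= /GRing.scale /=.
transitivity (h^-1 * (h * (p * v.1 + q * v.2))); first by congr (_ * _); ring.
by rewrite mulrA mulVf // mul1r.
Unshelve. all: by end_near. Qed.

Lemma smooth_on_affine2 (p q k : R) : smooth_on setT (fun x : plane => p * x.1 + q * x.2 + k).
Proof.
have oT := @openT plane.
apply: (smooth_onD oT); last exact: smooth_on_cst.
by apply: (smooth_onD oT); apply: (smooth_onM oT); first [exact: smooth_on_cst|exact: smooth_on_fst|exact: smooth_on_snd].
Qed.

Lemma derive_inv (f : plane -> R) (x v : plane) : differentiable f x -> f x != 0 ->
  'D_v (fun y => (f y)^-1) x = - ('D_v f x / f x ^+ 2).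
Proof.
move=> df f0; rewrite (deriveV f0 (diff_derivable df)) /GRing.scale /=.
by rewrite mulNr mulrC.
Qed.

Lemma angle_algebra (r t c s p q a b : R) : c ^+ 2 + s ^+ 2 = 1 -> 0 < r ->
  r + (c * p - s * q) != 0 -> (c * p - s * q) ^+ 2 + (s * p + c * q) ^+ 2 = t -> r ^+ 2 = t ->
  2 * (1 / (1 + ((s * p + c * q) / (r + (c * p - s * q))) ^+ 2) *
    (((s * a + c * b) * (r + (c * p - s * q)) -
     (s * p + c * q) * ((p * a + q * b) / r + (c * a - s * b))) / (r + (c * p - s * q)) ^+ 2)) =
  (p * b - q * a) / t.
Proof.
move=> cs r0 w0 yt rt.
have r0' : r != 0 by rewrite gt_eqF.
set w := r + _ in w0 *.
(* With Y1 and Y2 the rotated coordinates and w = r + Y1, the relation r^2 = Y1^2 + Y2^2 gives w^2 +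
   Y2^2 = 2 r w. *)
have E : 1 + ((s * p + c * q) / w) ^+ 2 = 2 * r / w.
  have -> : 2 * r / w = (2 * r * w) / w ^+ 2 by field.
  have -> : 1 + ((s * p + c * q) / w) ^+ 2 = (w ^+ 2 + (s * p + c * q) ^+ 2) / w ^+ 2 by field.
  congr (_ / _); have -> : (s * p + c * q) ^+ 2 = r ^+ 2 - (c * p - s * q) ^+ 2 by rewrite rt -yt; ring.
  by rewrite /w; ring.
rewrite E -rt.
have pq : p ^+ 2 + q ^+ 2 = r ^+ 2.
  rewrite rt -yt; transitivity ((c ^+ 2 + s ^+ 2) * (p ^+ 2 + q ^+ 2)); last by ring.
  by rewrite cs mul1r.
have e1 : p * a + q * b = (c * p - s * q) * (c * a - s * b) + (s * p + c * q) * (s * a + c * b).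
  by transitivity ((c ^+ 2 + s ^+ 2) * (p * a + q * b)); [rewrite cs mul1r|ring].
have e2 : p * b - q * a = (c * p - s * q) * (s * a + c * b) - (s * p + c * q) * (c * a - s * b).
  by transitivity ((c ^+ 2 + s ^+ 2) * (p * b - q * a)); [rewrite cs mul1r|ring].
rewrite e1 e2; have hr : r ^+ 2 = (c * p - s * q) ^+ 2 + (s * p + c * q) ^+ 2 by rewrite rt yt.
move: (c * p - s * q) (s * p + c * q) (c * a - s * b) (s * a + c * b) @w w0 hr {E e1 e2 yt rt cs pq}.
move=> Y1 Y2 A1 A2 w w0 hr.
have -> : A2 * w - Y2 * ((Y1 * A1 + Y2 * A2) / r + A1) = w * (Y1 * A2 - Y2 * A1) / r.
  apply: (mulIf r0'); rewrite divfK //.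
  have -> : (A2 * w - Y2 * ((Y1 * A1 + Y2 * A2) / r + A1)) * r =
     A2 * r ^+ 2 + A2 * Y1 * r - Y2 * (Y1 * A1 + Y2 * A2) - Y2 * A1 * r by rewrite /w; field.
  by rewrite hr /w; ring.
by field; rewrite r0' w0.
Qed.

Variables (x0 : plane) (ga : R).

Definition z1 (x : plane) : R := x.1 - x0.1.
Definition z2 (x : plane) : R := x.2 - x0.2.
Definition y1 (x : plane) : R := cos ga * z1 x - sin ga * z2 x.
Definition y2 (x : plane) : R := sin ga * z1 x + cos ga * z2 x.
Definition sqdist (x : plane) : R := z1 x ^+ 2 + z2 x ^+ 2.
(** The plane cut along the ray opposite to the bisector, on which the expression vanishes; the
    vertex belongs to that ray. *)
Definition slit : set plane := [set x | 0 < Num.sqrt (sqdist x) + y1 x].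
(* The polar angle in ]-pi, pi[, through the tangent half-angle formula. *)
Definition angle (x : plane) : R := 2 * atan (y2 x / (Num.sqrt (sqdist x) + y1 x)).
(** The first polar coordinate is the squared distance and not the distance: in (t, th) the planar
    measure has a constant density. *)
Definition unpolar (p : plane) : plane :=
  (x0.1 + Num.sqrt p.1 * (cos ga * cos p.2 + sin ga * sin p.2),
   x0.2 + Num.sqrt p.1 * (cos ga * sin p.2 - sin ga * cos p.2)).

Let oT := @openT plane.

Lemma smooth_on_z1 : smooth_on setT z1.
Proof. by apply: smooth_onB => //; [exact: smooth_on_fst|exact: smooth_on_cst]. Qed.

Lemma smooth_on_z2 : smooth_on setT z2.
Proof. by apply: smooth_onB => //; [exact: smooth_on_snd|exact: smooth_on_cst]. Qed.

Lemma derive_z1 v x : 'D_v z1 x = v.1.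
Proof.
rewrite (_ : z1 = fun x => 1 * x.1 + 0 * x.2 + - x0.1); first by rewrite derive_affine; ring.
by apply/funext => w; rewrite /z1; ring.
Qed.

Lemma derive_z2 v x : 'D_v z2 x = v.2.
Proof.
rewrite (_ : z2 = fun x => 0 * x.1 + 1 * x.2 + - x0.2); first by rewrite derive_affine; ring.
by apply/funext => w; rewrite /z2; ring.
Qed.

Lemma y1E : y1 = fun x => cos ga * x.1 + - sin ga * x.2 + (sin ga * x0.2 - cos ga * x0.1).
Proof. by apply/funext => x; rewrite /y1 /z1 /z2; ring. Qed.

Lemma y2E : y2 = fun x => sin ga * x.1 + cos ga * x.2 + (- sin ga * x0.1 - cos ga * x0.2).
Proof. by apply/funext => x; rewrite /y2 /z1 /z2; ring. Qed.

Lemma smooth_on_y1 : smooth_on setT y1. Proof. by rewrite y1E; exact: smooth_on_affine2. Qed.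

Lemma smooth_on_y2 : smooth_on setT y2. Proof. by rewrite y2E; exact: smooth_on_affine2. Qed.

Lemma sqdist_y x : y1 x ^+ 2 + y2 x ^+ 2 = sqdist x.
Proof.
rewrite /y1 /y2 /sqdist; have := cos2Dsin2 ga; move: (cos ga) (sin ga) (z1 x) (z2 x) => c s p q h.
transitivity ((c ^+ 2 + s ^+ 2) * (p ^+ 2 + q ^+ 2)); first by ring.
by rewrite h mul1r.
Qed.

Lemma sqdist_ge0 x : 0 <= sqdist x. Proof. by rewrite addr_ge0 ?sqr_ge0. Qed.

Lemma smooth_on_sqdist : smooth_on setT sqdist.
Proof.
rewrite (_ : sqdist = fun x => z1 x * z1 x + z2 x * z2 x).
  by apply: (smooth_onD oT); apply: (smooth_onM oT); first [exact: smooth_on_z1|exact: smooth_on_z2].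
by apply/funext => x; rewrite /sqdist !expr2.
Qed.

Lemma derive_sqdist v x : 'D_v sqdist x = 2 * (z1 x * v.1 + z2 x * v.2).
Proof.
have d1 : differentiable z1 x := smooth_on_diff smooth_on_z1 I.
have d2 : differentiable z2 x := smooth_on_diff smooth_on_z2 I.
rewrite (_ : sqdist = fun x => z1 x * z1 x + z2 x * z2 x); last first.
  by apply/funext => w; rewrite /sqdist !expr2.
rewrite deriveD; [|exact/diff_derivable/differentiableM|exact/diff_derivable/differentiableM].
by rewrite !derive_mul // derive_z1 derive_z2; ring.
Qed.

Lemma slit_gt0 x : slit x -> 0 < sqdist x.
Proof.
move=> Sx; rewrite lt_neqAle sqdist_ge0 andbT; apply/eqP => t0.
have y0 : y1 x = 0.
  have := sqdist_y x; rewrite -t0 => h; apply/eqP; rewrite -sqrf_eq0; apply/eqP.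
  by have := sqr_ge0 (y1 x); have := sqr_ge0 (y2 x); lra.
by move: Sx; rewrite /slit /= -t0 y0 sqrtr0 addr0 ltxx.
Qed.

Lemma continuous_sqdist : continuous sqdist.
Proof. by move=> x; exact: (smooth_on_continuous oT smooth_on_sqdist). Qed.

Lemma open_slit : open slit.
Proof.
have c : continuous (fun x => Num.sqrt (sqdist x) + y1 x).
  move=> x; apply: cvgD.
    by apply: (@continuous_comp _ _ _ sqdist Num.sqrt); [exact: continuous_sqdist|exact: sqrt_continuous].
  exact: (smooth_on_continuous oT smooth_on_y1).
by have /continuousP H := c; exact: (H [set u : R | 0 < u] (@open_gt R 0)).
Qed.

Lemma smooth_on_dist : smooth_on slit (fun x => Num.sqrt (sqdist x)).
Proof.
apply: (smooth_on_comp open_slit smooth_on_sqrt); last by move=> x; exact: slit_gt0.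
exact: smooth_on_sub smooth_on_sqdist.
Qed.

Lemma smooth_on_angle : smooth_on slit angle.
Proof.
have oS := open_slit.
apply: (smooth_onM oS); first exact: smooth_on_cst.
apply: (smooth_on_comp oS smooth_on_atan) => //.
apply: (smooth_onM oS); first exact: smooth_on_sub smooth_on_y2.
apply: (smooth_on_comp oS smooth_on_inv); last by move=> x; rewrite /slit /= => h; rewrite gt_eqF.
apply: (smooth_onD oS); first exact: smooth_on_dist.
exact: smooth_on_sub smooth_on_y1.
Qed.

Lemma derive_angle v x : slit x -> 'D_v angle x = (z1 x * v.2 - z2 x * v.1) / sqdist x.
Proof.
move=> Sx; have t0 := slit_gt0 Sx.
have dy1 : differentiable y1 x := smooth_on_diff smooth_on_y1 I.
have dy2 : differentiable y2 x := smooth_on_diff smooth_on_y2 I.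
have dt : differentiable sqdist x := smooth_on_diff smooth_on_sqdist I.
have r0 : 0 < Num.sqrt (sqdist x) by rewrite sqrtr_gt0.
have [ds eds] := is_derive1P (is_derive1_sqrt t0).
have dr : differentiable (fun x => Num.sqrt (sqdist x)) x := smooth_on_diff smooth_on_dist Sx.
have Dr : 'D_v (fun x => Num.sqrt (sqdist x)) x = (z1 x * v.1 + z2 x * v.2) / Num.sqrt (sqdist x).
  rewrite (derive_comp1 v dt ds) eds derive_sqdist.
  by move: r0; move: (Num.sqrt _) => r r0; field; rewrite gt_eqF.
have dw : differentiable (fun x => Num.sqrt (sqdist x) + y1 x) x by exact: differentiableD.
have w0 : Num.sqrt (sqdist x) + y1 x != 0 by rewrite gt_eqF.
have Dw : 'D_v (fun x => Num.sqrt (sqdist x) + y1 x) x =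
    (z1 x * v.1 + z2 x * v.2) / Num.sqrt (sqdist x) + (cos ga * v.1 - sin ga * v.2).
  by rewrite deriveD ?Dr; [rewrite y1E derive_affine; congr (_ + _); ring|exact: diff_derivable|exact: diff_derivable].
have Dq : 'D_v (fun x => y2 x / (Num.sqrt (sqdist x) + y1 x)) x =
    ((sin ga * v.1 + cos ga * v.2) * (Num.sqrt (sqdist x) + y1 x) -
    y2 x * ((z1 x * v.1 + z2 x * v.2) / Num.sqrt (sqdist x) + (cos ga * v.1 - sin ga * v.2))) /
    (Num.sqrt (sqdist x) + y1 x) ^+ 2.
  have dVw : differentiable (fun x => (Num.sqrt (sqdist x) + y1 x)^-1) x by exact: differentiableV.
  rewrite (derive_mul v dy2 dVw) (derive_inv v dw w0) Dw.
  have -> : 'D_v y2 x = sin ga * v.1 + cos ga * v.2 by rewrite y2E derive_affine.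
  move: (_ / Num.sqrt _ + _) (sin ga * v.1 + cos ga * v.2) (y2 x) w0; clear => X Y z.
  by move: (Num.sqrt _ + _) => w w0; field.
have [da eda] := is_derive1P (is_derive1_atan (y2 x / (Num.sqrt (sqdist x) + y1 x))).
have dq : differentiable (fun x => y2 x / (Num.sqrt (sqdist x) + y1 x)) x.
  by apply: differentiableM => //; exact: differentiableV.
have datan : differentiable (fun x => atan (y2 x / (Num.sqrt (sqdist x) + y1 x))) x.
  exact: (@differentiable_comp _ _ _ _ _ _ x dq da).
have d2 : differentiable (cst 2 : plane -> R) x by exact: differentiable_cst.
have E2 : 'D_v (cst 2 : plane -> R) x = 0 by exact: derive_cst.
rewrite [LHS](derive_mul v d2 datan) (derive_comp1 v dq da) eda Dq E2 mulr0 addr0 /cst.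
by apply: angle_algebra; [exact: cos2Dsin2|exact: r0|exact: w0|exact: sqdist_y|exact: sqr_sqrtr (sqdist_ge0 x)].
Qed.

Lemma cos_sin_2atan (q : R) : cos (2 * atan q) = (1 - q ^+ 2) / (1 + q ^+ 2) /\
  sin (2 * atan q) = 2 * q / (1 + q ^+ 2).
Proof.
have D0 : 0 < 1 + q ^+ 2 by rewrite ltr_wpDr // sqr_ge0.
have c2 : cos (atan q) ^+ 2 = (1 + q ^+ 2)^-1.
  by rewrite cos_atan exprVn sqr_sqrtr // ltW.
have c0 : cos (atan q) != 0.
  by rewrite cos_atan invr_eq0 gt_eqF // sqrtr_gt0.
have sq : sin (atan q) = q * cos (atan q).
  by apply: (mulIf (invr_neq0 c0)); rewrite mulfK //; exact: atanK.
rewrite mulr_natl cos_mulr2n sin_mulr2n sq c2; split; first by field; rewrite gt_eqF.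
by rewrite mulrCA -expr2 c2 -mulr_natl; field; rewrite gt_eqF.
Qed.

Lemma cos_sin_angle x : slit x ->
  Num.sqrt (sqdist x) * cos (angle x) = y1 x /\ Num.sqrt (sqdist x) * sin (angle x) = y2 x.
Proof.
move=> Sx; have t0 := slit_gt0 Sx; have r0 : 0 < Num.sqrt (sqdist x) by rewrite sqrtr_gt0.
have rt : Num.sqrt (sqdist x) ^+ 2 = y1 x ^+ 2 + y2 x ^+ 2 by rewrite sqdist_y sqr_sqrtr // sqdist_ge0.
rewrite /angle; have [-> ->] := cos_sin_2atan (y2 x / (Num.sqrt (sqdist x) + y1 x)).
have : 0 < Num.sqrt (sqdist x) + y1 x by exact: Sx.
move: (Num.sqrt (sqdist x)) (y1 x) (y2 x) r0 rt; clear => r p q r0 rt w0.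
have W : (r + p) ^+ 2 + q ^+ 2 = 2 * r * (r + p).
  have -> : q ^+ 2 = r ^+ 2 - p ^+ 2 by rewrite rt; ring.
  by ring.
have E : 1 + (q / (r + p)) ^+ 2 = 2 * r / (r + p).
  have -> : 2 * r / (r + p) = 2 * r * (r + p) / (r + p) ^+ 2 by field; rewrite gt_eqF.
  by rewrite -W; field; rewrite gt_eqF.
rewrite E; split; last by field; rewrite !gt_eqF.
have -> : 1 - (q / (r + p)) ^+ 2 = 2 - 2 * r / (r + p) by rewrite -E; ring.
by field; rewrite !gt_eqF.
Qed.

Lemma angle_bounds x : - pi < angle x < pi.
Proof.
have := atan_gtNpi2 (y2 x / (Num.sqrt (sqdist x) + y1 x)).
have := atan_ltpi2 (y2 x / (Num.sqrt (sqdist x) + y1 x)).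
rewrite /angle; move: (atan _) => A; lra.
Qed.

Lemma angle_unique x (r phi : R) : 0 < r -> - pi < phi < pi -> y1 x = r * cos phi ->
  y2 x = r * sin phi -> [/\ slit x, sqdist x = r ^+ 2 & angle x = phi].
Proof.
move=> r0 phipi E1 E2.
have T : sqdist x = r ^+ 2 by rewrite -sqdist_y E1 E2 !exprMn -mulrDr cos2Dsin2 mulr1.
have S : Num.sqrt (sqdist x) = r by rewrite T sqrtr_sqr gtr0_norm.
pose h := phi / 2; have hI : - (pi / 2) < h < pi / 2 by rewrite /h; lra.
have c0 : 0 < cos h by exact: cos_gt0_pihalf.
have pE : phi = h *+ 2 by rewrite -mulr_natl /h; field.
have C : r + r * cos phi = r * 2 * cos h ^+ 2 by rewrite pE cos_mulr2n -mulr_natl; ring.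
split=> //; first by rewrite /slit /= S E1 C !mulr_gt0 // exprn_gt0.
rewrite /angle S E1 E2 C.
have -> : r * sin phi / (r * 2 * cos h ^+ 2) = tan h.
  by rewrite pE sin_mulr2n -mulr_natl /tan; field; rewrite !gt_eqF.
by rewrite tanK ?in_itv //= mulr_natl -pE.
Qed.

Lemma unpolarK p : 0 < p.1 -> - pi < p.2 < pi ->
  [/\ slit (unpolar p), sqdist (unpolar p) = p.1 & angle (unpolar p) = p.2].
Proof.
move=> p0 ppi.
have r0 : 0 < Num.sqrt p.1 by rewrite sqrtr_gt0.
have cs := cos2Dsin2 ga.
have E1 : y1 (unpolar p) = Num.sqrt p.1 * cos p.2.
  rewrite /y1 /z1 /z2 /unpolar /=.
  transitivity ((cos ga ^+ 2 + sin ga ^+ 2) * (Num.sqrt p.1 * cos p.2)); last by rewrite cs mul1r.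
  by ring.
have E2 : y2 (unpolar p) = Num.sqrt p.1 * sin p.2.
  rewrite /y2 /z1 /z2 /unpolar /=.
  transitivity ((cos ga ^+ 2 + sin ga ^+ 2) * (Num.sqrt p.1 * sin p.2)); last by rewrite cs mul1r.
  by ring.
by have [? -> ?] := angle_unique r0 ppi E1 E2; rewrite sqr_sqrtr // ltW.
Qed.

Lemma polarK x : slit x -> unpolar (sqdist x, angle x) = x.
Proof.
move=> Sx; have [E1 E2] := cos_sin_angle Sx; rewrite /unpolar /=.
have cs := cos2Dsin2 ga; rewrite [RHS]surjective_pairing; congr (_, _).
- transitivity (x0.1 + (cos ga * (Num.sqrt (sqdist x) * cos (angle x)) +
    sin ga * (Num.sqrt (sqdist x) * sin (angle x)))); first by ring.
  rewrite E1 E2 /y1 /y2; transitivity ((cos ga ^+ 2 + sin ga ^+ 2) * z1 x + x0.1); first by ring.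
  by rewrite cs /z1; ring.
- transitivity (x0.2 + (cos ga * (Num.sqrt (sqdist x) * sin (angle x)) -
    sin ga * (Num.sqrt (sqdist x) * cos (angle x)))); first by ring.
  rewrite E1 E2 /y1 /y2; transitivity ((cos ga ^+ 2 + sin ga ^+ 2) * z2 x + x0.2); first by ring.
  by rewrite cs /z2; ring.
Qed.

Lemma continuous_unpolar : continuous unpolar.
Proof.
have c1 (p : plane) : {for p, continuous (fun p : plane => Num.sqrt p.1)}.
  by apply: (@continuous_comp _ _ _ fst Num.sqrt); [exact: cvg_fst|exact: sqrt_continuous].
have c2 (p : plane) : {for p, continuous (fun p : plane => cos p.2)}.
  by apply: (@continuous_comp _ _ _ snd cos); [exact: cvg_snd|exact: continuous_cos].
have c3 (p : plane) : {for p, continuous (fun p : plane => sin p.2)}.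
  by apply: (@continuous_comp _ _ _ snd sin); [exact: cvg_snd|exact: continuous_sin].
move=> p.
have d1 : {for p, continuous (fun p : plane => (unpolar p).1)}.
  apply: cvgD; first exact: cvg_cst.
  apply: cvgM; first exact: c1.
  by apply: cvgD; apply: cvgM; first [exact: cvg_cst|exact: c2|exact: c3].
have d2 : {for p, continuous (fun p : plane => (unpolar p).2)}.
  apply: cvgD; first exact: cvg_cst.
  apply: cvgM; first exact: c1.
  by apply: cvgB; apply: cvgM; first [exact: cvg_cst|exact: c2|exact: c3].
exact: (cvg_pair d1 d2).
Qed.

End polar_coordinates.

(** Turning by half the opening makes the sector symmetric about its axis, with half-angle
    [sg / 2 < pi], so it lies in the slit plane and the angle is smooth on it. The radius [e ^+ 2]
    is a squared distance: a Euclidean ball of radius [e] lies in the ball of the product norm. *)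
Lemma straight_corner_polar {R : realType} (Omega : set (R * R)) : has_straight_corner Omega ->
  exists (x0 : R * R) (ga s rr : R), [/\ 0 < s < pi, s != pi / 2, 0 < rr &
    forall x, sqdist x0 x < rr -> (Omega x <-> slit x0 ga x /\ - s < angle x0 ga x < s)].
Proof.
move=> [sg [al [x0 [U [/andP[sg0 sg2] sgpi /nbhs_ballP[e /= e0 eU] HU]]]]].
exists x0, (al - sg / 2), (sg / 2), (e ^+ 2); split.
- by apply/andP; split; lra.
- by apply: contra sgpi => /eqP h; apply/eqP; lra.
- by rewrite exprn_gt0.
move=> x xe; pose w := rotation al (x - x0).
have yw : y1 x0 (al - sg / 2) x = cos (sg / 2) * w.1 + sin (sg / 2) * w.2 /\
    y2 x0 (al - sg / 2) x = cos (sg / 2) * w.2 - sin (sg / 2) * w.1.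
  rewrite /y1 /y2 /z1 /z2 /w /rotation /= cosB sinB; split; ring.
have wn : w.1 ^+ 2 + w.2 ^+ 2 = sqdist x0 x.
  rewrite -(sqdist_y x0 (al - sg / 2)) yw.1 yw.2.
  have cs := cos2Dsin2 (sg / 2).
  transitivity ((cos (sg / 2) ^+ 2 + sin (sg / 2) ^+ 2) * (w.1 ^+ 2 + w.2 ^+ 2)); last by ring.
  by rewrite cs mul1r.
have Uw : U w.
  apply: eU; rewrite /ball /= /prod_ball /= /ball /= !sub0r !normrN.
  have aux (u v : R) : u ^+ 2 + v ^+ 2 < e ^+ 2 -> `|u| < e.
    move=> h; rewrite -(ltr_pXn2r (n := 2)) // ?nnegrE ?normr_ge0 ?(ltW e0) //.
    by rewrite real_normK ?num_real //; have := sqr_ge0 v; lra.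
  by split; [apply: (aux _ w.2); rewrite wn|apply: (aux _ w.1); rewrite addrC wn].
have Ow : Omega x <-> [set rotation al (x - x0) | x in Omega] w.
  split; first by move=> Ox; exists x.
  move=> [x' Ox' xx']; suff -> : x = x' by [].
  have cs := cos2Dsin2 al.
  have rinv (y : R * R) : y.1 = cos al * (rotation al y).1 + sin al * (rotation al y).2 /\
      y.2 = cos al * (rotation al y).2 - sin al * (rotation al y).1.
    rewrite /rotation /=; split.
    - by transitivity ((cos al ^+ 2 + sin al ^+ 2) * y.1); [rewrite cs mul1r|ring].
    - by transitivity ((cos al ^+ 2 + sin al ^+ 2) * y.2); [rewrite cs mul1r|ring].
  apply: (addIr (- x0)); rewrite [LHS]surjective_pairing [RHS]surjective_pairing.
  have [-> ->] := rinv (x - x0); have [-> ->] := rinv (x' - x0).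
  by rewrite -/w xx'.
have Sw : sector sg w <-> slit x0 (al - sg / 2) x /\ - (sg / 2) < angle x0 (al - sg / 2) x < sg / 2.
  split.
    move=> [r [th [r0 /andP[th0 th1] wE]]].
    have [|||Sx Tx Ax] := @angle_unique _ x0 (al - sg / 2) x r (th - sg / 2) r0.
    - by apply/andP; split; lra.
    - by rewrite yw.1 wE /= cosB; ring.
    - by rewrite yw.2 wE /= sinB; ring.
    by split=> //; rewrite Ax; lra.
  move=> [Sx thx]; have [E1 E2] := cos_sin_angle Sx.
  exists (Num.sqrt (sqdist x0 x)), (angle x0 (al - sg / 2) x + sg / 2); split.
  - by rewrite sqrtr_gt0; exact: slit_gt0 Sx.
  - by move: (angle _ _ _) thx => A; lra.
  rewrite [LHS]surjective_pairing cosD sinD !mulrBr !mulrDr !(mulrA (Num.sqrt _)) E1 E2 yw.1 yw.2.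
  have cs := cos2Dsin2 (sg / 2); congr (_, _).
  - by transitivity ((cos (sg / 2) ^+ 2 + sin (sg / 2) ^+ 2) * w.1); [rewrite cs mul1r|ring].
  - by transitivity ((cos (sg / 2) ^+ 2 + sin (sg / 2) ^+ 2) * w.2); [rewrite cs mul1r|ring].
rewrite Ow -Sw; split=> h.
- by have [] : (U `&` sector sg) w by rewrite -HU.
- by have [] : (U `&` [set rotation al (x - x0) | x in Omega]) w by rewrite HU.
Qed.

Section patched_test.
Context {R : realType}.
Local Notation plane := (R * R)%type.

Lemma patch_test (D K : set plane) (F : plane -> R) : open D -> compact K -> K `<=` D ->
  smooth_on D F -> (forall x, D x -> ~ K x -> F x = 0) -> test_function D (F \_ D).
Proof.
move=> oD cK KD sF F0; have clK : closed K by apply: compact_closed => //; exact: norm_hausdorff.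
have h0 x : ~ K x -> (F \_ D) x = 0.
  by move=> nK; rewrite /patch; case: ifPn => // /set_mem Dx; exact: F0.
have sK : support (F \_ D) `<=` K by exact: support_sub.
apply/test_functionE; split; last exact: subset_trans KD.
  move=> n; apply: diffn_cover => x _; have [Dx|nD] := pselect (D x).
    exists D => //; apply: (diffn_eq oD _ (sF n)) => y yD.
    by rewrite patchE yD.
  exists (~` K); first by move=> /KD.
  have oK : open (~` K) by exact: closed_openC.
  apply: (diffn_eq oK _ (diffn_cst n 0 oK)) => y /set_mem yK.
  by rewrite h0.
by apply: (subclosed_compact _ cK sK); exact: closed_support.
Qed.

End patched_test.

(** * The chart (t, th) and weak derivatives in it *)

Section polar_chart.
Context {R : realType}.
Local Notation plane := (R * R)%type.
Local Notation mplane := (measurableTypeR R * measurableTypeR R)%type.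
Local Notation mR := (measurableTypeR R).
Local Notation leb := (@lebesgue_measure R).
Variables (Omega : set plane) (x0 : plane) (ga s rr : R).
Hypotheses (oO : open Omega) (fO : (leb2 (Omega : set mplane) < +oo)%E).
Hypotheses (spi : 0 < s < pi) (rr0 : 0 < rr).
Hypothesis corner : forall x, sqdist x0 x < rr ->
  (Omega x <-> slit x0 ga x /\ - s < angle x0 ga x < s).
Local Notation t := (sqdist x0).
Local Notation th := (angle x0 ga).
Local Notation w1 := (z1 x0).
Local Notation w2 := (z2 x0).
Local Notation Q := (box 0 rr (- s) s).
Let mO := measurable_open oO.

Definition corner_part : set plane := [set x | Omega x /\ t x < rr].
Local Notation D := corner_part.

Lemma corner_part_sub : D `<=` Omega. Proof. by move=> x []. Qed.

Lemma corner_part_slit : D `<=` slit x0 ga.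
Proof. by move=> x [Ox tx]; have [] := (corner tx).1 Ox. Qed.

Lemma corner_part_box x : D x -> Q (t x, th x).
Proof.
move=> Dx; have [Ox tx] := Dx; have [Sx thx] := (corner tx).1 Ox.
by split=> //=; rewrite tx andbT; exact: slit_gt0 Sx.
Qed.

Lemma unpolar_corner_part p : Q p ->
  [/\ D (unpolar x0 ga p), t (unpolar x0 ga p) = p.1 & th (unpolar x0 ga p) = p.2].
Proof.
move=> [/andP[p0 pr] ps].
have ppi : - pi < p.2 < pi.
  have /andP[_ s1] := spi; case/andP: ps => p1 p2.
  by rewrite (lt_trans _ p1) ?ltrN2 //= (lt_trans p2).
have [Sp tp ap] := unpolarK x0 ga p0 ppi; split=> //; split; last by rewrite tp.
by apply/corner; rewrite ?tp // ap.
Qed.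

Lemma open_corner_part : open D.
Proof.
have -> : D = Omega `&` t @^-1` [set u | u < rr] by [].
apply: openI => //; have /continuousP H := @continuous_sqdist R x0.
exact: (H _ (@open_lt R rr)).
Qed.
Let oD := open_corner_part.
Let mD := measurable_open oD.

Lemma corner_part_finite : (leb2 (D : set mplane) < +oo)%E.
Proof. by apply: le_lt_trans fO; apply: le_measure; rewrite ?inE //; exact: corner_part_sub. Qed.

Lemma smooth_on_t : smooth_on D t.
Proof. exact: smooth_on_sub (smooth_on_sqdist x0). Qed.

Lemma smooth_on_th : smooth_on D th.
Proof. exact: smooth_on_sub corner_part_slit (@smooth_on_angle _ x0 ga). Qed.

Definition pull (al be : R -> R) : plane -> R := (fun x => al (t x) * be (th x)) \_ D.

Lemma pullE al be x : D x -> pull al be x = al (t x) * be (th x).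
Proof. by move=> Dx; rewrite /pull patchE mem_set. Qed.

Lemma smooth_on_pull al be : smooth_on setT al -> smooth_on setT be ->
  smooth_on D (fun x => al (t x) * be (th x)).
Proof.
move=> sa sb; apply: (smooth_onM oD).
  exact: (smooth_on_comp oD sa smooth_on_t).
exact: (smooth_on_comp oD sb smooth_on_th).
Qed.

Lemma pull_test al be : test1 0 rr al -> test1 (- s) s be -> test_function D (pull al be).
Proof.
move=> [sa [p [q [p0 qr a0]]]] [sb [p' [q' [p0' qr' b0]]]].
pose K := unpolar x0 ga @` (`[p, q]%classic `*` `[p', q']%classic).
apply: (@patch_test _ D K) => //.
- apply: continuous_compact; first by apply: continuous_subspaceT; exact: continuous_unpolar.
  by apply: compact_setX; exact: segment_compact.
- move=> _ [[u v] [/= + +] <-]; rewrite !in_itv /= => /andP[u1 u2] /andP[v1 v2].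
  by have [|//] := @unpolar_corner_part (u, v); split=> /=; lra.
- exact: smooth_on_pull.
- move=> x Dx nK; have [tx|nt] := boolP (p <= t x <= q); last by rewrite a0 ?mul0r //; exact/negP.
  have [thx|nth] := boolP (p' <= th x <= q'); last by rewrite b0 ?mulr0 //; exact/negP.
  exfalso; apply: nK; exists (t x, th x); first by split; rewrite /= in_itv.
  exact: polarK (corner_part_slit Dx).
Qed.

Lemma derive_pull al be v x : smooth_on setT al -> smooth_on setT be -> D x ->
  'D_v (pull al be) x = 'D_1 al (t x) * be (th x) * (2 * (w1 x * v.1 + w2 x * v.2)) +
    al (t x) * 'D_1 be (th x) * ((w1 x * v.2 - w2 x * v.1) / t x).
Proof.
move=> sa sb Dx; have Sx := corner_part_slit Dx.
have dt : differentiable t x := smooth_on_diff (smooth_on_sqdist x0) I.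
have dth : differentiable th x := smooth_on_diff (@smooth_on_angle _ x0 ga) Sx.
have da : differentiable al (t x) := (sa 1%N).1 _ I.
have db : differentiable be (th x) := (sb 1%N).1 _ I.
have dat : differentiable (fun x => al (t x)) x by exact: (@differentiable_comp _ _ _ _ t al x dt da).
have dbt : differentiable (fun x => be (th x)) x by exact: (@differentiable_comp _ _ _ _ th be x dth db).
transitivity ('D_v (fun x => al (t x) * be (th x)) x).
  apply: near_eq_derive; apply: (open_near_eq oD _ Dx) => y yD.
  by rewrite /pull patchE yD.
rewrite (derive_mul v dat dbt) (derive_comp1 v dt da) (derive_comp1 v dth db).
by rewrite derive_sqdist (derive_angle _ Sx); ring.
Qed.

(** The components of the field times [h] serve as test functions for the two partial derivatives;
    as the field has divergence 0, no term of order zero remains. *)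
Lemma weak_field (X1 X2 : plane -> R) (v : mplane -> R) (g : 'I_2 -> mplane -> R) (h : plane -> R) :
  smooth_on D X1 -> smooth_on D X2 ->
  (forall x, D x -> 'D_(basis2 ord0) X1 x + 'D_(basis2 ord_max) X2 x = 0) ->
  H1_gradient Omega v g -> test_function D h ->
  \int[leb2]_(x in D) (v x * (X1 x * 'D_(basis2 ord0) h x + X2 x * 'D_(basis2 ord_max) h x)) =
  - \int[leb2]_(x in D) ((g ord0 x * X1 x + g ord_max x * X2 x) * h x).
Proof.
move=> s1 s2 div0 [sv sg wg] tf.
have t1 := test_functionM oD s1 tf; have t2 := test_functionM oD s2 tf.
have T1 := test_function_sub corner_part_sub t1; have T2 := test_function_sub corner_part_sub t2.
have sOD (k : plane -> R) (f : plane -> R) : test_function D f ->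
    \int[leb2]_(x in Omega) (k x * f x) = \int[leb2]_(x in D) (k x * f x).
  move=> tD; apply: Rint_support; first exact: corner_part_sub.
  by move=> x _ nD; rewrite (test_out tD nD) mulr0.
have iOD (k : mplane -> R) (f : plane -> R) : sqint leb2 Omega k -> test_function D f ->
    intble leb2 D (fun x => k x * f x).
  move=> sk tD; apply: (integrableS mO mD corner_part_sub).
  exact: (sqint_test oO fO sk (test_function_sub corner_part_sub tD)).
have E1 := (weak_partialP Omega ord0 v (g ord0)).1 (wg ord0) _ T1.
have E2 := (weak_partialP Omega ord_max v (g ord_max)).1 (wg ord_max) _ T2.
rewrite (sOD _ _ (test_function_D _ t1)) (sOD _ _ t1) in E1.
rewrite (sOD _ _ (test_function_D _ t2)) (sOD _ _ t2) in E2.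
have F1 : \int[leb2]_(x in D) (v x * (X1 x * 'D_(basis2 ord0) h x + X2 x * 'D_(basis2 ord_max) h x)) =
    \int[leb2]_(x in D) (v x * 'D_(basis2 ord0) (fun x => X1 x * h x) x) +
    \int[leb2]_(x in D) (v x * 'D_(basis2 ord_max) (fun x => X2 x * h x) x).
  apply: (RintD_eq mD (iOD _ _ sv (test_function_D _ t1)) (iOD _ _ sv (test_function_D _ t2))) => x Dx.
  have /test_functionE[sh _ _] := tf; have dh : differentiable h x := smooth_on_diff sh I.
  rewrite (derive_mul _ (smooth_on_diff s1 Dx) dh) (derive_mul _ (smooth_on_diff s2 Dx) dh).
  have := div0 x Dx; rewrite -mulrDr.
  move: ('D_(basis2 ord0) X1 x) ('D_(basis2 ord_max) X2 x) ('D_(basis2 ord0) h x) ('D_(basis2 ord_max) h x).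
  move=> a b c d ab; congr (_ * _).
  by have -> : b = - a; [apply/eqP; rewrite -addr_eq0 addrC ab|ring].
have F2 : \int[leb2]_(x in D) ((g ord0 x * X1 x + g ord_max x * X2 x) * h x) =
    \int[leb2]_(x in D) (g ord0 x * (X1 x * h x)) + \int[leb2]_(x in D) (g ord_max x * (X2 x * h x)).
  by apply: (RintD_eq mD (iOD _ _ (sg ord0) t1) (iOD _ _ (sg ord_max) t2)) => x _; ring.
by rewrite F1 F2 E1 E2 opprD.
Qed.

End polar_chart.

Section polar_weak.
Context {R : realType}.
Local Notation plane := (R * R)%type.
Local Notation mplane := (measurableTypeR R * measurableTypeR R)%type.
Local Notation mR := (measurableTypeR R).
Local Notation leb := (@lebesgue_measure R).
Variables (Omega : set plane) (x0 : plane) (ga s rr : R).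
Hypotheses (oO : open Omega) (fO : (leb2 (Omega : set mplane) < +oo)%E).
Hypotheses (spi : 0 < s < pi) (rr0 : 0 < rr).
Hypothesis corner : forall x, sqdist x0 x < rr ->
  (Omega x <-> slit x0 ga x /\ - s < angle x0 ga x < s).
Local Notation t := (sqdist x0).
Local Notation th := (angle x0 ga).
Local Notation w1 := (z1 x0).
Local Notation w2 := (z2 x0).
Local Notation Q := (box 0 rr (- s) s).
Local Notation D := (corner_part Omega x0 rr).
Let mO := measurable_open oO.
Let oD : open D := @open_corner_part _ _ x0 rr oO.
Let mD := measurable_open oD.
Let DS : D `<=` slit x0 ga := corner_part_slit corner.

Lemma corner_part_t0 x : D x -> 0 < t x.
Proof. by move=> /DS; exact: slit_gt0. Qed.

(** The field [(- z2, z1)] has divergence 0, annihilates [t] and has derivative 1 on [th]: it is the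
    coordinate field of the angle. *)
Lemma weak_angular (v : mplane -> R) (g : 'I_2 -> mplane -> R) al be : H1_gradient Omega v g ->
  test1 0 rr al -> test1 (- s) s be ->
  \int[leb2]_(x in D) (v x * (al (t x) * 'D_1 be (th x))) =
  - \int[leb2]_(x in D) ((g ord_max x * w1 x - g ord0 x * w2 x) * (al (t x) * be (th x))).
Proof.
move=> Hv ta tb; have tp := pull_test oO spi corner ta tb.
have s1 : smooth_on D (fun x => 0 - w2 x).
  apply: smooth_onB => //; first exact: smooth_on_cst.
  exact: smooth_on_sub (@smooth_on_z2 _ x0).
have s2 : smooth_on D w1 by exact: smooth_on_sub (@smooth_on_z1 _ x0).
have dv x : D x -> 'D_(basis2 ord0) (fun x => 0 - w2 x) x + 'D_(basis2 ord_max) w1 x = 0.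
  move=> Dx; rewrite derive_z1 basis2_max basis2_0.
  rewrite (_ : (fun x => 0 - w2 x) = fun x => 0 * x.1 + - 1 * x.2 + x0.2).
    by rewrite derive_affine /=; ring.
  by apply/funext => y; rewrite /z2; ring.
have := weak_field oO fO s1 s2 dv Hv tp.
rewrite (_ : \int[leb2]_(x in D) _ = \int[leb2]_(x in D) (v x * (al (t x) * 'D_1 be (th x)))).
  move=> ->; congr (- _); apply: Rint_eq => // x Dx.
  by rewrite pullE //; ring.
apply: Rint_eq => // x Dx; have [sa _] := ta; have [sb _] := tb.
have P v' : 'D_v' (pull Omega x0 ga rr al be) x = _ := derive_pull oO corner v' sa sb Dx.
rewrite !P {P} basis2_0 basis2_max /=.
have t0 : t x != 0 by rewrite gt_eqF // corner_part_t0.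
congr (_ * _); move: ('D_1 al _) ('D_1 be _) => a b.
transitivity (al (t x) * b * ((w1 x ^+ 2 + w2 x ^+ 2) / t x)); first by field.
by rewrite -/(t x) divff // mulr1.
Qed.

(** The field [z / (2 t)] has divergence 0, annihilates [th] and has derivative 1 on [t]: it is the
    coordinate field of the squared distance. *)
Lemma weak_radial (v : mplane -> R) (g : 'I_2 -> mplane -> R) al be : H1_gradient Omega v g ->
  test1 0 rr al -> test1 (- s) s be ->
  \int[leb2]_(x in D) (v x * ('D_1 al (t x) * be (th x))) =
  - \int[leb2]_(x in D) ((g ord0 x * w1 x + g ord_max x * w2 x) / (2 * t x) * (al (t x) * be (th x))).
Proof.
move=> Hv ta tb; have tp := pull_test oO spi corner ta tb.
pose k x := (2 * t x)^-1.
have st : smooth_on D (fun x => 2 * t x).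
  by apply: smooth_onM => //; [exact: smooth_on_cst|exact: smooth_on_t].
have sk : smooth_on D k.
  apply: (smooth_on_comp oD (@smooth_on_inv R) st) => x Dx /=.
  by rewrite mulf_neq0 // gt_eqF // corner_part_t0.
have sw1 : smooth_on D w1 by exact: smooth_on_sub (@smooth_on_z1 _ x0).
have sw2 : smooth_on D w2 by exact: smooth_on_sub (@smooth_on_z2 _ x0).
have s1 : smooth_on D (fun x => w1 x * k x) by exact: smooth_onM.
have s2 : smooth_on D (fun x => w2 x * k x) by exact: smooth_onM.
have dt x : differentiable t x := smooth_on_diff (smooth_on_sqdist x0) I.
have Dk v0 x : D x -> 'D_v0 k x = - ((w1 x * v0.1 + w2 x * v0.2) / t x ^+ 2).
  move=> Dx; have t0 : t x != 0 by rewrite gt_eqF // corner_part_t0.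
  have d2 : differentiable (cst 2 : plane -> R) x by exact: differentiable_cst.
  have c2 : 'D_v0 (cst 2 : plane -> R) x = 0 by exact: derive_cst.
  rewrite /k (derive_inv v0 (smooth_on_diff st Dx)); last by rewrite mulf_neq0.
  have -> : 'D_v0 (fun x => 2 * t x) x = 2 * (2 * (w1 x * v0.1 + w2 x * v0.2)).
    by rewrite [LHS](derive_mul v0 d2 (dt x)) c2 derive_sqdist /cst mulr0 addr0.
  by move: (t x) t0 (w1 x * _ + _) => T T0 A; field.
have dv x : D x -> 'D_(basis2 ord0) (fun x => w1 x * k x) x + 'D_(basis2 ord_max) (fun x => w2 x * k x) x = 0.
  move=> Dx; have t0 : t x != 0 by rewrite gt_eqF // corner_part_t0.
  rewrite (derive_mul _ (smooth_on_diff sw1 Dx) (smooth_on_diff sk Dx)).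
  rewrite (derive_mul _ (smooth_on_diff sw2 Dx) (smooth_on_diff sk Dx)).
  rewrite !Dk // derive_z1 derive_z2 basis2_0 basis2_max /= /k.
  transitivity ((t x - (w1 x ^+ 2 + w2 x ^+ 2)) / t x ^+ 2); first by field.
  by rewrite -/(t x) subrr mul0r.
have := weak_field oO fO s1 s2 dv Hv tp.
rewrite (_ : \int[leb2]_(x in D) _ = \int[leb2]_(x in D) (v x * ('D_1 al (t x) * be (th x)))).
  move=> ->; congr (- _); apply: Rint_eq => // x Dx.
  by rewrite pullE // /k; move: (2 * t x)^-1 => c; ring.
apply: Rint_eq => // x Dx; have [sa _] := ta; have [sb _] := tb.
have P v' : 'D_v' (pull Omega x0 ga rr al be) x = _ := derive_pull oO corner v' sa sb Dx.
rewrite !P {P} basis2_0 basis2_max /= /k.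
have t0 : t x != 0 by rewrite gt_eqF // corner_part_t0.
congr (_ * _); move: ('D_1 al _) ('D_1 be _) => a b.
transitivity (a * be (th x) * ((w1 x ^+ 2 + w2 x ^+ 2) / t x)); first by field.
by rewrite -/(t x) divff // mulr1.
Qed.

Lemma H1_gradient_cst (c : R) : H1_gradient Omega (fun=> c) (fun _ _ => 0).
Proof.
split; first by apply: (@sqint_bounded _ _ _ _ _ mO `|c| _ fO).
  by move=> _; exact: (sqint0 _ mO).
move=> i; apply/weak_partialP => phi tp.
have W := @weak_partial_smooth1 R Omega (fun=> c) i oO (smooth_on_cst c oO).
have := (weak_partialP Omega i _ _).1 W phi tp.
move=> ->; congr (- _); apply: Rint_eq => // x _; congr (_ * _).
exact: derive_cst.
Qed.

(** The shift by 1 before and after the extension by 0 sends the complement of [D] to first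
    coordinate -1, outside the box; the preimage of the box is then exactly [D]. *)
Let T : mplane -> mplane := fun x => (((fun x => t x + 1) \_ D) x - 1, (th \_ D) x).

Lemma measurable_polar : measurable_fun setT T.
Proof.
apply: measurable_fun_pair.
  apply: measurable_funB; last exact: measurable_cst.
  apply/(measurable_restrictT _ mD); apply: measurable_funD; last exact: measurable_cst.
  by apply: (smooth_on_measurable oD); exact: smooth_on_t.
by apply/(measurable_restrictT _ mD); apply: (smooth_on_measurable oD); exact: (smooth_on_th corner).
Qed.

Let TD x : D x -> T x = (t x, th x).
Proof. by move=> Dx; rewrite /T !patchE mem_set //; congr (_, _); ring. Qed.

Let TQ : T @^-1` Q = D.
Proof.
apply/seteqP; split => x /=; last by move=> Dx; rewrite TD //; exact: (corner_part_box corner).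
by move=> [+ _]; rewrite /T /= patchE; case: ifPn => [/set_mem //|_] ; rewrite sub0r ltrNr oppr0; lra.
Qed.

Let mQ : measurable (Q : set mplane) := @measurable_box R _ _ _ _.

(** For the constant function 1 the weak formulas say that a derivative in either coordinate
    integrates to 0. A test function of one variable is its integral times a fixed one, up to a
    derivative, so only the product of the two integrals matters. *)
Lemma polar_test_integral : exists k : R, forall al be, test1 0 rr al -> test1 (- s) s be ->
  \int[leb2]_(x in D) (al (t x) * be (th x)) = k * (\int[leb]_u al u * \int[leb]_u be u).
Proof.
have /andP[s0 _] := spi; have ss : - s < s by lra.
have zero (f : plane -> R) : \int[leb2]_(x in D) (1 * f x) = \int[leb2]_(x in D) f x.
  by apply: Rint_eq => // x _; rewrite mul1r.
have zr (f h : plane -> R) : (forall x, h x = 0) -> - (\int[leb2]_(x in D) (h x * f x)) = 0.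
  by move=> h0; rewrite (@Rint0 _ _ _ leb2) ?oppr0 // => x _; rewrite h0 mul0r.
have rad al be : test1 0 rr al -> test1 (- s) s be ->
    \int[leb2]_(x in D) ('D_1 al (t x) * be (th x)) = 0.
  move=> ta tb; rewrite -(zero (fun x => 'D_1 al (t x) * be (th x))).
  rewrite (weak_radial (H1_gradient_cst 1) ta tb); apply: zr => x.
  by rewrite !mul0r addr0 mul0r.
have ang al be : test1 0 rr al -> test1 (- s) s be ->
    \int[leb2]_(x in D) (al (t x) * 'D_1 be (th x)) = 0.
  move=> ta tb; rewrite -(zero (fun x => al (t x) * 'D_1 be (th x))).
  rewrite (weak_angular (H1_gradient_cst 1) ta tb); apply: zr => x.
  by rewrite !mul0r subr0.
have [al0 ta0 al01] := test1_unit rr0; have [be0 tb0 be01] := test1_unit ss.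
exists (\int[leb2]_(x in D) (al0 (t x) * be0 (th x))) => al be ta tb.
have IP al' be' : test1 0 rr al' -> test1 (- s) s be' -> intble leb2 D (fun x => al' (t x) * be' (th x)).
  move=> ta' tb'; have tp := pull_test oO spi corner ta' tb'.
  have I1 := test_intble_on oD (test_function_sub (@subsetT _ D) tp).
  by apply: (intble_eq mD _ I1) => x Dx; rewrite pullE.
have step1 : \int[leb2]_(x in D) (al (t x) * be (th x)) =
    (\int[leb]_u al u) * \int[leb2]_(x in D) (al0 (t x) * be (th x)).
  set ka := \int[leb]_u al u.
  have t2 := test1_lin ka ta ta0.
  have [|tc Ec] := test1_cumul t2.
    rewrite RintB //; [|exact: test1_intble ta|by apply: intbleZ => //; exact: test1_intble ta0].
    by rewrite RintZ //; [rewrite al01 mulr1 subrr|exact: test1_intble ta0].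
  rewrite -(RintZ mD _ (IP _ _ ta0 tb)) -[RHS]addr0 -(rad _ _ tc tb).
  apply: (RintD_eq mD); first exact: (intbleZ mD _ (IP _ _ ta0 tb)).
    exact: (IP _ _ (test1_D tc) tb).
  by move=> x _; rewrite Ec; ring.
rewrite step1 mulrCA; congr (_ * _).
set kb := \int[leb]_u be u.
have t2 := test1_lin kb tb tb0.
have [|tc Ec] := test1_cumul t2.
  rewrite RintB //; [|exact: test1_intble tb|by apply: intbleZ => //; exact: test1_intble tb0].
  by rewrite RintZ //; [rewrite be01 mulr1 subrr|exact: test1_intble tb0].
rewrite mulrC -(RintZ mD _ (IP _ _ ta0 tb0)) -[RHS]addr0 -(ang _ _ ta0 tc).
apply: (RintD_eq mD); first exact: (intbleZ mD _ (IP _ _ ta0 tb0)).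
  exact: (IP _ _ ta0 (test1_D tc)).
by move=> x _; rewrite Ec; ring.
Qed.

Lemma Rint_test_prod (a b c d : R) al be : test1 a b al -> test1 c d be ->
  \int[leb2]_(x in box a b c d) (al x.1 * be x.2) = \int[leb]_u al u * \int[leb]_u be u.
Proof.
move=> ta tb; have Ia := test1_intble ta; have Ib := test1_intble tb.
rewrite (Rint_box (test1_out ta tb)); have [_ ->] := Rint_fubini (intble_prod Ia Ib).
transitivity (\int[leb]_u ((\int[leb]_w be w) * al u)).
  by apply: Rint_eq => u _ /=; rewrite RintZ // mulrC.
by rewrite RintZ // mulrC.
Qed.

(* The image of the planar measure is translation invariant in the coordinates
   [(t, th)], since [t] and [th] have divergence-free dual fields; this avoids a
   change of variables formula, at the price of an unspecified constant [k]. *)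
Lemma polar_box : exists2 k : R, 0 < k & forall a b c d : R,
  leb2 (T @^-1` (box a b c d `&` Q)) = (k%:E * leb2 (box a b c d `&` Q : set mplane))%E.
Proof.
have [k Hk] := polar_test_integral.
have fD : (leb2 (D : set mplane) < +oo)%E := corner_part_finite x0 rr oO fO.
have /andP[s0 _] := spi.
have lQ : leb2 (Q : set mplane) = (rr * (s - - s))%:E .
  have ss : - s <= s by lra.
  by rewrite (leb2_box (ltW rr0) ss) subr0.
have fQ : (leb2 (Q : set mplane) < +oo)%E by rewrite lQ ltry.
have main a b c d : leb2 (T @^-1` (box a b c d `&` Q)) = (k%:E * leb2 (box a b c d `&` Q : set mplane))%E.
  rewrite boxI; set p := Num.max a 0; set q := Num.min b rr; set r := Num.max c (- s); set r' := Num.min d s.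
  have p0 : 0 <= p by rewrite le_max lexx orbT.
  have qr : q <= rr by rewrite ge_min lexx orbT.
  have rs : - s <= r by rewrite le_max lexx orbT.
  have r's : r' <= s by rewrite ge_min lexx orbT.
  set B := box p q r r'.
  have mB : measurable (B : set mplane) by exact: measurable_box.
  have BQ : B `<=` Q by move=> x [/andP[? ?] /andP[? ?]]; split; apply/andP; split; lra.
  pose E := T @^-1` B; have ED : E `<=` D by move=> x Ex; rewrite -TQ; exact: BQ.
  have mE : measurable (E : set mplane).
    by rewrite -[X in measurable X]setTI; exact: measurable_polar.
  have fE : (leb2 (E : set mplane) < +oo)%E.
    by apply: le_lt_trans fD; apply: le_measure; rewrite ?inE.
  have fB : (leb2 (B : set mplane) < +oo)%E.
    by apply: le_lt_trans fQ; apply: le_measure; rewrite ?inE.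
  have tb1 n : test1 0 rr (bump p q n) by exact: test1_bump.
  have tb2 n : test1 (- s) s (bump r r' n) by exact: test1_bump.
  pose ind (u v y : R) : R := if u < y < v then 1 else 0.
  have [_ C1] : intble leb2 D (fun x => ind p q (t x) * ind r r' (th x)) /\
      \int[leb2]_(x in D) (bump p q n (t x) * bump r r' n (th x)) @[n --> \oo] -->
      \int[leb2]_(x in D) (ind p q (t x) * ind r r' (th x)).
    apply: (@Rint_cvg _ _ _ leb2 D (fun n x => bump p q n (t x) * bump r r' n (th x)) _ (fun=> 1)) => //.
    - move=> n; apply: (smooth_on_measurable oD).
      by apply: (smooth_on_pull oO corner); exact: smooth_on_bump.
    - by move=> x _; apply: cvgM; exact: bump_cvg.
    - by apply: (sqint_intble mD fD); apply: (@sqint_bounded _ _ _ _ _ mD `|1| _ fD).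
    - move=> n x _; have b1 := bump_ge0 p q n (t x); have b2 := bump_ge0 r r' n (th x).
      by rewrite (ger0_norm (mulr_ge0 b1 b2)); exact: (mulr_ile1 b1 b2 (bump_le1 _ _ _ _) (bump_le1 _ _ _ _)).
  have E1 : \int[leb2]_(x in D) (ind p q (t x) * ind r r' (th x)) = fine (leb2 (E : set mplane)).
    rewrite (@Rint_support _ _ _ leb2 E D) //; last first.
      move=> x Dx nE; rewrite /ind; case: ifPn => h1; last by rewrite mul0r.
      case: ifPn => h2; last by rewrite mulr0.
      by exfalso; apply: nE; rewrite /E /= TD.
    transitivity (\int[leb2]_(x in E) (1 : R)).
      apply: Rint_eq => // x Ex; have := Ex; rewrite /E /= TD; last exact: ED.
      by move=> [/= h1 h2]; rewrite /ind h1 h2 mulr1.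
    by rewrite Rintegral_cst // mul1r.
  have I1 : intble leb2 Q (fun=> 1).
    by apply: (sqint_intble mQ fQ); apply: (@sqint_bounded _ _ _ _ _ mQ `|1| _ fQ).
  have C2 := @Rint_bump_cvg R leb2 Q (fun=> 1) p q r r' mQ I1.
  have E2 : \int[leb2]_(x in Q `&` box p q r r') (1 : R) = fine (leb2 (B : set mplane)).
    by rewrite (_ : Q `&` _ = B); [rewrite Rintegral_cst // mul1r|rewrite setIC; exact/setIidl].
  rewrite E2 in C2; rewrite E1 in C1.
  have [w Ew] : exists w : nat -> R, forall n,
    w n = \int[leb2]_(x in Q) (1 * (bump p q n x.1 * bump r r' n x.2)) by eexists.
  have C2' : w n @[n --> \oo] --> fine (leb2 (B : set mplane)).
    by rewrite (funext Ew); exact: C2.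
  have C3 : k * w n @[n --> \oo] --> k * fine (leb2 (B : set mplane)).
    by apply: cvgM => //; exact: cvg_cst.
  have EE : (fun n => k * w n) =
      (fun n => \int[leb2]_(x in D) (bump p q n (t x) * bump r r' n (th x))).
    apply/funext => n; rewrite (Hk _ _ (tb1 n) (tb2 n)) -(Rint_test_prod (tb1 n) (tb2 n)) Ew.
    by congr (_ * _); apply: Rint_eq => x _; rewrite mul1r.
  rewrite EE in C3.
  have := cvg_unique _ C1 C3 => /(_ (@norm_hausdorff _ _)) F.
  rewrite -/E -[LHS]fineK ?ge0_fin_numE // F EFinM fineK // ge0_fin_numE //.
exists k => //.
have := main 0 rr (- s) s; rewrite setIid TQ lQ -EFinM => h.
have D0 : 0 < fine (leb2 (D : set mplane)).
  have rr2 : 0 < rr / 2 by rewrite divr_gt0.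
  have [Dp _ _] : [/\ D (unpolar x0 ga (rr / 2, 0)), t (unpolar x0 ga (rr / 2, 0)) = rr / 2 &
      th (unpolar x0 ga (rr / 2, 0)) = 0].
    by apply: (unpolar_corner_part spi corner); split => /=; lra.
  have /nbhs_ballP[e /= e0 eD] : nbhs (unpolar x0 ga (rr / 2, 0)) D by exact: open_nbhs_nbhs.
  move: eD; rewrite ball_box //; set z := unpolar _ _ _ => eD.
  have : (0 < leb2 (D : set mplane))%E.
    have mZ : measurable (box (z.1 - e) (z.1 + e) (z.2 - e) (z.2 + e) : set mplane) by exact: measurable_box.
    have le : (leb2 (box (z.1 - e) (z.1 + e) (z.2 - e) (z.2 + e) : set mplane) <= leb2 (D : set mplane))%E.
      by apply: le_measure; rewrite ?inE.
    apply: lt_le_trans le; rewrite leb2_box ;[rewrite lte_fin; apply: mulr_gt0|lra|lra]; lra.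
  by move=> h0; rewrite fine_gt0 // h0.
move: D0; rewrite h /=; have q0 : 0 < rr * (s - - s) by rewrite mulr_gt0 //; lra.
by rewrite pmulr_lgt0.
Qed.

(** Two finite measures that agree on boxes are equal; integrands of both signs are treated through
    their positive and negative parts. *)
Lemma polar_integral : exists2 k : R, 0 < k & forall f : mplane -> R, measurable_fun Q f ->
  intble leb2 D (fun x => f (t x, th x)) ->
  intble leb2 Q f /\ \int[leb2]_(x in D) f (t x, th x) = k * \int[leb2]_(x in Q) f x.
Proof.
have [k k0 Hk] := polar_box; exists k => //.
have fD : (leb2 (D : set mplane) < +oo)%E := corner_part_finite x0 rr oO fO.
pose knn := NngNum (ltW k0).
pose m2 : {measure set mplane -> \bar R} := mscale knn (mrestr leb2 mQ).
have mT := measurable_polar.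
have mE (A : set mplane) : measurable A -> A `<=` Q -> leb2 (T @^-1` A) = mscale knn leb2 A.
  move=> mA AQ.
  have := @measure_unique _ R mplane boxes (fun n => box (- n%:R) n%:R (- n%:R) n%:R)
    measurable_boxes setI_closed_boxes _ bigcup_box_nat
    (mrestr (pushforward leb2 T) mQ) m2.
  rewrite /= /mrestr /pushforward /m2 => H.
  rewrite -[X in T @^-1` X](setIidl AQ) -[X in mscale _ _ X](setIidl AQ).
  apply: (H _ mT _ _ A mA).
  - by move=> n; do 4 eexists; reflexivity.
  - by move=> _ [a [b [c [d ->]]]]; exact: Hk.
  - move=> n; apply: le_lt_trans fD; apply: le_measure; rewrite ?inE //.
      by rewrite -[X in measurable X]setTI; apply: mT => //; apply: measurableI => //; exact: measurable_box.
    by move=> x [_ Qx]; rewrite -TQ.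
have pos (f : mplane -> R) : measurable_fun Q f -> (forall x, 0 <= f x) ->
    intble leb2 D (fun x => f (t x, th x)) ->
    intble leb2 Q f /\ \int[leb2]_(x in D) f (t x, th x) = k * \int[leb2]_(x in Q) f x.
  move=> mf f0 If.
  have mfE : measurable_fun Q (EFin \o f) by exact/measurable_EFinP.
  have H1 : (\int[pushforward leb2 T]_(y in Q) (f y)%:E = \int[leb2]_(x in D) (f (T x))%:E)%E.
    have := @ge0_integral_pushforward _ _ _ _ R T mT leb2 Q (EFin \o f) mQ mfE.
    by rewrite TQ; apply => y _; rewrite lee_fin.
  have H2 : (\int[pushforward leb2 T]_(y in Q) (f y)%:E = \int[mscale knn leb2]_(y in Q) (f y)%:E)%E.
    by apply: eq_measure_integral => A mA AQ; exact: mE.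
  rewrite H2 ge0_integral_mscale // in H1; last by move=> y _; rewrite lee_fin.
  have H3 : (\int[leb2]_(x in D) (f (T x))%:E = (\int[leb2]_(x in D) f (t x, th x))%:E)%E.
    rewrite (EFin_Rintegral mD If); apply: eq_integral => x /set_mem Dx.
    by rewrite TD.
  rewrite H3 /= in H1.
  have [I EI] : exists I : R, (\int[leb2]_(x in Q) (f x)%:E = I%:E)%E.
    have : (0 <= \int[leb2]_(x in Q) (f x)%:E)%E by apply: integral_ge0 => x _; rewrite lee_fin.
    move: H1; case: (\int[leb2]_(x in Q) (f x)%:E)%E => [r _ _|/=|//]; first by exists r.
    by rewrite gt0_muley ?lte_fin.
  have IQ : intble leb2 Q f.
    apply/integrableP; split=> //.
    rewrite (_ : integral _ _ _ = I%:E) ?ltry // -EI; apply: eq_integral => x _.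
    by rewrite /= ger0_norm.
  split=> //; move: H1; rewrite EI -EFinM => -[<-]; congr (_ * _).
  by apply: EFin_inj; rewrite (EFin_Rintegral mQ IQ) EI.
move=> f mf If.
have mcomp (h : R -> R) : continuous h -> measurable_fun Q (fun x => h (f x)).
  by move=> ch; exact: (measurableT_comp (continuous_measurable_fun ch) mf).
have cp : continuous (fun u : R => Num.max u 0).
  by move=> u; apply: continuous_max; [exact: cvg_id|exact: cvg_cst].
have cn : continuous (fun u : R => Num.max (- u) 0).
  by move=> u; apply: continuous_max; [apply: cvgN; exact: cvg_id|exact: cvg_cst].
have p0 (u : R) : 0 <= Num.max u 0 by rewrite le_max lexx orbT.
have bound (h : R -> R) : continuous h -> (forall u, `|h u| <= `|u|) ->
    intble leb2 D (fun x => h (f (t x, th x))).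
  move=> ch bh; apply: (@intble_le _ _ _ _ _ mD _ (fun x => `|f (t x, th x)|)) => //.
    exact: (measurableT_comp (continuous_measurable_fun ch) (intble_measurable If)).
  exact: intble_norm.
have b1 (u : R) : `|Num.max u 0| <= `|u|.
  by rewrite ger0_norm // ge_max normr_ge0 ler_norm.
have b2 (u : R) : `|Num.max (- u) 0| <= `|u|.
  by rewrite ger0_norm // ge_max normr_ge0 andbT -normrN ler_norm.
have [I1 E1] := pos _ (mcomp _ cp) (fun x => p0 _) (bound _ cp b1).
have [I2 E2] := pos _ (mcomp _ cn) (fun x => p0 _) (bound _ cn b2).
have E (u : R) : u = Num.max u 0 - Num.max (- u) 0.
  case: (lerP u 0) => hu; first by rewrite max_l ?opprK ?add0r //; lra.
  by rewrite max_r ?subr0 //; lra.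
split; first by apply: (intble_eq mQ _ (intbleB mQ I1 I2)) => x _; rewrite -E.
have -> : \int[leb2]_(x in Q) f x =
    \int[leb2]_(x in Q) (Num.max (f x) 0 - Num.max (- f x) 0) by apply: Rint_eq => // x _; rewrite -E.
rewrite (RintB mQ I1 I2) mulrBr -E1 -E2 -(RintB mD (bound _ cp b1) (bound _ cn b2)).
by apply: Rint_eq => // x _; rewrite -E.
Qed.

End polar_weak.

Section test1_facts.
Context {R : realType}.
Implicit Types (a b : R) (al : R -> R).

Lemma test1_props a b al : test1 a b al ->
  smooth_on setT al /\ exists2 A : R, 0 <= A & forall x, `|al x| <= A.
Proof. by move=> ta; split; [case: ta|exact: test1_bounded ta]. Qed.

Lemma test1_vanish a b al : test1 a b al -> forall r, ~ (a < r < b) -> al r = 0.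
Proof.
by move=> [_ [p [q [ap qb al0]]]] r nr; apply: al0 => /andP[h1 h2]; apply: nr; apply/andP; split; lra.
Qed.

Lemma test1_wide a b a' b' al : a' <= a -> b <= b' -> test1 a b al -> test1 a' b' al.
Proof. by move=> aa bb [sa [p [q [ap qb al0]]]]; split=> //; exists p, q; split=> //; lra. Qed.

Lemma between_slices (a a' b' b t1 t2 u : R) : a < a' -> a' < b' -> b' < b ->
  a < t1 < a' -> b' < t2 < b -> u = t1 \/ u = t2 -> a < u < b.
Proof. by move=> ? ? ? ? ? [->|->]; lra. Qed.

Lemma strip_sub (a b u h : R) : h < u - a -> h < b - u ->
  [/\ forall y, u - h < y < u + h -> a < y < b, a < u - h & u + h < b].
Proof. by move=> h1 h2; split; [move=> y|idtac|idtac]; lra. Qed.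

End test1_facts.

(** * Truncated sectors between two circles *)

Section annulus.
Context {R : realType}.
Local Notation plane := (R * R)%type.
Local Notation mplane := (measurableTypeR R * measurableTypeR R)%type.
Local Notation mR := (measurableTypeR R).
Local Notation leb := (@lebesgue_measure R).
Variables (Omega : set plane) (x0 : plane) (ga s rr : R).
Hypotheses (oO : open Omega) (fO : (leb2 (Omega : set mplane) < +oo)%E).
Hypotheses (spi : 0 < s < pi) (rr0 : 0 < rr).
Hypothesis corner : forall x, sqdist x0 x < rr ->
  (Omega x <-> slit x0 ga x /\ - s < angle x0 ga x < s).
Local Notation t := (sqdist x0).
Local Notation th := (angle x0 ga).
Local Notation w1 := (z1 x0).
Local Notation w2 := (z2 x0).
Local Notation Q := (box 0 rr (- s) s).
Local Notation D := (corner_part Omega x0 rr).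
Local Notation up := (unpolar x0 ga).
Let mO := measurable_open oO.
Let oD : open D := @open_corner_part _ _ x0 rr oO.
Let mD := measurable_open oD.

Definition annulus (a b : R) : set plane := [set x | D x /\ a < t x < b].

Lemma annulus_sub a b : annulus a b `<=` Omega. Proof. by move=> x [[]]. Qed.

Lemma open_annulus a b : open (annulus a b).
Proof.
have /continuousP H := @continuous_sqdist R x0.
have -> : annulus a b = D `&` (t @^-1` [set u | a < u] `&` t @^-1` [set u | u < b]).
  by apply/seteqP; split => x [Dx]; [move=> /andP[]|move=> [/= h1 h2]; split=> //; rewrite h1].
apply: openI => //; apply: openI; [exact: (H _ (@open_gt R a))|exact: (H _ (@open_lt R b))].
Qed.

Lemma measurable_annulus a b : measurable (annulus a b : set mplane).
Proof. exact: measurable_open (@open_annulus a b). Qed.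

Let box_sub a b : 0 <= a -> b <= rr -> box a b (- s) s `<=` Q.
Proof. by move=> a0 brr p [/andP[p1 p2] p3]; split=> //; rewrite (le_lt_trans a0 p1) (lt_le_trans p2). Qed.

Lemma unpolar_annulus a b p : 0 <= a -> b <= rr -> box a b (- s) s p ->
  [/\ annulus a b (up p), t (up p) = p.1 & th (up p) = p.2].
Proof.
move=> a0 brr Bp; have [Dp tp thp] := unpolar_corner_part spi corner (box_sub a0 brr Bp).
by split=> //; split=> //; rewrite tp; case: Bp.
Qed.

Lemma measurable_up : measurable_fun (setT : set mplane) (up : mplane -> mplane).
Proof.
have m1 : measurable_fun (setT : set mplane) (fun p : mplane => (up p).1 : mR).
  apply: (continuous_on_measurable openT) => x _.
  by apply: continuous_comp; [exact: continuous_unpolar|exact: cvg_fst].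
have m2 : measurable_fun (setT : set mplane) (fun p : mplane => (up p).2 : mR).
  apply: (continuous_on_measurable openT) => x _.
  by apply: continuous_comp; [exact: continuous_unpolar|exact: cvg_snd].
exact: (measurable_fun_pair m1 m2).
Qed.

Lemma measurable_unpolar a b (F : mplane -> R) : 0 <= a -> b <= rr ->
  measurable_fun (annulus a b : set mplane) F ->
  measurable_fun (box a b (- s) s : set mplane) (fun p : mplane => F (up p)).
Proof.
move=> a0 brr mF; apply: (@measurable_comp _ _ _ _ _ _ (annulus a b : set mplane) F (box a b (- s) s : set mplane) (up : mplane -> mplane)) => //.
- exact: measurable_annulus.
- by move=> _ [p Bp <-]; have [] := unpolar_annulus a0 brr Bp.
- exact: (measurable_funS measurableT (@subsetT _ _) measurable_up).
Qed.

Lemma annulus_integral : exists2 k : R, 0 < k & forall a b (F : mplane -> R), 0 <= a -> b <= rr ->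
  intble leb2 (annulus a b) F ->
  intble leb2 (box a b (- s) s) (fun p => F (up p)) /\
  \int[leb2]_(x in annulus a b) F x = k * \int[leb2]_(p in box a b (- s) s) F (up p).
Proof.
have [k k0 Hk] := polar_integral oO fO spi rr0 corner; exists k => // a b F a0 brr IF.
have mA := measurable_annulus a b; have mB := @measurable_box R a b (- s) s.
have AD : annulus a b `<=` D by move=> x [].
have mF := intble_measurable IF.
pose f : mplane -> R := (fun p => F (up p)) \_ (box a b (- s) s).
have mf : measurable_fun Q f.
  apply: (measurable_funS measurableT (@subsetT _ _)).
  by apply/(measurable_restrictT _ mB); exact: measurable_unpolar.
have E x : D x -> f (t x, th x) = (F \_ (annulus a b)) x.
  move=> Dx; have [tb|nb] := pselect (a < t x < b).
    rewrite /f patch_in; last by split=> //=; case: (corner_part_box corner Dx).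
    by rewrite patchE mem_set // polarK //; exact: (corner_part_slit corner).
  by rewrite /f patch_box; [rewrite patchE memNset // => -[]|move=> [] /= ? _; exact: nb].
have IFp : intble leb2 D (F \_ (annulus a b)).
  rewrite -(@intble_support _ _ _ leb2 (annulus a b) D _ mA mD AD); last first.
    by move=> x _ nA; rewrite patchE memNset.
  by apply: (intble_eq mA _ IF) => x Ax; rewrite patchE mem_set.
have If : intble leb2 D (fun x => f (t x, th x)).
  by apply: (intble_eq mD _ IFp) => x Dx; rewrite E.
have [IQ EQ] := Hk f mf If.
have BQ := box_sub a0 brr.
have out p : Q p -> ~ box a b (- s) s p -> f p = 0 by move=> _ nB; rewrite /f patch_box.
split.
  apply: (intble_eq mB (f := f)); first by move=> p Bp; rewrite /f patch_in.
  exact: (integrableS (@measurable_box R _ _ _ _) mB BQ IQ).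
transitivity (\int[leb2]_(x in D) f (t x, th x)).
  rewrite (@Rint_support _ _ _ leb2 (annulus a b) D) //; last first.
    by move=> x Dx nA; rewrite E // patchE memNset.
  by apply: Rint_eq => // x Ax; rewrite E ?patchE ?mem_set //; exact: AD.
rewrite EQ; congr (_ * _); rewrite (@Rint_support _ _ _ leb2 (box a b (- s) s) Q) //.
by apply: Rint_eq => // p Bp; rewrite /f patch_in.
Qed.

Lemma sqint_sub (A : set mplane) (f : mplane -> R) : measurable A -> A `<=` Omega ->
  sqint leb2 Omega f -> sqint leb2 A f.
Proof.
move=> mA AO [mf If]; split; first exact: (measurable_funS mO AO mf).
exact: (integrableS mO mA AO If).
Qed.

(* Since nothing is known about the rest of the domain, [v] is controlled by its
   gradient in the annulus only.  On suitable circles [t = t1] and [t = t2] the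
   function [v - m] is bounded by [M], so that the part of it that [trunc M]
   cuts off is [o(h)] in the mean on the collars of width [h] around them. *)
Lemma annulus_slices (a b a' b' K : R) : 0 < a -> a < a' -> a' < b' -> b' < b -> b <= rr ->
  exists M M', [/\ 0 <= M, 0 <= M' & forall (v : mplane -> R) (g : 'I_2 -> mplane -> R),
    H1_gradient Omega v g -> nrm2 leb2 Omega (g ord0) + nrm2 leb2 Omega (g ord_max) <= K ->
    exists m t1 t2 : R, [/\ a < t1 < a', b' < t2 < b,
      nrm2 leb2 (annulus a b) (fun x => v x - m) <= M' &
      forall u, u = t1 \/ u = t2 -> forall e h0, 0 < e -> 0 < h0 -> exists h, 0 < h < h0 /\
        nrm2 leb2 (annulus (u - h) (u + h)) (fun x => v x - m - trunc M (v x - m)) <= e * h ^+ 2]].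
Proof.
move=> a0 aa' ab' bb' brr; have [k k0 Hk] := annulus_integral.
have /andP[s0 _] := spi; have ss : - s < s by lra.
have a0' := ltW a0.
have mA := measurable_annulus a b; have mB := @measurable_box R a b (- s) s.
have AO := @annulus_sub a b.
(* In the coordinates (t, th) the squared derivatives are at most |grad v|^2 / (4 t) and t |grad
   v|^2, with [t] between [a] and [b]; the division by [k] passes from the annulus to the box. *)
pose c1 := (4 * a)^-1 * `|K| / k; pose c2 := b * `|K| / k.
have b0 : 0 < b by lra.
have c10 : 0 <= c1 by rewrite /c1 !mulr_ge0 ?invr_ge0 ?mulr_ge0 //; exact: ltW.
have c20 : 0 <= c2 by rewrite /c2 !mulr_ge0 ?invr_ge0 //; exact: ltW.
have K10 : 0 < c1 + c2 + 1 by lra.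
have [M [M0 HM]] := slices aa' ab' bb' ss K10.
exists M, (k * M); split=> //; first by rewrite mulr_ge0 // ltW.
move=> v g Hv gK; have [sv sg wg] := Hv.
have box_sqint (F : mplane -> R) : sqint leb2 (annulus a b) F -> sqint leb2 (box a b (- s) s) (fun p => F (up p)) /\
    nrm2 leb2 (annulus a b) F = k * nrm2 leb2 (box a b (- s) s) (fun p => F (up p)).
  move=> [mF IF]; have [I1 E1] := Hk a b (fun x => F x ^+ 2) a0' brr IF.
  by split=> //; split=> //; exact: measurable_unpolar.
have svA := sqint_sub mA AO sv; have sgA i := sqint_sub mA AO (sg i).
pose G x := (g ord0 x * w1 x + g ord_max x * w2 x) / (2 * t x).
pose H x := g ord_max x * w1 x - g ord0 x * w2 x.
have tA x : annulus a b x -> a < t x < b by case.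
have wt x : w1 x ^+ 2 + w2 x ^+ 2 = t x by [].
have mw1 : measurable_fun (annulus a b : set mplane) w1.
  by apply: (smooth_on_measurable (@open_annulus a b)); exact: smooth_on_sub (@smooth_on_z1 _ x0).
have mw2 : measurable_fun (annulus a b : set mplane) w2.
  by apply: (smooth_on_measurable (@open_annulus a b)); exact: smooth_on_sub (@smooth_on_z2 _ x0).
have mt : measurable_fun (annulus a b : set mplane) (fun x => (2 * t x)^-1).
  apply: (smooth_on_measurable (@open_annulus a b)).
  have st : smooth_on (annulus a b) (fun x => 2 * t x).
    apply: smooth_onM; [exact: open_annulus|exact/smooth_on_cst/open_annulus|].
    exact: smooth_on_sub (smooth_on_sqdist x0).
  apply: (smooth_on_comp (@open_annulus a b) (@smooth_on_inv R) st) => x Ax /=.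
  by rewrite mulf_neq0 // gt_eqF // (lt_trans a0) //; case/andP: (tA x Ax).
have [mg0 _] := sgA ord0; have [mg1 _] := sgA ord_max.
have sgg : intble leb2 (annulus a b) (fun x => g ord0 x ^+ 2 + g ord_max x ^+ 2).
  by apply: (intbleD mA); exact: sqint_sq (sgA _).
have ggK : \int[leb2]_(x in annulus a b) (g ord0 x ^+ 2 + g ord_max x ^+ 2) <= `|K|.
  apply: le_trans (ler_norm K); apply: le_trans gK.
  rewrite (RintD mA (sqint_sq (sgA _)) (sqint_sq (sgA _))).
  have le1 i : \int[leb2]_(x in annulus a b) (g i x ^+ 2) <= nrm2 leb2 Omega (g i).
    by apply: (le_Rint_sub mA mO AO); [move=> x _; exact: sqr_ge0|exact: sqint_sq (sg i)].
  exact: lerD (le1 ord0) (le1 ord_max).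
have cs (p q x y : R) : (p * x + q * y) ^+ 2 <= (p ^+ 2 + q ^+ 2) * (x ^+ 2 + y ^+ 2).
  by rewrite -subr_ge0 (_ : _ - _ = (p * y - q * x) ^+ 2) ?sqr_ge0 //; ring.
have weighted (F : mplane -> R) (c : R) : measurable_fun (annulus a b) F -> 0 <= c ->
    (forall x, annulus a b x -> F x ^+ 2 <= c * (g ord0 x ^+ 2 + g ord_max x ^+ 2)) ->
    sqint leb2 (annulus a b) F /\ nrm2 leb2 (annulus a b) F <= c * `|K|.
  move=> mF c0 Fc; have Ic := intbleZ mA c sgg.
  have IF : intble leb2 (annulus a b) (fun x => F x ^+ 2).
    apply: (intble_le mA _ _ Ic) => [|x Ax]; last by rewrite ger0_norm ?sqr_ge0 //; exact: Fc.
    by under eq_fun do rewrite expr2; exact: measurable_funM.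
  split; first by split.
  apply: le_trans (_ : \int[leb2]_(x in annulus a b) (c * (g ord0 x ^+ 2 + g ord_max x ^+ 2)) <= _).
    exact: le_Rintegral.
  by rewrite (RintZ mA _ sgg) ler_wpM2l.
have [sG GK] : sqint leb2 (annulus a b) G /\ nrm2 leb2 (annulus a b) G <= (4 * a)^-1 * `|K|.
  apply: weighted.
  - by apply: measurable_funM => //; apply: measurable_funD; exact: measurable_funM.
  - by rewrite invr_ge0 mulr_ge0.
  move=> x Ax; have /andP[ta tb] := tA x Ax; have t0 : 0 < t x := lt_trans a0 ta.
  rewrite /G expr_div_n; apply: le_trans (_ : (g ord0 x ^+ 2 + g ord_max x ^+ 2) * t x / (2 * t x) ^+ 2 <= _).
    by rewrite ler_wpM2r ?invr_ge0 ?sqr_ge0 // -wt; exact: cs.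
  have -> : (g ord0 x ^+ 2 + g ord_max x ^+ 2) * t x / (2 * t x) ^+ 2 =
      (4 * t x)^-1 * (g ord0 x ^+ 2 + g ord_max x ^+ 2) by field; rewrite gt_eqF.
  rewrite ler_wpM2r ?addr_ge0 ?sqr_ge0 // lef_pV2 ?posrE ?mulr_gt0 //.
  by rewrite ler_pM2l // ltW.
have [sH HK] : sqint leb2 (annulus a b) H /\ nrm2 leb2 (annulus a b) H <= b * `|K|.
  apply: weighted => //; first by apply: measurable_funB; exact: measurable_funM.
    exact: ltW.
  move=> x Ax; have /andP[ta tb] := tA x Ax.
  apply: le_trans (_ : (g ord0 x ^+ 2 + g ord_max x ^+ 2) * t x <= _).
    have := cs (g ord_max x) (g ord0 x) (w1 x) (- w2 x); rewrite sqrrN mulrN -wt.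
    by rewrite (addrC (g ord_max x ^+ 2)).
  by rewrite mulrC ler_wpM2r ?addr_ge0 ?sqr_ge0 // ltW.
have [sV EV] := box_sqint _ svA; have [sG' EG] := box_sqint _ sG; have [sH' EH] := box_sqint _ sH.
have transfer (F : mplane -> R) (al be : R -> R) (F1 : intble leb2 (annulus a b) F) :
    smooth_on setT al -> (exists2 A, 0 <= A & forall x, `|al x| <= A) ->
    smooth_on setT be -> (exists2 B, 0 <= B & forall x, `|be x| <= B) ->
    (forall r, ~ (a < r < b) -> al r = 0) ->
    \int[leb2]_(x in D) (F x * (al (t x) * be (th x))) =
    k * \int[leb2]_(p in box a b (- s) s) (F (up p) * (al p.1 * be p.2)).
  move=> sa [A A0 aA] sb [B B0 bB] al0.
  have mab : measurable_fun (annulus a b : set mplane) (fun x => al (t x) * be (th x)).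
    apply: (measurable_funS mD (fun x (Ax : annulus a b x) => Ax.1)).
    by apply: (smooth_on_measurable oD); exact: (smooth_on_pull oO corner).
  have IF : intble leb2 (annulus a b) (fun x => F x * (al (t x) * be (th x))).
    have bd x : annulus a b x -> `|al (t x) * be (th x)| <= A * B by move=> _; rewrite normrM ler_pM.
    apply: (intble_eq mA _ (intbleM mA mab bd F1)) => x _; exact: mulrC.
  rewrite (@Rint_support _ _ _ leb2 (annulus a b) D).
  - have [_ ->] := Hk a b _ a0' brr IF; congr (_ * _); apply: Rint_eq => // p Bp.
    by have [_ -> ->] := unpolar_annulus a0' brr Bp.
  - by move=> x [].
  - by move=> x Dx nA; rewrite al0 ?mul0r ?mulr0 // => ab; exact: nA.
have fA : (leb2 (annulus a b : set mplane) < +oo)%E.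
  by apply: le_lt_trans fO; apply: le_measure; rewrite ?inE.
have IvA := sqint_intble mA fA svA; have IGA := sqint_intble mA fA sG; have IHA := sqint_intble mA fA sH.
have wide (al : R -> R) : test1 a b al -> test1 0 rr al := test1_wide a0' brr.
have kI : injective ( *%R k) by apply: mulfI; rewrite gt_eqF.
have [||||m [t1 [t2 [at1 bt2 Vm Hu]]]] := HM _ _ _ sV sG' sH'.
- move=> al be ta tb; apply: kI.
  have [sa ba] := test1_props ta; have [sb bb] := test1_props tb; have [sda bda] := test1_props (test1_D ta).
  rewrite -(transfer _ _ _ IvA sda bda sb bb (test1_vanish (test1_D ta))) mulrN.
  rewrite -(transfer _ _ _ IGA sa ba sb bb (test1_vanish ta)).
  exact: (weak_radial oO fO spi corner Hv (wide _ ta) tb).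
- move=> al be ta tb; apply: kI.
  have [sa ba] := test1_props ta; have [sb bb] := test1_props tb; have [sdb bdb] := test1_props (test1_D tb).
  rewrite -(transfer _ _ _ IvA sa ba sdb bdb (test1_vanish ta)) mulrN.
  rewrite -(transfer _ _ _ IHA sa ba sb bb (test1_vanish ta)).
  exact: (weak_angular oO fO spi corner Hv (wide _ ta) tb).
- rewrite -(ler_pM2l k0) -EG; apply: le_trans GK _.
  have -> : k * (c1 + c2 + 1) = (4 * a)^-1 * `|K| + b * `|K| + k.
    by rewrite /c1 /c2; move: (4 * a)^-1 => A; field; rewrite gt_eqF.
  by rewrite -addrA lerDl addr_ge0 ?mulr_ge0 // ltW.
- rewrite -(ler_pM2l k0) -EH; apply: le_trans HK _.
  have -> : k * (c1 + c2 + 1) = (4 * a)^-1 * `|K| + b * `|K| + k.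
    by rewrite /c1 /c2; move: (4 * a)^-1 => A; field; rewrite gt_eqF.
  by rewrite -addrA addrCA lerDl addr_ge0 // ?(ltW k0) // mulr_ge0 // invr_ge0 mulr_ge0.
exists m, t1, t2.
have sm : sqint leb2 (annulus a b) (fun x => v x - m).
  by apply: (sqintB mA) => //; apply: (@sqint_bounded _ _ _ _ _ mA `|m|).
split=> //.
  have [_ ->] := box_sqint _ sm; rewrite ler_pM2l //.
move=> u ut e h0 e0 h00.
have uab : a < u < b := between_slices aa' ab' bb' at1 bt2 ut.
have h1 : 0 < Num.min h0 (Num.min (u - a) (b - u)).
  by rewrite !lt_min h00 /= !subr_gt0.
have ek : 0 < e / k by rewrite divr_gt0.
have [h [/andP[hp]]] := Hu u ut _ _ ek h1.
rewrite !lt_min => /andP[hh0 /andP[hu1 hu2]] He.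
exists h; rewrite hp hh0; split=> //.
have cM : continuous (trunc M) by have [] := C11_continuous (trunc_C11 M).
have [mVm _] := sm.
have sT : sqint leb2 (annulus a b) (fun x => v x - m - trunc M (v x - m)).
  apply: (@sqint_le _ _ _ _ _ mA _ (fun x => v x - m)) => //.
    by apply: measurable_funB => //; exact: (measurableT_comp (continuous_measurable_fun cM) mVm).
  by move=> x _; have := @trunc_error R M (v x - m) 0; rewrite normr0 subr0; apply.
have sub : annulus (u - h) (u + h) `<=` annulus a b.
  by move=> x [Dx tx]; split=> //; have [+ _ _] := strip_sub hu1 hu2; apply.
have IT : intble leb2 (annulus (u - h) (u + h)) (fun x => (v x - m - trunc M (v x - m)) ^+ 2).
  by apply: (integrableS mA (measurable_annulus _ _) sub); exact: sqint_sq.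
have [] := Hk (u - h) (u + h) _ _ _ IT.
- by have [_ ah _] := strip_sub hu1 hu2; exact: le_trans a0' (ltW ah).
- by have [_ _ bh] := strip_sub hu1 hu2; exact: le_trans (ltW bh) brr.
move=> _; rewrite /nrm2 => ->.
have -> : e * h ^+ 2 = k * (e / k * h ^+ 2) by field; rewrite gt_eqF.
by rewrite ler_pM2l.
Qed.

End annulus.

(** * Existence of the Leray projection *)

Section energy_arithmetic.
Context {R : realType}.
Implicit Types a b c d p q r k j : R.

(** In this lemma and the next two, [a], [b] and [c] are the values of a quadratic functional at two
    points and at their midpoint, [p] is the squared distance of the points and [j] a reference
    level; the two expansions encode the parallelogram identity. *)
Lemma midpoint_gap a b c d p q r j : a <= j + q -> b <= j + r ->
  b = a + 2 * 1 * d + 1 ^+ 2 * p -> c = a + 2 * (1 / 2) * d + (1 / 2) ^+ 2 * p ->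
  j <= c -> r <= q -> p <= 4 * q.
Proof. lra. Qed.

Lemma midpoint_level a b c d p q r j k : a <= j + q -> b <= j + r ->
  b = a + 2 * 1 * d + 1 ^+ 2 * p -> c = a + 2 * (1 / 2) * d + (1 / 2) ^+ 2 * p ->
  r <= q -> q <= k -> 0 <= p -> c <= j + k.
Proof. lra. Qed.

Lemma midpoint_norm a b c d p q r j : a <= j + q -> b <= j + r ->
  b = a + 2 * 1 * d + 1 ^+ 2 * p -> c = a + 2 * (1 / 2) * d + (1 / 2) ^+ 2 * p ->
  j - q < c -> r <= q -> p <= 8 * q.
Proof. lra. Qed.

Lemma near_minimum a b c p q j : a <= j + q -> j <= a + 2 * c * b + c ^+ 2 * p ->
  0 <= q + 2 * c * b + c ^+ 2 * p.
Proof. by move: (2 * c * b) (c ^+ 2 * p) => x y; lra. Qed.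

Lemma double_le (x y z : R) : x <= z -> y <= z -> x + y <= 2 * z. Proof. lra. Qed.

Lemma six_le (x y z w : R) : z <= y -> w <= 2 * x -> y <= x -> 2 * z + 2 * w <= 6 * x. Proof. lra. Qed.

End energy_arithmetic.

Section abstract_leray.
Context {R : realType}.
Local Notation plane := (R * R)%type.
Local Notation mplane := (measurableTypeR R * measurableTypeR R)%type.
Variable Omega : set plane.
Hypotheses (oO : open Omega) (fO : (leb2 (Omega : set mplane) < +oo)%E).
Hypothesis pO : (0 < leb2 (Omega : set mplane))%E.
Let mO := measurable_open oO.
Local Notation sq f := (sqint leb2 Omega f).
Local Notation N f := (nrm2 leb2 Omega f).
Implicit Types (v w : mplane -> R) (g h : 'I_2 -> mplane -> R).

Lemma sum_ord2 (f : 'I_2 -> R) : \sum_(i < 2) f i = f ord0 + f ord_max.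
Proof. by rewrite big_ord_recl big_ord_recl big_ord0 addr0; congr (_ + f _); exact: val_inj. Qed.

Definition gip g h : R := ip leb2 Omega (g ord0) (h ord0) + ip leb2 Omega (g ord_max) (h ord_max).
Definition gnrm2 g : R := N (g ord0) + N (g ord_max).
Definition gadd g (c : R) h : 'I_2 -> mplane -> R := fun i x => g i x + c * h i x.
Definition gsq g := forall i, sq (g i).

Lemma gadd_sq g c h : gsq g -> gsq h -> gsq (gadd g c h).
Proof. by move=> sg sh i; apply: (sqintD mO) => //; exact: (sqintZ mO). Qed.

Lemma gnrm2_ge0 g : 0 <= gnrm2 g. Proof. by rewrite addr_ge0 // nrm2_ge0. Qed.

Lemma gnrm2_gadd g c h : gsq g -> gsq h ->
  gnrm2 (gadd g c h) = gnrm2 g + 2 * c * gip g h + c ^+ 2 * gnrm2 h.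
Proof.
move=> sg sh; have E i : N (gadd g c h i) = N (g i) + 2 * c * ip leb2 Omega (g i) (h i) + c ^+ 2 * N (h i).
  have sc := sqintZ mO c (sh i).
  by rewrite /gadd (nrm2D mO (sg i) sc) (nrm2Z mO c (sh i)) ipC (ipZl mO c (sh i) (sg i)) ipC; ring.
by rewrite /gnrm2 !E /gip; ring.
Qed.

Lemma gip_gadd g c h k : gsq g -> gsq h -> gsq k ->
  gip (gadd g c h) k = gip g k + c * gip h k.
Proof.
move=> sg sh sk; have E i : ip leb2 Omega (gadd g c h i) (k i) = ip leb2 Omega (g i) (k i) + c * ip leb2 Omega (h i) (k i).
  have sc := sqintZ mO c (sh i).
  by rewrite /gadd (ipDl mO (sg i) sc (sk i)) (ipZl mO c (sh i) (sk i)).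
by rewrite /gip !E; ring.
Qed.

Lemma discriminant (a p q : R) : 0 <= q -> (forall c, 0 <= p + 2 * c * a + c ^+ 2 * q) -> a ^+ 2 <= p * q.
Proof.
move=> q0 pos; have [q1|q1] := ltrP 0 q.
  have := pos (- (a / q)).
  have -> : p + 2 * - (a / q) * a + (- (a / q)) ^+ 2 * q = (p * q - a ^+ 2) / q by field; rewrite gt_eqF.
  by rewrite pmulr_lge0 ?invr_gt0 // subr_ge0.
have q00 : q = 0 by lra.
subst q; suff -> : a = 0 by rewrite expr0n /= mulr0.
apply/eqP; apply: contraT => a0; have := pos (- ((p + 1) / (2 * a))).
have -> : p + 2 * - ((p + 1) / (2 * a)) * a + (- ((p + 1) / (2 * a))) ^+ 2 * 0 = - 1 by field.
by rewrite oppr_ge0 ler10.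
Qed.

Lemma gcauchy_schwarz g h : gsq g -> gsq h -> gip g h ^+ 2 <= gnrm2 g * gnrm2 h.
Proof.
move=> sg sh; apply: discriminant => [|c]; first exact: gnrm2_ge0.
by rewrite -gnrm2_gadd // gnrm2_ge0.
Qed.

Lemma geometric_le0 (x c : R) : (forall n : nat, x <= c * 8^-1 ^+ n) -> x <= 0.
Proof.
move=> H; rewrite leNgt; apply/negP => x0.
have g0 : (8^-1 : R) ^+ n @[n --> \oo] --> (0 : R).
  by apply: cvg_expr; rewrite ger0_norm ?invr_ge0 // invf_lt1 // ltr1n.
have C : c * (8^-1 : R) ^+ n @[n --> \oo] --> (0 : R).
  by rewrite -(mulr0 c); apply: cvgM => //; exact: cvg_cst.
have [M _ HM] := cvgr_lt 0 C _ x0.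
by have := lt_le_trans (HM M (leqnn M)) (H M); rewrite ltxx.
Qed.

Definition vadd v (c : R) w : mplane -> R := fun x => v x + c * w x.

Lemma vadd_sq v c w : sq v -> sq w -> sq (vadd v c w).
Proof. by move=> sv sw; apply: (sqintD mO) => //; exact: (sqintZ mO). Qed.

Lemma nrm2_vadd v c w : sq v -> sq w ->
  N (vadd v c w) = N v + 2 * c * ip leb2 Omega v w + c ^+ 2 * N w.
Proof.
move=> sv sw; have sc := sqintZ mO c sw.
by rewrite /vadd (nrm2D mO sv sc) (nrm2Z mO c sw) ipC (ipZl mO c sw sv) ipC; ring.
Qed.

Lemma H1_vadd v g c w h : H1_gradient Omega v g -> H1_gradient Omega w h ->
  H1_gradient Omega (vadd v c w) (gadd g c h).
Proof.
move=> [sv sg wg] [sw sh wh]; split; first exact: vadd_sq.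
  exact: gadd_sq.
by move=> i; exact: (weak_partial_linear oO fO c sv (sg i) sw (sh i) (wg i) (wh i)).
Qed.

Lemma test_sq phi : test_function Omega phi -> sq (phi : mplane -> R).
Proof.
move=> tp; have [M M0 bM] := test_bounded (test_function_sub (@subsetT _ Omega) tp).
apply: (@sqint_bounded _ _ _ _ _ mO M _ fO); last by move=> x _; exact: bM.
exact: (test_measurable_fun oO tp).
Qed.

Lemma ip_small v w (e : R) : sq v -> sq w -> N v <= e -> ip leb2 Omega v w ^+ 2 <= e * N w.
Proof.
move=> sv sw ve; apply: le_trans (cauchy_schwarz mO sv sw) _.
by rewrite ler_wpM2r // nrm2_ge0.
Qed.

Lemma sqrD_le (x y : R) : (x + y) ^+ 2 <= 2 * x ^+ 2 + 2 * y ^+ 2.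
Proof. by rewrite -subr_ge0 (_ : _ - _ = (x - y) ^+ 2) ?sqr_ge0 //; ring. Qed.

Lemma weak_partial_limit (i : 'I_2) v w (v_ w_ : nat -> mplane -> R) : sq v -> sq w ->
  (forall n, sq (v_ n)) -> (forall n, sq (w_ n)) ->
  (forall n, weak_partial Omega [:: i] (v_ n) (w_ n)) ->
  (forall n, N (fun x => v_ n x - v x) <= 8^-1 ^+ n) ->
  (forall n, N (fun x => w_ n x - w x) <= 8^-1 ^+ n) ->
  weak_partial Omega [:: i] v w.
Proof.
move=> sv sw sv_ sw_ W cv cw; apply/weak_partialP => phi tp.
have sp := test_sq tp; have sd := test_sq (test_function_D (basis2 i) tp).
set dp : mplane -> R := fun x => 'D_(basis2 i) phi x in sd.
apply/eqP; rewrite -addr_eq0; apply/eqP.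
rewrite -[X in X + _]/(ip leb2 Omega v dp) -[X in _ + X]/(ip leb2 Omega w phi).
set x := _ + _; apply/eqP; rewrite -sqrf_eq0 eq_le sqr_ge0 andbT.
apply: (@geometric_le0 _ (2 * N dp + 2 * N phi)) => n.
have W0 : ip leb2 Omega (v_ n) dp + ip leb2 Omega (w_ n) phi = 0.
  by have := (weak_partialP Omega i _ _).1 (W n) phi tp; rewrite /ip => ->; rewrite addNr.
have s1 := sqintB mO (sv_ n) sv; have s2 := sqintB mO (sw_ n) sw.
have -> : x = - (ip leb2 Omega (fun x => v_ n x - v x) dp + ip leb2 Omega (fun x => w_ n x - w x) phi).
  rewrite (ipBl mO (sv_ n) sv sd) (ipBl mO (sw_ n) sw sp) /x.
  move: W0; move: (ip _ _ (v_ n) _) (ip _ _ (w_ n) _) (ip _ _ v _) (ip _ _ w _) => A B C E W0.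
  by have -> : B = - A; [apply/eqP; rewrite -addr_eq0 addrC W0|ring].
rewrite sqrrN; apply: le_trans (sqrD_le _ _) _.
have b1 := ip_small s1 sd (cv n); have b2 := ip_small s2 sp (cw n).
have -> : (2 * N dp + 2 * N phi) * 8^-1 ^+ n = 2 * (8^-1 ^+ n * N dp) + 2 * (8^-1 ^+ n * N phi) by ring.
by apply: lerD; rewrite ler_pM2l.
Qed.

Section existence.
Variable F : 'I_2 -> mplane -> R.
Hypothesis sF : gsq F.
Let E g := gnrm2 (gadd F 1 g).
Local Notation H1 := (H1_gradient Omega).

Let H0 : H1 (fun=> 0) (fun _ _ => 0). Proof. exact: H1_gradient_cst. Qed.

Let E0 : E (fun _ _ => 0) = gnrm2 F.
Proof. by rewrite /E; congr gnrm2; apply/funext => i; apply/funext => x; rewrite /gadd mulr0 addr0. Qed.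

Let Eadd g c h : gsq g -> gsq h ->
  E (gadd g c h) = E g + 2 * c * gip (gadd F 1 g) h + c ^+ 2 * gnrm2 h.
Proof.
move=> sg sh; rewrite /E -gnrm2_gadd //; last exact: gadd_sq.
by congr gnrm2; apply/funext => i; apply/funext => x; rewrite /gadd; ring.
Qed.

(* The hypothesis replaces a Poincare inequality, which fails in general: at an
   arbitrarily small cost in energy a competitor can be taken with a bounded
   L^2 norm. *)
Lemma leray_projection_exists (K : R) :
  (forall v g, H1 v g -> E g <= gnrm2 F + 1 -> forall e, 0 < e ->
    exists v' g', [/\ H1 v' g', E g' <= E g + e & N v' <= K]) ->
  exists PF, leray_projection Omega F PF.
Proof.
move=> HK.
pose A : set R := [set E g | g in [set g | exists v, H1 v g]].
have A0 : A (gnrm2 F) by exists (fun _ _ => 0) => //=; exists (fun=> 0).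
have Alb : lbound A 0 by move=> _ [g _ <-]; exact: gnrm2_ge0.
have hA : has_inf A by split; [exists (gnrm2 F)|exists 0].
have [J EJ] : exists J, J = inf A by exists (inf A).
have JE v g : H1 v g -> J <= E g by move=> vg; rewrite EJ; apply: (ge_inf hA.2); exists g => //; exists v.
have JF : J <= gnrm2 F by rewrite -E0; exact: JE H0.
pose Lv (e : R) v := exists g, H1 v g /\ E g <= J + e.
have LK e : 0 < e -> exists v, Lv e v /\ N v <= K.
  move=> e0; pose e1 := Num.min e 1.
  have e10 : 0 < e1 / 2 by rewrite /e1 divr_gt0 // lt_min e0 ltr01.
  have [_ [g [v vg] <-] Eg] := inf_adherent e10 hA.
  have e1b : e1 <= 1 by rewrite ge_min lexx orbT.
  have e1e : e1 <= e by rewrite ge_min lexx.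
  have [|v' [g' [vg' Eg' Nv']]] := HK v g vg _ (e1 / 2) e10.
    by apply: le_trans (ltW Eg) _; rewrite -EJ; move: JF e1b; move: (gnrm2 F) (J) (e1) => X Y Z; lra.
  exists v'; split=> //; exists g'; split=> //; apply: le_trans Eg' _.
  by move: Eg e1e; rewrite -EJ; move: (E g) (J) (e1) => X Y Z; lra.
(* A second minimisation, of the L^2 norm among functions of nearly minimal energy. The energy alone
   controls only gradients; the minimal norm makes the functions themselves converge. *)
pose B : set R := [set r | forall e, 0 < e -> exists v, Lv e v /\ N v <= r].
have BK : B K by exact: LK.
have hB : has_inf B.
  split; first by exists K.
  by exists 0 => r /(_ 1 ltr01) [v [_ h]]; apply: le_trans h; exact: nrm2_ge0.
have [S ES] : exists S, S = inf B by exists (inf B).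
have near e eta : 0 < e -> 0 < eta -> exists v g, [/\ H1 v g, E g <= J + e & N v <= S + eta].
  move=> e0 eta0; have [r Br] := inf_adherent eta0 hB; rewrite -ES => rS.
  have [v [[g [vg Eg]] Nv]] := Br e e0; exists v, g; split=> //.
  exact: le_trans Nv (ltW rS).
pose eta (n : nat) : R := 8^-1 ^+ n / 8.
have eta0 n : 0 < eta n by rewrite divr_gt0 // exprn_gt0 // invr_gt0.
(* Since [S] is an infimum, functions whose energy is close enough to the minimum cannot have a norm
   noticeably below it. *)
have far n : exists e, 0 < e /\ forall v, Lv e v -> S - eta n < N v.
  apply: contrapT => nex; have : B (S - eta n).
    move=> e e0; apply: contrapT => nv; apply: nex; exists e; split=> // v Lev.
    by rewrite ltNge; apply/negP => h; apply: nv; exists v.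
  move=> /(ge_inf hB.2); rewrite -ES; have := eta0 n; move: (S) (eta n) => X Y; lra.
have [f Hf] := choice far.
(* The precision of the n-th energy: decreasing in [n], fine enough for the lower bound on the norm,
   and below the geometric rate. *)
pose e_ := fix e_ n := if n is m.+1 then Num.min (e_ m) (Num.min (f n) (eta n)) else Num.min (f 0%N) (eta 0%N).
have e_0 n : 0 < e_ n.
  by elim: n => [|n IH] /=; rewrite !lt_min ?IH ?(Hf _).1 ?eta0.
have e_f n : e_ n <= f n /\ e_ n <= eta n by case: n => [|n] /=; rewrite !ge_min !lexx ?orbT.
have e_S n m : (n <= m)%N -> e_ m <= e_ n.
  elim: m => [|m IH]; first by rewrite leqn0 => /eqP ->.
  rewrite leq_eqVlt => /orP[/eqP -> //|/IH h]; apply: le_trans h.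
  by rewrite /= ge_min lexx.
have eta_le n m : (n <= m)%N -> eta m <= eta n.
  move=> nm; rewrite /eta ler_pM2r ?invr_gt0 //.
  by apply: ler_wiXn2l => //; rewrite ?invr_ge0 // invf_le1 // ler1n.
have Hex n : exists V : (mplane -> R) * ('I_2 -> mplane -> R),
    [/\ H1 V.1 V.2, E V.2 <= J + e_ n & N V.1 <= S + eta n].
  by have [v [g h]] := near _ _ (e_0 n) (eta0 n); exists (v, g).
have [V HV] := choice Hex.
pose v_ n := (V n).1; pose g_ n := (V n).2.
have sv_ n : sq (v_ n) by have [[]] := HV n.
have sg_ n : gsq (g_ n) by have [[]] := HV n.
(* Convexity is used twice. The midpoint has energy at least [J], which makes the gradients close;
   it has itself nearly minimal energy, hence a norm above [S - eta n], which makes the functions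
   close. *)
have cau n m : (n <= m)%N -> N (fun x => v_ m x - v_ n x) <= 8^-1 ^+ n /\
    forall i, N (fun x => g_ m i x - g_ n i x) <= 8^-1 ^+ n.
  move=> nm; have [Hn En Nn] := HV n; have [Hm Em Nm] := HV m.
  pose dv := vadd (v_ m) (- 1) (v_ n); pose dg := gadd (g_ m) (- 1) (g_ n).
  have Hd : H1 dv dg by exact: H1_vadd.
  have Hmid := H1_vadd (1 / 2) Hn Hd.
  have [sdv sdg _] := Hd.
  have E1 : E (g_ m) = E (g_ n) + 2 * 1 * gip (gadd F 1 (g_ n)) dg + 1 ^+ 2 * gnrm2 dg.
    rewrite -Eadd //; congr E; apply/funext => i; apply/funext => x.
    by rewrite /gadd /dg /gadd; ring.
  have E2 := Eadd (1 / 2) (sg_ n) sdg.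
  have N1 : N (v_ m) = N (v_ n) + 2 * 1 * ip leb2 Omega (v_ n) dv + 1 ^+ 2 * N dv.
    rewrite -nrm2_vadd //; congr (nrm2 _ _ _); apply/funext => x.
    by rewrite /vadd /dv /vadd; ring.
  have N2 := nrm2_vadd (1 / 2) (sv_ n) sdv.
  have Jm := JE _ _ Hmid; have [e_fn e_etan] := e_f n; have enm := e_S n m nm.
  have gle : gnrm2 dg <= 4 * e_ n.
    exact: (midpoint_gap En Em E1 E2 Jm enm).
  have mid : S - eta n < N (vadd (v_ n) (1 / 2) dv).
    apply: (Hf n).2; exists (gadd (g_ n) (1 / 2) dg); split=> //.
    have gd0 := gnrm2_ge0 dg.
    exact: (midpoint_level En Em E1 E2 enm e_fn gd0).
  have ee : 8^-1 ^+ n = 8 * eta n by rewrite /eta; field.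
  split.
    rewrite (_ : (fun x => _) = dv); last by apply/funext => x; rewrite /dv /vadd; ring.
    rewrite ee; exact: (midpoint_norm Nn Nm N1 N2 mid (eta_le n m nm)).
  move=> i; rewrite (_ : (fun x => _) = dg i); last by apply/funext => x; rewrite /dg /gadd; ring.
  apply: le_trans (_ : gnrm2 dg <= _).
    have [->|/ord2_max ->] := eqVneq i ord0; first by rewrite lerDl nrm2_ge0.
    by rewrite lerDr nrm2_ge0.
  rewrite ee; apply: le_trans gle _.
  by apply: ler_pM => //; [exact: ltW|rewrite ler_nat].
have [q sq_q cq] := sqint_rapidly_cauchy mO sv_ (fun n m nm => (cau n m nm).1).
have [G0 sG0 cG0] := sqint_rapidly_cauchy mO (fun n => sg_ n ord0) (fun n m nm => (cau n m nm).2 ord0).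
have [G1 sG1 cG1] := sqint_rapidly_cauchy mO (fun n => sg_ n ord_max) (fun n m nm => (cau n m nm).2 ord_max).
pose G : 'I_2 -> mplane -> R := fun i => if i == ord0 then G0 else G1.
have sG : gsq G by move=> i; rewrite /G; case: ifP.
have cG i n : N (fun x => g_ n i x - G i x) <= 8^-1 ^+ n.
  by have [->|/ord2_max ->] := eqVneq i ord0; [exact: cG0|exact: cG1].
have Hq : H1 q G.
  split=> // i; apply: (weak_partial_limit sq_q (sG i) sv_ (fun n => sg_ n i) _ cq (cG i)).
  by move=> n; have [[_ _ w] _ _] := HV n; exact: w.
(* Near the minimum the energy along [h] is a quadratic polynomial that stays above [J]. Its
   discriminant bounds the linear coefficient by the precision [e_ n], and the bound passes to the
   limit. *)
have EL phi h : H1 phi h -> gip (gadd F 1 G) h = 0.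
  move=> Hphi; have [_ sh _] := Hphi; apply/eqP; rewrite -sqrf_eq0 eq_le sqr_ge0 andbT.
  apply: (@geometric_le0 _ (2 * gnrm2 h + 4 * gnrm2 h)) => n.
  have [Hn En _] := HV n; have h0 := gnrm2_ge0 h.
  have step1 : gip (gadd F 1 (g_ n)) h ^+ 2 <= e_ n * gnrm2 h.
    apply: discriminant => // c; have := JE _ _ (H1_vadd c Hn Hphi).
    rewrite (Eadd _ (sg_ n) sh); exact: near_minimum En.
  have sd : gsq (gadd G (- 1) (g_ n)) by exact: gadd_sq.
  have step2 : gip (gadd G (- 1) (g_ n)) h ^+ 2 <= (2 * 8^-1 ^+ n) * gnrm2 h.
    apply: le_trans (gcauchy_schwarz sd sh) _; rewrite ler_wpM2r //.
    have Ei i : N (gadd G (- 1) (g_ n) i) = N (fun x => g_ n i x - G i x).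
      rewrite -[RHS]nrm2N; congr (nrm2 _ _ _); apply/funext => x; rewrite /gadd; ring.
    rewrite /gnrm2 !Ei; exact: double_le.
  have -> : gip (gadd F 1 G) h = gip (gadd F 1 (g_ n)) h + gip (gadd G (- 1) (g_ n)) h.
    rewrite !gip_gadd //; ring.
  apply: le_trans (sqrD_le _ _) _.
  have ee : e_ n <= 8^-1 ^+ n.
    have [_ h1] := e_f n; apply: le_trans h1 _; rewrite /eta ler_pdivrMr // ler_peMr ?ler1n //.
  have step3 : e_ n * gnrm2 h <= 8^-1 ^+ n * gnrm2 h by rewrite ler_wpM2r.
  have -> : (2 * gnrm2 h + 4 * gnrm2 h) * 8^-1 ^+ n = 6 * (8^-1 ^+ n * gnrm2 h) by ring.
  by rewrite -mulrA in step2; exact: six_le step1 step2 step3.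
pose vol := fine (leb2 (Omega : set mplane)).
have vol0 : 0 < vol by rewrite /vol fine_gt0 // pO.
pose m := (\int[leb2]_(x in Omega) q x) / vol.
exists (gadd F 1 G); split; first exact: sF.
exists (vadd q (- m) (fun=> 1)), (gadd G (- m) (fun _ _ => 0)); split.
- by apply: H1_vadd => //; exact: H1_gradient_cst.
- have I1 : intble leb2 Omega (fun=> 1 : R).
    by apply: (sqint_intble mO fO); apply: (@sqint_bounded _ _ _ _ _ mO `|1| _ fO).
  rewrite /vadd (RintD mO (sqint_intble mO fO sq_q) (intbleZ mO _ I1)) (RintZ mO _ I1).
  rewrite Rintegral_cst // mul1r -/vol /m mulNr divfK ?subrr // gt_eqF //.
- by move=> i x _; rewrite /gadd; ring.
move=> phi h Hphi; have [_ sh _] := Hphi; transitivity (gip (gadd F 1 G) h); last exact: EL Hphi.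
have sP := gadd_sq 1 sF sG.
rewrite /gip /ip -(RintD mO (sqint_mul mO (sP ord0) (sh ord0)) (sqint_mul mO (sP ord_max) (sh ord_max))).
by apply: Rint_eq => // x _; rewrite sum_ord2.
Qed.

End existence.

End abstract_leray.

Section step_derivative.
Context {R : realType}.

Lemma step_D_out (x : R) : x < 0 \/ 1 < x -> 'D_1 (step : R -> R) x = 0.
Proof.
case=> hx.
  rewrite (@near_eq_derive _ _ _ (step : R -> R) (cst 0) x 1) ?derive_cst //.
  by apply: (open_near_eq (@open_lt R 0)) => // y /set_mem /= y0; rewrite step0 // ltW.
rewrite (@near_eq_derive _ _ _ (step : R -> R) (cst 1) x 1) ?derive_cst //.
by apply: (open_near_eq (@open_gt R 1)) => // y /set_mem /= y0; rewrite step1 // ltW.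
Qed.

Definition unit_support (g : R -> R) := smooth_on setT g /\ forall x, x < 0 \/ 1 < x -> g x = 0.

Lemma unit_support_D (g : R -> R) : unit_support g -> unit_support (fun x => 'D_1 g x).
Proof.
move=> [sg g0]; split; first by move=> n; exact: (sg n.+1).2.
move=> x [hx|hx]; rewrite (@near_eq_derive _ _ _ g (cst 0) x 1) ?derive_cst //.
  by apply: (open_near_eq (@open_lt R 0)) => // y /set_mem /= y0; rewrite g0 //; left.
by apply: (open_near_eq (@open_gt R 1)) => // y /set_mem /= y0; rewrite g0 //; right.
Qed.

Lemma unit_support_bounded (g : R -> R) : unit_support g -> exists2 L : R, 1 <= L & forall x, `|g x| <= L.
Proof.
move=> [sg g0]; have cD : continuous (fun x : R => `|g x|).
  have cd : continuous g by exact: smooth1_continuous.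
  by move=> x; apply: cvg_norm; exact: cd.
have [c _ Hc] := @EVT_max R (fun x => `|g x|) 0 1 ler01 (continuous_subspaceT cD).
exists (1 + `|g c|); first by rewrite lerDl.
move=> x; have [xI|] := boolP (x \in `[0, 1]); first by apply: le_trans (Hc x xI) _; rewrite lerDr.
rewrite in_itv /= negb_and -!ltNge => /orP hx; rewrite g0 // normr0.
by rewrite addr_ge0.
Qed.

Lemma unit_support_step : unit_support (fun x => 'D_1 (step : R -> R) x).
Proof.
split; first by move=> n; exact: (@smooth_on_step R n.+1).2.
exact: step_D_out.
Qed.

Lemma step_D_bounded : exists2 L : R, 1 <= L & forall x, `|'D_1 (step : R -> R) x| <= L.
Proof. exact: unit_support_bounded unit_support_step. Qed.

Lemma smooth_on_scaled_step (p k : R) : smooth_on setT (fun r : R => step (p * r + k)).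
Proof.
move=> n; apply: (@diffn_comp _ _ n setT setT step (fun r : R => p * r + k)) => //.
- exact: openT.
- exact: smooth_on_step.
- exact: smooth_on_affine.
Qed.

Lemma derive_scaled_step (p k : R) (f : R * R -> R) (x v : R * R) : differentiable f x ->
  'D_v (fun y => step (p * f y + k)) x = 'D_1 (step : R -> R) (p * f x + k) * (p * 'D_v f x).
Proof.
move=> df; have dp : differentiable (cst p : R * R -> R) x by exact: differentiable_cst.
have dk : differentiable (cst k : R * R -> R) x by exact: differentiable_cst.
have dm : differentiable (fun y => p * f y) x by exact: differentiableM.
have da : differentiable (fun y => p * f y + k) x by exact: differentiableD.
have ds : differentiable (step : R -> R) (p * f x + k) by exact: (smooth_on_step 1%N).1.
rewrite (derive_comp1 v da ds); congr (_ * _).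
rewrite [LHS](deriveD (diff_derivable dm) (diff_derivable dk)) [X in X + _](derive_mul v dp df).
have -> : 'D_v (cst p : R * R -> R) x = 0 by exact: derive_cst.
have -> : 'D_v (cst k : R * R -> R) x = 0 by exact: derive_cst.
by rewrite mulr0 !addr0.
Qed.

Lemma sqr_le_le (x y : R) : 0 <= y -> x ^+ 2 <= y ^+ 2 -> x <= y.
Proof. by move=> y0 h; rewrite leNgt; apply/negP => yx; nra. Qed.

Lemma sqr_norm_le (x y : R) : `|x| <= `|y| -> x ^+ 2 <= y ^+ 2.
Proof. by move=> h; rewrite -(real_normK (num_real x)) -(real_normK (num_real y)) ler_sqr ?nnegrE. Qed.

Lemma convex_bound (c d : R) : 0 <= c <= 1 -> `|d| <= 1 -> `|c + (1 - c) * d| <= 1.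
Proof. by rewrite !ler_norml => h1 h2; apply/andP; split; nra. Qed.

End step_derivative.

(** * Radial cutoffs and competitors *)

Section radial_cutoff.
Context {R : realType}.
Local Notation plane := (R * R)%type.
Variable x0 : plane.
Local Notation t := (sqdist x0).

Definition cutoff (t1 t2 h1 h2 : R) (x : plane) : R :=
  step (2 / h1 * t x + - (2 / h1 * t1)) * step (- (2 / h2) * t x + 2 / h2 * t2).

Section cutoff.
Variables t1 t2 h1 h2 : R.
Hypotheses (h10 : 0 < h1) (h20 : 0 < h2).
Local Notation chi := (cutoff t1 t2 h1 h2).

Lemma smooth_on_cutoff : smooth_on setT chi.
Proof.
have st := smooth_on_sqdist x0.
apply: (smooth_onM openT).
  exact: (smooth_on_comp openT (smooth_on_scaled_step (2 / h1) (- (2 / h1 * t1))) st).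
exact: (smooth_on_comp openT (smooth_on_scaled_step (- (2 / h2)) (2 / h2 * t2)) st).
Qed.

Lemma cutoff_01 x : 0 <= chi x <= 1.
Proof. by rewrite /cutoff mulr_ge0 ?step_ge0 //= mulr_ile1 ?step_ge0 ?step_le1. Qed.

Lemma cutoff_one x : t1 + h1 <= t x <= t2 - h2 -> chi x = 1.
Proof.
move=> /andP[u1 u2]; rewrite /cutoff !step1 ?mulr1 //.
  have -> : - (2 / h2) * t x + 2 / h2 * t2 = 2 * ((t2 - t x) / h2) by field; rewrite gt_eqF.
  have : 1 <= (t2 - t x) / h2 by rewrite ler_pdivlMr // mul1r; move: u2; move: (t x) => T; lra.
  by move: (_ / h2) => X; lra.
have -> : 2 / h1 * t x + - (2 / h1 * t1) = 2 * ((t x - t1) / h1) by field; rewrite gt_eqF.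
have : 1 <= (t x - t1) / h1 by rewrite ler_pdivlMr // mul1r; move: u1; move: (t x) => T; lra.
by move: (_ / h1) => X; lra.
Qed.

Lemma cutoff_out x : ~ (t1 < t x < t2) -> chi x = 0.
Proof.
move=> /negP; rewrite negb_and -!leNgt => /orP[u|u]; rewrite /cutoff.
  rewrite step0 ?mul0r // -mulrBr mulr_ge0_le0 ?subr_le0 //.
  by rewrite divr_ge0 // ltW.
rewrite [X in _ * X]step0 ?mulr0 // mulNr addrC -mulrBr mulr_ge0_le0 ?subr_le0 //.
by rewrite divr_ge0 // ltW.
Qed.

(** The squared derivative is split into one term for each collar, as the two collars have unrelated
    widths. The size comes from the slope 2 / h of the argument, the bound [L] on the derivative of
    [step] and the bound 4 t on a squared partial derivative of [t]. *)
Lemma cutoff_D (L : R) (i : 'I_2) x : (forall y, `|'D_1 (step : R -> R) y| <= L) ->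
  exists dA dB : R, [/\ ('D_(basis2 i) chi x) ^+ 2 <= 2 * dA + 2 * dB, 0 <= dA & 0 <= dB] /\
    [/\ dA <= 16 * L ^+ 2 * t x / h1 ^+ 2, dB <= 16 * L ^+ 2 * t x / h2 ^+ 2,
     (~ (t1 - h1 < t x < t1 + h1) -> dA = 0) & (~ (t2 - h2 < t x < t2 + h2) -> dB = 0)].
Proof.
move=> HL; have dt : differentiable t x := smooth_on_diff (smooth_on_sqdist x0) I.
pose DA := 'D_1 (step : R -> R) (2 / h1 * t x + - (2 / h1 * t1)) * (2 / h1 * 'D_(basis2 i) t x).
pose DB := 'D_1 (step : R -> R) (- (2 / h2) * t x + 2 / h2 * t2) * (- (2 / h2) * 'D_(basis2 i) t x).
have tD : ('D_(basis2 i) t x) ^+ 2 <= 4 * t x.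
  rewrite derive_sqdist exprMn -natrX ler_pM2l //.
  have [->|/ord2_max ->] := eqVneq i ord0; rewrite ?basis2_0 ?basis2_max /= !mulr0 !mulr1 ?addr0 ?add0r.
    by rewrite /sqdist lerDl sqr_ge0.
  by rewrite /sqdist lerDr sqr_ge0.
have bound (y h c : R) : 0 < h -> c ^+ 2 = (2 / h) ^+ 2 ->
    ('D_1 (step : R -> R) y * (c * 'D_(basis2 i) t x)) ^+ 2 <= 16 * L ^+ 2 * t x / h ^+ 2.
  move=> h0 c2; rewrite !exprMn c2.
  have -> : 16 * L ^+ 2 * t x / h ^+ 2 = L ^+ 2 * ((2 / h) ^+ 2 * (4 * t x)).
    by move: (t x) => T; field; rewrite gt_eqF.
  apply: ler_pM (sqr_ge0 _) (mulr_ge0 (sqr_ge0 _) (sqr_ge0 _)) _ _.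
    apply: sqr_norm_le; apply: le_trans (HL y) _; exact: ler_norm.
  by apply: ler_wpM2l; [exact: sqr_ge0|].
exists (DA ^+ 2), (DB ^+ 2); split; split.
- have s1 := smooth_on_comp openT (smooth_on_scaled_step (2 / h1) (- (2 / h1 * t1))) (smooth_on_sqdist x0) (fun _ _ => I).
  have s2 := smooth_on_comp openT (smooth_on_scaled_step (- (2 / h2)) (2 / h2 * t2)) (smooth_on_sqdist x0) (fun _ _ => I).
  rewrite [X in X ^+ 2](derive_mul _ (smooth_on_diff s1 I) (smooth_on_diff s2 I)).
  rewrite (derive_scaled_step _ _ _ dt) (derive_scaled_step _ _ _ dt) -/DA -/DB.
  apply: le_trans (sqrD_le _ _) _; rewrite addrC; apply: lerD; rewrite ler_pM2l //.
    by apply: sqr_norm_le; rewrite normrM ler_piMl // ger0_norm ?step_ge0 ?step_le1.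
  by apply: sqr_norm_le; rewrite normrM ler_piMl // ger0_norm ?step_ge0 ?step_le1.
- exact: sqr_ge0.
- exact: sqr_ge0.
- exact: bound.
- by apply: bound => //; rewrite sqrrN.
- move=> nt; rewrite /DA step_D_out ?mul0r ?expr0n //.
  have -> : 2 / h1 * t x + - (2 / h1 * t1) = 2 * ((t x - t1) / h1) by field; rewrite gt_eqF.
  have [u|u] := ltrP (t x) t1; [left|right].
    by rewrite pmulr_rlt0 // pmulr_llt0 ?invr_gt0 // subr_lt0.
  have : 1 <= (t x - t1) / h1.
    rewrite ler_pdivlMr // mul1r leNgt; apply/negP => v; apply: nt.
    by move: u v h10; move: (t x) => T; lra.
  by move: (_ / h1) => X; lra.
- move=> nt; rewrite /DB step_D_out ?mul0r ?expr0n //.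
  have -> : - (2 / h2) * t x + 2 / h2 * t2 = 2 * ((t2 - t x) / h2) by field; rewrite gt_eqF.
  have [u|u] := ltrP t2 (t x); [left|right].
    by rewrite pmulr_rlt0 // pmulr_llt0 ?invr_gt0 // subr_lt0.
  have : 1 <= (t2 - t x) / h2.
    rewrite ler_pdivlMr // mul1r leNgt; apply/negP => v; apply: nt.
    by move: u v h20; move: (t x) => T; lra.
  by move: (_ / h2) => X; lra.
Qed.

End cutoff.

End radial_cutoff.

Section indicator_estimates.
Context {d : measure_display} {T : measurableType d} {R : realType}.
Variables (mu : {measure set T -> \bar R}) (D : set T).
Hypothesis mD : measurable D.
Local Notation sq f := (sqint mu D f).
Local Notation N f := (nrm2 mu D f).

Lemma sqint_indic (A : set T) (f : T -> R) : measurable A -> sq f -> sq (fun x => \1_A x * f x).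
Proof.
move=> mA; apply: (sqintM mD (C := 1)); first exact: measurable_indic.
by move=> x _; rewrite indicE; case: (_ \in _); rewrite ?normr1 ?normr0.
Qed.

Lemma nrm2_indic (A : set T) (f : T -> R) : A `<=` D -> N (fun x => \1_A x * f x) = nrm2 mu A f.
Proof.
move=> AD; rewrite /nrm2 [LHS]Rintegral_mkcond [RHS]Rintegral_mkcond; apply: Rint_eq => x _.
rewrite !patchE indicE; have [xA|xA] := boolP (x \in A).
  by rewrite mem_set ?mul1r //; apply: AD; rewrite -inE.
by rewrite mul0r expr0n; case: ifP.
Qed.

Lemma nrm2_le (r p : T -> R) : sq r -> sq p -> (forall x, D x -> r x ^+ 2 <= p x ^+ 2) -> N r <= N p.
Proof. by move=> [_ sr] [_ sp] H; exact: (le_Rintegral mD sr sp H). Qed.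

Lemma nrm2_le2 (r p q : T -> R) (al be : R) : sq r -> sq p -> sq q ->
  (forall x, D x -> r x ^+ 2 <= al * p x ^+ 2 + be * q x ^+ 2) -> N r <= al * N p + be * N q.
Proof.
move=> [_ sr] [_ sp] [_ sq_] H; have Ip := intbleZ mD al sp; have Iq := intbleZ mD be sq_.
rewrite /nrm2 -(RintZ mD al sp) -(RintZ mD be sq_) -(RintD mD Ip Iq).
exact: (le_Rintegral mD sr (intbleD mD Ip Iq) H).
Qed.

End indicator_estimates.

Section competitor_arithmetic.
Context {R : realType}.
Implicit Types x y : R.

Lemma cutoff_bound (L b t h d : R) : 0 < h -> t <= b -> d <= 16 * L ^+ 2 * t / h ^+ 2 ->
  2 * d <= 32 * L ^+ 2 * b / h ^+ 2.
Proof.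
move=> h0 tb dB; have : 16 * L ^+ 2 * t / h ^+ 2 <= 16 * L ^+ 2 * b / h ^+ 2.
  by rewrite ler_pM2r ?invr_gt0 ?exprn_gt0 // ler_wpM2l // mulr_ge0 // sqr_ge0.
have -> : 32 * L ^+ 2 * b / h ^+ 2 = 2 * (16 * L ^+ 2 * b / h ^+ 2) by ring.
by move: (16 * L ^+ 2 * b / h ^+ 2) (16 * L ^+ 2 * t / h ^+ 2) dB => x y; lra.
Qed.

Lemma competitor_energy (P r p q E0 e dl : R) : 0 < e -> 0 <= q -> q <= dl -> p ^+ 2 <= P * q ->
  P <= E0 -> 0 < E0 -> dl <= e / 2 -> dl <= e ^+ 2 / (16 * E0) -> r = P + 2 * 1 * p + 1 ^+ 2 * q ->
  0 <= P -> r <= P + e.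
Proof.
move=> e0 q0 qd pP PE E00 d1 d2 -> P0.
have : p <= e / 4.
  apply: sqr_le_le; first by rewrite divr_ge0 // ltW.
  apply: le_trans pP _; apply: le_trans (_ : E0 * (e ^+ 2 / (16 * E0)) <= _).
    by apply: ler_pM => //; exact: le_trans qd d2.
  have -> : E0 * (e ^+ 2 / (16 * E0)) = (e / 4) ^+ 2 by field; rewrite gt_eqF.
  exact: lexx.
by rewrite expr1n mul1r mulr1; clear d2 pP; lra.
Qed.

End competitor_arithmetic.

Section competitor.
Context {R : realType}.
Local Notation plane := (R * R)%type.
Local Notation mplane := (measurableTypeR R * measurableTypeR R)%type.
Variables (Omega : set plane).
Hypotheses (oO : open Omega) (fO : (leb2 (Omega : set mplane) < +oo)%E).
Let mO := measurable_open oO.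
Local Notation sq f := (sqint leb2 Omega f).
Local Notation N f := (nrm2 leb2 Omega f).
Local Notation H1 := (H1_gradient Omega).
Implicit Types (v w chi : mplane -> R) (g : 'I_2 -> mplane -> R).

Lemma H1_sub_cst v g m : H1 v g -> H1 (fun x => v x - m) g.
Proof.
move=> Hv; have := H1_vadd oO fO (-1) Hv (H1_gradient_cst oO fO m).
have -> : vadd v (-1) (fun=> m) = (fun x => v x - m) by apply/funext => x; rewrite /vadd mulN1r.
suff -> : gadd g (-1) (fun _ _ => 0) = g by [].
by apply/funext => i; apply/funext => x; rewrite /gadd mulr0 addr0.
Qed.

Lemma H1_trunc M w g : 0 <= M -> H1 w g ->
  H1 (fun x => trunc M (w x)) (fun i x => trunc' M (w x) * g i x).
Proof.
move=> M0 [sw sg Wg].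
have b3 u : `|trunc' M u| <= 3 by apply: le_trans (trunc'_bounds u M0) _; rewrite ler1n.
have C i := weak_chain_rule oO fO sw (sg i) (Wg i) (trunc_C11 M) b3 (trunc_lip M).
split; first by have [] := C ord0.
  by move=> i; have [] := C i.
by move=> i; have [] := C i.
Qed.

Lemma H1_cutoff chi w g (B : R) : smooth_on setT (chi : plane -> R) ->
  (forall x, `|chi x| <= 1) -> (forall i x, Omega x -> `|'D_(basis2 i) (chi : plane -> R) x| <= B) ->
  H1 w g -> H1 (fun x => chi x * w x) (fun i x => chi x * g i x + 'D_(basis2 i) (chi : plane -> R) x * w x).
Proof.
move=> sc c1 cB [sw sg Wg].
have scO : smooth_on Omega (chi : plane -> R) by apply: smooth_on_sub sc.
have mc := smooth_on_measurable oO scO.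
have mD i := smooth_on_measurable oO (smooth_on_D (basis2 i) scO).
have c1' x : Omega x -> `|chi x| <= 1 by move=> _; exact: c1.
split; first exact: (sqintM mO mc c1' sw).
  by move=> i; apply: (sqintD mO); [exact: (sqintM mO mc c1' (sg i))|exact: (sqintM mO (mD i) (cB i) sw)].
by move=> i; exact: (weak_partialM oO fO sw (sg i) scO (Wg i)).
Qed.

(* The competitor is [v - m] where [chi = 1] and its truncation where [chi = 0];
   the truncation does not increase the gradient. *)
Lemma H1_competitor v g m M chi (B : R) : 0 <= M -> smooth_on setT (chi : plane -> R) ->
  (forall x, `|chi x| <= 1) -> (forall i x, Omega x -> `|'D_(basis2 i) (chi : plane -> R) x| <= B) ->
  H1 v g -> H1 (fun x => trunc M (v x - m) + 1 * (chi x * (v x - m - trunc M (v x - m))))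
    (fun i x => trunc' M (v x - m) * g i x + 1 * (chi x * (g i x - trunc' M (v x - m) * g i x) +
       'D_(basis2 i) (chi : plane -> R) x * (v x - m - trunc M (v x - m)))).
Proof.
move=> M0 sc c1 cB Hv; have Hw := H1_sub_cst m Hv; have Ht := H1_trunc M0 Hw.
have Hp := H1_vadd oO fO (-1) Hw Ht.
have E1 : vadd (fun x => v x - m) (-1) (fun x => trunc M (v x - m)) = fun x => v x - m - trunc M (v x - m).
  by apply/funext => x; rewrite /vadd mulN1r.
have E2 : gadd g (-1) (fun i x => trunc' M (v x - m) * g i x) =
    fun i x => g i x - trunc' M (v x - m) * g i x.
  by apply/funext => i; apply/funext => x; rewrite /gadd mulN1r.
rewrite E1 E2 in Hp; have Hc := H1_cutoff sc c1 cB Hp.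
exact: (H1_vadd oO fO 1 Ht Hc).
Qed.

Lemma gnrm2_sub_le (F g : 'I_2 -> mplane -> R) : gsq Omega F -> gsq Omega g ->
  gnrm2 Omega g <= 2 * gnrm2 Omega (gadd F 1 g) + 2 * gnrm2 Omega F.
Proof.
move=> sF sg; have E i : N (g i) <= 2 * N (gadd F 1 g i) + 2 * N (F i).
  rewrite -[N (F i)]nrm2N; have sA := gadd_sq oO 1 sF sg i.
  apply: le_trans (nrm2D_le mO sA (sqintN mO (sF i))).
  rewrite le_eqVlt; apply/orP; left; apply/eqP.
  by apply: Rint_eq => x _; rewrite /gadd mul1r; congr (_ ^+ 2); ring.
rewrite /gnrm2; have := lerD (E ord0) (E ord_max).
by move=> h; apply: (le_trans h); rewrite !mulrDr addrACA.
Qed.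

(** Apart from the term with the derivative of [chi], the competitor costs nothing: where [F] lives,
    [chi] is 1 and the gradient is unchanged; elsewhere [F] is 0 and the gradient is multiplied by a
    mean of 1 and [trunc'], of modulus at most 1. *)
Lemma competitor_value (F : 'I_2 -> mplane -> R) v g m M chi (B dl e E0 : R) :
  gsq Omega F -> 0 <= M -> smooth_on setT (chi : plane -> R) ->
  (forall x, 0 <= chi x <= 1) -> (forall i x, Omega x -> `|'D_(basis2 i) (chi : plane -> R) x| <= B) ->
  (forall i x, Omega x -> chi x = 1 \/ F i x = 0) ->
  H1 v g -> gnrm2 Omega (gadd F 1 g) <= E0 -> 0 < E0 -> 0 < e -> dl <= e / 2 -> dl <= e ^+ 2 / (16 * E0) ->
  (gnrm2 Omega (fun i x => 'D_(basis2 i) (chi : plane -> R) x * (v x - m - trunc M (v x - m))) <= dl) ->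
  gnrm2 Omega (gadd F 1 (fun i x => trunc' M (v x - m) * g i x + 1 * (chi x * (g i x - trunc' M (v x - m) * g i x) +
       'D_(basis2 i) (chi : plane -> R) x * (v x - m - trunc M (v x - m))))) <=
  gnrm2 Omega (gadd F 1 g) + e.
Proof.
move=> sF M0 sc c01 cB cF Hv gE E00 e0 d1 d2.
set r := fun i x => _ * _ => rd; set G := fun i x => _ + _.
have [_ sg _] := Hv.
have c1 x : `|chi x| <= 1 by have /andP[? ?] := c01 x; rewrite ger0_norm.
have [_ sG _] := H1_competitor m M0 sc c1 cB Hv.
have scO : smooth_on Omega (chi : plane -> R) by apply: smooth_on_sub sc.
have [sw' _ _] := H1_sub_cst m Hv; have [st _ _] := H1_trunc M0 (H1_sub_cst m Hv).
have sr : gsq Omega r.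
  move=> i; apply: (sqintM mO _ (cB i)); last exact: (sqintB mO sw' st).
  exact: (smooth_on_measurable oO (smooth_on_D (basis2 i) scO)).
pose P := gadd (gadd F 1 G) (-1) r; have sA : gsq Omega (gadd F 1 G) := gadd_sq oO 1 sF sG.
have sP : gsq Omega P := gadd_sq oO (-1) sA sr.
have EG : gadd F 1 G = gadd P 1 r.
  by apply/funext => i; apply/funext => x; rewrite /P /gadd; move: (r i x) (G i x) => y z; ring.
have PE : gnrm2 Omega P <= gnrm2 Omega (gadd F 1 g).
  have E i : N (P i) <= N (gadd F 1 g i).
    apply: (nrm2_le mO (sP i) (gadd_sq oO 1 sF sg i)) => x Ox; apply: sqr_norm_le.
    have -> : P i x = F i x + (chi x + (1 - chi x) * trunc' M (v x - m)) * g i x.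
      rewrite /P /gadd /G /r; move: ('D_(basis2 i) _ x) (trunc M _) (trunc' M _) => y z z'; ring.
    have := convex_bound (c01 x) (trunc'_bounds (v x - m) M0).
    rewrite /gadd mul1r; case: (cF i x Ox) => [-> _|->]; first by rewrite subrr mul0r addr0 mul1r.
    by rewrite !add0r normrM => h; rewrite ler_piMl.
  exact: lerD (E ord0) (E ord_max).
rewrite EG; apply: le_trans (lerD PE (lexx e)).
exact: (competitor_energy e0 (gnrm2_ge0 _ r) rd (gcauchy_schwarz oO sP sr) (le_trans PE gE) E00 d1 d2
  (gnrm2_gadd oO 1 sP sr) (gnrm2_ge0 _ P)).
Qed.

End competitor.

(** * The Leray projection of fields supported near the corner *)

Section corner_leray.
Context {R : realType}.
Local Notation plane := (R * R)%type.
Local Notation mplane := (measurableTypeR R * measurableTypeR R)%type.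
Variables (Omega : set plane) (x0 : plane) (ga s rr : R).
Hypotheses (oO : open Omega) (fO : (leb2 (Omega : set mplane) < +oo)%E).
Hypotheses (spi : 0 < s < pi) (rr0 : 0 < rr).
Hypothesis corner : forall x, sqdist x0 x < rr ->
  (Omega x <-> slit x0 ga x /\ - s < angle x0 ga x < s).
Let mO := measurable_open oO.
Local Notation A p q := (annulus Omega x0 rr p q).
Let mA p q : measurable (A p q : set mplane) := measurable_annulus x0 rr oO p q.
Let AO p q : A p q `<=` Omega := @annulus_sub R Omega x0 rr p q.
Local Notation sq f := (sqint leb2 Omega f).
Local Notation N f := (nrm2 leb2 Omega f).
Local Notation t := (sqdist x0).

Lemma cutoff_D_indic (t1 t2 h1 h2 b L : R) : 0 < h1 -> 0 < h2 -> t1 + h1 <= b -> t2 + h2 <= b -> b <= rr ->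
  (forall y, `|'D_1 (step : R -> R) y| <= L) -> forall i x, Omega x ->
  ('D_(basis2 i) (cutoff x0 t1 t2 h1 h2) x) ^+ 2 <=
    32 * L ^+ 2 * b / h1 ^+ 2 * \1_(A (t1 - h1) (t1 + h1)) x ^+ 2 +
    32 * L ^+ 2 * b / h2 ^+ 2 * \1_(A (t2 - h2) (t2 + h2)) x ^+ 2.
Proof.
move=> h10 h20 b1 b2 brr HL i x Ox.
have [dA [dB [[H dA0 dB0] [uA uB zA zB]]]] := cutoff_D x0 t1 t2 h10 h20 i x HL.
have E (c h d : R) : 0 < h -> c + h <= b -> 0 <= d -> d <= 16 * L ^+ 2 * t x / h ^+ 2 ->
    (~ (c - h < t x < c + h) -> d = 0) ->
    2 * d <= 32 * L ^+ 2 * b / h ^+ 2 * \1_(A (c - h) (c + h)) x ^+ 2.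
  move=> h0 cb d0 ud zd; rewrite indicE; have [hx|/negP hx] := boolP (c - h < t x < c + h).
    have tb : t x < b by move/andP: hx => [_ u]; exact: lt_le_trans u cb.
    rewrite mem_set; last by split=> //; split=> //; exact: lt_le_trans tb brr.
    by rewrite expr1n mulr1; apply: cutoff_bound ud => //; exact: ltW.
  by rewrite (zd hx) mulr0 memNset ?expr0n ?mulr0 // => -[].
exact: le_trans H (lerD (E _ _ _ h10 b1 dA0 uA zA) (E _ _ _ h20 b2 dB0 uB zB)).
Qed.

Lemma sqr_le_norm (x c : R) : x ^+ 2 <= c -> `|x| <= 1 + c.
Proof. by rewrite -(real_normK (num_real x)); have := normr_ge0 x; move: `|x| => y; nra. Qed.

Lemma sqr_factor (al be p q x : R) : al * (p * x) ^+ 2 + be * (q * x) ^+ 2 = (al * p ^+ 2 + be * q ^+ 2) * x ^+ 2.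
Proof. by ring. Qed.

Hypothesis pO : (0 < leb2 (Omega : set mplane))%E.
Variables (a a' b' b : R).
Hypotheses (a0 : 0 < a) (aa' : a < a') (ab' : a' < b') (bb' : b' < b) (brr : b <= rr).

(** The bound [2 * E0 + 2 * gnrm2 Omega F] controls the gradients of all competitors that matter, so
    the level [M] of the truncation is uniform. The collars may depend on the function: their width
    enters the energy through [C / h ^+ 2], which the [o(h ^+ 2)] of the cut-off part outweighs. *)
Theorem corner_leray (F : 'I_2 -> mplane -> R) : gsq Omega F ->
  (forall i x, Omega x -> ~ A a' b' x -> F i x = 0) -> exists PF, leray_projection Omega F PF.
Proof.
move=> sF F0; pose E0 := gnrm2 Omega F + 1; have F0' := gnrm2_ge0 Omega F.
have E00 : 0 < E0 by rewrite ltr_wpDl.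
have [M [M' [M0 M'0 HS]]] := annulus_slices oO fO spi rr0 corner (2 * E0 + 2 * gnrm2 Omega F) a0 aa' ab' bb' brr.
have [L L1 HL] := @step_D_bounded R.
have b0 : 0 < b by exact: lt_trans (lt_trans a0 aa') (lt_trans ab' bb').
pose C := 32 * L ^+ 2 * b.
have C0 : 0 < C by rewrite !mulr_gt0 // (lt_le_trans ltr01 L1).
have s1 : sq (fun=> M + 1).
  by apply: (@sqint_bounded _ _ _ _ _ mO `|M + 1| _ fO).
(* The competitor is a function bounded by [M + 1] plus one that lives in the annulus and is at most
   |v - m| there; this gives a bound on its norm that is the same for all [v]. *)
apply: (leray_projection_exists oO fO pO sF (K := 2 * N (fun=> M + 1) + 2 * M')).
move=> v g Hv; cbv beta; rewrite -/E0 => gE e e0.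
have [sv sg _] := Hv.
pose dl := Num.min (e / 2) (e ^+ 2 / (16 * E0)).
have dl0 : 0 < dl by rewrite lt_min !divr_gt0 ?mulr_gt0 ?exprn_gt0.
have Kg : N (g ord0) + N (g ord_max) <= 2 * E0 + 2 * gnrm2 Omega F.
  by apply: le_trans (gnrm2_sub_le oO sF sg) _; rewrite lerD2r ler_pM2l.
have [m [t1 [t2 [/andP[l1 l2] /andP[l3 l4] NM' small]]]] := HS v g Hv Kg.
pose psi : mplane -> R := fun x => v x - m - trunc M (v x - m).
(* On a collar the squared derivatives of the cutoff are at most [C / h ^+ 2], so each collar
   receives the share [dl / 4] for each of the two components. *)
have e1 : 0 < dl / (4 * C) by rewrite divr_gt0 // mulr_gt0.
have [|h1 [/andP[h10 h1u] N1]] := small t1 (or_introl erefl) _ (a' - t1) e1; first by rewrite subr_gt0.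
have [|h2 [/andP[h20]]] := small t2 (or_intror erefl) _ (Num.min (t2 - b') (b - t2)) e1.
  by rewrite lt_min !subr_gt0 l3.
rewrite lt_min => /andP[h2u h2u'] N2; rewrite -/psi in N1 N2.
pose chi := cutoff x0 t1 t2 h1 h2.
have t1h1 : t1 + h1 <= a' by rewrite -lerBrDl ltW.
have t1h1b : t1 + h1 <= b by apply: le_trans t1h1 (ltW (lt_trans ab' bb')).
have t2h2 : b' <= t2 - h2 by rewrite lerBrDr -lerBrDl ltW.
have t2h2b : t2 + h2 <= b by rewrite -lerBrDl ltW.
have DI := cutoff_D_indic h10 h20 t1h1b t2h2b brr HL.
have I01 (B : set mplane) x : 0 <= (\1_B x : R) ^+ 2 <= 1 by rewrite indicE; case: (_ \in _); rewrite ?expr1n ?expr0n ?ler01 ?lexx.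
have Ch0 h : 0 <= C / h ^+ 2 by rewrite divr_ge0 ?sqr_ge0 // ltW.
have NI p q (f : mplane -> R) (c : R) : nrm2 leb2 (A p q) f <= c -> N (fun x : mplane => \1_(A p q) x * f x) <= c.
  by move=> h; apply: le_trans h; rewrite le_eqVlt; apply/orP; left; apply/eqP; exact: (nrm2_indic leb2 f (@AO p q)).
pose B := 1 + (C / h1 ^+ 2 + C / h2 ^+ 2).
have cB i x : Omega x -> `|'D_(basis2 i) chi x| <= B.
  move=> Ox; apply: sqr_le_norm; apply: le_trans (DI i x Ox) _; rewrite -/C.
  by apply: lerD; rewrite -[leRHS]mulr1 ler_wpM2l //; have /andP[] := I01 _ x.
have sc : smooth_on setT chi := smooth_on_cutoff x0 t1 t2 h1 h2.
have c01 : forall x, 0 <= chi x <= 1 := @cutoff_01 R x0 t1 t2 h1 h2.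
have c1 x : `|chi x| <= 1 by have /andP[? ?] := c01 x; rewrite ger0_norm.
have cF i x : Omega x -> chi x = 1 \/ F i x = 0.
  move=> Ox; have [[_ /andP[u1 u2]]|nA] := pselect (A a' b' x); [left|by right; exact: F0].
  apply: cutoff_one => //; apply/andP; split; first exact: le_trans t1h1 (ltW u1).
  exact: le_trans (ltW u2) t2h2.
have [sw _ _] := H1_sub_cst oO fO m Hv; have [st _ _] := H1_trunc oO fO M0 (H1_sub_cst oO fO m Hv).
have spsi : sq psi := sqintB mO sw st.
have Hc := H1_competitor oO fO m M0 sc c1 cB Hv.
eexists; eexists; split; first exact: Hc.
  have rd : gnrm2 Omega (fun i x => 'D_(basis2 i) chi x * psi x) <= dl.
    have scO : smooth_on Omega chi by apply: smooth_on_sub sc.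
    have E i : N (fun x => 'D_(basis2 i) chi x * psi x) <= dl / 2.
      have sr : sq (fun x : mplane => 'D_(basis2 i) chi x * psi x).
        by apply: (sqintM mO _ (cB i) spsi); exact: (smooth_on_measurable oO (smooth_on_D (basis2 i) scO)).
      have := @nrm2_le2 _ _ _ _ _ mO _ _ _ (C / h1 ^+ 2) (C / h2 ^+ 2) sr
        (sqint_indic mO (mA (t1 - h1) (t1 + h1)) spsi) (sqint_indic mO (mA (t2 - h2) (t2 + h2)) spsi).
      move=> H; apply: le_trans (H _) _.
        by move=> x Ox; rewrite sqr_factor exprMn; apply: ler_wpM2r (sqr_ge0 _) _ _ (DI i x Ox).
      have F' h : 0 < h -> C / h ^+ 2 * (dl / (4 * C) * h ^+ 2) = dl / 4 by move=> h0; field; rewrite !gt_eqF.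
      have -> : dl / 2 = C / h1 ^+ 2 * (dl / (4 * C) * h1 ^+ 2) + C / h2 ^+ 2 * (dl / (4 * C) * h2 ^+ 2).
        by rewrite !F' //; field.
      exact: lerD (ler_wpM2l (Ch0 h1) (NI _ _ _ _ N1)) (ler_wpM2l (Ch0 h2) (NI _ _ _ _ N2)).
    by rewrite [leRHS](splitr dl); exact: lerD (E ord0) (E ord_max).
  apply: (competitor_value oO fO (E0 := E0) (dl := dl) sF M0 sc c01 cB cF Hv gE E00 e0 _ _ rd).
    by rewrite /dl ge_min lexx.
  by rewrite /dl ge_min lexx orbT.
have [sv' _ _] := Hc.
apply: le_trans (nrm2_le2 (al := 2) (be := 2) mO sv' s1 (sqint_indic mO (mA a b) sw) _) _; last first.
  exact: lerD (lexx _) (ler_wpM2l (ler0n R 2) (NI _ _ _ _ NM')).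
move=> x Ox; apply: le_trans (sqrD_le _ _) _; apply: lerD; rewrite ler_pM2l //.
  apply: sqr_norm_le; apply: le_trans (trunc_bounded _ M0) _; exact: ler_norm.
rewrite mul1r; apply: sqr_norm_le.
have [hx|hx] := boolP (t1 < t x < t2).
  have /andP[u1 u2] := hx; rewrite indicE mem_set; last first.
    split; last by rewrite (lt_trans l1 u1) (lt_trans u2 l4).
    by split=> //; exact: lt_le_trans (lt_trans u2 l4) brr.
  rewrite mul1r normrM; apply: le_trans (ler_piMl (normr_ge0 _) (c1 x)) _.
  by have := @trunc_error _ M (v x - m) 0; rewrite normr0 subr0; apply.
have chi0 : chi x = 0 by apply: cutoff_out => //; apply/negP.
by rewrite chi0 mul0r normr0.
Qed.

End corner_leray.

(** * The vector field near the corner *)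

Section radial_cut.
Context {R : realType}.
Local Notation plane := (R * R)%type.
Local Notation mplane := (measurableTypeR R * measurableTypeR R)%type.

(** The outermost derivative of the test function is moved first and becomes the innermost one on
    [f], whence the reversed word. *)
Lemma weak_partial_smooth (Omega : set plane) (w : seq 'I_2) (f : plane -> R) : open Omega ->
  smooth_on Omega f -> weak_partial Omega w f (partial (rev w) f).
Proof.
move=> oO; elim: w f => [|i w IH] f sf phi tp; first by rewrite expr0 mul1r.
have := weak_partial_smooth1 i oO sf (test_function_partial w tp); rewrite [size [:: i]]/= expr1 => E.
transitivity (-1 * \int[leb2]_(x in Omega) ('D_(basis2 i) f x * partial w phi x)); first exact: E.
rewrite (IH _ (smooth_on_D (basis2 i) sf) phi tp) mulrA -exprS rev_cons; congr (_ * _).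
by apply: Rint_eq => x _; rewrite [in RHS]/partial foldr_rcons.
Qed.

Variables (Omega : set plane) (x0 : plane) (ga s rr : R).
Hypotheses (oO : open Omega) (fO : (leb2 (Omega : set mplane) < +oo)%E).
Hypotheses (spi : 0 < s < pi) (rr0 : 0 < rr).
Hypothesis corner : forall x, sqdist x0 x < rr ->
  (Omega x <-> slit x0 ga x /\ - s < angle x0 ga x < s).
Local Notation t := (sqdist x0).
Local Notation th := (angle x0 ga).
Local Notation S := (slit x0 ga).
Local Notation D := (corner_part Omega x0 rr).
Let mO := measurable_open oO.
Let oS : open S := @open_slit R x0 ga.
Let oD : open D. Proof. exact: open_corner_part. Qed.
Let DS : D `<=` S := corner_part_slit corner.
Variables (a b : R).
Hypotheses (a0 : 0 < a) (brr : b < rr).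

Definition radial_support (f : plane -> R) := forall x, S x -> t x < a \/ b < t x -> f x = 0.

Let open_t_lt c : open [set x | t x < c].
Proof. by have /continuousP H := @continuous_sqdist R x0; exact: (H _ (@open_lt R c)). Qed.

Let open_t_gt c : open [set x | c < t x].
Proof. by have /continuousP H := @continuous_sqdist R x0; exact: (H _ (@open_gt R c)). Qed.

Lemma radial_support_D f v : radial_support f -> radial_support (fun x => 'D_v f x).
Proof.
move=> f0 x Sx hx; have [P [oP Px HP]] : exists P, [/\ open P, P x & forall y, P y -> f y = 0].
  case: hx => hx.
    exists (S `&` [set y | t y < a]); split=> //; first exact: openI.
    by move=> y [Sy ty]; apply: f0 => //; left.
  exists (S `&` [set y | b < t y]); split=> //; first exact: openI.
  by move=> y [Sy ty]; apply: f0 => //; right.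
rewrite (@near_eq_derive _ _ _ f (cst 0) x v) ?derive_cst //.
by apply: (open_near_eq oP _ Px) => y /set_mem; exact: HP.
Qed.

Lemma radial_support_partial f w : radial_support f -> radial_support (partial w f).
Proof. by move=> f0; elim: w => [//|i w IH]; exact: radial_support_D. Qed.

Section one_function.
Variable f : plane -> R.
Hypotheses (sf : smooth_on S f) (f0 : radial_support f).

Lemma cutE x : D x -> (f \_ D) x = f x. Proof. by move=> Dx; rewrite patchE mem_set. Qed.

Lemma cut_far x : b < t x -> (f \_ D) x = 0.
Proof.
move=> bt; rewrite patchE; case: ifPn => // /set_mem Dx; apply: f0; first exact: DS.
by right.
Qed.

(** Inside [Omega] the region [D] ends only on the circle [t = rr]; there [f] has been 0 since
    [t = b < rr], so the extension by 0 creates no singularity. *)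
Lemma smooth_on_cut : smooth_on Omega (f \_ D).
Proof.
move=> n; apply: diffn_cover => x Ox; have [tx|tx] := ltrP (t x) rr.
  exists D => //; apply: (diffn_eq oD _ (diffn_sub DS (sf n))) => y /set_mem Dy.
  by rewrite cutE.
exists [set y | b < t y]; first exact: lt_le_trans tx.
apply: (diffn_eq (@open_t_gt b) _ (diffn_cst n 0 (@open_t_gt b))) => y /set_mem yb.
by rewrite cut_far.
Qed.

Lemma derive_cut v x : Omega x -> 'D_v (f \_ D) x = ((fun y => 'D_v f y) \_ D) x.
Proof.
move=> Ox; have [tx|tx] := ltrP (t x) rr.
  rewrite [RHS]patchE mem_set //; apply: near_eq_derive.
  apply: (@open_near_eq _ _ D) => //.
  by move=> y /set_mem Dy; rewrite cutE.
rewrite [RHS]patchE memNset; last by move=> [_]; rewrite ltNge tx.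
rewrite (@near_eq_derive _ _ _ _ (cst 0) x v) ?derive_cst //.
apply: (open_near_eq (@open_t_gt b)); last exact: lt_le_trans tx.
by move=> y /set_mem yb; rewrite cut_far.
Qed.

(** The closed truncated sector is compact and still lies in the slit plane because [s < pi], so [f]
    is smooth up to both sides. *)
Lemma radial_bounded : exists2 B, 0 <= B & forall x, D x -> `|f x| <= B.
Proof.
pose K := unpolar x0 ga @` (`[a, b]%classic `*` `[(- s), s]%classic).
have cK : compact K.
  apply: continuous_compact; first by apply: continuous_subspaceT; exact: continuous_unpolar.
  by apply: compact_setX; exact: segment_compact.
have KS x : K x -> S x.
  move=> [[u v] [/= + +] <-]; rewrite !in_itv /= => /andP[u1 u2] /andP[v1 v2].
  have /andP[s0 s1] := spi; have [] // := @unpolarK _ x0 ga (u, v); first exact: lt_le_trans u1.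
  by rewrite /= (le_lt_trans v2 s1) andbT (lt_le_trans _ v1) // ltrN2.
have [B B0 HB] := compact_max_norm cK (fun x Kx => smooth_on_continuous oS sf (KS x Kx)).
exists B => // x Dx; have [/andP[h1 h2]|] := boolP (a <= t x <= b).
  apply: HB; have [_ /= v] := corner_part_box corner Dx; have /andP[v1 v2] := v.
  exists (t x, th x); last by apply: polarK; exact: DS.
  by split; rewrite /= in_itv /= ?h1 ?h2 // !ltW.
rewrite negb_and -!ltNge => h; rewrite f0 ?normr0 //; first exact: DS.
by case/orP: h; [left|right].
Qed.

Lemma sqint_cut : sqint leb2 Omega (f \_ D).
Proof.
have [B B0 HB] := radial_bounded.
apply: (sqint_bounded (C := B) mO fO); first exact: smooth_on_measurable oO smooth_on_cut.
by move=> x _; rewrite patchE; case: ifPn => [/set_mem/HB//|_]; rewrite normr0.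
Qed.

End one_function.

Lemma partial_cut f w x : smooth_on S f -> radial_support f -> Omega x ->
  partial w (f \_ D) x = (partial w f \_ D) x.
Proof.
move=> sf f0; elim: w x => [//|i w IH] x Ox.
rewrite [LHS](@near_eq_derive _ _ _ _ (partial w f \_ D) x (basis2 i)).
  exact: (derive_cut (radial_support_partial w f0)).
by apply: (open_near_eq oO _ Ox) => y /set_mem; exact: IH.
Qed.

Lemma in_H_cut m f : smooth_on S f -> radial_support f -> in_H m Omega (f \_ D).
Proof.
move=> sf f0; split; first exact: sqint_cut.
move=> w _; exists (partial (rev w) (f \_ D)).
  apply: (sqint_eq mO _ (sqint_cut (smooth_on_partial (rev w) sf) (radial_support_partial (rev w) f0))).
  by move=> x Ox; rewrite partial_cut.
by apply: weak_partial_smooth => //; exact: smooth_on_cut.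
Qed.

Lemma H1_gradient_cut f : smooth_on S f -> radial_support f ->
  H1_gradient Omega (f \_ D) (fun i => (fun x => 'D_(basis2 i) f x) \_ D).
Proof.
move=> sf f0; split; first exact: sqint_cut.
  by move=> i; apply: sqint_cut; [exact: smooth_on_D|exact: radial_support_D].
move=> i; apply: (weak_partial_eq (fun _ _ => erefl) _ (weak_partial_smooth1 i oO (smooth_on_cut sf f0))).
by move=> x /set_mem Ox; exact: derive_cut.
Qed.

End radial_cut.

Section lateral_cutoff.
Context {R : realType}.

Lemma derive_bump (p q : R) (n : nat) (y : R) : 'D_1 (bump p q n) y =
  step (n.+1%:R * (y - p) - 1) * (- (n.+1%:R * 'D_1 (step : R -> R) (n.+1%:R * (q - y) - 1))) +
  step (n.+1%:R * (q - y) - 1) * (n.+1%:R * 'D_1 (step : R -> R) (n.+1%:R * (y - p) - 1)).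
Proof.
have E (k l : R) : is_derive y (1 : R) (fun z : R => step (k * z + l)) (k * 'D_1 (step : R -> R) (k * y + l)).
  have da : differentiable (fun z : R => k * z + l) y := (smooth_on_affine k l 1%N).1 y I.
  have ds : differentiable (step : R -> R) (k * y + l) := (smooth_on_step 1%N).1 _ I.
  have dc : differentiable (fun z : R => step (k * z + l)) y := (smooth_on_scaled_step k l 1%N).1 y I.
  apply: DeriveDef; first exact: diff_derivable.
  have -> : 'D_1 (fun z : R => step (k * z + l)) y = 'D_1 (step : R -> R) (k * y + l) * 'D_1 (fun z : R => k * z + l) y.
    exact: (@derive_comp1 R _ (step : R -> R) (fun z : R => k * z + l) y 1 da ds).
  have H : is_derive y (1 : R) (fun z : R => k * z + l) k.
    rewrite (_ : (fun z : R => k * z + l) = k *: (id : R -> R) + cst l); last by apply/funext.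
    by apply: is_derive_eq; rewrite /GRing.scale /= mulr1 addr0.
  by rewrite (@derive_val _ _ _ _ _ _ _ H) mulrC.
have E1 := E n.+1%:R (- (n.+1%:R * p) - 1); have E2 := E (- n.+1%:R) (n.+1%:R * q - 1).
have -> : bump p q n = fun z => step (n.+1%:R * z + (- (n.+1%:R * p) - 1)) * step (- n.+1%:R * z + (n.+1%:R * q - 1)).
  by apply/funext => z; rewrite /bump; congr (step _ * step _); ring.
have d1 : differentiable (fun z : R => step (n.+1%:R * z + (- (n.+1%:R * p) - 1))) y := (smooth_on_scaled_step _ _ 1%N).1 y I.
have d2 : differentiable (fun z : R => step (- n.+1%:R * z + (n.+1%:R * q - 1))) y := (smooth_on_scaled_step _ _ 1%N).1 y I.
rewrite (derive_mul (1 : R) d1 d2) (@derive_val _ _ _ _ _ _ _ E1) (@derive_val _ _ _ _ _ _ _ E2).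
have -> : n.+1%:R * y + (- (n.+1%:R * p) - 1) = n.+1%:R * (y - p) - 1 by ring.
have -> : - n.+1%:R * y + (n.+1%:R * q - 1) = n.+1%:R * (q - y) - 1 by ring.
by rewrite mulNr.
Qed.

Lemma bump_eventually (p q y : R) : p < y < q ->
  \forall n \near \oo, bump p q n y = 1 /\ 'D_1 (bump p q n) y = 0.
Proof.
move=> /andP[py yq].
have c1 : 0 < (y - p) / 2 by rewrite divr_gt0 ?subr_gt0.
have c2 : 0 < (q - y) / 2 by rewrite divr_gt0 ?subr_gt0.
have K (c : R) (n : nat) : n.+1%:R^-1 < c / 2 -> 1 < n.+1%:R * c - 1.
  move=> h; have N0 : (0 : R) < n.+1%:R by rewrite ltr0n.
  have : n.+1%:R * n.+1%:R^-1 < n.+1%:R * (c / 2) by rewrite ltr_pM2l.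
  rewrite mulfV ?gt_eqF // mulrA; move: (_ * c) => z; lra.
near=> n.
have h1 : 1 < n.+1%:R * (y - p) - 1 by apply: K; near: n; exact: (near_infty_natSinv_lt (PosNum c1)).
have h2 : 1 < n.+1%:R * (q - y) - 1 by apply: K; near: n; exact: (near_infty_natSinv_lt (PosNum c2)).
rewrite derive_bump /bump !step1 ?(ltW h1) ?(ltW h2) // !step_D_out; [|by right|by right].
by rewrite !mulr0 oppr0 !mulr0 addr0 mulr1.
Unshelve. all: by end_near. Qed.

Lemma mixed_le (d u v A B K : R) : `|u| <= 1 -> `|v| <= 1 -> `|d * A| <= K -> `|d * B| <= K ->
  `|d * (u * - B + v * A)| <= K + K.
Proof.
move=> u1 v1 hA hB; have -> : d * (u * - B + v * A) = u * - (d * B) + v * (d * A) by ring.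
apply: le_trans (ler_normD _ _) _; rewrite !(normrM u) !(normrM v) normrN.
by apply: lerD; apply: le_trans (ler_piMl (normr_ge0 _) _) _.
Qed.

(** The derivative of the bump grows like [n], but it is supported within the distance 2/(n+1) of
    the ends, where a [d] that vanishes linearly compensates for the growth. *)
Lemma bump_D_bound (p q y L C d : R) (n : nat) : 0 <= C -> (forall z, `|'D_1 (step : R -> R) z| <= L) ->
  `|d| <= C * (y - p) -> `|d| <= C * (q - y) -> `|d * 'D_1 (bump p q n) y| <= 4 * C * L.
Proof.
move=> C0 HL d1 d2; have N0 : (0 : R) < n.+1%:R by rewrite ltr0n.
have L0 : 0 <= L by apply: le_trans (HL 0).
have K (c : R) : `|d| <= C * c -> `|d * (n.+1%:R * 'D_1 (step : R -> R) (n.+1%:R * c - 1))| <= 2 * C * L.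
  move=> dc; have [h|h] := lerP (n.+1%:R * c) 2; last first.
    by rewrite step_D_out ?mulr0 ?normr0 ?mulr_ge0 //; right; rewrite ltrBrDr.
  rewrite mulrA normrM; apply: ler_pM => //; rewrite normrM [`|n.+1%:R|]gtr0_norm // mulrC.
  apply: le_trans (ler_wpM2l (ltW N0) dc) _; rewrite mulrCA mulrC ler_wpM2r //.
have K1 := K _ d1; have K2 := K _ d2; rewrite derive_bump.
have -> : 4 * C * L = 2 * C * L + 2 * C * L by ring.
by apply: mixed_le => //; rewrite ger0_norm ?step_ge0 ?step_le1.
Qed.

End lateral_cutoff.

(** * Vanishing on the sides gives membership in the closure of the test functions *)

Section H10_cut.
Context {R : realType}.
Local Notation plane := (R * R)%type.
Local Notation mplane := (measurableTypeR R * measurableTypeR R)%type.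
Variables (Omega : set plane) (x0 : plane) (ga s rr : R).
Hypotheses (oO : open Omega) (fO : (leb2 (Omega : set mplane) < +oo)%E).
Hypotheses (spi : 0 < s < pi).
Hypothesis corner : forall x, sqdist x0 x < rr ->
  (Omega x <-> slit x0 ga x /\ - s < angle x0 ga x < s).
Local Notation t := (sqdist x0).
Local Notation th := (angle x0 ga).
Local Notation S := (slit x0 ga).
Local Notation D := (corner_part Omega x0 rr).
Let mO := measurable_open oO.
Let oS : open S := @open_slit R x0 ga.
Let DS : D `<=` S := corner_part_slit corner.

Lemma z_sqr_le (i : 'I_2) x : 0 < t x ->
  [/\ z1 x0 x ^+ 2 <= t x, z2 x0 x ^+ 2 <= t x & slit x0 ga x -> ('D_(basis2 i) th x) ^+ 2 <= (t x)^-1].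
Proof.
move=> t0; have h1 : z1 x0 x ^+ 2 <= t x by rewrite /sqdist lerDl sqr_ge0.
have h2 : z2 x0 x ^+ 2 <= t x by rewrite /sqdist lerDr sqr_ge0.
split=> // Sx; rewrite derive_angle // expr_div_n ler_pdivrMr ?exprn_gt0 // expr2 mulrA mulVf ?gt_eqF // mul1r.
have [->|/ord2_max ->] := eqVneq i ord0; rewrite ?basis2_0 ?basis2_max /= !mulr0 !mulr1 ?sub0r ?subr0 //.
by rewrite mulrNN -expr2.
Qed.

Variables (a b : R).
Hypotheses (a0 : 0 < a) (brr : b < rr).
Variables (f : plane -> R) (C : R).
Hypotheses (sf : smooth_on S f) (f0 : radial_support x0 ga a b f) (C0 : 0 <= C).
Hypothesis edge : forall x, D x -> `|f x| <= C * (th x + s) /\ `|f x| <= C * (s - th x).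

Local Notation be n := (bump (- s) s n).
Local Notation phi n := ((fun x => be n (th x) * f x) \_ D).

Let sbe n : smooth_on S (fun x => be n (th x)).
Proof. exact: (smooth_on_comp oS (@smooth_on_bump R (- s) s n) (@smooth_on_angle R x0 ga)). Qed.

Let sphi n : smooth_on S (fun x => be n (th x) * f x).
Proof. exact: smooth_onM. Qed.

Let rphi n : radial_support x0 ga a b (fun x => be n (th x) * f x).
Proof. by move=> x Sx hx; rewrite f0 // mulr0. Qed.

Lemma edge_test n : test_function Omega (phi n).
Proof.
apply: (test_function_sub (@corner_part_sub R Omega x0 rr)).
pose K := unpolar x0 ga @` (`[a, b]%classic `*` `[(- s + n.+1%:R^-1), (s - n.+1%:R^-1)]%classic).
have N0 : (0 : R) < n.+1%:R^-1 by rewrite invr_gt0 ltr0n.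
apply: (@patch_test _ D K); first exact: open_corner_part.
- apply: continuous_compact; first by apply: continuous_subspaceT; exact: continuous_unpolar.
  by apply: compact_setX; exact: segment_compact.
- move=> _ [[u v] [/= + +] <-]; rewrite !in_itv /= => /andP[u1 u2] /andP[v1 v2].
  have [|//] := @unpolar_corner_part _ Omega x0 ga s rr spi corner (u, v).
  by split=> /=; move: u1 u2 v1 v2 N0 a0 brr; move: (n.+1%:R^-1) => N u1 u2 v1 v2 N0 a0' brr';
    apply/andP; split; lra.
- exact: smooth_on_sub DS (sphi n).
- move=> x Dx nK; have [tx|nt] := boolP (a <= t x <= b); last first.
    move: nt; rewrite negb_and -!ltNge => h; rewrite f0 ?mulr0 //; first exact: DS.
    by case/orP: h; [left|right].
  rewrite bump_out ?mul0r // => hx; apply: nK; exists (t x, th x); last by apply: polarK; exact: DS.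
  by split; rewrite /= in_itv.
Qed.

(** The angular bumps times [f] are test functions. The differences and their gradients are bounded
    uniformly in [n], thanks to the linear vanishing at the sides, and each point sees them become 0
    eventually; dominated convergence concludes. *)
Lemma in_H10_cut : in_H10 Omega (f \_ D).
Proof.
have [_ sg _] := H1_gradient_cut oO fO spi corner a0 brr sf f0.
exists (fun i => (fun x => 'D_(basis2 i) f x) \_ D); first exact: (H1_gradient_cut oO fO spi corner a0 brr sf f0).
move=> e e0; have [L L1 HL] := @step_D_bounded R.
have scut := sqint_cut oO fO spi corner a0 brr.
pose F0 n (x : mplane) := (f \_ D) x - phi n x.
pose F i n (x : mplane) := ((fun x => 'D_(basis2 i) f x) \_ D) x - 'D_(basis2 i) (phi n) x.
have dphi i n x : Omega x -> 'D_(basis2 i) (phi n) x = ((fun y => 'D_(basis2 i) (fun x => be n (th x) * f x) y) \_ D) x.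
  exact: (derive_cut oO corner brr (@rphi n)).
have mF0 n : measurable_fun (Omega : set mplane) (F0 n).
  by apply: measurable_funB; [exact: (scut _ sf f0).1|exact: (scut _ (@sphi n) (@rphi n)).1].
have mF i n : measurable_fun (Omega : set mplane) (F i n).
  apply: measurable_funB; first exact: (scut _ (smooth_on_D (basis2 i) sf) (radial_support_D (basis2 i) f0)).1.
  exact: (smooth_on_measurable oO (smooth_on_D (basis2 i) (smooth_on_cut oO corner brr (@sphi n) (@rphi n)))).
have FE i n x : D x -> F i n x = (1 - be n (th x)) * 'D_(basis2 i) f x -
    'D_(basis2 i) th x * (f x * 'D_1 (be n : R -> R) (th x)).
  move=> Dx; have Sx := DS Dx; have Ox := corner_part_sub Dx; rewrite /F dphi // !patchE mem_set //.
  have dth : differentiable th x := smooth_on_diff (@smooth_on_angle _ x0 ga) Sx.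
  have db : differentiable (be n : R -> R) (th x) := (@smooth_on_bump R (- s) s n 1%N).1 _ I.
  rewrite (derive_mul _ (smooth_on_diff (@sbe n) Sx) (smooth_on_diff sf Sx)).
  have -> : 'D_(basis2 i) (fun x => be n (th x)) x = 'D_1 (be n : R -> R) (th x) * 'D_(basis2 i) th x.
    exact: (derive_comp1 _ dth db).
  by move: ('D_(basis2 i) f x) ('D_(basis2 i) th x) ('D_1 (be n : R -> R) (th x)) (be n (th x)) => p q r u; ring.
have F0E n x : D x -> F0 n x = (1 - be n (th x)) * f x.
  by move=> Dx; rewrite /F0 !patchE mem_set // mulrBl mul1r.
have out n x : ~ D x -> F0 n x = 0. by move=> nD; rewrite /F0 !patchE memNset // subrr.
have outi i n x : Omega x -> ~ D x -> F i n x = 0.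
  by move=> Ox nD; rewrite /F dphi // !patchE memNset // subrr.
have [B0 B00 HB0] := radial_bounded spi corner a0 sf f0.
have Bi i := radial_bounded spi corner a0 (smooth_on_D (basis2 i) sf) (radial_support_D (basis2 i) f0).
have b01 n y : `|1 - be n y| <= 1.
  by have := bump_ge0 (- s) s n y; have := bump_le1 (- s) s n y; rewrite ler_norml; move: (be n y) => z; lra.
have ev x : D x -> \forall n \near \oo, be n (th x) = 1 /\ 'D_1 (be n : R -> R) (th x) = 0.
  by move=> Dx; apply: bump_eventually; have [] := corner_part_box corner Dx.
have lim0 (G : nat -> mplane -> R) (B : R) : (forall n, measurable_fun (Omega : set mplane) (G n)) ->
    (forall n x, Omega x -> `|G n x| <= B) -> (forall x, Omega x -> \forall n \near \oo, G n x = 0) ->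
    \int[leb2]_(x in Omega) (G n x ^+ 2) @[n --> \oo] --> (0 : R).
  move=> mG GB G0.
  have IB : intble leb2 Omega (fun=> B ^+ 2).
    have s1 : sqint leb2 Omega (fun=> B) by apply: (@sqint_bounded _ _ _ _ _ mO `|B| _ fO).
    exact: s1.2.
  have c0 x : Omega x -> (fun n => G n x ^+ 2) @ \oo --> (0 : R).
    move=> Ox; apply: cvg_near_cst; have := G0 x Ox; apply: filterS => n ->; by rewrite expr0n.
  have bd n x : Omega x -> `|G n x ^+ 2| <= B ^+ 2.
    move=> Ox; rewrite ger0_norm ?sqr_ge0 //; apply: sqr_norm_le.
    by rewrite [`|B|]ger0_norm ?GB // (le_trans (normr_ge0 _) (GB n x Ox)).
  have [_ c] := Rint_cvg mO (fun n => measurable_funX 2%N (mG n)) c0 IB bd.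
  by move: c; rewrite Rint0.
have L0 := lim0 F0 B0 mF0.
have Li i : \int[leb2]_(x in Omega) (F i n x ^+ 2) @[n --> \oo] --> (0 : R).
  have [B B_0 HB] := Bi i.
  (* [1 + a^-1] bounds the derivative of the angle on the support of [f], and [4 * C * L] the
     product of [f] with the derivative of the bump. *)
  apply: (lim0 (F i) (B + (1 + a^-1) * (4 * C * L)) (mF i)).
    move=> n x Ox; have [Dx|nD] := pselect (D x); last first.
      by rewrite outi // normr0 addr_ge0 // !mulr_ge0 ?addr_ge0 ?invr_ge0 ?(le_trans ler01 L1) ?(ltW a0).
    rewrite FE //; apply: le_trans (ler_normB _ _) _; rewrite !normrM; apply: lerD.
      by rewrite -[leRHS]mul1r; apply: ler_pM => //; exact: HB.
    have [ta|ta] := lerP a (t x); last first.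
      have fx0 : f x = 0 by apply: f0; [exact: DS|left].
      have L0' : 0 <= L by exact: le_trans ler01 L1.
      have a1 : 0 <= a^-1 by rewrite invr_ge0 ltW.
      by rewrite fx0 normr0 mul0r mulr0 !mulr_ge0 // addr_ge0.
    have t0 : 0 < t x by exact: lt_le_trans ta.
    apply: ler_pM => //; last first.
      by have [e1 e2] := edge Dx; rewrite -normrM; apply: bump_D_bound => //; rewrite opprK.
    apply: sqr_le_norm; have [_ _ H] := z_sqr_le i t0.
    by apply: le_trans (H (DS Dx)) _; rewrite lef_pV2.
  move=> x Ox; have [Dx|nD] := pselect (D x); last by apply: nearW => n; exact: outi.
  by have := ev x Dx; apply: filterS => n [h1 h2]; rewrite FE // h1 h2 subrr mul0r !mulr0 subrr.
have {}L0 : \int[leb2]_(x in Omega) (F0 n x ^+ 2) @[n --> \oo] --> (0 : R).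
  apply: L0.
    move=> n x Ox; have [Dx|nD] := pselect (D x); last by rewrite out // normr0.
    by rewrite F0E // normrM -[leRHS]mul1r; apply: ler_pM => //; exact: HB0.
  move=> x Ox; have [Dx|nD] := pselect (D x); last by apply: nearW => n; exact: out.
  by have := ev x Dx; apply: filterS => n [h1 _]; rewrite F0E // h1 subrr mul0r.
have : (fun n => \int[leb2]_(x in Omega) (F0 n x ^+ 2) + (\int[leb2]_(x in Omega) (F ord0 n x ^+ 2) +
    \int[leb2]_(x in Omega) (F ord_max n x ^+ 2))) @ \oo --> (0 + (0 + 0) : R).
  by apply: cvgD; [exact: L0|apply: cvgD; exact: Li].
rewrite !addr0 => Lsum.
have [N _ HN] := cvgr_lt _ Lsum _ e0.
exists (phi N); first exact: edge_test.
by rewrite sum_ord2; exact: (HN N (leqnn N)).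
Qed.

End H10_cut.

(** * Derivatives in closed form near the corner *)

Section explicit_gradients.
Context {R : realType}.
Local Notation plane := (R * R)%type.
Variables (x0 : plane) (ga : R).
Local Notation t := (sqdist x0).
Local Notation th := (angle x0 ga).
Local Notation S := (slit x0 ga).
Let oS : open S := @open_slit R x0 ga.
Implicit Types f g h : plane -> R.

(** A function together with its gradient as formulas: second derivatives are found by combining
    such triples, and every verification becomes an identity of rational expressions. *)
Definition has_gradient f g1 g2 := smooth_on S f /\
  forall v x, S x -> 'D_v f x = g1 x * v.1 + g2 x * v.2.

Lemma gradient_eq f g1 g2 f' g1' g2' : {in S, f =1 f'} -> {in S, g1 =1 g1'} -> {in S, g2 =1 g2'} ->
  has_gradient f g1 g2 -> has_gradient f' g1' g2'.
Proof.
move=> ef e1 e2 [sf H]; split; first exact: smooth_on_eq sf.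
move=> v x Sx; rewrite -(@near_eq_derive _ _ _ f f' x v); last exact: (open_near_eq oS ef Sx).
by rewrite H // e1 ?e2 // inE.
Qed.

Lemma gradient_D0 f g1 g2 x : has_gradient f g1 g2 -> S x -> 'D_(basis2 ord0) f x = g1 x.
Proof. by move=> [_ H] Sx; rewrite H // basis2_0 /= mulr1 mulr0 addr0. Qed.

Lemma gradient_Dmax f g1 g2 x : has_gradient f g1 g2 -> S x -> 'D_(basis2 ord_max) f x = g2 x.
Proof. by move=> [_ H] Sx; rewrite H // basis2_max /= mulr1 mulr0 add0r. Qed.

Lemma gradient_D0D f g1 g2 x v : has_gradient f g1 g2 -> S x ->
  'D_v (fun y => 'D_(basis2 ord0) f y) x = 'D_v g1 x.
Proof.
move=> H Sx; apply: near_eq_derive; apply: (open_near_eq oS _ Sx) => y /set_mem Sy.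
exact: gradient_D0 H Sy.
Qed.

Lemma gradient_DmaxD f g1 g2 x v : has_gradient f g1 g2 -> S x ->
  'D_v (fun y => 'D_(basis2 ord_max) f y) x = 'D_v g2 x.
Proof.
move=> H Sx; apply: near_eq_derive; apply: (open_near_eq oS _ Sx) => y /set_mem Sy.
exact: gradient_Dmax H Sy.
Qed.

Lemma gradientM f g1 g2 h k1 k2 : has_gradient f g1 g2 -> has_gradient h k1 k2 ->
  has_gradient (fun x => f x * h x) (fun x => f x * k1 x + h x * g1 x) (fun x => f x * k2 x + h x * g2 x).
Proof.
move=> [sf Hf] [sh Hh]; split; first exact: smooth_onM.
move=> v x Sx; rewrite (derive_mul v (smooth_on_diff sf Sx) (smooth_on_diff sh Sx)) Hf // Hh //; ring.
Qed.

Lemma gradientD f g1 g2 h k1 k2 : has_gradient f g1 g2 -> has_gradient h k1 k2 ->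
  has_gradient (fun x => f x + h x) (fun x => g1 x + k1 x) (fun x => g2 x + k2 x).
Proof.
move=> [sf Hf] [sh Hh]; split; first exact: smooth_onD.
move=> v x Sx; transitivity ('D_v f x + 'D_v h x).
  exact: (deriveD (diff_derivable (smooth_on_diff sf Sx)) (diff_derivable (smooth_on_diff sh Sx))).
by rewrite Hf // Hh //; ring.
Qed.

Lemma gradient_cst (c : R) : has_gradient (fun=> c) (fun=> 0) (fun=> 0).
Proof.
split; first exact: smooth_on_cst.
by move=> v x _; rewrite !mul0r addr0; exact: derive_cst.
Qed.

Lemma gradientZ (c : R) f g1 g2 : has_gradient f g1 g2 ->
  has_gradient (fun x => c * f x) (fun x => c * g1 x) (fun x => c * g2 x).
Proof.
move=> /(gradientM (gradient_cst c)); apply: gradient_eq => // x _; rewrite mulr0 addr0 //.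
Qed.

Lemma gradient_z1 : has_gradient (z1 x0) (fun=> 1) (fun=> 0).
Proof.
split; first exact: smooth_on_sub (@smooth_on_z1 R x0).
by move=> v x _; rewrite derive_z1; ring.
Qed.

Lemma gradient_z2 : has_gradient (z2 x0) (fun=> 0) (fun=> 1).
Proof.
split; first exact: smooth_on_sub (@smooth_on_z2 R x0).
by move=> v x _; rewrite derive_z2; ring.
Qed.

Lemma gradient_radial (F F1 : R -> R) : smooth_on [set r : R | 0 < r] F ->
  (forall r : R, 0 < r -> 'D_1 F r = F1 r) ->
  has_gradient (fun x => F (t x)) (fun x => F1 (t x) * (2 * z1 x0 x)) (fun x => F1 (t x) * (2 * z2 x0 x)).
Proof.
move=> sF DF; split.
  apply: (smooth_on_comp oS sF); first exact: smooth_on_sub (smooth_on_sqdist x0).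
  by move=> x; exact: slit_gt0.
move=> v x Sx; have t0 := slit_gt0 Sx.
have dt : differentiable t x := smooth_on_diff (smooth_on_sqdist x0) I.
rewrite (derive_comp1 v dt ((sF 1%N).1 _ t0)) DF // derive_sqdist; ring.
Qed.

Lemma gradient_angle : has_gradient th (fun x => - z2 x0 x / t x) (fun x => z1 x0 x / t x).
Proof.
split; first exact: smooth_on_angle.
by move=> v x Sx; rewrite derive_angle //; move: (t x)^-1 => T; ring.
Qed.

Lemma gradient_inv : has_gradient (fun x => (t x)^-1) (fun x => - (t x)^-1 ^+ 2 * (2 * z1 x0 x))
  (fun x => - (t x)^-1 ^+ 2 * (2 * z2 x0 x)).
Proof.
apply: (@gradient_radial _ (fun r => - r^-1 ^+ 2)) => [n|r r0].
  by apply: diffn_sub (@smooth_on_inv R n) => r /= r0; rewrite gt_eqF.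
by rewrite (@derive_val _ _ _ _ _ _ _ (is_deriveV (lt0r_neq0 r0) (is_derive_id r 1))) /GRing.scale /= mulr1 exprVn.
Qed.

Section field.
Variables (F F1 F2 : R -> R).
Hypotheses (sF : smooth_on [set r : R | 0 < r] F) (sF1 : smooth_on [set r : R | 0 < r] F1).
Hypotheses (DF : forall r : R, 0 < r -> 'D_1 F r = F1 r) (DF1 : forall r : R, 0 < r -> 'D_1 F1 r = F2 r).

Definition lin (p q : R) : plane -> R := fun x => p * z1 x0 x + q * z2 x0 x.
(* The angle is harmonic with gradient [(- z2, z1) / t], hence
   [th * lin p q] has the Laplacian [2 * lin q (- p) / t]. *)
Definition field (p q m n : R) : plane -> R := fun x => th x * lin p q x + lin m n x.
Definition field1 (p q m n : R) : plane -> R := fun x => - z2 x0 x / t x * lin p q x + th x * p + m.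
Definition field2 (p q m n : R) : plane -> R := fun x => z1 x0 x / t x * lin p q x + th x * q + n.

Lemma gradient_lin p q : has_gradient (lin p q) (fun=> p) (fun=> q).
Proof.
have := gradientD (gradientZ p gradient_z1) (gradientZ q gradient_z2).
by apply: gradient_eq => // x _; ring.
Qed.

Lemma gradient_field p q m n : has_gradient (field p q m n) (field1 p q m n) (field2 p q m n).
Proof.
have := gradientD (gradientM gradient_angle (gradient_lin p q)) (gradient_lin m n).
by apply: gradient_eq => // x _; rewrite /field1 /field2; ring.
Qed.

Lemma gradient_radial_field p q m n : has_gradient (fun x => F (t x) * field p q m n x)
  (fun x => F1 (t x) * (2 * z1 x0 x) * field p q m n x + F (t x) * field1 p q m n x)
  (fun x => F1 (t x) * (2 * z2 x0 x) * field p q m n x + F (t x) * field2 p q m n x).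
Proof.
have := gradientM (gradient_radial sF DF) (gradient_field p q m n).
by apply: gradient_eq => // x _; ring.
Qed.

Lemma gradient_z_over_t (z : plane -> R) k1 k2 : has_gradient z k1 k2 ->
  has_gradient (fun x => z x / t x) (fun x => k1 x / t x - 2 * z1 x0 x * z x / t x ^+ 2)
    (fun x => k2 x / t x - 2 * z2 x0 x * z x / t x ^+ 2).
Proof.
move=> H; have := gradientM H gradient_inv.
by apply: gradient_eq => // x _; rewrite exprVn; ring.
Qed.

(** The field is homogeneous of degree 1, so [z . grad] reproduces it. The mixed term therefore
    contributes [4 * F1] times the field, and the Laplacian of [F (t x)] contributes
    [4 * F1 + 4 * t * F2]. *)
Lemma laplacian_radial_field p q m n x : S x ->
  laplacian (fun x => F (t x) * field p q m n x) x =
  (8 * F1 (t x) + 4 * t x * F2 (t x)) * field p q m n x + F (t x) * (2 * lin q (- p) x / t x).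
Proof.
move=> Sx; have t0 := slit_gt0 Sx.
have Gu := gradient_radial_field p q m n.
have GF := gradient_radial sF DF; have GF1 := gradient_radial sF1 DF1.
have Gf := gradient_field p q m n; have Gl := gradient_lin p q.
have G1 : has_gradient (field1 p q m n)
    (fun x => - 2 * p * z2 x0 x / t x + 2 * z1 x0 x * z2 x0 x * lin p q x / t x ^+ 2)
    (fun x => - lin p q x / t x - z2 x0 x / t x * q + 2 * z2 x0 x ^+ 2 * lin p q x / t x ^+ 2 + p * z1 x0 x / t x).
  have := gradientD (gradientD (gradientM (gradientZ (-1) (gradient_z_over_t gradient_z2)) Gl)
    (gradientZ p gradient_angle)) (gradient_cst m).
  by apply: gradient_eq => y _; rewrite /field1; move: (t y)^-1; rewrite ?exprVn => T; ring.
have G2 : has_gradient (field2 p q m n)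
    (fun x => lin p q x / t x + z1 x0 x / t x * p - 2 * z1 x0 x ^+ 2 * lin p q x / t x ^+ 2 - q * z2 x0 x / t x)
    (fun x => 2 * q * z1 x0 x / t x - 2 * z1 x0 x * z2 x0 x * lin p q x / t x ^+ 2).
  have := gradientD (gradientD (gradientM (gradient_z_over_t gradient_z1) Gl)
    (gradientZ q gradient_angle)) (gradient_cst n).
  by apply: gradient_eq => y _; rewrite /field2; move: (t y)^-1; rewrite ?exprVn => T; ring.
have H1 := gradientD (gradientM (gradientM GF1 (gradientZ 2 gradient_z1)) Gf) (gradientM GF G1).
have H2 := gradientD (gradientM (gradientM GF1 (gradientZ 2 gradient_z2)) Gf) (gradientM GF G2).
rewrite /laplacian sum_ord2 /partial /= (gradient_D0D _ Gu Sx) (gradient_DmaxD _ Gu Sx).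
rewrite (gradient_D0 H1 Sx) (gradient_Dmax H2 Sx) /field /field1 /field2 /lin.
have t0' : z1 x0 x ^+ 2 + z2 x0 x ^+ 2 != 0 by rewrite gt_eqF.
have tE : t x = z1 x0 x ^+ 2 + z2 x0 x ^+ 2 by [].
rewrite tE; move: (z1 x0 x) (z2 x0 x) (F _) (F1 _) (F2 _) (th x) t0' => a b c d e A T0.
by field.
Qed.

End field.

End explicit_gradients.

Section pointwise_arithmetic.
Context {R : realType}.
Implicit Types a b c d m n p q r x y A B : R.

Lemma norm_mul_le x y A B : `|x| <= A -> `|y| <= B -> `|x * y| <= A * B.
Proof. by move=> h1 h2; rewrite normrM ler_pM. Qed.

Lemma lin_le m n a b r : `|a| <= r -> `|b| <= r -> `|m * a + n * b| <= (`|m| + `|n|) * r.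
Proof.
move=> h1 h2; apply: le_trans (ler_normD _ _) _; rewrite mulrDl.
exact: lerD (norm_mul_le (lexx _) h1) (norm_mul_le (lexx _) h2).
Qed.

(** The factor 4 bounds the angle, as pi < 4. *)
Definition field_size p q m n : R := 4 * (`|p| + `|q|) + (`|m| + `|n|).

Lemma field_size_ge0 p q m n : 0 <= field_size p q m n.
Proof. by rewrite addr_ge0 ?mulr_ge0 ?addr_ge0. Qed.

Lemma field_le c p q m n a b r : `|c| <= 4 -> `|a| <= r -> `|b| <= r ->
  `|c * (p * a + q * b) + (m * a + n * b)| <= field_size p q m n * r.
Proof.
move=> h1 h2 h3; apply: le_trans (ler_normD _ _) _; rewrite /field_size mulrDl -mulrA.
exact: lerD (norm_mul_le h1 (lin_le _ _ h2 h3)) (lin_le _ _ h2 h3).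
Qed.

Lemma field_D_le c p q m n a b d r k l : 0 < r -> `|c| <= 4 -> `|a| <= r -> `|b| <= r -> `|d| <= r ->
  `|k| <= `|p| + `|q| -> `|l| <= `|m| + `|n| ->
  `|d / r ^+ 2 * (p * a + q * b) + c * k + l| <= 2 * field_size p q m n.
Proof.
move=> r0 hc ha hb hd hk hl; apply: le_trans (ler_normD _ _) _.
have : `|d / r ^+ 2 * (p * a + q * b) + c * k| <= (r / r ^+ 2) * ((`|p| + `|q|) * r) + 4 * (`|p| + `|q|).
  apply: le_trans (ler_normD _ _) _; apply: lerD; last exact: norm_mul_le.
  apply: norm_mul_le; last exact: lin_le.
  by rewrite normrM [`|(r ^+ 2)^-1|]ger0_norm ?invr_ge0 ?sqr_ge0 // ler_wpM2r // invr_ge0 sqr_ge0.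
have -> : r / r ^+ 2 * ((`|p| + `|q|) * r) = `|p| + `|q| by field; rewrite gt_eqF.
move: hl; rewrite /field_size; have := normr_ge0 p; have := normr_ge0 q; have := normr_ge0 m; have := normr_ge0 n.
by move: `|p| `|q| `|m| `|n| `|l| (`|_ + _|) => u1 u2 u3 u4 u5 u6; lra.
Qed.

Lemma quad_le m n p a b r : `|a| <= r -> `|b| <= r ->
  `|m * a ^+ 2 + n * (a * b) + p * b ^+ 2| <= (`|m| + `|n| + `|p|) * r ^+ 2.
Proof.
move=> ha hb; apply: le_trans (ler_normD _ _) _; rewrite mulrDl mulrDl !expr2; apply: lerD.
  apply: le_trans (ler_normD _ _) _; apply: lerD; apply: norm_mul_le => //; exact: norm_mul_le.
by apply: norm_mul_le => //; exact: norm_mul_le.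
Qed.

Lemma quad_D_le m n p a b r : `|a| <= r -> `|b| <= r ->
  `|2 * m * a + n * b| <= 2 * (`|m| + `|n| + `|p|) * r.
Proof.
move=> ha hb; have r0 : 0 <= r by exact: le_trans (normr_ge0 a) ha.
apply: le_trans (lin_le _ _ ha hb) _; apply: ler_wpM2r => //.
rewrite normrM ger0_norm //; have := normr_ge0 n; have := normr_ge0 p; lra.
Qed.

(* The first-order errors all have the size [B / r], the main term [z / r ^ 2] being of size [1 / r]. *)
Lemma laplacian_error_le x y f r B cf : 0 < r -> `|x| * r ^+ 2 <= B -> `|y| * r ^+ 4 <= 2 * B ->
  `|f| <= cf * r -> `|(8 * x + 4 * r ^+ 2 * y) * f| <= 16 * B * cf / r.
Proof.
move=> r0 hx hy hf; have r2 : 0 < r ^+ 2 by rewrite exprn_gt0.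
have -> : 16 * B * cf / r = (16 * B / r ^+ 2) * (cf * r) by field; rewrite gt_eqF.
apply: norm_mul_le hf; rewrite ler_pdivlMr //.
have E : `|8 * x + 4 * r ^+ 2 * y| <= 8 * `|x| + 4 * (r ^+ 2 * `|y|).
  apply: le_trans (ler_normD _ _) _; rewrite -[4 * _ * y]mulrA !(normrM 8) !(normrM 4) (normrM (r ^+ 2)).
  by rewrite [`|8|]ger0_norm // [`|4|]ger0_norm // [`|r ^+ 2|]gtr0_norm.
apply: le_trans (ler_wpM2r (ltW r2) E) _; rewrite mulrDl.
have -> : 4 * (r ^+ 2 * `|y|) * r ^+ 2 = 4 * (`|y| * r ^+ 4) by ring.
rewrite -mulrA; lra.
Qed.

Lemma divergence_error_le c x y z f g r B cQ : 0 < r -> `|x| * r ^+ 2 <= B -> `|y| * r ^+ 4 <= 2 * B ->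
  `|z| <= r -> `|f| <= cQ * r ^+ 2 -> `|g| <= 2 * cQ * r ->
  `|c * (x * (2 * z)) + 2 * (x * g + f * (y * (2 * z)))| <= (2 * `|c| + 12 * cQ) * B / r.
Proof.
move=> r0 hx hy hz hf hg; have r2 : 0 < r ^+ 2 by rewrite exprn_gt0.
have r4 : 0 < r ^+ 4 by rewrite exprn_gt0.
have x' : `|x| <= B / r ^+ 2 by rewrite ler_pdivlMr.
have y' : `|y| <= 2 * B / r ^+ 4 by rewrite ler_pdivlMr.
have z' : `|2 * z| <= 2 * r by rewrite normrM ger0_norm // ler_pM2l.
have h1 := norm_mul_le (lexx `|c|) (norm_mul_le x' z').
have h2 := norm_mul_le x' hg; have h3 := norm_mul_le hf (norm_mul_le y' z').
apply: le_trans (ler_normD _ _) _.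
have h4 : `|2 * (x * g + f * (y * (2 * z)))| <= 2 * (B / r ^+ 2 * (2 * cQ * r) + cQ * r ^+ 2 * (2 * B / r ^+ 4 * (2 * r))).
  by rewrite normrM ger0_norm // ler_pM2l //; apply: le_trans (ler_normD _ _) _; exact: lerD.
apply: le_trans (lerD h1 h4) _; rewrite le_eqVlt; apply/orP; left; apply/eqP.
by field; rewrite gt_eqF.
Qed.

Lemma gradient_field_le x w z f g r B M cf : 0 < r -> `|x| * r ^+ 2 <= B -> `|w| <= M -> `|z| <= r ->
  `|f| <= cf * r -> `|g| <= 2 * cf -> `|x * (2 * z) * f + w * g| <= 2 * (B + M) * cf.
Proof.
move=> r0 hx hw hz hf hg; have r2 : 0 < r ^+ 2 by rewrite exprn_gt0.
have x' : `|x| <= B / r ^+ 2 by rewrite ler_pdivlMr.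
have z' : `|2 * z| <= 2 * r by rewrite normrM ger0_norm // ler_pM2l.
apply: le_trans (ler_normD _ _) _.
apply: le_trans (lerD (norm_mul_le (norm_mul_le x' z') hf) (norm_mul_le hw hg)) _.
by rewrite le_eqVlt; apply/orP; left; apply/eqP; field; rewrite gt_eqF.
Qed.

End pointwise_arithmetic.

Section divergence.
Context {R : realType}.
Local Notation plane := (R * R)%type.
Variables (x0 : plane) (ga : R).
Local Notation t := (sqdist x0).
Local Notation th := (angle x0 ga).
Local Notation S := (slit x0 ga).
Variables (F F1 F2 : R -> R).
Hypotheses (sF : smooth_on [set r : R | 0 < r] F) (sF1 : smooth_on [set r : R | 0 < r] F1).
Hypotheses (DF : forall r : R, 0 < r -> 'D_1 F r = F1 r) (DF1 : forall r : R, 0 < r -> 'D_1 F1 r = F2 r).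
Variables (m1 n1 m2 n2 : R).
Local Notation U1 := (field x0 ga 0 (1 / 2) m1 n1).
Local Notation U2 := (field x0 ga (- (1 / 2)) 0 m2 n2).
Local Notation c := (m1 + n2 - 1 / 2).

(** This is the inner product of [z] with the field: its angular part is orthogonal to [z], so only
    the linear part is left. The same angular part contributes -1/2 to the divergence. *)
Definition quad : plane -> R := fun x =>
  m1 * z1 x0 x ^+ 2 + (n1 + m2) * (z1 x0 x * z2 x0 x) + n2 * z2 x0 x ^+ 2.

Lemma divergence_radial_field x : S x ->
  'D_(basis2 ord0) (fun y => F (t y) * U1 y) x + 'D_(basis2 ord_max) (fun y => F (t y) * U2 y) x =
  c * F (t x) + 2 * (F1 (t x) * quad x).
Proof.
move=> Sx; have t0 := slit_gt0 Sx.
have tE : t x = z1 x0 x ^+ 2 + z2 x0 x ^+ 2 by [].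
rewrite (gradient_D0 (gradient_radial_field x0 ga sF DF _ _ _ _) Sx).
rewrite (gradient_Dmax (gradient_radial_field x0 ga sF DF _ _ _ _) Sx).
rewrite /field /field1 /field2 /lin /quad.
move: t0; rewrite tE; move: (z1 x0 x) (z2 x0 x) (F _) (F1 _) (th x) => a b u v e t0.
by field; rewrite gt_eqF.
Qed.

Lemma gradient_quad : has_gradient x0 ga quad
  (fun x => 2 * m1 * z1 x0 x + (n1 + m2) * z2 x0 x) (fun x => 2 * n2 * z2 x0 x + (n1 + m2) * z1 x0 x).
Proof.
have G1 := gradient_z1 x0 ga; have G2 := gradient_z2 x0 ga.
have := gradientD (gradientD (gradientZ m1 (gradientM G1 G1)) (gradientZ (n1 + m2) (gradientM G1 G2)))
  (gradientZ n2 (gradientM G2 G2)).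
by apply: gradient_eq => x _; rewrite /quad ?expr2; ring.
Qed.

Lemma gradient_divergence : has_gradient x0 ga
  (fun x => 'D_(basis2 ord0) (fun y => F (t y) * U1 y) x + 'D_(basis2 ord_max) (fun y => F (t y) * U2 y) x)
  (fun x => c * (F1 (t x) * (2 * z1 x0 x)) + 2 * (F1 (t x) * (2 * m1 * z1 x0 x + (n1 + m2) * z2 x0 x) +
    quad x * (F2 (t x) * (2 * z1 x0 x))))
  (fun x => c * (F1 (t x) * (2 * z2 x0 x)) + 2 * (F1 (t x) * (2 * n2 * z2 x0 x + (n1 + m2) * z1 x0 x) +
    quad x * (F2 (t x) * (2 * z2 x0 x)))).
Proof.
have := gradientD (gradientZ c (gradient_radial x0 ga sF DF))
  (gradientZ 2 (gradientM (gradient_radial x0 ga sF1 DF1) gradient_quad)).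
by apply: gradient_eq => // x /set_mem Sx; rewrite divergence_radial_field.
Qed.

Lemma grad_divergence_sum (i : 'I_2) x : S x ->
  'D_(basis2 i) (fun y => 'D_(basis2 ord0) (fun y => F (t y) * U1 y) y) x +
  'D_(basis2 i) (fun y => 'D_(basis2 ord_max) (fun y => F (t y) * U2 y) y) x =
  c * (F1 (t x) * (2 * lin x0 (basis2 i).1 (basis2 i).2 x)) +
  2 * (F1 (t x) * (if i == ord0 then 2 * m1 * z1 x0 x + (n1 + m2) * z2 x0 x
         else 2 * n2 * z2 x0 x + (n1 + m2) * z1 x0 x) +
    quad x * (F2 (t x) * (2 * lin x0 (basis2 i).1 (basis2 i).2 x))).
Proof.
move=> Sx; have [s1 _] := gradient_radial_field x0 ga sF DF 0 (1 / 2) m1 n1.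
have [s2 _] := gradient_radial_field x0 ga sF DF (- (1 / 2)) 0 m2 n2.
transitivity ('D_(basis2 i) (fun x => 'D_(basis2 ord0) (fun y => F (t y) * U1 y) x +
   'D_(basis2 ord_max) (fun y => F (t y) * U2 y) x) x).
  symmetry; apply: deriveD; apply: diff_derivable; apply: smooth_on_diff Sx; exact: smooth_on_D.
have l0 : lin x0 (basis2 ord0).1 (basis2 ord0).2 x = z1 x0 x.
  by rewrite basis2_0 /lin mul1r mul0r addr0.
have l1 : lin x0 (basis2 ord_max).1 (basis2 ord_max).2 x = z2 x0 x.
  by rewrite basis2_max /lin mul1r mul0r add0r.
have [->|/ord2_max ->] := eqVneq i ord0; first by rewrite (gradient_D0 gradient_divergence Sx) l0.
by rewrite (gradient_Dmax gradient_divergence Sx) l1.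
Qed.

End divergence.

(** * The commutator for a field that is smooth inside the domain *)

Section commutator.
Context {R : realType}.
Local Notation plane := (R * R)%type.
Local Notation mplane := (measurableTypeR R * measurableTypeR R)%type.
Variable Omega : set plane.
Hypotheses (oO : open Omega) (fO : (leb2 (Omega : set mplane) < +oo)%E).
Let mO := measurable_open oO.
Local Notation sq f := (sqint leb2 Omega f).

Lemma H1_test phi : test_function Omega phi -> H1_gradient Omega phi (fun j x => 'D_(basis2 j) phi x).
Proof.
move=> tp; split; first exact: test_sq.
  by move=> j; apply: test_sq => //; exact: test_function_D.
have [sp _ _] := (test_functionE Omega phi).1 tp.
by move=> j; apply: weak_partial_smooth1 => //; exact: smooth_on_sub sp.
Qed.

Lemma leray_projection_sq (a Pa : 'I_2 -> plane -> R) i : leray_projection Omega a Pa -> sq (Pa i).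
Proof.
move=> [sa [q [gq [[_ sg _] _ E _]]]].
by apply: (sqint_eq mO _ (sqintD mO (sa i) (sg i))) => x Ox; rewrite E.
Qed.

Let sign2 (x : R) : (-1) ^+ 2 * x = x.
Proof. by rewrite sqrrN expr1n mul1r. Qed.

Let cancel4 (a b c d : R) : a + b + (c + d) = 0 -> b + d = - (a + c).
Proof. lra. Qed.

Lemma derive_cycle phi (i j : 'I_2) x : test_function Omega phi ->
  'D_(basis2 i) (fun x => 'D_(basis2 j) (fun x => 'D_(basis2 j) phi x) x) x =
  'D_(basis2 j) (fun x => 'D_(basis2 j) (fun x => 'D_(basis2 i) phi x) x) x.
Proof.
move=> tp; have [sp _ _] := (test_functionE Omega phi).1 tp.
have E : (fun y => 'D_(basis2 i) (fun x => 'D_(basis2 j) phi x) y) = (fun y => 'D_(basis2 j) (fun x => 'D_(basis2 i) phi x) y).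
  apply/funext => y; exact: (@derive_commute R _ setT phi y (basis2 i) (basis2 j) openT sp I).
transitivity ('D_(basis2 j) (fun y => 'D_(basis2 i) (fun x => 'D_(basis2 j) phi x) y) x).
  exact: (@derive_commute R _ setT _ x (basis2 i) (basis2 j) openT (smooth_on_D (basis2 j) sp) I).
exact: (congr1 (fun g : plane -> R => 'D_(basis2 j) g x) E).
Qed.

(** The projection is tested with the gradient of ['D_(basis2 i) phi], which shows that the [i]-th
    component of the gradient of [q] has the distributional Laplacian [- G i]. All derivatives stay
    on the test function, since [q] is only known to be in H^1. *)
Lemma commutator_smooth (u Pu Lu PLu G : 'I_2 -> plane -> R) :
  (forall i, smooth_on Omega (u i)) -> leray_projection Omega u Pu ->
  (forall i, in_L2 Omega (Lu i) /\ weak_laplacian Omega (u i) (Lu i)) ->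
  leray_projection Omega Lu PLu -> (forall i, sq (G i)) ->
  (forall i x, Omega x -> G i x = \sum_(j < 2) 'D_(basis2 i) (fun y => 'D_(basis2 j) (u j) y) x) ->
  laplace_leray_commutator Omega u (fun i x => Lu i x - G i x - PLu i x).
Proof.
move=> su LP HL LPL sG GE; exists Pu, Lu, PLu; split=> //.
  move=> i; apply: (sqintB mO); last exact: leray_projection_sq LPL.
  by apply: (sqintB mO) => //; case: (HL i).
move=> i phi tp; have sPLu := leray_projection_sq i LPL; have [sLu WL] := HL i.
have [sU [q [gq [Hq _ PuE EL]]]] := LP; have [sq_ sgq Wq] := Hq.
have tD j psi : test_function Omega psi -> test_function Omega (fun x => 'D_(basis2 j) psi x) by move=> h; exact: test_function_D.
have IT (v : mplane -> R) psi : sq v -> test_function Omega psi -> intble leb2 Omega (fun x => v x * psi x).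
  by move=> sv tpsi; exact: (sqint_test oO fO sv tpsi).
pose d2 j k : plane -> R := fun x => 'D_(basis2 j) (fun y => 'D_(basis2 k) phi y) x.
have td2 j k : test_function Omega (d2 j k) by exact: (tD j _ (tD k _ tp)).
(* Both integrals are minus the pairing of [q] with one and the same third derivative of [phi]. *)
have Jq j : \int[leb2]_(x in Omega) (gq i x * d2 j j x) = \int[leb2]_(x in Omega) (gq j x * d2 j i x).
  have W1 := (weak_partialP Omega i q (gq i)).1 (Wq i) _ (td2 j j).
  have W2 := (weak_partialP Omega j q (gq j)).1 (Wq j) _ (td2 j i).
  apply: (oppr_inj (etrans (esym W1) (etrans _ W2))); apply: Rint_eq => x _.
  exact: (congr1 (fun z => q x * z) (derive_cycle i j x tp)).
have Ju j : \int[leb2]_(x in Omega) (u j x * d2 j i x) =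
    \int[leb2]_(x in Omega) ('D_(basis2 i) (fun y => 'D_(basis2 j) (u j) y) x * phi x).
  exact: (etrans (weak_partial_smooth [:: j; i] oO (su j) tp) (sign2 _)).
have JE : \int[leb2]_(x in Omega) (gq i x * laplacian phi x) = - \int[leb2]_(x in Omega) (G i x * phi x).
  have E0 := EL _ _ (H1_test (tD i _ tp)).
  have I1 j := IT _ _ (sU j) (td2 j i); have I2 j := IT _ _ (sgq j) (td2 j i).
  have E1 : \int[leb2]_(x in Omega) (\sum_(j < 2) Pu j x * d2 j i x) =
      (\int[leb2]_(x in Omega) (u ord0 x * d2 ord0 i x) + \int[leb2]_(x in Omega) (gq ord0 x * d2 ord0 i x)) +
      (\int[leb2]_(x in Omega) (u ord_max x * d2 ord_max i x) + \int[leb2]_(x in Omega) (gq ord_max x * d2 ord_max i x)).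
    apply: etrans (RintD_eq mO (intbleD mO (I1 ord0) (I2 ord0)) (intbleD mO (I1 ord_max) (I2 ord_max)) _)
      (congr2 +%R (RintD mO (I1 ord0) (I2 ord0)) (RintD mO (I1 ord_max) (I2 ord_max))).
    by move=> x Ox; rewrite sum_ord2 !PuE // !mulrDl.
  have E2 : \int[leb2]_(x in Omega) (gq i x * laplacian phi x) =
      \int[leb2]_(x in Omega) (gq i x * d2 ord0 ord0 x) + \int[leb2]_(x in Omega) (gq i x * d2 ord_max ord_max x).
    apply: (RintD_eq mO (IT _ _ (sgq i) (td2 ord0 ord0)) (IT _ _ (sgq i) (td2 ord_max ord_max))).
    by move=> x _; rewrite /laplacian sum_ord2 mulrDr.
  have E3 : \int[leb2]_(x in Omega) (G i x * phi x) =
      \int[leb2]_(x in Omega) (u ord0 x * d2 ord0 i x) + \int[leb2]_(x in Omega) (u ord_max x * d2 ord_max i x).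
    have I3 j : intble leb2 Omega (fun x => 'D_(basis2 i) (fun y => 'D_(basis2 j) (u j) y) x * phi x).
      apply: (test_intble_on oO); apply: test_function_sub (@subsetT _ Omega) _.
      apply: test_functionM => //; apply: smooth_on_D; exact: smooth_on_D.
    apply: etrans (RintD_eq mO (I3 ord0) (I3 ord_max) _) (congr2 +%R (esym (Ju ord0)) (esym (Ju ord_max))).
    by move=> x Ox; rewrite GE // sum_ord2 mulrDl.
  exact: (etrans E2 (etrans (congr2 +%R (Jq ord0) (Jq ord_max))
    (etrans (cancel4 (etrans (esym E1) E0)) (congr1 -%R (esym E3))))).
have tL : test_function Omega (laplacian phi).
  have -> : laplacian phi = fun x => d2 ord0 ord0 x + d2 ord_max ord_max x.
    by apply/funext => x; rewrite /laplacian sum_ord2.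
  exact: test_functionD.
have A : \int[leb2]_(x in Omega) (Pu i x * laplacian phi x) =
    \int[leb2]_(x in Omega) (Lu i x * phi x) - \int[leb2]_(x in Omega) (G i x * phi x).
  apply: etrans (RintD_eq mO (IT _ _ (sU i) tL) (IT _ _ (sgq i) tL) _) (congr2 +%R (WL phi tp) JE).
  by move=> x Ox; rewrite PuE // mulrDl.
have I1 := IT _ _ sLu tp; have I2 := IT _ _ (sG i) tp; have I3 := IT _ _ sPLu tp.
have B : \int[leb2]_(x in Omega) ((Lu i x - G i x - PLu i x) * phi x) =
    \int[leb2]_(x in Omega) (Lu i x * phi x) - \int[leb2]_(x in Omega) (G i x * phi x) -
    \int[leb2]_(x in Omega) (PLu i x * phi x).
  apply: etrans (etrans (RintB mO (intbleB mO I1 I2) I3) (congr1 (fun z => z - _) (RintB mO I1 I2))).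
  by apply: Rint_eq => x _; rewrite !mulrBl.
exact: (etrans (congr1 (fun z => z - _) A) (esym B)).
Qed.

Lemma weak_laplacian_smooth f : smooth_on Omega f -> weak_laplacian Omega f (laplacian f).
Proof.
move=> sf phi tp; have tD j psi : test_function Omega psi -> test_function Omega (fun x => 'D_(basis2 j) psi x) by move=> h; exact: test_function_D.
have IB g : smooth_on Omega g -> test_function Omega (fun x => g x * phi x) by move=> sg; exact: test_functionM.
have IT g psi : smooth_on Omega g -> test_function Omega psi -> intble leb2 Omega (fun x => g x * psi x).
  move=> sg tpsi; apply: (test_intble_on oO); apply: test_function_sub (@subsetT _ Omega) _.
  exact: test_functionM.
have W j := etrans (weak_partial_smooth [:: j; j] oO sf tp) (sign2 _).
have sD j : smooth_on Omega (fun x => 'D_(basis2 j) (fun y => 'D_(basis2 j) f y) x).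
  by apply: smooth_on_D; exact: smooth_on_D.
transitivity (\int[leb2]_(x in Omega) (f x * partial [:: ord0; ord0] phi x) + \int[leb2]_(x in Omega) (f x * partial [:: ord_max; ord_max] phi x)).
  apply: (RintD_eq mO (IT _ _ sf (tD _ _ (tD _ _ tp))) (IT _ _ sf (tD _ _ (tD _ _ tp)))).
  by move=> x _; rewrite /laplacian sum_ord2 mulrDr.
transitivity (\int[leb2]_(x in Omega) (partial [:: ord0; ord0] f x * phi x) + \int[leb2]_(x in Omega) (partial [:: ord_max; ord_max] f x * phi x)).
  exact: (congr2 +%R (W ord0) (W ord_max)).
symmetry; apply: (RintD_eq mO (IT _ _ (sD ord0) tp) (IT _ _ (sD ord_max) tp)).
by move=> x _; rewrite /laplacian sum_ord2 mulrDl.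
Qed.

End commutator.

(** * Integrals of radial functions over annuli *)

Section radial_integral.
Context {R : realType}.
Local Notation plane := (R * R)%type.
Local Notation mplane := (measurableTypeR R * measurableTypeR R)%type.
Local Notation mR := (measurableTypeR R).
Local Notation leb := (@lebesgue_measure R).

Lemma derivative_within (P : R -> R) (a b : R) : 0 < a -> smooth_on [set r : R | 0 < r] P ->
  {within `[a, b], continuous (fun r : R => 'D_1 P r)}.
Proof.
move=> a0 sP; apply: continuous_in_subspaceT => r; rewrite inE /= in_itv /= => /andP[ar _].
by apply: differentiable_continuous; apply: ((sP 2%N).2 1).1; exact: lt_le_trans ar.
Qed.

Lemma interval_FTC (P : R -> R) (a b : R) : 0 < a -> a < b -> smooth_on [set r : R | 0 < r] P ->
  intble leb (`]a, b[%classic : set mR) (fun r : R => 'D_1 P r) /\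
  \int[leb]_(r in `]a, b[) 'D_1 P r = P b - P a.
Proof.
move=> a0 ab sP; have cD := derivative_within (b := b) a0 sP.
have dP (r : R) : 0 < r -> differentiable P r by move=> r0; exact: (sP 1%N).1.
have I1 := continuous_compact_integrable (@segment_compact _ a b) cD.
have I2 : intble leb (`]a, b[%classic : set mR) (fun r : R => 'D_1 P r).
  apply: (integrableS _ _ _ I1) => //; exact: subset_itv_oo_cc.
split=> //; rewrite /Rintegral -(@integral_itv_bndoo _ a b _ true false); last first.
  by apply/measurable_EFinP; exact: intble_measurable I2.
rewrite (@continuous_FTC2 _ _ P a b) //.
- split.
  + by move=> r; rewrite in_itv /= => /andP[ar _]; apply: diff_derivable; apply: dP; exact: lt_trans ar.
  + by apply: cvg_at_right_filter; apply: differentiable_continuous; exact: dP.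
  + by apply: cvg_at_left_filter; apply: differentiable_continuous; apply: dP; exact: lt_trans ab.
- by move=> r _; rewrite derive1E.
Qed.

Lemma Rint_box_fst (p : R -> R) (a b c d : R) : c <= d -> intble leb (`]a, b[%classic : set mR) p ->
  \int[leb2]_(x in box a b c d) p x.1 = (d - c) * \int[leb]_(r in `]a, b[) p r.
Proof.
move=> cd Ip; pose J : set mR := `]c, d[%classic; pose i : mR -> R := \1_J.
have mJ : measurable J by exact: measurable_itv.
pose I : set mR := `]a, b[%classic; have mI : measurable I by exact: measurable_itv.
have IK : intble leb setT (p \_ I : mR -> R).
  apply/(@intble_support _ _ _ leb I setT _ mI measurableT) => //.
    by move=> x _ nx; rewrite patchE memNset.
  by apply: (intble_eq mI _ Ip) => x Ix; rewrite patchE mem_set.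
have lJ : leb J = (d - c)%:E by exact: (leb_oo cd).
have Ii : intble leb setT i.
  apply/(@intble_support _ _ _ leb J setT _ mJ measurableT) => //.
    by move=> x _ nx; rewrite /i indicE memNset.
  apply: (intble_eq mJ (f := fun=> 1)); first by move=> x Jx; rewrite /i indicE mem_set.
  have f1 : (leb J < +oo)%E by rewrite lJ ltry.
  apply: (sqint_intble mJ f1); apply: (sqint_bounded (C := 1) mJ f1); first exact: measurable_cst.
  by move=> x _; rewrite normr1.
transitivity (\int[leb2]_(x in box a b c d) ((p \_ I) x.1 * i x.2)).
  apply: Rint_eq => x [/= x1 x2]; rewrite patchE mem_set; last by rewrite /I /= in_itv.
  by rewrite /i indicE mem_set ?mulr1 // /J /= in_itv.
rewrite Rint_box; last first.
  move=> x nx; rewrite patchE /i indicE; case: ifPn => [/set_mem|_]; last by rewrite mul0r.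
  rewrite /I /= in_itv => x1; rewrite memNset ?mulr0 // /J /= in_itv => x2; exact: nx.
have [_ ->] := Rint_fubini (intble_prod IK Ii).
have Ei : \int[leb]_y i y = d - c.
  rewrite /Rintegral /i (integral_indic leb measurableT mJ) setIT.
  exact: (congr1 fine lJ).
transitivity (\int[leb]_x ((d - c) * (p \_ I) x)).
  by apply: Rint_eq => x _ /=; rewrite RintZ // Ei mulrC.
by rewrite RintZ // -Rintegral_mkcond.
Qed.

Variables (Omega : set plane) (x0 : plane) (ga s rr : R).
Hypotheses (oO : open Omega) (fO : (leb2 (Omega : set mplane) < +oo)%E).
Hypotheses (spi : 0 < s < pi) (rr0 : 0 < rr).
Hypothesis corner : forall x, sqdist x0 x < rr ->
  (Omega x <-> slit x0 ga x /\ - s < angle x0 ga x < s).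
Local Notation t := (sqdist x0).
Local Notation A a b := (annulus Omega x0 rr a b).

(** In the coordinates (t, th) a radial function does not depend on the second variable, so the
    fundamental theorem evaluates the integral. Integrands are always presented as derivatives, and
    the density of the measure stays inside [k]. *)
Lemma radial_integral : exists2 k : R, 0 < k & forall (a b : R) (P : R -> R),
  0 < a -> a < b -> b <= rr -> smooth_on [set r : R | 0 < r] P ->
  intble leb2 (A a b) (fun x : mplane => 'D_1 P (t x)) /\
  \int[leb2]_(x in A a b) 'D_1 P (t x) = k * (P b - P a).
Proof.
have [k k0 Hk] := annulus_integral oO fO spi rr0 corner.
have /andP[s0 _] := spi.
exists (k * (s - - s)); first by rewrite mulr_gt0 // opprK addr_gt0.
move=> a b P a0 ab brr sP.
have mA : measurable (A a b : set mplane) := measurable_annulus x0 rr oO a b.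
have fA : (leb2 (A a b : set mplane) < +oo)%E.
  by apply: le_lt_trans fO; apply: le_measure; rewrite ?inE //; [exact: measurable_open|exact: annulus_sub].
have AS : A a b `<=` slit x0 ga by move=> x [[Ox tx] _]; have [] := (corner tx).1 Ox.
have cD := derivative_within (b := b) a0 sP.
have cN : {within `[a, b], continuous (fun r : R => `|'D_1 P r|)}.
  by move=> r; apply: cvg_norm; exact: cD.
have [c _ Hc] := @EVT_max R (fun r => `|'D_1 P r|) a b (ltW ab) cN.
have sA : smooth_on (A a b) (fun x => 'D_1 P (t x)).
  apply: (smooth_on_sub AS); apply: (smooth_on_comp (@open_slit R x0 ga) (F := fun r : R => 'D_1 P r) (J := [set r : R | 0 < r])).
  - by move=> n; exact: (sP n.+1).2.
  - exact: smooth_on_sub (smooth_on_sqdist x0).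
  - by move=> x; exact: slit_gt0.
have IA : intble leb2 (A a b) (fun x : mplane => 'D_1 P (t x)).
  apply: (sqint_intble mA fA); apply: (sqint_bounded (C := `|'D_1 P c|) mA fA).
    exact: smooth_on_measurable (@open_annulus R Omega x0 rr oO a b) sA.
  by move=> x [_ /andP[x1 x2]]; apply: Hc; rewrite in_itv /= !ltW.
split=> //; have [Ib ->] := Hk a b _ (ltW a0) brr IA.
have [I1 <-] := interval_FTC a0 ab sP; rewrite -mulrA; congr (_ * _).
rewrite -(Rint_box_fst _ I1); last by rewrite ge0_cp // ltW.
apply: Rint_eq => p [/andP[p1 p2] /andP[p3 p4]].
have /andP[_ spi'] := spi.
have [] // := @unpolarK R x0 ga p; first exact: lt_trans p1.
  by rewrite (lt_trans _ p3) ?ltrN2 //= (lt_trans p4).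
by move=> _ ->.
Qed.

End radial_integral.

Section profile_arithmetic.
Context {R : realType}.
Implicit Types dl p q r c L : R.

Lemma profile2_algebra dl p q r c : 0 < r ->
  dl * p * (1 * - r^-1 ^+ 2) + r^-1 * (dl * (dl * q / r) + p * 0) = dl * (dl * q / r) / r - dl * p / r ^+ 2.
Proof. by move=> r0; field; rewrite gt_eqF. Qed.

Lemma potential_algebra dl p q r : 0 < dl -> 0 < r ->
  (2 * dl)^-1 * (dl * p / r) + q * 0 = p / (2 * r).
Proof. by move=> dl0 r0; field; rewrite !gt_eqF. Qed.

Lemma sum3_le (x y z : R) : 1 <= x -> 1 <= y -> 1 <= z -> [/\ x <= x + y + z, y <= x + y + z & z <= x + y + z].
Proof. by move=> h1 h2 h3; split; lra. Qed.

Lemma profile1_estimate dl p r L : 0 < dl -> 0 < r -> `|p| <= L -> `|dl * p / r| * r <= dl * L.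
Proof.
move=> dl0 r0 h.
by rewrite !normrM [`|r^-1|]gtr0_norm ?invr_gt0 // mulfVK ?gt_eqF // [`|dl|]gtr0_norm // ler_pM2l.
Qed.

Lemma profile2_estimate dl p q r L : 0 < dl -> dl <= 1 -> 0 < r -> `|p| <= L -> `|q| <= L ->
  `|dl * (dl * q / r) / r - dl * p / r ^+ 2| * r ^+ 2 <= 2 * (dl * L).
Proof.
move=> dl0 dl1 r0 hp hq.
have -> : `|dl * (dl * q / r) / r - dl * p / r ^+ 2| * r ^+ 2 = `|dl * (dl * q - p)|.
  rewrite -{2}[r ^+ 2]ger0_norm ?sqr_ge0 // -normrM; congr `|_|.
  by field; rewrite gt_eqF.
rewrite normrM [`|dl|]gtr0_norm // mulrCA ler_pM2l //; apply: le_trans (ler_normB _ _) _.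
rewrite normrM [`|dl|]gtr0_norm //; have : dl * `|q| <= `|q| by rewrite ler_piMl.
by move: (dl * `|q|) => z; lra.
Qed.

End profile_arithmetic.

(** * The logarithmic cutoff profile *)

Section logarithmic_profile.
Context {R : realType}.
Implicit Types (g : R -> R) (dl r : R).

Lemma smooth_on_log g dl : smooth_on setT g -> smooth_on [set r : R | 0 < r] (fun r => g (dl * ln r + 2)).
Proof.
move=> sg n; apply: (@diffn_comp _ _ n _ setT g (fun r : R => dl * ln r + 2) (@open_gt R 0) (sg n)) => //.
apply: (diffnD (@open_gt R 0)); last exact: (diffn_cst n 2 (@open_gt R 0)).
apply: (diffnM (@open_gt R 0)); first exact: (diffn_cst n dl (@open_gt R 0)).
exact: smooth_on_ln.
Qed.

Lemma derive_log g dl r : smooth_on setT g -> 0 < r ->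
  'D_1 (fun r => g (dl * ln r + 2)) r = dl * 'D_1 g (dl * ln r + 2) / r.
Proof.
move=> sg r0; have H : is_derive r (1 : R) (fun r : R => dl * ln r + 2) (dl / r).
  rewrite (_ : (fun r : R => dl * ln r + 2) = dl *: (@ln R : R -> R) + cst 2); last by apply/funext.
  apply: is_derive_eq; first by apply: is_deriveD; apply: is_deriveZ; exact: is_derive1_ln.
  by rewrite /GRing.scale /= addr0.
have [dl' dv] := is_derive1P H.
rewrite [LHS](@derive_comp1 R _ g (fun r : R => dl * ln r + 2) r 1 dl' ((sg 1%N).1 _ I)) dv mul1r.
by rewrite mulrCA mulrA.
Qed.

Local Notation st1 := (fun x => 'D_1 (step : R -> R) x).
Local Notation st2 := (fun x => 'D_1 st1 x).
Local Notation st3 := (fun x => 'D_1 st2 x).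

(* [profile dl] is supported in [exp (- 2 / dl), exp (- 1 / dl)]. *)
Definition profile dl r : R := st1 (dl * ln r + 2).
Definition profile1 dl r : R := dl * st2 (dl * ln r + 2) / r.
Definition profile2 dl r : R := dl * (dl * st3 (dl * ln r + 2) / r) / r - dl * st2 (dl * ln r + 2) / r ^+ 2.
(** The profile is the derivative of [step] in the logarithmic variable precisely so that
    [profile dl r / (2 * r)] has this explicit and bounded primitive; composed with [t], it is a
    potential of the main part of the Laplacian. *)
Definition potential dl r : R := (2 * dl)^-1 * step (dl * ln r + 2).

Let s1 : smooth_on setT st1 := (@unit_support_step R).1.
Let s2 : smooth_on setT st2 := (unit_support_D (@unit_support_step R)).1.

Lemma smooth_on_profile dl : smooth_on [set r : R | 0 < r] (profile dl).
Proof. exact: smooth_on_log. Qed.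

Lemma derive_profile dl r : 0 < r -> 'D_1 (profile dl) r = profile1 dl r.
Proof. exact: derive_log. Qed.

Lemma smooth_on_profile1 dl : smooth_on [set r : R | 0 < r] (profile1 dl).
Proof.
move=> n; apply: (diffnM (@open_gt R 0)); last first.
  by apply: diffn_sub (@smooth_on_inv R n) => r /= r0; rewrite gt_eqF.
apply: (diffnM (@open_gt R 0)); first exact: (diffn_cst n dl (@open_gt R 0)).
exact: (smooth_on_log dl s2 n).
Qed.

Lemma derive_profile1 dl r : 0 < r -> 'D_1 (profile1 dl) r = profile2 dl r.
Proof.
move=> r0; have dinv : is_derive r (1 : R) (@GRing.inv R) (- r^-1 ^+ 2).
  apply: is_derive_eq (is_deriveV (lt0r_neq0 r0) (is_derive_id r 1)) _.
  by rewrite /GRing.scale /= mulr1 exprVn.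
have [di vi] := is_derive1P dinv.
have d2 : differentiable (fun r : R => st2 (dl * ln r + 2)) r := (smooth_on_log dl s2 1%N).1 r r0.
have dc : differentiable (cst dl : R -> R) r by exact: differentiable_cst.
have d1 : differentiable (fun r : R => dl * st2 (dl * ln r + 2)) r by exact: differentiableM.
rewrite [LHS](derive_mul (1 : R) d1 di) vi (derive_mul (1 : R) dc d2) (derive_log dl s2 r0).
have -> : 'D_1 (cst dl : R -> R) r = 0 by exact: derive_cst.
exact: profile2_algebra.
Qed.

Lemma smooth_on_potential dl : smooth_on [set r : R | 0 < r] (potential dl).
Proof.
move=> n; apply: (diffnM (@open_gt R 0)); first exact: (diffn_cst n _ (@open_gt R 0)).
by apply: smooth_on_log; exact: smooth_on_step.
Qed.

Lemma derive_potential dl r : 0 < dl -> 0 < r -> 'D_1 (potential dl) r = profile dl r / (2 * r).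
Proof.
move=> dl0 r0; have dS : differentiable (fun r : R => step (dl * ln r + 2)) r := (smooth_on_log dl (@smooth_on_step R) 1%N).1 r r0.
have dc : differentiable (cst (2 * dl)^-1 : R -> R) r by exact: differentiable_cst.
rewrite [LHS](derive_mul (1 : R) dc dS) (derive_log dl (@smooth_on_step R) r0).
have -> : 'D_1 (cst (2 * dl)^-1 : R -> R) r = 0 by exact: derive_cst.
exact: potential_algebra.
Qed.

Lemma log_lt_inner dl r : 0 < dl -> 0 < r -> r < expR (- 2 / dl) -> dl * ln r + 2 < 0.
Proof.
move=> dl0 r0; rewrite -{1}(lnK r0) ltr_expR ltr_pdivlMr // mulrC; lra.
Qed.

Lemma log_gt_outer dl r : 0 < dl -> 0 < r -> expR (- 1 / dl) < r -> 1 < dl * ln r + 2.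
Proof.
move=> dl0 r0; rewrite -{1}(lnK r0) ltr_expR ltr_pdivrMr // mulrC; lra.
Qed.

Lemma profile_support dl r : 0 < dl -> 0 < r -> r < expR (- 2 / dl) \/ expR (- 1 / dl) < r -> profile dl r = 0.
Proof.
move=> dl0 r0 h; apply: step_D_out; case: h => h; [left|right]; first exact: log_lt_inner.
exact: log_gt_outer.
Qed.

(** Each derivative of a function of [dl * ln r] brings the factor [dl / r]. In [profile2] the
    derivative of [1 / r] leaves a term with a single [dl], and [dl <= 1] absorbs the other one. *)
Lemma profile_bounds : exists2 L : R, 1 <= L & forall dl r, 0 < dl -> dl <= 1 -> 0 < r ->
  [/\ `|profile dl r| <= L, `|profile1 dl r| * r <= dl * L & `|profile2 dl r| * r ^+ 2 <= 2 * (dl * L)].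
Proof.
have [L1 L11 H1] := unit_support_bounded (@unit_support_step R).
have [L2 L21 H2] := unit_support_bounded (unit_support_D (@unit_support_step R)).
have [L3 L31 H3] := unit_support_bounded (unit_support_D (unit_support_D (@unit_support_step R))).
have [M1 M2 M3] := sum3_le L11 L21 L31.
exists (L1 + L2 + L3) => [|dl r dl0 dl1 r0]; first exact: le_trans L11 M1.
have h1 := le_trans (H1 (dl * ln r + 2)) M1; have h2 := le_trans (H2 (dl * ln r + 2)) M2.
have h3 := le_trans (H3 (dl * ln r + 2)) M3.
exact (And3 h1 (profile1_estimate dl0 r0 h2) (profile2_estimate dl0 dl1 r0 h2 h3)).
Qed.

End logarithmic_profile.

(** * The linear part that makes the field vanish on both sides *)

Section edge_condition.
Context {R : realType}.
Local Notation plane := (R * R)%type.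

Lemma MVT_lipschitz (f g : R -> R) : (forall x, is_derive x (1 : R) f (g x)) -> (forall x, `|g x| <= 1) ->
  forall a b, `|f a - f b| <= `|a - b|.
Proof.
move=> df g1 a b; wlog ab : a b / b <= a.
  move=> H; have [h|h] := leP b a; first exact: H.
  by rewrite distrC [leRHS]distrC; apply: H; exact: ltW.
have cf x : {for x, continuous f}.
  by apply: differentiable_continuous; apply/derivable1_diffP; exact: ex_derive.
have [c _ ->] := MVT_segment ab (fun x _ => df x) (continuous_subspaceT cf).
by rewrite normrM; apply: ler_piMl.
Qed.

Lemma sin_lipschitz (a b : R) : `|sin a - sin b| <= `|a - b|.
Proof.
apply: (@MVT_lipschitz sin cos) => x; rewrite ler_norml; apply/andP; split; [exact: cos_geN1|exact: cos_le1].
Qed.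

Lemma cos_lipschitz (a b : R) : `|cos a - cos b| <= `|a - b|.
Proof.
apply: (@MVT_lipschitz cos (fun x => - sin x)) => x.
by rewrite normrN ler_norml; apply/andP; split; [exact: sin_geN1|exact: sin_le1].
Qed.

(** The expression vanishes at [th = s] by the hypothesis and is Lipschitz on the interval in
    question. As it is even in [th], the estimate at the other side follows by reflection. *)
Lemma edge_even (s k th : R) : 0 <= s -> s * sin s / 2 = k * cos s ->
  `|th * sin th / 2 - k * cos th| <= (1 + s + `|k|) * `|s - th|.
Proof.
move=> s0 H; have -> : th * sin th / 2 - k * cos th =
    (th - s) * (sin th / 2) + s / 2 * (sin th - sin s) - k * (cos th - cos s).
  by apply/eqP; rewrite -subr_eq0; apply/eqP; transitivity (s * sin s / 2 - k * cos s); [field|rewrite H subrr].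
have h1 := sin_lipschitz th s; have h2 := cos_lipschitz th s.
have h3 : `|sin th| <= 1 by rewrite ler_norml sin_geN1 sin_le1.
rewrite [`|s - th|]distrC; apply: le_trans (ler_normB _ _) _; rewrite [leRHS]mulrDl; apply: lerD; last first.
  by rewrite normrM; apply: ler_wpM2l.
apply: le_trans (ler_normD _ _) _; rewrite [leRHS]mulrDl mul1r; apply: lerD.
  rewrite normrM ler_piMr // normrM [`|2^-1|]ger0_norm ?invr_ge0 //; have := normr_ge0 (sin th); lra.
rewrite normrM; apply: ler_pM => //; rewrite ger0_norm ?divr_ge0 //; lra.
Qed.

Lemma edge_odd (s k th : R) : 0 <= s -> s * cos s / 2 = k * sin s ->
  `|- th * cos th / 2 + k * sin th| <= (1 + s + `|k|) * `|s - th|.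
Proof.
move=> s0 H; have -> : - th * cos th / 2 + k * sin th =
    - ((th - s) * (cos th / 2) + s / 2 * (cos th - cos s) - k * (sin th - sin s)).
  by apply/eqP; rewrite -subr_eq0; apply/eqP; transitivity (k * sin s - s * cos s / 2); [field|rewrite H subrr].
have h1 := sin_lipschitz th s; have h2 := cos_lipschitz th s.
have h3 : `|cos th| <= 1 by rewrite ler_norml cos_geN1 cos_le1.
rewrite normrN [`|s - th|]distrC; apply: le_trans (ler_normB _ _) _; rewrite [leRHS]mulrDl; apply: lerD; last first.
  by rewrite normrM; apply: ler_wpM2l.
apply: le_trans (ler_normD _ _) _; rewrite [leRHS]mulrDl mul1r; apply: lerD.
  rewrite normrM ler_piMr // normrM [`|2^-1|]ger0_norm ?invr_ge0 //; have := normr_ge0 (cos th); lra.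
rewrite normrM; apply: ler_pM => //; rewrite ger0_norm ?divr_ge0 //; lra.
Qed.

(* In the coordinates [y] of the bisector the field is
   [(th y2 / 2 - k1 y1, - th y1 / 2 + k2 y2)]; both components vanish at
   [th = s] and [th = - s] for [k1 = s tan s / 2] and [k2 = s cot s / 2]. *)
Lemma sector_field_coefficients (x0 : plane) (ga s : R) : 0 < s < pi -> s != pi / 2 ->
  exists m1 n1 m2 n2 C : R, 0 <= C /\ forall x, slit x0 ga x ->
    let r := Num.sqrt (sqdist x0 x) in let th := angle x0 ga x in
    [/\ `|field x0 ga 0 (1 / 2) m1 n1 x| <= C * r * `|s - th|,
        `|field x0 ga 0 (1 / 2) m1 n1 x| <= C * r * `|s + th|,
        `|field x0 ga (- (1 / 2)) 0 m2 n2 x| <= C * r * `|s - th| &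
        `|field x0 ga (- (1 / 2)) 0 m2 n2 x| <= C * r * `|s + th|].
Proof.
move=> /andP[s0 spi] s2.
have sn : sin s != 0 by rewrite gt_eqF // sin_gt0_pi // s0.
have cs : cos s != 0.
  apply/negP => /eqP c0; have [h|h] := ltrP s (pi / 2).
    have := @cos_gt0_pihalf R s; rewrite c0 ltxx h (lt_trans _ s0) ?oppr_lt0 ?divr_gt0 ?pi_gt0 //.
    by move=> /(_ isT).
  have h' : pi / 2 < s by rewrite lt_neqAle eq_sym s2.
  have := @cos_gt0_pihalf R (s - pi); rewrite cosB cospi sinpi c0 mul0r mulr0 addr0 ltxx => H.
  have : false by apply: H; move: h' spi; have := pi_gt0 R; move: pi => p *; apply/andP; split; lra.
  by [].
pose k1 := s * sin s / (2 * cos s); pose k2 := s * cos s / (2 * sin s).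
have E1 : s * sin s / 2 = k1 * cos s by rewrite /k1; field.
have E2 : s * cos s / 2 = k2 * sin s by rewrite /k2; field.
pose c := cos ga; pose d := sin ga.
(* The diagonal map with entries [- k1] and [k2] in the frame of the bisector, conjugated by the
   rotation into the original coordinates. *)
exists (k2 * d ^+ 2 - k1 * c ^+ 2), ((k1 + k2) * c * d), ((k1 + k2) * c * d), (k2 * c ^+ 2 - k1 * d ^+ 2).
exists ((1 + s + `|k1|) + (1 + s + `|k2|)); split; first by rewrite !addr_ge0 // ltW.
move=> x Sx r th.
have [y1E y2E] := cos_sin_angle Sx; have cd := cos2Dsin2 ga.
have r0 : 0 <= r by exact: sqrtr_ge0.
pose v1 := r * (th * sin th / 2 - k1 * cos th); pose v2 := r * (- th * cos th / 2 + k2 * sin th).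
have V1 : v1 = th * y2 x0 ga x / 2 - k1 * y1 x0 ga x by rewrite -y1E -y2E /v1 /r /th; ring.
have V2 : v2 = - th * y1 x0 ga x / 2 + k2 * y2 x0 ga x by rewrite -y1E -y2E /v2 /r /th; ring.
have Z1 : z1 x0 x = c * y1 x0 ga x + d * y2 x0 ga x.
  rewrite /y1 /y2 -/c -/d; transitivity ((c ^+ 2 + d ^+ 2) * z1 x0 x); last by ring.
  by rewrite cd mul1r.
have Z2 : z2 x0 x = c * y2 x0 ga x - d * y1 x0 ga x.
  rewrite /y1 /y2 -/c -/d; transitivity ((c ^+ 2 + d ^+ 2) * z2 x0 x); last by ring.
  by rewrite cd mul1r.
have U1 : field x0 ga 0 (1 / 2) (k2 * d ^+ 2 - k1 * c ^+ 2) ((k1 + k2) * c * d) x = c * v1 + d * v2.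
  transitivity (th * z2 x0 x / 2 + (c ^+ 2 + d ^+ 2) * (k2 * d * y2 x0 ga x - k1 * c * y1 x0 ga x)).
    by rewrite /field /lin -/th Z1 Z2; ring.
  by rewrite cd mul1r Z2 V1 V2; ring.
have U2 : field x0 ga (- (1 / 2)) 0 ((k1 + k2) * c * d) (k2 * c ^+ 2 - k1 * d ^+ 2) x = c * v2 - d * v1.
  transitivity (- th * z1 x0 x / 2 + (c ^+ 2 + d ^+ 2) * (k2 * c * y2 x0 ga x + k1 * d * y1 x0 ga x)).
    by rewrite /field /lin -/th Z1 Z2; ring.
  by rewrite cd mul1r Z1 V1 V2; ring.
have c1 : `|c| <= 1 by rewrite ler_norml cos_geN1 cos_le1.
have d1 : `|d| <= 1 by rewrite ler_norml sin_geN1 sin_le1.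
have bound (p q q1 q2 w : R) : `|p| <= 1 -> `|q| <= 1 -> `|q1| <= r * ((1 + s + `|k1|) * w) ->
    `|q2| <= r * ((1 + s + `|k2|) * w) -> `|p * q1 + q * q2| <= (1 + s + `|k1| + (1 + s + `|k2|)) * r * w.
  move=> hp hq h1 h2; apply: le_trans (ler_normD _ _) _.
  have -> : (1 + s + `|k1| + (1 + s + `|k2|)) * r * w = r * ((1 + s + `|k1|) * w) + r * ((1 + s + `|k2|) * w) by ring.
  by rewrite (normrM p) (normrM q); apply: lerD; apply: le_trans (ler_piMl (normr_ge0 _) _) _.
have s0' := ltW s0.
have B1 : `|v1| <= r * ((1 + s + `|k1|) * `|s - th|).
  by rewrite normrM ger0_norm // ler_wpM2l // edge_even.
have B2 : `|v2| <= r * ((1 + s + `|k2|) * `|s - th|).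
  by rewrite normrM ger0_norm // ler_wpM2l // edge_odd.
have B1' : `|v1| <= r * ((1 + s + `|k1|) * `|s + th|).
  have := @edge_even s k1 (- th) s0' E1; rewrite sinN cosN mulrNN opprK => h.
  by rewrite normrM ger0_norm // ler_wpM2l.
have B2' : `|v2| <= r * ((1 + s + `|k2|) * `|s + th|).
  have e : `|- th * cos th / 2 + k2 * sin th| = `|- - th * cos (- th) / 2 + k2 * sin (- th)|.
    by rewrite -normrN sinN cosN; congr `|_|; ring.
  have := @edge_odd s k2 (- th) s0' E2; rewrite -e opprK => h.
  by rewrite normrM ger0_norm // ler_wpM2l.
have dN : `|- d| <= 1 by rewrite normrN.
have U2' : c * v2 - d * v1 = - d * v1 + c * v2 by ring.
by rewrite U1 U2 U2'; split; apply: bound.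
Qed.

End edge_condition.

Section planar_measure.
Context {R : realType}.
Local Notation plane := (R * R)%type.
Local Notation mplane := (measurableTypeR R * measurableTypeR R)%type.

Lemma bounded_leb2_finite (A : set plane) : open A -> bounded_set A -> (leb2 (A : set mplane) < +oo)%E.
Proof.
move=> oA bA; have [M M0 HM] := ex_strict_bound_gt0 bA.
apply: (@le_lt_trans _ _ (leb2 (box (- M) M (- M) M : set mplane))); last first.
  by rewrite leb2_box ?ltry // ge0_cp // ltW.
apply: le_measure; rewrite ?inE; [exact: measurable_open|exact: measurable_box|].
move=> x Ax; have xM : `|x| < M := HM x Ax.
have := xM; rewrite prod_normE gt_max => /andP[x1 x2].
by split=> /=; rewrite -ltr_norml.
Qed.

Lemma open_leb2_gt0 (A : set plane) : open A -> A !=set0 -> (0 < leb2 (A : set mplane))%E.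
Proof.
move=> oA [z Az]; have /nbhs_ballP[e /= e0 He] := open_nbhs_nbhs (conj oA Az).
pose B : set mplane := box (z.1 - e) (z.1 + e) (z.2 - e) (z.2 + e).
apply: (@lt_le_trans _ _ (leb2 B)).
  have h (c : R) : c - e <= c + e by lra.
  have d (c : R) : 0 < c + e - (c - e) by lra.
  by rewrite leb2_box // lte_fin mulr_gt0.
apply: le_measure; rewrite ?inE; [exact: measurable_box|exact: measurable_open|].
move=> x [x1 x2]; apply: He; split; rewrite /ball /= ltr_distlC.
  by [].
by [].
Qed.

End planar_measure.

(** * Pointwise estimates of the vector field *)

Section corner_dipole.
Context {R : realType}.
Local Notation plane := (R * R)%type.
Local Notation mplane := (measurableTypeR R * measurableTypeR R)%type.
Variables (x0 : plane) (ga : R) (m1 n1 m2 n2 dl : R).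
Local Notation t := (sqdist x0).
Local Notation S := (slit x0 ga).
Local Notation X r := (profile dl r).
Implicit Types (i j : 'I_2) (x : plane).

Definition dipole_field i : plane -> R :=
  if i == ord0 then field x0 ga 0 (1 / 2) m1 n1 else field x0 ga (- (1 / 2)) 0 m2 n2.
Definition dipole i : plane -> R := fun x => X (t x) * dipole_field i x.
Definition dipole_size := field_size 0 (1 / 2) m1 n1 + field_size (- (1 / 2)) 0 m2 n2.
Definition zcoord i x : R := if i == ord0 then z1 x0 x else z2 x0 x.
Definition grad_div i x : R := 'D_(basis2 i) (fun y => 'D_(basis2 ord0) (dipole ord0) y) x +
  'D_(basis2 i) (fun y => 'D_(basis2 ord_max) (dipole ord_max) y) x.

Hypotheses (dl0 : 0 < dl).

Lemma ord2_cases (P : 'I_2 -> Prop) : P ord0 -> P ord_max -> forall i, P i.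
Proof. by move=> h0 h1 i; have [->//|/ord2_max ->] := eqVneq i ord0. Qed.

Lemma dipole_gradient i : exists g1 g2 : plane -> R, has_gradient x0 ga (dipole i) g1 g2.
Proof.
have G := gradient_radial_field x0 ga (@smooth_on_profile R dl) (@derive_profile R dl).
move: i; apply: ord2_cases; eexists; eexists; exact: G.
Qed.

Lemma smooth_on_dipole i : smooth_on S (dipole i).
Proof. by have [g1 [g2 []]] := dipole_gradient i. Qed.

Lemma radial_support_profile (f : plane -> R) :
  radial_support x0 ga (expR (- 2 / dl)) (expR (- 1 / dl)) (fun x => X (t x) * f x).
Proof. by move=> x /slit_gt0 t0 h; rewrite profile_support ?mul0r. Qed.

Lemma dipole_size_ge0 : 0 <= dipole_size.
Proof. by rewrite addr_ge0 ?field_size_ge0. Qed.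

Lemma angle_le4 x : `|angle x0 ga x| <= 4.
Proof.
have /andP[h1 h2] := angle_bounds x0 ga x; have := @pihalf_lt2 R.
rewrite ler_norml => h; apply/andP; split; move: h h1 h2; move: pi (angle x0 ga x) => p A; lra.
Qed.

Lemma zcoord_le i x : `|zcoord i x| <= Num.sqrt (t x).
Proof.
have H (u : R) : u ^+ 2 <= t x -> `|u| <= Num.sqrt (t x) by move=> h; rewrite -sqrtr_sqr ler_wsqrtr.
move: i; apply: ord2_cases; apply: H; rewrite /sqdist /=; [rewrite lerDl|rewrite lerDr]; exact: sqr_ge0.
Qed.

Lemma dipole_field_le i x : `|dipole_field i x| <= dipole_size * Num.sqrt (t x).
Proof.
have r0 : 0 <= Num.sqrt (t x) by exact: sqrtr_ge0.
have h1 := zcoord_le ord0 x; have h2 := zcoord_le ord_max x.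
move: i; apply: ord2_cases; apply: le_trans (field_le _ _ _ _ (angle_le4 x) h1 h2) _; apply: ler_wpM2r => //.
  by rewrite /dipole_size lerDl field_size_ge0.
by rewrite /dipole_size lerDr field_size_ge0.
Qed.

Variable L : R.
Hypothesis L1 : 1 <= L.
Hypothesis bounds : forall r, 0 < r ->
  [/\ `|X r| <= L, `|profile1 dl r| * r <= dl * L & `|profile2 dl r| * r ^+ 2 <= 2 * (dl * L)].

Let root x : S x -> 0 < Num.sqrt (t x) /\ Num.sqrt (t x) ^+ 2 = t x.
Proof. by move=> /slit_gt0 t0; rewrite sqrtr_gt0 sqr_sqrtr ?ltW. Qed.

Let bounds' x : S x -> let r := Num.sqrt (t x) in
  [/\ `|X (t x)| <= L, `|profile1 dl (t x)| * r ^+ 2 <= dl * L & `|profile2 dl (t x)| * r ^+ 4 <= 2 * (dl * L)].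
Proof.
move=> Sx r; have [r0 r2] := root Sx; have [h1 h2 h3] := bounds (slit_gt0 Sx).
split=> //; first by rewrite r2.
have -> : r ^+ 4 = (t x) ^+ 2 by rewrite -[4%N]/(2 * 2)%N exprM r2.
exact: h3.
Qed.

Lemma laplacian_dipole i x : S x -> laplacian (dipole i) x =
  (8 * profile1 dl (t x) + 4 * t x * profile2 dl (t x)) * dipole_field i x + X (t x) * (zcoord i x / t x).
Proof.
move=> Sx; have E := laplacian_radial_field (@smooth_on_profile R dl) (@smooth_on_profile1 R dl)
  (@derive_profile R dl) (@derive_profile1 R dl) _ _ _ _ Sx.
have e2 : (2 : R) * (1 / 2) = 1 by field.
move: i; apply: ord2_cases; apply: etrans (E _ _ _ _) _; congr (_ + _ * (_ / _)); rewrite /lin /zcoord /=.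
  by rewrite oppr0 mul0r addr0 mulrA e2 mul1r.
by rewrite opprK mul0r add0r mulrA e2 mul1r.
Qed.

Lemma laplacian_dipole_error i x : S x ->
  `|laplacian (dipole i) x - X (t x) * (zcoord i x / t x)| <= 16 * (dl * L) * dipole_size / Num.sqrt (t x).
Proof.
move=> Sx; have [r0 r2] := root Sx; have [_ h2 h3] := bounds' Sx.
rewrite laplacian_dipole // addrK -[Y in 4 * Y]r2.
exact: laplacian_error_le r0 h2 h3 (dipole_field_le i x).
Qed.

Definition divergence_size := 2 * `|m1 + n2 - 1 / 2| + 12 * (`|m1| + `|n1 + m2| + `|n2|).

Lemma grad_div_le i x : S x -> `|grad_div i x| <= divergence_size * (dl * L) / Num.sqrt (t x).
Proof.
move=> Sx; have [r0 r2] := root Sx; have [_ h2 h3] := bounds' Sx.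
have E := grad_divergence_sum (@smooth_on_profile R dl) (@smooth_on_profile1 R dl)
  (@derive_profile R dl) (@derive_profile1 R dl) m1 n1 m2 n2 _ Sx.
rewrite /grad_div; apply: le_trans (_ : `|_| <= _); first by rewrite (E i); exact: lexx.
have hz1 := zcoord_le ord0 x; have hz2 := zcoord_le ord_max x.
have hl : `|lin x0 (basis2 i).1 (basis2 i).2 x| <= Num.sqrt (t x).
  move: i; apply: ord2_cases; rewrite ?basis2_0 ?basis2_max /lin /= !mul1r !mul0r ?addr0 ?add0r //.
apply: divergence_error_le => //; first exact: quad_le.
move: i hl; apply: ord2_cases => _ /=; first exact: quad_D_le.
apply: le_trans (@quad_D_le R n2 (n1 + m2) m1 _ _ _ hz2 hz1) _.
by rewrite le_eqVlt; apply/orP; left; apply/eqP; ring.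
Qed.

(** The derivative of the profile has size dl / t, while [z] and the field have size at most a
    constant times the square root of [t]; their product is bounded uniformly in [dl], unlike the
    second derivatives. *)
Lemma dipole_D_le i j x : dl <= 1 -> S x -> `|'D_(basis2 j) (dipole i) x| <= 4 * L * dipole_size.
Proof.
move=> dl1 Sx; have [r0 r2] := root Sx; have [h1 h2 _] := bounds' Sx.
have G p q m n := gradient_radial_field x0 ga (@smooth_on_profile R dl) (@derive_profile R dl) p q m n.
have hz1 := zcoord_le ord0 x; have hz2 := zcoord_le ord_max x; have ha := angle_le4 x.
have tE := r2; have L0 : 0 <= L by exact: le_trans ler01 L1.
have main p q m n : field_size p q m n <= dipole_size ->
    `|'D_(basis2 j) (fun x => X (t x) * field x0 ga p q m n x) x| <= 4 * L * dipole_size.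
  move=> hs; have hf := field_le p q m n ha hz1 hz2.
  have hz2N : `|- z2 x0 x| <= Num.sqrt (t x) by rewrite normrN.
  have kp : `|p| <= `|p| + `|q| by rewrite lerDl.
  have kq : `|q| <= `|p| + `|q| by rewrite lerDr.
  have km : `|m| <= `|m| + `|n| by rewrite lerDl.
  have kn : `|n| <= `|m| + `|n| by rewrite lerDr.
  have K y : y <= 2 * (dl * L + L) * field_size p q m n -> y <= 4 * L * dipole_size.
    move=> h; apply: le_trans h _; have : dl * L <= L by rewrite ler_piMl.
    have : 0 <= dl * L by rewrite mulr_ge0 // ltW.
    by move: (dl * L) => z z0 zL; apply: ler_pM => //; rewrite ?field_size_ge0 ?mulr_ge0 ?addr_ge0 //; lra.
  apply: K; move: j; apply: ord2_cases.
    rewrite (gradient_D0 (G p q m n) Sx); apply: (gradient_field_le r0 h2 h1 hz1 hf).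
    by rewrite /field1 -[in Y in Y * lin _ _ _ _]tE; exact: (field_D_le r0 ha hz1 hz2 hz2N kp km).
  rewrite (gradient_Dmax (G p q m n) Sx); apply: (gradient_field_le r0 h2 h1 hz2 hf).
  by rewrite /field2 -[in Y in Y * lin _ _ _ _]tE; exact: (field_D_le r0 ha hz1 hz2 hz1 kq kn).
move: i; apply: ord2_cases; apply: main.
  by rewrite /dipole_size lerDl field_size_ge0.
by rewrite /dipole_size lerDr field_size_ge0.
Qed.

End corner_dipole.

Section dipole_algebra.
Context {R : realType}.

Lemma lower_algebra (dl r p q l : R) : 0 < dl -> 0 < r ->
  4 / 5 / dl * (dl * p / r) + q * 0 + (- (4 / 25) / r + l * 0) = 4 / 5 * (p / r) - 4 / 25 / r.
Proof. by move=> dl0 r0; field; rewrite !gt_eqF. Qed.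

Lemma potential_gradient_algebra (p z T : R) : 0 < T -> p / (2 * T) * (2 * z) = p * (z / T).
Proof. by move=> T0; field; rewrite gt_eqF. Qed.

Lemma main_part_algebra (p u v T : R) : 0 < T -> u ^+ 2 + v ^+ 2 = T ->
  4 / 5 * (p / T) - 4 / 25 / T <= (p * (u / T)) ^+ 2 + (p * (v / T)) ^+ 2.
Proof.
move=> T0 E; have -> : (p * (u / T)) ^+ 2 + (p * (v / T)) ^+ 2 = p ^+ 2 * (u ^+ 2 + v ^+ 2) / T ^+ 2.
  by field; rewrite gt_eqF.
rewrite E -subr_ge0.
have -> : p ^+ 2 * T / T ^+ 2 - (4 / 5 * (p / T) - 4 / 25 / T) = (p - 2 / 5) ^+ 2 / T by field; rewrite gt_eqF.
by rewrite divr_ge0 ?sqr_ge0 // ltW.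
Qed.

End dipole_algebra.

(** * Norms of the main part and of the errors *)

Section dipole_integrals.
Context {R : realType}.
Local Notation plane := (R * R)%type.
Local Notation mplane := (measurableTypeR R * measurableTypeR R)%type.
Variables (Omega : set plane) (x0 : plane) (ga s rr : R).
Hypotheses (oO : open Omega) (fO : (leb2 (Omega : set mplane) < +oo)%E).
Hypotheses (spi : 0 < s < pi) (rr0 : 0 < rr).
Hypothesis corner : forall x, sqdist x0 x < rr ->
  (Omega x <-> slit x0 ga x /\ - s < angle x0 ga x < s).
Local Notation t := (sqdist x0).
Local Notation S := (slit x0 ga).
Local Notation D := (corner_part Omega x0 rr).
Local Notation A p q := (annulus Omega x0 rr p q).
Local Notation N f := (nrm2 leb2 Omega f).
Let mO := measurable_open oO.
Let DS : D `<=` S := corner_part_slit corner.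
Variables (dl k : R).
Hypotheses (dl0 : 0 < dl) (k0 : 0 < k).
Hypothesis Hk : forall (a b : R) (P : R -> R),
  0 < a -> a < b -> b <= rr -> smooth_on [set r : R | 0 < r] P ->
  intble leb2 (A a b) (fun x : mplane => 'D_1 P (t x)) /\
  \int[leb2]_(x in A a b) 'D_1 P (t x) = k * (P b - P a).
Local Notation a := (expR (- 2 / dl)).
Local Notation b := (expR (- 1 / dl)).
Local Notation a' := (expR (- 3 / dl)).
Local Notation b' := (expR (- (1 / 2) / dl)).
Hypothesis b'rr : b' < rr.

Lemma scales : [/\ 0 < a', a' < a, a < b, b < b' & b < rr].
Proof.
have h (p q : R) : p < q -> expR (p / dl) < expR (q / dl).
  by move=> pq; rewrite ltr_expR ltr_pM2r ?invr_gt0.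
have bb' : b < b' by apply: h; lra.
split=> //; first exact: expR_gt0.
- by apply: h; lra.
- by apply: h; lra.
- exact: lt_trans bb' b'rr.
Qed.

Lemma cut_off_annulus f x : radial_support x0 ga a b f -> Omega x -> ~ A a' b' x -> (f \_ D) x = 0.
Proof.
move=> f0 Ox nA; have [_ a'a _ bb' _] := scales.
rewrite patchE; case: ifPn => // /set_mem Dx; apply: f0; first exact: DS.
have [h|h] := ltrP (t x) a; first by left.
have [h'|h'] := ltrP b (t x); first by right.
by exfalso; apply: nA; split=> //; rewrite (lt_le_trans a'a h) (le_lt_trans h' bb').
Qed.

(** The integral of 1 / t is the length of the annulus in the variable ln t, here (3 - 1/2) / dl.
    With [c] proportional to [dl] the result is of order [dl]. *)
Lemma radial_norm_le f c : smooth_on S f -> radial_support x0 ga a b f ->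
  (forall x, S x -> `|f x| <= c / Num.sqrt (t x)) -> N (f \_ D) <= c ^+ 2 * (k * (5 / 2 / dl)).
Proof.
move=> sf f0 fc; have [a'0 a'a ab bb' brr] := scales.
have mA : measurable (A a' b' : set mplane) := measurable_annulus x0 rr oO a' b'.
have sN := sqint_cut oO fO spi corner (expR_gt0 _) brr sf f0.
have a'b' : a' < b' by exact: lt_trans a'a (lt_trans ab bb').
have [Il Jl] := Hk a'0 a'b' (ltW b'rr) (@smooth_on_ln R).
have -> : N (f \_ D) = \int[leb2]_(x in A a' b') ((f \_ D) x ^+ 2).
  apply: Rint_support; first exact: annulus_sub.
  by move=> x Ox nA; rewrite cut_off_annulus // expr0n.
have E : k * (5 / 2 / dl) = \int[leb2]_(x in A a' b') 'D_1 (@ln R) (t x).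
  by rewrite Jl !expRK; congr (_ * _); field; rewrite gt_eqF.
rewrite E -(RintZ mA _ Il); apply: (le_Rintegral mA).
- exact: (sqint_sub oO mA (@annulus_sub R Omega x0 rr a' b') sN).2.
- exact: intbleZ.
move=> x [Dx _]; rewrite cutE //; have Sx := DS Dx; have t0 := slit_gt0 Sx.
have -> : 'D_1 (@ln R) (t x) = (t x)^-1 by apply: derive_val; exact: is_derive1_ln.
have r0 : 0 < Num.sqrt (t x) by rewrite sqrtr_gt0.
have -> : c ^+ 2 * (t x)^-1 = (c / Num.sqrt (t x)) ^+ 2 by rewrite expr_div_n sqr_sqrtr // ltW.
by apply: sqr_norm_le; apply: le_trans (fc x Sx) _; exact: ler_norm.
Qed.

Definition main_part i : plane -> R := fun x => profile dl (t x) * (zcoord x0 i x / t x).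

Lemma smooth_on_main_part i : smooth_on S (main_part i).
Proof.
have G0 := gradient_radial x0 ga (@smooth_on_profile R dl) (@derive_profile R dl).
move: i; apply: ord2_cases; rewrite /main_part /zcoord /=.
  by have [] := gradientM G0 (gradient_z_over_t (gradient_z1 x0 ga)).
by have [] := gradientM G0 (gradient_z_over_t (gradient_z2 x0 ga)).
Qed.

(* From [X ^ 2 >= (4 / 5) X - 4 / 25], the right-hand side divided by [t] being an exact derivative. *)
Lemma main_part_lower : 2 / 5 * k / dl <= N (main_part ord0 \_ D) + N (main_part ord_max \_ D).
Proof.
have [a'0 a'a ab bb' brr] := scales.
have mA : measurable (A a' b' : set mplane) := measurable_annulus x0 rr oO a' b'.
have AO := @annulus_sub R Omega x0 rr a' b'.
have sM i := sqint_cut oO fO spi corner (expR_gt0 _) brr (smooth_on_main_part i)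
  (@radial_support_profile R x0 ga dl dl0 _).
have a'b' : a' < b' by exact: lt_trans a'a (lt_trans ab bb').
(* In the variable ln t the profile has integral 1 / dl over a length (5/2) / dl, hence the mean
   2/5; expanding the square of its deviation from this mean gives the best constant, 4/5 -
   (4/25)(5/2) = 2/5. *)
pose P (r : R) := (4 / 5 / dl) * step (dl * ln r + 2) + - (4 / 25) * ln r.
have oP := @open_gt R 0.
have sS := smooth_on_log dl (@smooth_on_step R).
have s1 : smooth_on [set r : R | 0 < r] (fun r : R => (4 / 5 / dl) * step (dl * ln r + 2)).
  by move=> n; apply: (diffnM oP _ (sS n)); exact: (diffn_cst n _ oP).
have s2 : smooth_on [set r : R | 0 < r] (fun r : R => - (4 / 25) * ln r).
  by move=> n; apply: (diffnM oP _ (@smooth_on_ln R n)); exact: (diffn_cst n _ oP).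
have sP : smooth_on [set r : R | 0 < r] P by move=> n; exact: (diffnD oP (s1 n) (s2 n)).
have DP (r : R) : 0 < r -> 'D_1 P r = 4 / 5 * (profile dl r / r) - 4 / 25 / r.
  move=> r0; have dc (c : R) : differentiable (cst c : R -> R) r by exact: differentiable_cst.
  have dc0 (c : R) : 'D_1 (cst c : R -> R) r = 0 by exact: derive_cst.
  transitivity ('D_1 (fun r : R => (4 / 5 / dl) * step (dl * ln r + 2)) r + 'D_1 (fun r : R => - (4 / 25) * ln r) r).
    exact: (deriveD (diff_derivable ((s1 1%N).1 r r0)) (diff_derivable ((s2 1%N).1 r r0))).
  have E1 := derive_mul (1 : R) (dc (4 / 5 / dl)) ((sS 1%N).1 r r0).
  have E2 := derive_mul (1 : R) (dc (- (4 / 25))) ((@smooth_on_ln R 1%N).1 r r0).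
  rewrite (etrans E1 (congr2 +%R (congr1 _ (derive_log dl (@smooth_on_step R) r0)) (congr1 _ (dc0 _)))).
  rewrite (etrans E2 (congr2 +%R (congr1 _ (@derive_val _ _ _ _ _ _ _ (is_derive1_ln r0))) (congr1 _ (dc0 _)))).
  exact: lower_algebra.
have [IP JP] := Hk a'0 a'b' (ltW b'rr) sP.
have sub i : nrm2 leb2 (A a' b') (main_part i \_ D) <= N (main_part i \_ D).
  by apply: (le_Rint_sub mA mO AO) => [x _|]; [exact: sqr_ge0|exact: (sM i).2].
apply: le_trans (lerD (sub ord0) (sub ord_max)).
have sA i := sqint_sub oO mA AO (sM i).
rewrite /nrm2 -(RintD mA (sA ord0).2 (sA ord_max).2).
have -> : 2 / 5 * k / dl = \int[leb2]_(x in A a' b') 'D_1 P (t x).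
  rewrite JP /P !expRK step1; last by rewrite mulrC divfK ?gt_eqF //; lra.
  rewrite step0; last by rewrite mulrC divfK ?gt_eqF //; lra.
  by field; rewrite gt_eqF.
apply: (le_Rintegral mA IP (intbleD mA (sA ord0).2 (sA ord_max).2)).
move=> x [Dx _]; rewrite !cutE //; have t0 := slit_gt0 (DS Dx); rewrite DP // /main_part /zcoord /=.
exact: main_part_algebra.
Qed.

(** The potential is a smooth function of [t] on the whole domain, because [t] is positive there,
    and it is constant outside of the annulus. It can thus be used as a global test function against
    the projection. *)
Lemma main_part_gradient : (forall x, Omega x -> t x < rr -> S x) ->
  H1_gradient Omega (fun x => potential dl (t x)) (fun i => main_part i \_ D).
Proof.
move=> OS; have [a'0 a'a ab bb' brr] := scales.
have Ot x : Omega x -> 0 < t x.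
  move=> Ox; have [h|h] := ltrP (t x) rr; last exact: lt_le_trans h.
  exact: slit_gt0 (OS x Ox h).
have sphi : smooth_on Omega (fun x => potential dl (t x)).
  by apply: (smooth_on_comp oO (@smooth_on_potential R dl)) => //; exact: smooth_on_sub (smooth_on_sqdist x0).
have DE i x : Omega x -> 'D_(basis2 i) (fun x => potential dl (t x)) x = (main_part i \_ D) x.
  move=> Ox; have t0 := Ot x Ox.
  have dt : differentiable t x := smooth_on_diff (smooth_on_sqdist x0) I.
  have E : 'D_(basis2 i) (fun x => potential dl (t x)) x = profile dl (t x) * (zcoord x0 i x / t x).
    transitivity ('D_1 (potential dl) (t x) * 'D_(basis2 i) t x).
      exact: (derive_comp1 _ dt ((@smooth_on_potential R dl 1%N).1 _ t0)).
    have dz : 'D_(basis2 i) t x = 2 * zcoord x0 i x.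
      rewrite derive_sqdist; move: i; apply: ord2_cases; rewrite ?basis2_0 ?basis2_max /zcoord /=; ring.
    rewrite (derive_potential dl0 t0) dz; exact: potential_gradient_algebra.
  rewrite E patchE; case: ifPn => // /negP nD; rewrite profile_support ?mul0r //; right.
  apply: lt_le_trans brr _; rewrite leNgt; apply/negP => h; apply: nD; rewrite inE.
  by split.
split.
- apply: (sqint_bounded (C := (2 * dl)^-1) mO fO); first exact: smooth_on_measurable.
  move=> x _; rewrite /potential normrM gtr0_norm ?invr_gt0 ?mulr_gt0 //.
  by rewrite ler_piMr ?invr_ge0 ?mulr_ge0 // ?(ltW dl0) // ger0_norm ?step_ge0 ?step_le1.
- move=> i; exact: (sqint_cut oO fO spi corner (expR_gt0 _) brr (smooth_on_main_part i)
  (@radial_support_profile R x0 ga dl dl0 _)).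
- move=> i; apply: (weak_partial_eq (fun _ _ => erefl) _ (weak_partial_smooth1 i oO sphi)).
  by move=> x /set_mem Ox; exact: DE.
Qed.

End dipole_integrals.

(** * Comparison of the energies and choice of the scale *)

Section energy_comparison.
Context {R : realType}.
Local Notation plane := (R * R)%type.
Local Notation mplane := (measurableTypeR R * measurableTypeR R)%type.

Lemma weighted_lower (NE NA g e : R) : 0 < e -> 0 <= NE + 2 * e * g + e ^+ 2 * NA -> - (NE / e + e * NA) <= 2 * g.
Proof.
move=> e0 h; rewrite -subr_ge0; have -> : 2 * g - - (NE / e + e * NA) = (NE + 2 * e * g + e ^+ 2 * NA) / e.
  by field; rewrite gt_eqF.
by rewrite divr_ge0 // ltW.
Qed.

Lemma weighted_upper (NE NA g e : R) : - (NE / e + e * NA) <= 2 * - g ->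
  NE + 2 * 1 * g + 1 ^+ 2 * NA <= (1 + e) * NA + (1 + e^-1) * NE.
Proof.
have -> : (1 + e) * NA + (1 + e^-1) * NE = NA + e * NA + NE + NE / e by ring.
by rewrite expr1n; move: (NE / e) (e * NA) => p q; lra.
Qed.

(** In the application E + A is the Laplacian, G the gradient of the divergence and P the projected
    Laplacian. From |W - A|^2 >= 0 and the orthogonality of P and A one gets |W|^2 >= |A|^2 + 2 <E -
    G, A>; the last term is split with the weight [e]. *)
Lemma energy_bounds (Omega : set plane) (A E G P : 'I_2 -> mplane -> R) (e : R) : open Omega -> 0 < e ->
  gsq Omega A -> gsq Omega E -> gsq Omega G -> gsq Omega P -> gip Omega P A = 0 ->
  (1 - e) * gnrm2 Omega A - gnrm2 Omega (gadd E (-1) G) / e <=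
    gnrm2 Omega (gadd (gadd (gadd E 1 A) (-1) G) (-1) P) /\
  gnrm2 Omega (gadd E 1 A) <= (1 + e) * gnrm2 Omega A + (1 + e^-1) * gnrm2 Omega E.
Proof.
move=> oO e0 sA sE sG sP PA; pose W := gadd (gadd (gadd E 1 A) (-1) G) (-1) P.
have sL := gadd_sq oO 1 sE sA; have sLG := gadd_sq oO (-1) sL sG; have sW := gadd_sq oO (-1) sLG sP.
have sEG := gadd_sq oO (-1) sE sG.
have WA : gip Omega W A = gip Omega (gadd E (-1) G) A + gip Omega A A.
  rewrite (gip_gadd oO (-1) sLG sP sA) (gip_gadd oO (-1) sL sG sA) (gip_gadd oO 1 sE sA sA) PA.
  by rewrite (gip_gadd oO (-1) sE sG sA); ring.
have AA : gip Omega A A = gnrm2 Omega A by rewrite /gip /gnrm2 !nrm2E.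
have h1 := gnrm2_ge0 Omega (gadd W (-1) A); rewrite (gnrm2_gadd oO (-1) sW sA) WA AA in h1.
have h2 := gnrm2_ge0 Omega (gadd (gadd E (-1) G) e A); rewrite (gnrm2_gadd oO e sEG sA) in h2.
have h3 := gnrm2_ge0 Omega (gadd E (- e) A); rewrite (gnrm2_gadd oO (- e) sE sA) in h3.
have k2 := weighted_lower e0 h2.
have k3 : - (gnrm2 Omega E / e + e * gnrm2 Omega A) <= 2 * (- gip Omega E A).
  by apply: weighted_lower => //; apply: le_trans h3 _; rewrite le_eqVlt; apply/orP; left; apply/eqP; ring.
split.
  move: h1 k2; move: (gip _ _ _) (gnrm2 Omega A) (gnrm2 Omega W) (gnrm2 Omega _ / e) => p q r z; lra.
rewrite (gnrm2_gadd oO 1 sE sA); exact: weighted_upper.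
Qed.

Lemma small_scale (k c K rr beta C : R) : 0 < k -> 0 <= c -> 0 <= K -> 0 < rr -> beta < 1 ->
  exists dl : R, [/\ 0 < dl, dl <= 1, expR (- (1 / 2) / dl) < rr &
    forall NA NW NL ND, 2 / 5 * k / dl <= NA ->
      (forall e, 0 < e -> (1 - e) * NA - c / e <= NW /\ NL <= (1 + e) * NA + (1 + e^-1) * c) ->
      0 <= NL -> 0 <= ND -> ND <= K -> beta * NL + C * ND < NW].
Proof.
(* [NL] is only bounded from above, so a negative [beta] is replaced by 0. *)
move=> k0 c0 K0 rr0 b1; pose be := Num.max beta 0.
have be1 : be < 1 by rewrite gt_max b1 ltr01.
have be0 : 0 <= be by rewrite le_max lexx orbT.
have bebe : beta <= be by rewrite le_max lexx.
(* The coefficient of [NA] in the comparison is 1 - e - be (1 + e), which is at least 1 - be - 2 e =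
   (1 - be) / 2. *)
pose e := (1 - be) / 4; have e0 : 0 < e by rewrite divr_gt0 // subr_gt0.
pose Z := c / e + (1 + e^-1) * c + `|C| * K.
have Z0 : 0 <= Z by rewrite !addr_ge0 ?mulr_ge0 ?addr_ge0 ?invr_ge0 // ltW.
(* [Z] collects all terms that stay bounded; for [dl <= q] the remaining share of [NA] is at least
   [Z + 1], which makes the inequality strict. *)
pose q := (1 - be) / 2 * (2 / 5 * k) / (Z + 1).
have Z1 : 0 < Z + 1 by rewrite ltr_wpDl.
have q0 : 0 < q by rewrite !divr_gt0 // !mulr_gt0 ?subr_gt0 // ?invr_gt0.
have l0 : 0 < 2 * (`|ln rr| + 1) by rewrite mulr_gt0 // ltr_wpDl.
pose dl := Num.min 1 (Num.min q (2 * (`|ln rr| + 1))^-1).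
have dl0 : 0 < dl by rewrite !lt_min ltr01 q0 invr_gt0.
have dlq : dl <= q by rewrite /dl !ge_min lexx !orbT.
have dll : dl <= (2 * (`|ln rr| + 1))^-1 by rewrite /dl !ge_min lexx !orbT.
exists dl; split=> //; first by rewrite /dl ge_min lexx.
  have h : `|ln rr| + 1 <= 1 / 2 / dl.
    rewrite ler_pdivlMr // mulrC; apply: le_trans (ler_wpM2r _ dll) _; first by rewrite addr_ge0.
    by rewrite le_eqVlt; apply/orP; left; apply/eqP; field; rewrite gt_eqF // ltr_wpDl.
  rewrite -[ltRHS]lnK // ltr_expR mulNr; have := ler_norm (- ln rr); rewrite normrN.
  by move: (1 / 2 / dl) h => y; lra.
move=> NA NW NL ND hNA He NL0 ND0 NDK; have [h1 h2] := He e e0.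
have hZ : Z + 1 <= (1 - be) / 2 * NA.
  have : (1 - be) / 2 * (2 / 5 * k / dl) <= (1 - be) / 2 * NA.
    by rewrite ler_wpM2l // divr_ge0 // subr_ge0 ltW.
  apply: le_trans; rewrite mulrA ler_pdivlMr // mulrC.
  by move: dlq; rewrite /q ler_pdivlMr.
have hC : C * ND <= `|C| * K by exact: le_trans (ler_wpM2r ND0 (ler_norm C)) (ler_wpM2l (normr_ge0 C) NDK).
have hb : beta * NL <= be * ((1 + e) * NA + (1 + e^-1) * c).
  by apply: le_trans (ler_wpM2r NL0 bebe) _; rewrite ler_wpM2l.
have hbc : be * ((1 + e^-1) * c) <= (1 + e^-1) * c.
  have ec : 0 <= (1 + e^-1) * c by rewrite mulr_ge0 // addr_ge0 // invr_ge0 ltW.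
  exact: ler_piMl ec (ltW be1).
have NA0 : 0 <= NA by apply: le_trans hNA; rewrite ltW // !divr_gt0 // !mulr_gt0 // invr_gt0.
have hne : be * (e * NA) <= e * NA by exact: ler_piMl (mulr_ge0 (ltW e0) NA0) (ltW be1).
have E4 : 4 * (e * NA) = (1 - be) * NA by rewrite /e; field.
move: hb; rewrite mulrDr [(1 + e) * NA]mulrDl mul1r [be * (NA + _)]mulrDr => hb.
move: hZ h1; rewrite /Z [(1 - e) * NA]mulrBl mul1r => hZ h1.
have E5 : (1 - be) / 2 * NA = 2 * (e * NA) by rewrite /e; field.
have E6 : be * NA = NA - 4 * (e * NA) by rewrite E4; ring.
rewrite E5 in hZ; rewrite E6 in hb.
move: hb hbc hne h1 hC hZ; move: (be * ((1 + e^-1) * c)) (be * (e * NA)) (e * NA) (c / e) ((1 + e^-1) * c) (`|C| * K) (C * ND) (beta * NL) => *.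
lra.
Qed.

End energy_comparison.

(** * The family of fields and its estimates *)

Section assembly.
Context {R : realType}.
Local Notation plane := (R * R)%type.
Local Notation mplane := (measurableTypeR R * measurableTypeR R)%type.
Variables (Omega : set plane) (x0 : plane) (ga s rr : R).
Hypotheses (oO : open Omega) (fO : (leb2 (Omega : set mplane) < +oo)%E).
Hypothesis pO : (0 < leb2 (Omega : set mplane))%E.
Hypotheses (spi : 0 < s < pi) (s2 : s != pi / 2) (rr0 : 0 < rr).
Hypothesis corner : forall x, sqdist x0 x < rr ->
  (Omega x <-> slit x0 ga x /\ - s < angle x0 ga x < s).
Local Notation t := (sqdist x0).
Local Notation S := (slit x0 ga).
Local Notation D := (corner_part Omega x0 rr).
Local Notation N f := (nrm2 leb2 Omega f).
Let mO := measurable_open oO.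
Let oS : open S := @open_slit R x0 ga.
Let DS : D `<=` S := corner_part_slit corner.

Lemma two_le_four (x y : R) : 0 <= x -> 0 <= y -> 2 * x <= 4 * x + 4 * y.
Proof. lra. Qed.

Lemma laplacianE f x : laplacian f x = partial [:: ord0; ord0] f x + partial [:: ord_max; ord_max] f x :> R.
Proof. exact: sum_ord2. Qed.

Lemma smooth_on_laplacian (f : plane -> R) : smooth_on S f -> smooth_on S (laplacian f).
Proof.
move=> sf; have -> : laplacian f = (fun x => partial [:: ord0; ord0] f x + partial [:: ord_max; ord_max] f x).
  by apply/funext => x; exact: laplacianE.
exact: (smooth_onD oS (smooth_on_partial _ sf) (smooth_on_partial _ sf)).
Qed.

Lemma radial_supportD a b (f g : plane -> R) : radial_support x0 ga a b f -> radial_support x0 ga a b g ->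
  radial_support x0 ga a b (fun x => f x + g x).
Proof. by move=> rf rg x Sx hx; rewrite rf // rg // addr0. Qed.

Lemma radial_support_laplacian a b (f : plane -> R) : radial_support x0 ga a b f ->
  radial_support x0 ga a b (laplacian f).
Proof.
move=> rf; have -> : laplacian f = (fun x => partial [:: ord0; ord0] f x + partial [:: ord_max; ord_max] f x).
  by apply/funext => x; exact: laplacianE.
exact: (radial_supportD (radial_support_partial _ rf) (radial_support_partial _ rf)).
Qed.

Lemma cutD (f g : plane -> R) x : (f \_ D) x + (g \_ D) x = ((fun y => f y + g y) \_ D) x.
Proof. by rewrite !patchE; case: ifPn => // _; rewrite addr0. Qed.

Lemma laplacian_cut a b (f : plane -> R) x : b < rr -> smooth_on S f -> radial_support x0 ga a b f -> Omega x ->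
  laplacian (f \_ D) x = (laplacian f \_ D) x.
Proof.
move=> brr sf rf Ox; rewrite laplacianE.
have E w := partial_cut oO corner brr w sf rf Ox.
apply: etrans (congr2 +%R (E _) (E _)) _; apply: etrans (cutD _ _ _) _.
by congr (patch _ _ _ x); apply/funext => y; rewrite laplacianE.
Qed.

Lemma Rint_gnrm2 (g : 'I_2 -> mplane -> R) : gsq Omega g ->
  \int[leb2]_(x in Omega) (\sum_(i < 2) g i x ^+ 2) = gnrm2 Omega g.
Proof.
move=> sg; apply: (RintD_eq mO (sg ord0).2 (sg ord_max).2) => x _.
exact: sum_ord2.
Qed.

Lemma sqrt_le1D (r : R) : 0 <= r -> Num.sqrt r <= 1 + r.
Proof.
move=> r0; rewrite -[leRHS]ger0_norm ?addr_ge0 // -sqrtr_sqr ler_wsqrtr //; nra.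
Qed.

(** The constants are chosen before [dl]: the squared norm [NA] of the main part grows like 1 / dl,
    while [c] and [K] control the errors and the gradient for all scales at once. *)
Lemma corner_commutator_estimate : exists k c K : R, [/\ 0 < k, 0 <= c, 0 <= K &
  forall dl, 0 < dl -> dl <= 1 -> expR (- (1 / 2) / dl) < rr ->
  exists (u w Lu : 'I_2 -> R * R -> R) (Du : 'I_2 -> 'I_2 -> R * R -> R),
    [/\ forall i, in_H 2 Omega (u i) /\ in_H10 Omega (u i),
        laplace_leray_commutator Omega u w,
        forall i, in_L2 Omega (Lu i) /\ weak_laplacian Omega (u i) (Lu i),
        forall i, H1_gradient Omega (u i) (Du i) &
        exists NA, 2 / 5 * k / dl <= NA /\
        let NW := \int[leb2]_(x in Omega) (\sum_(i < 2) w i x ^+ 2) in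
        let NL := \int[leb2]_(x in Omega) (\sum_(i < 2) Lu i x ^+ 2) in
        let ND := \int[leb2]_(x in Omega) (\sum_(i < 2) \sum_(j < 2) Du i j x ^+ 2) in
        (forall e, 0 < e -> (1 - e) * NA - c / e <= NW /\ NL <= (1 + e) * NA + (1 + e^-1) * c) /\
        [/\ 0 <= NL, 0 <= ND & ND <= K]]].
Proof.
have [k k0 Hk] := radial_integral oO fO spi rr0 corner.
have [L L1 HL] := @profile_bounds R.
have [m1 [n1 [m2 [n2 [Ce [Ce0 HC]]]]]] := sector_field_coefficients x0 ga spi s2.
have L0 : 0 <= L by exact: le_trans L1.
pose cf := dipole_size m1 n1 m2 n2; have cf0 : 0 <= cf := dipole_size_ge0 m1 n1 m2 n2.
pose C1 := (16 * L * cf) ^+ 2 * (k * (5 / 2)).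
pose C2 := (divergence_size m1 n1 m2 n2 * L) ^+ 2 * (k * (5 / 2)).
have C10 : 0 <= C1 by rewrite mulr_ge0 ?sqr_ge0 // mulr_ge0 // ltW.
have C20 : 0 <= C2 by rewrite mulr_ge0 ?sqr_ge0 // mulr_ge0 // ltW.
(* Each of the four first derivatives is at most [4 * L * cf], so the sum of their squares is at
   most the square of twice this. *)
pose K := N (fun=> 2 * (4 * L * cf)).
exists k, (4 * C1 + 4 * C2), K; split=> //; [by rewrite addr_ge0 // mulr_ge0|exact: nrm2_ge0|].
move=> dl dl0 dl1 dlrr; have bounds := fun r r0 => HL dl r dl0 dl1 r0.
have [a'0 a'a ab bb' brr] := scales dl0 dlrr.
set a := expR (- 2 / dl) in a'a ab; set b := expR (- 1 / dl) in ab bb' brr.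
have a0 : 0 < a by exact: expR_gt0.
pose f := dipole x0 ga m1 n1 m2 n2 dl.
have sf i : smooth_on S (f i) := smooth_on_dipole x0 ga m1 n1 m2 n2 dl i.
have rf i : radial_support x0 ga a b (f i) by exact: radial_support_profile.
have sD v g : smooth_on S g -> smooth_on S (fun x => 'D_v g x) by exact: smooth_on_D.
have slap i : smooth_on S (laplacian (f i)) := smooth_on_laplacian (sf i).
have rlap i : radial_support x0 ga a b (laplacian (f i)) := radial_support_laplacian (rf i).
pose gd i := grad_div x0 ga m1 n1 m2 n2 dl i.
have sgd i : smooth_on S (gd i).
  exact: (smooth_onD oS (sD (basis2 i) _ (sD (basis2 ord0) _ (sf ord0))) (sD (basis2 i) _ (sD (basis2 ord_max) _ (sf ord_max)))).
have rgd i : radial_support x0 ga a b (gd i).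
  exact: (radial_supportD (radial_support_partial [:: i; ord0] (rf ord0)) (radial_support_partial [:: i; ord_max] (rf ord_max))).
have rmain i : radial_support x0 ga a b (main_part x0 dl i) by exact: radial_support_profile.
have smain i := smooth_on_main_part x0 ga dl i.
have scut g : smooth_on S g -> radial_support x0 ga a b g -> sqint leb2 Omega (g \_ D).
  exact: (sqint_cut oO fO spi corner a0 brr).
pose u i : plane -> R := f i \_ D; pose Lu i : plane -> R := laplacian (f i) \_ D.
pose G i : plane -> R := gd i \_ D; pose A i : plane -> R := main_part x0 dl i \_ D.
pose Du i j : plane -> R := (fun x => 'D_(basis2 j) (f i) x) \_ D.
have su i : smooth_on Omega (u i) := smooth_on_cut oO corner brr (sf i) (rf i).
have off g : radial_support x0 ga a b g -> forall x, Omega x -> ~ annulus Omega x0 rr (expR (- 3 / dl)) (expR (- (1 / 2) / dl)) x ->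
    (g \_ D) x = 0.
  by move=> rg x; exact: (cut_off_annulus corner dl0 dlrr rg).
(* The inner collars of the truncation get the room between [a2] and the annulus; the outer ones lie
   between the annulus and the circle [t = rr]. *)
have a2 : 0 < expR (- 3 / dl) / 2 by rewrite divr_gt0.
have a2' : expR (- 3 / dl) / 2 < expR (- 3 / dl) by rewrite ltr_pdivrMr // ltr_pMr // ltr1n.
have a'b' := lt_trans a'a (lt_trans ab bb').
have leray (g : 'I_2 -> plane -> R) : (forall i, smooth_on S (g i)) -> (forall i, radial_support x0 ga a b (g i)) ->
    exists P, leray_projection Omega (fun i => g i \_ D) P.
  move=> sg rg; apply: (corner_leray oO fO spi rr0 corner pO a2 a2' a'b' dlrr (lexx rr)).
    by move=> i; exact: scut.
  by move=> i x; exact: off.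
have [Pu HPu] := leray f sf rf; have [PLu HPLu] := leray (fun i => laplacian (f i)) slap rlap.
have HLu i : in_L2 Omega (Lu i) /\ weak_laplacian Omega (u i) (Lu i).
  split; first exact: scut.
  move=> phi tp; apply: etrans (weak_laplacian_smooth oO (su i) tp) _; apply: Rint_eq => x Ox.
  exact: (congr1 (fun z => z * phi x) (laplacian_cut brr (sf i) (rf i) Ox)).
have sG i : sqint leb2 Omega (G i) by exact: scut.
have GE i x : Omega x -> G i x = \sum_(j < 2) 'D_(basis2 i) (fun y => 'D_(basis2 j) (u j) y) x.
  move=> Ox; have E j := partial_cut oO corner brr [:: i; j] (sf j) (rf j) Ox.
  exact: (esym (etrans (sum_ord2 _) (etrans (congr2 +%R (E ord0) (E ord_max)) (cutD _ _ _)))).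
have H1u i : H1_gradient Omega (u i) (Du i) := H1_gradient_cut oO fO spi corner a0 brr (sf i) (rf i).
exists u, (fun i x => Lu i x - G i x - PLu i x), Lu, Du; split.
- move=> i; split; first exact: (in_H_cut oO fO spi corner a0 brr 2 (sf i) (rf i)).
  apply: (in_H10_cut oO fO spi corner a0 brr (C := L * (Ce * (1 + rr))) (sf i) (rf i)).
    by rewrite !mulr_ge0 // addr_ge0 // ltW.
  move=> x Dx; have Sx := DS Dx; have [_ tx] := Dx.
  have [_ /= /andP[h1 h2]] := corner_part_box corner Dx.
  have [X1 _ _] := bounds _ (slit_gt0 Sx).
  have sq : Num.sqrt (t x) <= 1 + rr.
    by apply: le_trans (sqrt_le1D (sqdist_ge0 x0 x)) _; rewrite lerD2l ltW.
  have [e1 e2 e3 e4] := HC x Sx.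
  have main v y : 0 <= v -> `|y| <= Ce * Num.sqrt (t x) * `|v| -> `|profile dl (t x) * y| <= L * (Ce * (1 + rr)) * v.
    move=> v0 hy; rewrite -mulrA; apply: norm_mul_le X1 _; apply: le_trans hy _; rewrite (ger0_norm v0).
    by rewrite ler_wpM2r // ler_wpM2l.
  have v1 : 0 <= s - angle x0 ga x by rewrite subr_ge0 ltW.
  have v2 : 0 <= s + angle x0 ga x by rewrite -lerBlDl sub0r ltW.
  have -> : angle x0 ga x + s = s + angle x0 ga x by exact: addrC.
  move: i; apply: ord2_cases.
    exact: (conj (main _ _ v2 e2) (main _ _ v1 e1)).
  exact: (conj (main _ _ v2 e4) (main _ _ v1 e3)).
- exact: (commutator_smooth oO fO su HPu HLu HPLu sG GE).
- exact: HLu.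
- exact: H1u.
have sA : gsq Omega A by move=> i; exact: scut.
have sLu : gsq Omega Lu by move=> i; exact: scut.
have sGG : gsq Omega G := sG.
have sP : gsq Omega PLu by move=> i; exact: (leray_projection_sq oO i HPLu).
pose E := gadd Lu (-1) A; have sE : gsq Omega E := gadd_sq oO (-1) sLu sA.
have PA : gip Omega PLu A = 0.
  have [_ [q [gq [_ _ _ EL]]]] := HPLu.
  have := EL _ _ (main_part_gradient oO fO spi rr0 corner dl0 dlrr (fun x Ox tx => ((corner tx).1 Ox).1)).
  move=> <-; apply: esym.
  by apply: (RintD_eq mO (sqint_mul mO (sP ord0) (sA ord0)) (sqint_mul mO (sP ord_max) (sA ord_max))) => x _; exact: sum_ord2.
have EA : gadd E 1 A = Lu.
  by apply/funext => i; apply/funext => x; rewrite /E /gadd mulN1r mul1r subrK.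
have WE : gadd (gadd (gadd E 1 A) (-1) G) (-1) PLu = (fun i x => Lu i x - G i x - PLu i x).
  by rewrite EA; apply/funext => i; apply/funext => x; rewrite /gadd !mulN1r.
have sW : gsq Omega (fun i x => Lu i x - G i x - PLu i x).
  by rewrite -WE EA; apply: (gadd_sq oO) => //; exact: (gadd_sq oO).
(* Two factors [dl] from the pointwise bounds meet one factor [1 / dl] from the logarithmic length,
   which leaves a bound independent of [dl <= 1]. *)
have dlE (c : R) : (c * dl) ^+ 2 * (k * (5 / 2 / dl)) <= c ^+ 2 * (k * (5 / 2)).
  have -> : (c * dl) ^+ 2 * (k * (5 / 2 / dl)) = dl * (c ^+ 2 * (k * (5 / 2))) by field; rewrite gt_eqF.
  by rewrite ler_piMl // mulr_ge0 ?sqr_ge0 // mulr_ge0 // ltW.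
have NE i : N (E i) <= C1.
  have sE' : smooth_on S (fun x => laplacian (f i) x - main_part x0 dl i x) by exact: smooth_onB.
  have rE : radial_support x0 ga a b (fun x => laplacian (f i) x - main_part x0 dl i x).
    by move=> x Sx hx; rewrite rlap // rmain // subrr.
  have := radial_norm_le oO fO spi corner dl0 Hk dlrr (c := (16 * L * cf) * dl) sE' rE.
  have -> : N ((fun x => laplacian (f i) x - main_part x0 dl i x) \_ D) = N (E i).
    apply: Rint_eq => x _; rewrite /E /gadd /Lu /A !patchE; case: ifPn => _; rewrite mulN1r //.
    by rewrite subrr.
  move=> h; apply: le_trans (h _) (dlE _) => x Sx.
  have -> : 16 * L * cf * dl = 16 * (dl * L) * cf by ring.
  exact: (laplacian_dipole_error m1 n1 m2 n2 bounds i Sx).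
have NG i : N (G i) <= C2.
  have := radial_norm_le oO fO spi corner dl0 Hk dlrr (c := (divergence_size m1 n1 m2 n2 * L) * dl) (sgd i) (rgd i).
  move=> h; apply: le_trans (h _) (dlE _) => x Sx.
  have -> : divergence_size m1 n1 m2 n2 * L * dl = divergence_size m1 n1 m2 n2 * (dl * L) by ring.
  exact: (grad_div_le m1 n1 m2 n2 bounds i Sx).
have gE : gnrm2 Omega E <= 2 * C1 by rewrite mulr2n mulrDl mul1r; exact: lerD (NE ord0) (NE ord_max).
have gEG : gnrm2 Omega (gadd E (-1) G) <= 4 * C1 + 4 * C2.
  have h i : N (gadd E (-1) G i) <= 2 * C1 + 2 * C2.
    apply: le_trans (nrm2D_le mO (sE i) (sqintZ mO (-1) (sG i))) _.
    rewrite nrm2Z // sqrrN expr1n mul1r; apply: lerD; rewrite ler_pM2l //.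
  have -> : 4 * C1 + 4 * C2 = (2 * C1 + 2 * C2) + (2 * C1 + 2 * C2) by ring.
  exact: lerD (h ord0) (h ord_max).
exists (gnrm2 Omega A); split; first exact: (main_part_lower oO fO spi corner dl0 Hk dlrr).
cbv zeta; rewrite (Rint_gnrm2 sW) (Rint_gnrm2 sLu); split.
  move=> e e0; have [h1 h2] := energy_bounds oO e0 sA sE sGG sP PA.
  rewrite WE in h1; rewrite EA in h2; split.
    by apply: le_trans h1; rewrite lerD2l lerN2 ler_pM2r // invr_gt0.
  apply: le_trans h2 _; rewrite lerD2l ler_wpM2l ?addr_ge0 ?invr_ge0 ?(ltW e0) //.
  exact: le_trans gE (two_le_four C10 C20).
split; first exact: gnrm2_ge0.
  by apply: (Rint_ge0 _) => x _; rewrite sumr_ge0 // => i _; rewrite sumr_ge0 // => j _; exact: sqr_ge0.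
have sDu i j : sqint leb2 Omega (Du i j) by exact: (scut _ (sD _ _ (sf i)) (radial_support_D _ (rf i))).
have IK : sqint leb2 Omega (fun=> 2 * (4 * L * cf)).
  by apply: (@sqint_bounded _ _ _ _ _ mO `|2 * (4 * L * cf)| _ fO).
apply: (le_Rintegral mO _ IK.2).
  by apply: (intble_sum mO) => i; apply: (intble_sum mO) => j; exact: (sDu i j).2.
move=> x Ox; rewrite !sum_ord2.
have h i j : Du i j x ^+ 2 <= (4 * L * cf) ^+ 2.
  apply: sqr_norm_le; rewrite /Du patchE; case: ifPn => [/set_mem Dx|_]; last by rewrite normr0.
  apply: le_trans (dipole_D_le m1 n1 m2 n2 dl0 L1 bounds i j dl1 (DS Dx)) _; exact: ler_norm.
have -> : (2 * (4 * L * cf)) ^+ 2 = (4 * L * cf) ^+ 2 + (4 * L * cf) ^+ 2 + ((4 * L * cf) ^+ 2 + (4 * L * cf) ^+ 2) by ring.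
by apply: lerD; apply: lerD; exact: h.
Qed.

End assembly.

Unset Implicit Arguments.

Theorem theorem1p2 (R : realType) (Omega : set (R * R))
  (domOmega : bounded_domain Omega) (cornerOmega : has_straight_corner Omega)
  (beta C : R) (beta_lt1 : beta < 1) :
  exists (u w Lu : 'I_2 -> R * R -> R) (Du : 'I_2 -> 'I_2 -> R * R -> R),
    [/\ forall i, in_H 2 Omega (u i) /\ in_H10 Omega (u i),
        laplace_leray_commutator Omega u w,
        forall i, in_L2 Omega (Lu i) /\ weak_laplacian Omega (u i) (Lu i),
        forall i, H1_gradient Omega (u i) (Du i) &
        \int[leb2]_(x in Omega) (\sum_(i < 2) w i x ^+ 2) >
        beta * \int[leb2]_(x in Omega) (\sum_(i < 2) Lu i x ^+ 2) +
        C * \int[leb2]_(x in Omega) (\sum_(i < 2) \sum_(j < 2) Du i j x ^+ 2)].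
Proof.
have [oO _ neO bO] := domOmega.
have fO := bounded_leb2_finite oO bO; have pO := open_leb2_gt0 oO neO.
have [x0 [ga [s [rr [spi s2 rr0 corner]]]]] := straight_corner_polar cornerOmega.
have [k [c [K [k0 c0 K0 H]]]] := corner_commutator_estimate oO fO pO spi s2 rr0 corner.
(* Since [k], [c] and [K] are independent of the scale, [dl] can now be adapted to [beta] and
   [C]. *)
have [dl [dl0 dl1 dlrr Hdl]] := small_scale C k0 c0 K0 rr0 beta_lt1.
have [u [w [Lu [Du [h1 h2 h3 h4 [NA [hNA [He [NL0 ND0 NDK]]]]]]]]] := H dl dl0 dl1 dlrr.
exists u, w, Lu, Du; split=> //.
exact: (Hdl NA _ _ _ hNA He NL0 ND0 NDK).
Qed.
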